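(* Let $q>2$ and let $\chi$ be a primitive Dirichlet character mod $q$. Let $\rho'=\beta'+i\gamma'$ run over the critical points of the Riemann zeta function (points with $\zeta'(\rho')=0$) satisfying $\beta'>1$. Then $$\liminf_{\gamma'\to\infty}|L(\rho',\chi)|\log\log\gamma'\leq\frac{\pi^2e^{-C_0}}{6}\prod_{p\mid q}\frac{p+1}{p},$$ where the product is over the primes $p$ dividing $q$.
   Context: $\zeta$ is the Riemann zeta function, $L(s,\chi)$ is the Dirichlet $L$-function of $\chi$, and $C_0$ is Euler's constant. The liminf is taken over the critical points $\rho'=\beta'+i\gamma'$ of $\zeta$ with $\beta'>1$ as $\gamma'\to+\infty$, with $q$ and $\chi$ fixed. The statement is unconditional. *)

(* Defs.v *)
From Stdlib Require Import Reals ZArith Znumtheory List.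
From Coquelicot Require Import Coquelicot.
Open Scope R_scope.

Definition Cexp (z : C) : C :=
  (exp (Re z) * cos (Im z), exp (Re z) * sin (Im z)).

(* n^(-s), with the real logarithm; meant for n >= 1. *)
Definition ncpow_opp (n : nat) (s : C) : C :=
  Cexp (- (s * RtoC (ln (INR n))))%C.

(* The sum over n >= 1 of a(n) n^(-s), computed componentwise; the index k of
   [Series] stands for n = k + 1. *)
Definition dirichlet_series (a : nat -> C) (s : C) : C :=
  let term k := (a (S k) * ncpow_opp (S k) s)%C in
  (Series (fun k => Re (term k)), Series (fun k => Im (term k))).

(* The Riemann zeta function on Re s > 1, where its Dirichlet series converges;
   no value is intended elsewhere.  The half-plane is open, so the derivative
   at a point of it does not depend on the values outside. *)
Definition zeta : C -> C := dirichlet_series (fun _ => RtoC 1).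

(* The Dirichlet L-function, likewise intended on Re s > 1 only. *)
Definition Lfun (chi : Z -> C) : C -> C :=
  dirichlet_series (fun n => chi (Z.of_nat n)).

(* A character of (Z/qZ)^*, viewed as a function on Z extended by 0. *)
Record dirichlet_character (q : nat) (chi : Z -> C) : Prop := {
  dchar_periodic : forall n : Z, chi (n + Z.of_nat q)%Z = chi n;
  dchar_mult : forall m n : Z, chi (m * n)%Z = (chi m * chi n)%C;
  dchar_support :
    forall n : Z, chi n <> RtoC 0 <-> Z.gcd n (Z.of_nat q) = 1%Z }.

Definition induces (psi : Z -> C) (q : nat) (chi : Z -> C) : Prop :=
  forall n : Z, Z.gcd n (Z.of_nat q) = 1%Z -> chi n = psi n.

Definition primitive_character (q : nat) (chi : Z -> C) : Prop :=
  dirichlet_character q chi /\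
  forall (d : nat) (psi : Z -> C),
    Nat.divide d q -> dirichlet_character d psi -> induces psi q chi -> d = q.

Definition critical_point (f : C -> C) (rho : C) : Prop :=
  @is_derive C_AbsRing C_NormedModule f rho (RtoC 0).

(* liminf of f(z) as Im z -> +oo with z in A, i.e. the supremum over T of the
   infimum of f over the z in A with Im z > T; the infimum of the empty set
   is +oo. *)
Definition LimInf_Im (A : C -> Prop) (f : C -> R) : Rbar :=
  Rbar_lub (fun m : Rbar => exists T : R,
    m = Glb_Rbar (fun x : R => exists z : C, A z /\ T < Im z /\ x = f z)).

Definition euler_constant : R :=
  real (Lim_seq (fun n => sum_n_m (fun k => / INR k) 1 n - ln (INR n))).

Definition prime_divisor_list (q : nat) : list nat :=
  filter (fun p => if prime_dec (Z.of_nat p)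
                   then Nat.eqb (Nat.modulo q p) 0 else false)
         (seq 1 q).

Definition prod_prime_divisors (q : nat) (f : nat -> R) : R :=
  fold_right Rmult 1 (map f (prime_divisor_list q)).

(* Main.v *)
(** On Re s > 1 one has -zeta'/zeta = F with F(s) = sum_n Lambda(n) n^-s, so zeros of F are
    critical points of zeta.  Fix a large k, put x = e^k and s = 1 + k^-3.  A resonator (a
    product of Fejer-type polynomials in p^-it over the primes p of a finite set A, used as
    a weight in a mean-square argument) gives arbitrarily large heights t, with
    log log t <= (1 + 4 eta) k, at which p^-it is close to a prescribed unimodular z_p for
    all p in A, while the integers free of the primes of A contribute next to nothing to F,
    F' and L(., chi).  Take z_p = -conj(chi(p)) for p <= x prime to q.  As L(1, chi) <> 0,
    these primes contribute O(1) to F; two further blocks of primes below e^((1 + 3 eta) k),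
    both of bounded mass, are given phases that cancel this contribution while keeping F' as
    large as k.  Newton's method then yields a zero rho of F near s + it.  There, up to a
    factor close to 1, 1/|L(rho, chi)| is the product of 1 + 1/p over the p <= x prime to q,
    and a form of Mertens' third theorem valid for infinitely many k bounds it below by
    e^C0 k / zeta(2) divided by the product of 1 + 1/p over p | q; here zeta(2) <= pi^2/6. *)

Require Import Defs.
From Stdlib Require Import Reals ZArith.
From Coquelicot Require Import Coquelicot.
Open Scope R_scope.

(* Inside the module [<] on nat is MathComp's boolean order; the statement below needs [lt]. *)
Module Resonance.

From Stdlib Require Import Lra Lia.
From HB Require Import structures.
From mathcomp Require Import all_boot zify.
From mathcomp Require cyclic.
Set Implicit Arguments.
Unset Strict Implicit.
Unset Printing Implicit Defensive.
Delimit Scope R_scope with R.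
Open Scope R_scope.

(** Simultaneous approximation alone would control the primes of A but not the integers free of A,
    which at s are not small in absolute value: their sum is about k^3 / k. The resonator handles
    both demands in one average, and a Fejer degree of k^100 multiplies log t only by a power of k,
    which is negligible in log log t. The shift k^-3 is so small that p^-s and 1/p agree up to a
    relative error O(k^-2) at every prime used, yet large enough that all series at s are bounded by
    powers of k. One extra block would not do: the contribution of the primes up to x to F is known
    only to be bounded, so a first block of phase 1 and larger mass makes the total v definitely
    nonzero, and a second block of phase -v/|v| cancels it. The primes of the second block have
    logarithms larger by a fixed factor, so the sums with one more factor ln p cannot cancel; this
    keeps F' large. Mass means the sum of ln p / p, hence the sum of 1/p over the blocks is O(1/k)
    and L is hardly affected. The factor 1/zeta(2) comes from 1 + y = (1 - y^2)/(1 - y). *)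

HB.instance Definition _ := Monoid.isComLaw.Build R 0 Rplus
  (fun x y z => esym (Rplus_assoc x y z)) Rplus_comm Rplus_0_l.
HB.instance Definition _ := Monoid.isComLaw.Build R 1 Rmult
  (fun x y z => esym (Rmult_assoc x y z)) Rmult_comm Rmult_1_l.
HB.instance Definition _ := Monoid.isMulLaw.Build R 0 Rmult Rmult_0_l Rmult_0_r.
HB.instance Definition _ := Monoid.isAddLaw.Build R Rmult Rplus
  Rmult_plus_distr_r Rmult_plus_distr_l.
HB.instance Definition _ := Monoid.isComLaw.Build C (RtoC 0) Cplus
  Cplus_assoc Cplus_comm Cplus_0_l.
HB.instance Definition _ := Monoid.isComLaw.Build C (RtoC 1) Cmult
  Cmult_assoc Cmult_comm Cmult_1_l.
HB.instance Definition _ := Monoid.isMulLaw.Build C (RtoC 0) Cmult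
  Cmult_0_l Cmult_0_r.
HB.instance Definition _ := Monoid.isAddLaw.Build C Cmult Cplus
  Cmult_plus_distr_r Cmult_plus_distr_l.

(** * Finite sums and products in R and C *)

Notation "\sum_ ( i <- r | P ) F" := (\big[Rplus/0%R]_(i <- r | P%B) F%R) : R_scope.
Notation "\sum_ ( i <- r ) F" := (\big[Rplus/0%R]_(i <- r) F%R) : R_scope.
Notation "\sum_ ( m <= i < n | P ) F" := (\big[Rplus/0%R]_(m <= i < n | P%B) F%R) : R_scope.
Notation "\sum_ ( m <= i < n ) F" := (\big[Rplus/0%R]_(m <= i < n) F%R) : R_scope.
Notation "\prod_ ( i <- r | P ) F" := (\big[Rmult/1%R]_(i <- r | P%B) F%R) : R_scope.
Notation "\prod_ ( i <- r ) F" := (\big[Rmult/1%R]_(i <- r) F%R) : R_scope.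
Notation "\sum_ ( i <- r | P ) F" := (\big[Cplus/RtoC 0]_(i <- r | P%B) F%C) : C_scope.
Notation "\sum_ ( i <- r ) F" := (\big[Cplus/RtoC 0]_(i <- r) F%C) : C_scope.
Notation "\sum_ ( m <= i < n | P ) F" := (\big[Cplus/RtoC 0]_(m <= i < n | P%B) F%C) : C_scope.
Notation "\sum_ ( m <= i < n ) F" := (\big[Cplus/RtoC 0]_(m <= i < n) F%C) : C_scope.
Notation "\prod_ ( i <- r | P ) F" := (\big[Cmult/RtoC 1]_(i <- r | P%B) F%C) : C_scope.
Notation "\prod_ ( i <- r ) F" := (\big[Cmult/RtoC 1]_(i <- r) F%C) : C_scope.

Lemma Rsum_le (I : Type) (r : seq I) (P : pred I) (F G : I -> R) :
  (forall i, P i -> F i <= G i) ->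
  \sum_(i <- r | P i) F i <= \sum_(i <- r | P i) G i.
Proof. by move=> h; elim/big_ind2: _ => // *; lra. Qed.

Lemma Rsum_le_seq (I : eqType) (r : seq I) (P : pred I) (F G : I -> R) :
  (forall i, i \in r -> P i -> F i <= G i) ->
  \sum_(i <- r | P i) F i <= \sum_(i <- r | P i) G i.
Proof.
move=> h; rewrite big_seq_cond [X in _ <= X]big_seq_cond.
by apply: Rsum_le => i /andP[]; apply: h.
Qed.

Lemma Rsum_le_nat (m n : nat) (F G : nat -> R) :
  (forall i, (m <= i < n)%N -> F i <= G i) ->
  \sum_(m <= i < n) F i <= \sum_(m <= i < n) G i.
Proof.
by move=> h; apply: Rsum_le_seq => i; rewrite mem_index_iota => /h.
Qed.

Lemma Rsum_ge0 (I : Type) (r : seq I) (P : pred I) (F : I -> R) :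
  (forall i, P i -> 0 <= F i) -> 0 <= \sum_(i <- r | P i) F i.
Proof. by move=> h; elim/big_ind: _ => // *; lra. Qed.

Lemma Rsum_ge0_seq (I : eqType) (r : seq I) (P : pred I) (F : I -> R) :
  (forall i, i \in r -> P i -> 0 <= F i) -> 0 <= \sum_(i <- r | P i) F i.
Proof.
by move=> h; rewrite big_seq_cond; apply: Rsum_ge0 => i /andP[]; apply: h.
Qed.

Lemma Rsum_sub (I : Type) (r : seq I) (P Q : pred I) (F : I -> R) :
  (forall i, P i -> Q i) -> (forall i, Q i -> 0 <= F i) ->
  \sum_(i <- r | P i) F i <= \sum_(i <- r | Q i) F i.
Proof.
move=> hPQ h0; rewrite big_mkcond [X in _ <= X]big_mkcond; apply: Rsum_le => i _.
have := hPQ i; have := h0 i.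
by case: (P i); case: (Q i) => // h1 h2; try lra; [have := h2 isT | have := h1 isT; lra].
Qed.

Lemma Rsum_widen (m n p : nat) (F : nat -> R) (P : pred nat) :
  (n <= p)%N -> (forall i, (n <= i)%N -> 0 <= F i) ->
  \sum_(m <= i < n | P i) F i <= \sum_(m <= i < p | P i) F i.
Proof.
move=> hnp h0; have [hmn|hnm] := leqP m n; last first.
  by rewrite [X in X <= _]big_geq; [apply: Rsum_ge0_seq => i; rewrite mem_index_iota => /andP[h1 _] _; apply: h0; lia | lia].
rewrite [X in _ <= X](big_cat_nat _ (n := n)) //=.
suff: 0 <= \sum_(n <= i < p | P i) F i by lra.
by apply: Rsum_ge0_seq => i; rewrite mem_index_iota => /andP[h1 _] _; apply: h0.
Qed.

Lemma Rsum_opp (I : Type) (r : seq I) (P : pred I) (F : I -> R) :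
  \sum_(i <- r | P i) - F i = - \sum_(i <- r | P i) F i.
Proof. by apply: (big_ind2 (fun x y => x = - y)) => // [|x y z t -> ->]; lra. Qed.

Lemma Rsum_minus (I : Type) (r : seq I) (P : pred I) (F G : I -> R) :
  \sum_(i <- r | P i) (F i - G i) =
  \sum_(i <- r | P i) F i - \sum_(i <- r | P i) G i.
Proof. by rewrite big_split /= Rsum_opp. Qed.

Lemma Csum_opp (I : Type) (r : seq I) (P : pred I) (F : I -> C) :
  (\sum_(i <- r | P i) - F i = - \sum_(i <- r | P i) F i)%C.
Proof. by apply: (big_ind2 (fun x y => x = - y)%C) => // [|x y z t -> ->]; ring. Qed.

Lemma Csum_minus (I : Type) (r : seq I) (P : pred I) (F G : I -> C) :
  (\sum_(i <- r | P i) (F i - G i) =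
   \sum_(i <- r | P i) F i - \sum_(i <- r | P i) G i)%C.
Proof. by rewrite big_split /= Csum_opp. Qed.

Lemma Rsum_const_nat (m n : nat) (c : R) :
  \sum_(m <= i < n) c = INR (n - m) * c.
Proof.
rewrite big_const_nat; elim: (n - m)%N => [|k IH]; first by rewrite /=; lra.
by rewrite iterS IH S_INR; lra.
Qed.

Lemma Rsum_const (I : Type) (r : seq I) (c : R) :
  \sum_(i <- r) c = INR (size r) * c.
Proof.
elim: r => [|x r IH]; first by rewrite big_nil /=; lra.
by rewrite big_cons IH [size (_ :: _)]/= S_INR; lra.
Qed.

Lemma Cmod_sum_le (I : Type) (r : seq I) (P : pred I) (F : I -> C) :
  Cmod (\sum_(i <- r | P i) F i)%C <= \sum_(i <- r | P i) Cmod (F i).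
Proof.
apply: (big_ind2 (fun x y => Cmod x <= y)) => // [|x1 y1 x2 y2 h1 h2|i _].
- by rewrite Cmod_0; lra.
- by have := Cmod_triangle x1 x2; lra.
- exact: Rle_refl.
Qed.

Lemma Rabs_sum_le (I : Type) (r : seq I) (P : pred I) (F : I -> R) :
  Rabs (\sum_(i <- r | P i) F i) <= \sum_(i <- r | P i) Rabs (F i).
Proof.
apply: (big_ind2 (fun x y => Rabs x <= y)) => // [|x1 y1 x2 y2 h1 h2|i _].
- by rewrite Rabs_R0; lra.
- by have := Rabs_triang x1 x2; lra.
- exact: Rle_refl.
Qed.

Lemma RtoC_sum (I : Type) (r : seq I) (P : pred I) (F : I -> R) :
  RtoC (\sum_(i <- r | P i) F i) = (\sum_(i <- r | P i) RtoC (F i))%C.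
Proof. by apply: big_morph => // x y; rewrite RtoC_plus. Qed.

Lemma RtoC_prod (I : Type) (r : seq I) (P : pred I) (F : I -> R) :
  RtoC (\prod_(i <- r | P i) F i) = (\prod_(i <- r | P i) RtoC (F i))%C.
Proof. by apply: big_morph => // x y; rewrite RtoC_mult. Qed.

Lemma Re_sum (I : Type) (r : seq I) (P : pred I) (F : I -> C) :
  Re (\sum_(i <- r | P i) F i)%C = \sum_(i <- r | P i) Re (F i).
Proof. by apply: (big_morph Re). Qed.

Lemma Im_sum (I : Type) (r : seq I) (P : pred I) (F : I -> C) :
  Im (\sum_(i <- r | P i) F i)%C = \sum_(i <- r | P i) Im (F i).
Proof. by apply: (big_morph Im). Qed.

Lemma Cconj_sum (I : Type) (r : seq I) (P : pred I) (F : I -> C) :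
  Cconj (\sum_(i <- r | P i) F i)%C = (\sum_(i <- r | P i) Cconj (F i))%C.
Proof.
apply: (big_morph Cconj) => [x y|]; first by rewrite Cplus_conj.
by rewrite /Cconj /=; congr pair; lra.
Qed.

Lemma Cmod_prod (I : Type) (r : seq I) (P : pred I) (F : I -> C) :
  Cmod (\prod_(i <- r | P i) F i)%C = \prod_(i <- r | P i) Cmod (F i).
Proof. by apply: (big_morph Cmod) => [x y|]; rewrite ?Cmod_mult ?Cmod_1. Qed.

Lemma Rprod_gt0 (I : eqType) (r : seq I) (P : pred I) (F : I -> R) :
  (forall i, i \in r -> P i -> 0 < F i) -> 0 < \prod_(i <- r | P i) F i.
Proof.
move=> h; rewrite big_seq_cond; elim/big_ind: _ => [|x y|i /andP[]]; first lra.
  exact: Rmult_lt_0_compat.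
exact: h.
Qed.

Lemma Rprod_le (I : eqType) (r : seq I) (P : pred I) (F G : I -> R) :
  (forall i, i \in r -> P i -> 0 <= F i <= G i) ->
  \prod_(i <- r | P i) F i <= \prod_(i <- r | P i) G i.
Proof.
move=> h; suff: 0 <= \prod_(i <- r | P i) F i <= \prod_(i <- r | P i) G i by lra.
rewrite big_seq_cond [X in _ <= _ <= X]big_seq_cond.
apply: (big_ind2 (fun x y => 0 <= x <= y)) => [|x1 y1 x2 y2 h1 h2|i /andP[]].
- by lra.
- by split; [apply: Rmult_le_pos | apply: Rmult_le_compat]; lra.
- exact: h.
Qed.

(** Weierstrass' product inequality. The induction must also carry that the product lies in
    [0, 1]. *)
Lemma Rprod_one_minus_ge (I : eqType) (r : seq I) (P : pred I) (a : I -> R) :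
  (forall i, i \in r -> P i -> 0 <= a i <= 1) ->
  1 - \sum_(i <- r | P i) a i <= \prod_(i <- r | P i) (1 - a i).
Proof.
move=> h; suff: 0 <= \prod_(i <- r | P i) (1 - a i) <= 1 /\
  1 - \sum_(i <- r | P i) a i <= \prod_(i <- r | P i) (1 - a i) by case.
elim: r h => [|x r IH] h; first by rewrite !big_nil; lra.
have /IH [h1 h2] : forall i, i \in r -> P i -> 0 <= a i <= 1.
  by move=> i hi; apply: h; rewrite inE hi orbT.
rewrite !big_cons; case hx: (P x) => //.
have := h x (mem_head _ _) hx; set p := \big[_/_]_(_ <- _ | _) _ in h1 h2 *.
by nra.
Qed.

Lemma Rprod_exp (I : Type) (r : seq I) (P : pred I) (F : I -> R) :
  \prod_(i <- r | P i) exp (F i) = exp (\sum_(i <- r | P i) F i).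
Proof. by symmetry; apply: (big_morph exp) => [x y|]; rewrite ?exp_plus ?exp_0. Qed.

Lemma ln_prod (I : eqType) (r : seq I) (P : pred I) (F : I -> R) :
  (forall i, i \in r -> P i -> 0 < F i) ->
  ln (\prod_(i <- r | P i) F i) = \sum_(i <- r | P i) ln (F i).
Proof.
move=> h; rewrite -[RHS]ln_exp -Rprod_exp; congr ln.
rewrite big_seq_cond [RHS]big_seq_cond; apply: eq_bigr => i /andP[h1 h2].
by rewrite exp_ln //; apply: h.
Qed.

Lemma Rprod_pow (I : Type) (r : seq I) (P : pred I) (F : I -> R) (k : nat) :
  \prod_(i <- r | P i) F i ^ k = (\prod_(i <- r | P i) F i) ^ k.
Proof. symmetry; apply: (big_morph (pow^~ k)) => [x y|] /=; last exact: pow1.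
exact: Rpow_mult_distr. Qed.

Lemma INR_leq (m n : nat) : (m <= n)%N -> INR m <= INR n.
Proof. by move=> h; apply: le_INR; lia. Qed.

Lemma INR_addn m n : INR (m + n)%N = INR m + INR n.
Proof. by rewrite plus_INR. Qed.

Lemma INR_muln m n : INR (m * n)%N = INR m * INR n.
Proof. by rewrite mult_INR. Qed.

Lemma INR_expn m n : INR (m ^ n)%N = INR m ^ n.
Proof. by elim: n => [|n IH]; rewrite ?expnS ?INR_muln ?IH. Qed.

Lemma INR_ge1 n : (0 < n)%N -> 1 <= INR n.
Proof. by move=> h; apply: (INR_leq (m := 1)). Qed.

Lemma INR_subn m n : (n <= m)%N -> INR (m - n)%N = INR m - INR n.
Proof. by move=> h; rewrite minus_INR //; lia. Qed.

Lemma INR_leq_inv (m n : nat) : INR m <= INR n -> (m <= n)%N.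
Proof. by move=> h; have := INR_le _ _ h; lia. Qed.

Lemma INR_pos (n : nat) : 0 <= INR n. Proof. exact: pos_INR. Qed.

(** Includes n = 0, where [ln] takes its default value 0; sums over all naturals then need no side
    condition. *)
Lemma ln_INR_ge0 n : 0 <= ln (INR n).
Proof.
case: n => [|n].
  by unfold ln; destruct (Rlt_dec 0 (INR 0)) as [h|h]; [case: (Rlt_irrefl _ h)|apply: Rle_refl].
by rewrite -ln_1; apply: ln_le; [lra | exact: INR_ge1].
Qed.

Lemma ln_INR_muln m n : (0 < m)%N -> (0 < n)%N ->
  ln (INR (m * n)%N) = ln (INR m) + ln (INR n).
Proof. by move=> /INR_ge1 h1 /INR_ge1 h2; rewrite INR_muln ln_mult //; lra. Qed.

Lemma ln_INR_expn m j : (0 < m)%N -> ln (INR (m ^ j)%N) = INR j * ln (INR m).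
Proof.
move=> m0; elim: j => [|j IH]; first by rewrite expn0 /= ln_1; lra.
by rewrite expnS ln_INR_muln ?expn_gt0 ?m0 // IH S_INR; lra.
Qed.

Lemma exp_le_compat x y : x <= y -> exp x <= exp y.
Proof. by case=> [/exp_increasing|->]; lra. Qed.

Lemma ln_le_sub1 x : 0 < x -> ln x <= x - 1.
Proof. by move=> h; have := exp_ineq1_le (ln x); rewrite exp_ln //; lra. Qed.

Lemma ln_ge_1subV x : 0 < x -> 1 - / x <= ln x.
Proof.
by move=> h; have := ln_le_sub1 (Rinv_0_lt_compat _ h); rewrite ln_Rinv //; lra.
Qed.

(** * Complex powers *)

Lemma Cexp_plus (a b : C) : Cexp (a + b)%C = (Cexp a * Cexp b)%C.
Proof.
case: a b => [a1 a2] [b1 b2].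
rewrite /Cexp /Cmult /Cplus /= exp_plus cos_plus sin_plus.
by congr pair; ring.
Qed.

Lemma Cexp_0 : Cexp 0 = 1.
Proof. by rewrite /Cexp /= exp_0 cos_0 sin_0; congr pair; ring. Qed.

Lemma Cmod_Cexp (a : C) : Cmod (Cexp a) = exp (Re a).
Proof.
case: a => x y; have h0 := exp_pos x.
rewrite /Cmod /Cexp /=; set e := exp _ in h0 *.
have h : sin y * sin y + cos y * cos y = 1 := sin2_cos2 y.
rewrite (_ : _ + _ = e * e * (sin y * sin y + cos y * cos y)); last by ring.
by rewrite h Rmult_1_r sqrt_square; lra.
Qed.

Lemma Cconj_Cexp (a : C) : Cconj (Cexp a) = Cexp (Cconj a).
Proof. by case: a => x y; rewrite /Cexp /Cconj /= cos_neg sin_neg; congr pair; ring. Qed.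

Lemma im_le_Cmod (c : C) : Rabs (Im c) <= Cmod c.
Proof. by have := Rmax_Cmod c; have := Rmax_r (Rabs (fst c)) (Rabs (snd c)); rewrite /Im; lra. Qed.

(** Take c = conj w / |w|. Bounds on complex quantities thereby reduce to real parts of their
    rotations, to which the real mean value theorem applies. *)
Lemma Cmod_le_of_Re (w : C) (B : R) :
  (forall c : C, Cmod c = 1 -> Re (c * w)%C <= B) -> Cmod w <= B.
Proof.
move=> h; have [w0|/Cmod_gt_0 w0] := Ceq_dec w 0.
  have := h 1 Cmod_1; rewrite w0 Cmod_0 /=; lra.
have m0 : Cmod w <> 0 by lra.
have mC : RtoC (Cmod w) <> 0 by move=> /RtoC_inj.
have hc : Cmod (Cconj w / Cmod w)%C = 1.
  rewrite Cmod_div // Cmod_conj Cmod_R Rabs_pos_eq; last by lra.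
  by field.
have := h _ hc.
rewrite (_ : (Cconj w / Cmod w * w)%C = RtoC (Cmod w)) //.
have e : (w * Cconj w)%C = RtoC (Cmod w ^ 2) by rewrite Cmod2_conj.
have -> : (Cconj w / Cmod w * w = (w * Cconj w) / Cmod w)%C by field.
by rewrite e RtoC_pow; field.
Qed.

Lemma is_derive_Re_Cexp (c w : C) (t : R) :
  is_derive (fun t : R => Re (c * Cexp (t * w))%C) t (Re (c * w * Cexp (t * w))%C).
Proof.
case: c w => [a b] [u v]; rewrite /Cexp /=.
auto_derive; first by [].
by rewrite /Rminus; ring.
Qed.

Lemma Re_mul_unit_le (c w : C) : Cmod c = 1 -> Re (c * w)%C <= Cmod w.
Proof.
move=> h; have := re_le_Cmod (c * w); rewrite Cmod_mult h Rmult_1_l.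
by have := Rle_abs (Re (c * w)); lra.
Qed.

Lemma Cmod_Cexp_scal_le (t : R) (w : C) : 0 <= t <= 1 ->
  Cmod (Cexp (t * w)) <= exp (Cmod w).
Proof.
move=> ht; rewrite Cmod_Cexp; apply: exp_le_compat.
have -> : Re (t * w) = t * Re w by case: w => a b /=; ring.
have := re_le_Cmod w; have := Rle_abs (Re w); have := Rabs_pos (Re w).
by nra.
Qed.

(** Mean value theorem on [0, 1] for t -> Re (c exp (t w)), with c an arbitrary rotation. *)
Lemma Cexp_sub1_le (w : C) : Cmod (Cexp w - 1)%C <= Cmod w * exp (Cmod w).
Proof.
apply: Cmod_le_of_Re => c hc.
have [t [h1 [h2 h3]]] := MVT_cor2 _ _ 0 1 Rlt_0_1
  (fun t _ => proj1 (is_derive_Reals _ _ _) (is_derive_Re_Cexp c w t)).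
rewrite !Cmult_0_l !Cmult_1_l Cexp_0 Rminus_0_r Rmult_1_r in h1.
have -> : Re (c * (Cexp w - 1))%C = Re (c * Cexp w)%C - Re (c * 1)%C.
  by case: c {hc h1} => a b; case: (Cexp w) => u v /=; ring.
rewrite h1 -Cmult_assoc.
apply: Rle_trans (Re_mul_unit_le _ hc) _; rewrite Cmod_mult.
by apply: Rmult_le_compat_l (Cmod_ge_0 w) _; apply: Cmod_Cexp_scal_le; lra.
Qed.

Lemma Cexp_sub1_sub_le (w : C) :
  Cmod (Cexp w - 1 - w)%C <= Cmod w ^ 2 * exp (Cmod w).
Proof.
apply: Cmod_le_of_Re => c hc.
have hd t : is_derive (fun t : R => Re (c * Cexp (t * w))%C - t * Re (c * w)%C) t
   (Re (c * w * Cexp (t * w))%C - Re (c * w)%C).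
  apply: (is_derive_minus (V := R_NormedModule)); first exact: is_derive_Re_Cexp.
  by move: (Re (c * w)%C) => y; auto_derive; [|rewrite Rmult_1_l].
have [t [h1 [h2 h3]]] := MVT_cor2 _ _ 0 1 Rlt_0_1
  (fun t _ => proj1 (is_derive_Reals _ _ _) (hd t)).
rewrite !Cmult_0_l !Cmult_1_l Cexp_0 Rminus_0_r Rmult_1_r Rmult_0_l Rmult_1_l in h1.
have -> : Re (c * (Cexp w - 1 - w))%C =
    Re (c * Cexp w)%C - Re (c * w)%C - (Re (c * 1)%C - 0).
  by case: (Cexp w) => u v; case: c {hc h1 hd} => a b; case: w => x y /=; ring.
have -> : Re (c * Cexp w)%C - Re (c * w)%C - (Re (c * 1)%C - 0) =
   Re (c * (w * (Cexp (t * w) - 1)))%C.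
  by rewrite h1; case: (Cexp _) => u v; case: c {hc h1 hd} => a b; case: w => x y /=; ring.
apply: Rle_trans (Re_mul_unit_le _ hc) _; rewrite Cmod_mult.
have -> : Cmod w ^ 2 * exp (Cmod w) = Cmod w * (Cmod w * exp (Cmod w)) by ring.
apply: Rmult_le_compat_l (Cmod_ge_0 w) _.
apply: Rle_trans (Cexp_sub1_le _) _.
rewrite Cmod_mult Cmod_R Rabs_pos_eq; last by lra.
have h0 := Cmod_ge_0 w.
apply: Rmult_le_compat; [by apply: Rmult_le_pos; lra | by left; apply: exp_pos | by nra|].
by apply: exp_le_compat; nra.
Qed.

(** The real power n^(-x), which is the modulus of n^(-s) when Re s = x. Since [ln 0] is 0, its
    value at n = 0 is 1. *)
Definition npw (n : nat) (x : R) : R := exp (- x * ln (INR n)).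

Lemma npw_gt0 n x : 0 < npw n x. Proof. exact: exp_pos. Qed.

Lemma npw_plus n x y : npw n (x + y) = npw n x * npw n y.
Proof. by rewrite /npw -exp_plus; congr exp; ring. Qed.

Lemma npw_mul m n x : (0 < m)%N -> (0 < n)%N -> npw (m * n) x = npw m x * npw n x.
Proof. by move=> h1 h2; rewrite /npw ln_INR_muln // -exp_plus; congr exp; ring. Qed.

Lemma npw_le n x y : x <= y -> npw n y <= npw n x.
Proof. by move=> h; apply: exp_le_compat; have := ln_INR_ge0 n; nra. Qed.

Lemma npw_anti m n x : 0 <= x -> (0 < m)%N -> (m <= n)%N -> npw n x <= npw m x.
Proof.
move=> h0 h1 h2; apply: exp_le_compat.
have : ln (INR m) <= ln (INR n).
  by apply: ln_le; [have := INR_ge1 h1; lra | apply: INR_leq].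
by nra.
Qed.

Lemma npw_1 n : (0 < n)%N -> npw n 1 = / INR n.
Proof.
move=> h; rewrite /npw -(exp_ln (/ INR n)); last by apply: Rinv_0_lt_compat; have := INR_ge1 h; lra.
by rewrite ln_Rinv; [congr exp; ring | have := INR_ge1 h; lra].
Qed.

Lemma npw_0 n : npw n 0 = 1.
Proof. by rewrite /npw Ropp_0 Rmult_0_l exp_0. Qed.

Lemma npw_1n x : npw 1 x = 1.
Proof. by rewrite /npw /= ln_1 Rmult_0_r exp_0. Qed.

Lemma npw_le1 n x : 0 <= x -> npw n x <= 1.
Proof. by move=> h; rewrite -(npw_0 n); apply: npw_le. Qed.

Lemma npw_leV n x : (0 < n)%N -> 1 <= x -> npw n x <= / INR n.
Proof. by move=> h1 h2; rewrite -npw_1 //; apply: npw_le. Qed.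

Lemma npw_2 n : (0 < n)%N -> npw n 2 = / INR n ^ 2.
Proof.
move=> h; rewrite (_ : 2 = 1 + 1) // npw_plus npw_1 //.
by field; have := INR_ge1 h; lra.
Qed.

Lemma Cmod_ncpow n s : Cmod (ncpow_opp n s) = npw n (Re s).
Proof.
rewrite /ncpow_opp Cmod_Cexp /npw; congr exp.
by case: s => x y /=; ring.
Qed.

Lemma ncpow_1n s : ncpow_opp 1 s = 1.
Proof. by rewrite /ncpow_opp /= ln_1 Cmult_0_r -Cexp_0; congr Cexp; ring. Qed.

Lemma ncpow_mul m n s : (0 < m)%N -> (0 < n)%N ->
  ncpow_opp (m * n) s = (ncpow_opp m s * ncpow_opp n s)%C.
Proof.
move=> h1 h2; rewrite /ncpow_opp ln_INR_muln // -Cexp_plus RtoC_plus.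
by congr Cexp; ring.
Qed.

Lemma ncpow_expn p j s : (0 < p)%N -> ncpow_opp (p ^ j) s = (ncpow_opp p s ^ j)%C.
Proof.
move=> h; elim: j => [|j IH]; first by rewrite expn0 ncpow_1n.
by rewrite expnS ncpow_mul ?expn_gt0 ?h // IH.
Qed.

Lemma ncpow_plus n s h : ncpow_opp n (s + h)%C = (ncpow_opp n s * ncpow_opp n h)%C.
Proof. by rewrite /ncpow_opp -Cexp_plus; congr Cexp; ring. Qed.

Lemma ncpow_RtoC n (x : R) : ncpow_opp n x = npw n x.
Proof.
rewrite /ncpow_opp /Cexp /npw /= (_ : - (x * 0 + 0 * ln (INR n)) = 0); last by ring.
rewrite cos_0 sin_0 (_ : - (x * ln (INR n) - 0 * 0) = - x * ln (INR n)); last by ring.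
by congr pair; ring.
Qed.

Lemma Cconj_ncpow n s : Cconj (ncpow_opp n s) = ncpow_opp n (Cconj s).
Proof. by case: s => x y; rewrite /ncpow_opp Cconj_Cexp; f_equal; apply: injective_projections => /=; ring. Qed.

Lemma Cmod_hln (h : C) n : Cmod (- (h * ln (INR n)))%C = Cmod h * ln (INR n).
Proof.
by rewrite Cmod_opp Cmod_mult Cmod_R Rabs_pos_eq //; apply: ln_INR_ge0.
Qed.

Lemma exp_hln (h : C) n s : npw n (Re s) * exp (Cmod h * ln (INR n)) = npw n (Re s - Cmod h).
Proof. by rewrite /npw -exp_plus; congr exp; ring. Qed.

Lemma ncpow_lip (n : nat) (s h : C) :
  Cmod (ncpow_opp n (s + h) - ncpow_opp n s)%C <=
  Cmod h * (ln (INR n) * npw n (Re s - Cmod h)).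
Proof.
rewrite ncpow_plus.
have -> : (ncpow_opp n s * ncpow_opp n h - ncpow_opp n s =
  ncpow_opp n s * (ncpow_opp n h - 1))%C by ring.
rewrite Cmod_mult Cmod_ncpow -exp_hln.
have := Cexp_sub1_le (- (h * ln (INR n)))%C; rewrite Cmod_hln => h1.
have := Rmult_le_compat_l _ _ _ (Rlt_le _ _ (npw_gt0 n (Re s))) h1.
by rewrite /ncpow_opp; nra.
Qed.

Lemma ncpow_lip2 (n : nat) (s h : C) :
  Cmod (ncpow_opp n (s + h) - ncpow_opp n s + h * (ln (INR n) * ncpow_opp n s))%C <=
  Cmod h ^ 2 * (ln (INR n) ^ 2 * npw n (Re s - Cmod h)).
Proof.
rewrite ncpow_plus.
have -> : (ncpow_opp n s * ncpow_opp n h - ncpow_opp n s +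
   h * (ln (INR n) * ncpow_opp n s) =
  ncpow_opp n s * (Cexp (- (h * ln (INR n))) - 1 - (- (h * ln (INR n)))))%C.
  by rewrite {2}/ncpow_opp; ring.
rewrite Cmod_mult Cmod_ncpow -exp_hln.
have := Cexp_sub1_sub_le (- (h * ln (INR n)))%C; rewrite Cmod_hln => h1.
have := Rmult_le_compat_l _ _ _ (Rlt_le _ _ (npw_gt0 n (Re s))) h1.
by rewrite Rpow_mult_distr; nra.
Qed.

Lemma Re_ge_sub (s s0 : C) (r : R) : Cmod (s - s0)%C <= r -> Re s0 - r <= Re s.
Proof.
move=> h; have := re_le_Cmod (s - s0)%C; have := Rle_abs (- Re (s - s0)%C).
by rewrite Rabs_Ropp; case: s s0 {h} (h) => a b [c d] /=; lra.
Qed.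

Lemma Im_ge_sub (s s0 : C) (r : R) : Cmod (s - s0)%C <= r ->
  Im s0 - r <= Im s <= Im s0 + r.
Proof.
move=> h; have := im_le_Cmod (s - s0)%C; have := Rle_abs (- Im (s - s0)%C).
have := Rle_abs (Im (s - s0)%C).
by rewrite Rabs_Ropp; case: s s0 {h} (h) => a b [c d] /=; lra.
Qed.

(** The slope between any two points of a disc is compared with the derivative at its centre, as
    Newton's method with a frozen derivative requires. The loss 3r in the exponent is r for moving
    from s0 to s and 2r for |s' - s|. *)
Lemma ncpow_strong_diff (n : nat) (s0 s s' : C) (r : R) :
  Cmod (s - s0)%C <= r -> Cmod (s' - s0)%C <= r ->
  Cmod (ncpow_opp n s' - ncpow_opp n s + (s' - s) * (ln (INR n) * ncpow_opp n s0))%C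
  <= Cmod (s' - s)%C * (3 * r * (ln (INR n) ^ 2 * npw n (Re s0 - 3 * r))).
Proof.
move=> h1 h2; set h := (s' - s)%C.
have hh : Cmod h <= 2 * r.
  rewrite (_ : h = (s' - s0) + - (s - s0))%C; last by rewrite /h; ring.
  by have := Cmod_triangle (s' - s0) (- (s - s0)); rewrite Cmod_opp; lra.
have h0 := Cmod_ge_0 h; have r0 : 0 <= r by have := Cmod_ge_0 (s - s0)%C; lra.
have l0 := ln_INR_ge0 n.
have -> : (ncpow_opp n s' - ncpow_opp n s + h * (ln (INR n) * ncpow_opp n s0) =
  (ncpow_opp n (s + h) - ncpow_opp n s + h * (ln (INR n) * ncpow_opp n s)) +
  - (h * ln (INR n) * (ncpow_opp n (s0 + (s - s0)) - ncpow_opp n s0)))%C.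
  have -> : (s + h = s')%C by rewrite /h; ring.
  have -> : (s0 + (s - s0) = s)%C by ring.
  by ring.
apply: Rle_trans (Cmod_triangle _ _) _; rewrite Cmod_opp !Cmod_mult.
rewrite Cmod_R Rabs_pos_eq //.
have A := ncpow_lip2 n s h; have B := ncpow_lip n s0 (s - s0).
have A1 : npw n (Re s - Cmod h) <= npw n (Re s0 - 3 * r).
  by apply: npw_le; have := Re_ge_sub h1; lra.
have B1 : npw n (Re s0 - Cmod (s - s0)) <= npw n (Re s0 - 3 * r).
  by apply: npw_le; lra.
have A2 := npw_gt0 n (Re s - Cmod h); have B2 := npw_gt0 n (Re s0 - Cmod (s - s0)).
set L := ln (INR n) in l0 A B *; set E := npw n (Re s0 - 3 * r) in A1 B1 *.
have A3 : Cmod h ^ 2 * (L ^ 2 * npw n (Re s - Cmod h)) <= Cmod h * (2 * r * (L ^ 2 * E)).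
  have : L ^ 2 * npw n (Re s - Cmod h) <= L ^ 2 * E by apply: Rmult_le_compat_l => //; nra.
  have : 0 <= L ^ 2 * npw n (Re s - Cmod h) by apply: Rmult_le_pos; nra.
  set x := _ * npw _ _; set y := _ * E => x0 xy.
  rewrite -[Cmod h ^ 2]/(Cmod h * (Cmod h * 1)) Rmult_1_r Rmult_assoc.
  by apply: Rmult_le_compat_l => //; apply: Rmult_le_compat.
have B3 : Cmod (ncpow_opp n (s0 + (s - s0)) - ncpow_opp n s0)%C <= r * (L * E).
  apply: Rle_trans B _; apply: Rmult_le_compat => //.
  - exact: Cmod_ge_0.
  - by apply: Rmult_le_pos; lra.
  - by apply: Rmult_le_compat_l.
have B4 : Cmod h * L * Cmod (ncpow_opp n (s0 + (s - s0)) - ncpow_opp n s0)%C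
   <= Cmod h * L * (r * (L * E)).
  by apply: Rmult_le_compat_l => //; apply: Rmult_le_pos.
by nra.
Qed.

(** * Dirichlet series *)

(** Together with [npw_succ_diff_le] this replaces the integral test: the differences of n^(-d)
    telescope and are comparable with d n^(-1-d). *)
Lemma npw_succ_diff_ge (n : nat) (d : R) : 0 < d -> (0 < n)%N ->
  d * npw n.+1 (1 + d) <= npw n d - npw n.+1 d.
Proof.
move=> d0 n0; have n1 := INR_ge1 n0.
have e : npw n d = npw n.+1 d * exp (d * (ln (INR n.+1) - ln (INR n))).
  by rewrite /npw -exp_plus; congr exp; ring.
have h1 : / INR n.+1 <= ln (INR n.+1) - ln (INR n).
  rewrite -ln_div; [|rewrite S_INR; lra|lra].
  apply: Rle_trans (ln_ge_1subV _); last by apply: Rdiv_lt_0_compat; rewrite ?S_INR; lra.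
  by right; rewrite S_INR; field; lra.
have h2 := exp_ineq1_le (d * (ln (INR n.+1) - ln (INR n))).
rewrite e Rplus_comm npw_plus npw_1 //.
have p0 := npw_gt0 n.+1 d; set E := exp _ in h2 *; set L := _ - ln _ in h1 h2.
have : npw n.+1 d * (1 + d * / INR n.+1) <= npw n.+1 d * E.
  apply: Rmult_le_compat_l; first lra.
  by have := Rmult_le_compat_l d _ _ (Rlt_le _ _ d0) h1; lra.
lra.
Qed.

Lemma npw_succ_diff_le (n : nat) (d : R) : 0 < d -> (0 < n)%N ->
  npw n d - npw n.+1 d <= d * npw n (1 + d).
Proof.
move=> d0 n0; have n1 := INR_ge1 n0.
have e : npw n.+1 d = npw n d * exp (- (d * (ln (INR n.+1) - ln (INR n)))).
  by rewrite /npw -exp_plus; congr exp; ring.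
have h1 : ln (INR n.+1) - ln (INR n) <= / INR n.
  rewrite -ln_div; [|rewrite S_INR; lra|lra].
  apply: Rle_trans (ln_le_sub1 _) _; first by apply: Rdiv_lt_0_compat; rewrite ?S_INR; lra.
  by right; rewrite S_INR; field; lra.
have h2 := exp_ineq1_le (- (d * (ln (INR n.+1) - ln (INR n)))).
rewrite e Rplus_comm npw_plus npw_1 //.
have p0 := npw_gt0 n d; set E := exp _ in h2 *; set L := _ - ln _ in h1 h2.
have : npw n d * (1 - d * / INR n) <= npw n d * E.
  apply: Rmult_le_compat_l; first lra.
  by have := Rmult_le_compat_l d _ _ (Rlt_le _ _ d0) h1; lra.
lra.
Qed.

Lemma npw_tail (M N : nat) (d : R) : 0 < d -> (0 < M)%N ->
  \sum_(M.+1 <= n < N) npw n (1 + d) <= npw M d / d.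
Proof.
move=> d0 M0; have [hN|hN] := leqP N M.+1.
  rewrite big_geq //; apply: Rlt_le; apply: Rdiv_lt_0_compat => //; exact: npw_gt0.
suff : \sum_(M.+1 <= n < N) npw n (1 + d) <= (npw M d - npw N.-1 d) / d.
  have := npw_gt0 N.-1 d => h1 h2; apply: Rle_trans h2 _.
  by apply: Rmult_le_compat_r; [left; apply: Rinv_0_lt_compat | lra].
elim: N {hN} (ltnW hN) => // N IH; rewrite leq_eqVlt => /orP[/eqP <-|hN].
  by rewrite big_geq //; right; rewrite /=; field; lra.
rewrite big_nat_recr //=.
have := IH hN; case: N hN {IH} => // N hN /= h.
have /(npw_succ_diff_ge d0) h1 : (0 < N)%N by lia.
have : npw N.+1 (1 + d) <= (npw N d - npw N.+1 d) / d.
  by apply/Rle_div_r => //; lra.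
rewrite (_ : (npw M d - npw N.+1 d) / d = (npw M d - npw N d) / d + (npw N d - npw N.+1 d) / d); first lra.
by field; lra.
Qed.

Lemma npw_sum_le (N : nat) (d : R) : 0 < d ->
  \sum_(1 <= n < N) npw n (1 + d) <= 1 + / d.
Proof.
move=> d0; have i0 := Rinv_0_lt_compat _ d0; have [hN|hN] := leqP N 1.
  by rewrite big_geq //; lra.
rewrite big_ltn // npw_1n.
by have := npw_tail N d0 (isT : 0 < 1)%N; rewrite npw_1n /Rdiv; lra.
Qed.

Lemma npw_sum_ge (N : nat) (d : R) : 0 < d -> (0 < N)%N ->
  (1 - npw N d) / d <= \sum_(1 <= n < N) npw n (1 + d).
Proof.
move=> d0; elim: N => // -[|N] IH _.
  by rewrite big_geq // npw_1n; right; field; lra.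
rewrite big_nat_recr //=.
have h := npw_succ_diff_le d0 (ltn0Sn N).
have h1 : (npw N.+1 d - npw N.+2 d) / d <= npw N.+1 (1 + d).
  by apply/Rle_div_l => //; lra.
have -> : (1 - npw N.+2 d) / d = (1 - npw N.+1 d) / d + (npw N.+1 d - npw N.+2 d) / d.
  by field; lra.
by have := IH isT; lra.
Qed.

(** Half of the exponent d pays for the logarithms: ln n <= c exp (ln n / c) with c = 2(j+1)/d.
    Using j+1 instead of j keeps c positive when j = 0. *)
Lemma ln_pow_npw_le (j n : nat) (d : R) : 0 < d ->
  ln (INR n) ^ j * npw n (1 + d) <=
  (2 * INR j.+1 / d) ^ j * npw n (1 + d / 2).
Proof.
move=> d0; have j1 : 1 <= INR j.+1 by apply: INR_ge1.
have l0 := ln_INR_ge0 n; set c := 2 * INR j.+1 / d.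
have c0 : 0 < c by apply: Rdiv_lt_0_compat => //; lra.
set x := ln (INR n) / c.
have x0 : 0 <= x by apply: Rmult_le_pos => //; left; apply: Rinv_0_lt_compat.
have h1 : ln (INR n) <= c * exp x.
  have -> : ln (INR n) = c * x by rewrite /x; field; lra.
  by apply: Rmult_le_compat_l; [lra | have := exp_ineq1_le x; lra].
have h2 : ln (INR n) ^ j <= c ^ j * exp (INR j.+1 * x).
  apply: Rle_trans (pow_incr _ _ j (conj l0 h1)) _.
  rewrite Rpow_mult_distr; apply: Rmult_le_compat_l; first by apply: pow_le; lra.
  rewrite -(exp_ln (exp x ^ j)); last by apply: pow_lt; apply: exp_pos.
  rewrite ln_pow; last by apply: exp_pos.
  by rewrite ln_exp; apply: exp_le_compat; apply: Rmult_le_compat_r => //; apply: INR_leq.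
have e : exp (INR j.+1 * x) * npw n (1 + d) = npw n (1 + d / 2).
  by rewrite /npw -exp_plus; congr exp; rewrite /x /c; field; lra.
rewrite -e -Rmult_assoc; apply: Rmult_le_compat_r h2.
by left; apply: npw_gt0.
Qed.

Lemma ln_pow_const_ge0 (j : nat) (d : R) : 0 < d -> 0 <= (2 * INR j.+1 / d) ^ j.
Proof.
move=> d0; apply: pow_le; apply: Rmult_le_pos; first by have := INR_pos j.+1; lra.
by left; apply: Rinv_0_lt_compat.
Qed.

Lemma ln_pow_tail (j M N : nat) (d : R) : 0 < d -> (0 < M)%N ->
  \sum_(M.+1 <= n < N) ln (INR n) ^ j * npw n (1 + d) <=
  (2 * INR j.+1 / d) ^ j * (2 / d) * npw M (d / 2).
Proof.
move=> d0 M0; apply: Rle_trans (Rsum_le_nat (fun i _ => ln_pow_npw_le j i d0)) _.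
rewrite -big_distrr Rmult_assoc; apply: Rmult_le_compat_l; first exact: ln_pow_const_ge0.
have d2 : 0 < d / 2 by lra.
apply: Rle_trans (npw_tail N d2 M0) _; right; field; lra.
Qed.

Lemma ln_pow_sum_le (j N : nat) (d : R) : 0 < d ->
  \sum_(1 <= n < N) ln (INR n) ^ j * npw n (1 + d) <=
  (2 * INR j.+1 / d) ^ j * (1 + 2 / d).
Proof.
move=> d0; apply: Rle_trans (Rsum_le_nat (fun i _ => ln_pow_npw_le j i d0)) _.
rewrite -big_distrr; apply: Rmult_le_compat_l; first exact: ln_pow_const_ge0.
have d2 : 0 < d / 2 by lra.
apply: Rle_trans (npw_sum_le N d2) _; right; field; lra.
Qed.

(** * Limits of complex sequences and sums of complex series *)

Definition Clim (v : nat -> C) (l : C) : Prop :=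
  forall eps, 0 < eps -> exists N, forall n, (N <= n)%N -> Cmod (v n - l)%C < eps.

Definition Csum_to (u : nat -> C) (l : C) : Prop :=
  Clim (fun N => \sum_(1 <= n < N.+1) u n)%C l.

Lemma Clim_const c : Clim (fun _ => c) c.
Proof. by move=> e e0; exists 0%N => n _; rewrite (_ : c - c = 0)%C ?Cmod_0 //; ring. Qed.

Lemma Clim_ext (u v : nat -> C) l : (forall n, u n = v n) -> Clim u l -> Clim v l.
Proof. by move=> h hu e e0; have [N hN] := hu e e0; exists N => n; rewrite -h; apply: hN. Qed.

Lemma Clim_plus u v l m : Clim u l -> Clim v m -> Clim (fun n => u n + v n)%C (l + m)%C.
Proof.
move=> hu hv e e0; have e2 : 0 < e / 2 by lra.
have [N1 h1] := hu _ e2; have [N2 h2] := hv _ e2.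
exists (maxn N1 N2) => n; rewrite geq_max => /andP[n1 n2].
rewrite (_ : u n + v n - (l + m) = (u n - l) + (v n - m))%C; last by ring.
by have := Cmod_triangle (u n - l) (v n - m); have := h1 n n1; have := h2 n n2; lra.
Qed.

Lemma Clim_scal c u l : Clim u l -> Clim (fun n => c * u n)%C (c * l)%C.
Proof.
move=> hu e e0; have c0 := Cmod_ge_0 c.
have e2 : 0 < e / (Cmod c + 1) by apply: Rdiv_lt_0_compat; lra.
have [N hN] := hu _ e2; exists N => n /hN h.
rewrite (_ : c * u n - c * l = c * (u n - l))%C; last by ring.
rewrite Cmod_mult; apply: Rle_lt_trans (_ : (Cmod c + 1) * Cmod (u n - l)%C < e).
  by have := Cmod_ge_0 (u n - l)%C; nra.
rewrite Rmult_comm; have /Rlt_div_r := h; apply; lra.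
Qed.

Lemma Clim_opp u l : Clim u l -> Clim (fun n => - u n)%C (- l)%C.
Proof.
move=> /(Clim_scal (-1)%R) h; have -> : (- l = (-1)%R * l)%C by ring.
by apply: Clim_ext h => n; ring.
Qed.

Lemma Clim_minus u v l m : Clim u l -> Clim v m -> Clim (fun n => u n - v n)%C (l - m)%C.
Proof. by move=> hu hv; apply: Clim_plus => //; apply: Clim_opp. Qed.

Lemma Clim_le u l B : Clim u l -> (exists N, forall n, (N <= n)%N -> Cmod (u n) <= B) ->
  Cmod l <= B.
Proof.
move=> hu [N0 hB]; case: (Rle_lt_dec (Cmod l) B) => // h.
have e0 : 0 < Cmod l - B by lra.
have [N hN] := hu _ e0; have := hN _ (leq_maxl N N0); have := hB _ (leq_maxr N N0).
set n := maxn _ _ => h1 h2.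
have : Cmod l <= Cmod (u n) + Cmod (u n - l)%C.
  rewrite -(Cmod_opp (u n - l)); apply: Rle_trans (Cmod_triangle _ _).
  by right; congr Cmod; ring.
lra.
Qed.

Lemma Clim_sub_le u l a B : Clim u l ->
  (exists N, forall n, (N <= n)%N -> Cmod (u n - a)%C <= B) -> Cmod (l - a)%C <= B.
Proof.
by move=> hu; apply: Clim_le; apply: Clim_minus hu (Clim_const a).
Qed.

Lemma Clim_unique u l m : Clim u l -> Clim u m -> l = m.
Proof.
move=> hl hm.
have h : Clim (fun n => 0) (l - m)%C.
  by apply: Clim_ext (Clim_minus hl hm) => n; ring.
have /Rle_antisym H : Cmod (l - m)%C <= 0.
  by apply: Clim_le h _; exists 0%N => n _; rewrite Cmod_0; lra.
have /Cmod_eq_0 e : Cmod (l - m)%C = 0 by apply: H; apply: Cmod_ge_0.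
by have -> : (l = (l - m) + m)%C; [ring | rewrite e; ring].
Qed.

Lemma Clim_sum (I : Type) (r : seq I) (u : I -> nat -> C) (l : I -> C) :
  (forall i, Clim (u i) (l i)) ->
  Clim (fun n => \sum_(i <- r) u i n)%C (\sum_(i <- r) l i)%C.
Proof.
move=> h; elim: r => [|i r IH].
  by rewrite big_nil; apply: Clim_ext (Clim_const 0) => n; rewrite big_nil.
rewrite big_cons; apply: Clim_ext (Clim_plus (h i) IH) => n.
by rewrite big_cons.
Qed.

Lemma Clim_sub (u : nat -> C) (l : C) (phi : nat -> nat) :
  (forall M, exists N, forall n, (N <= n)%N -> (M <= phi n)%N) ->
  Clim u l -> Clim (fun n => u (phi n)) l.
Proof.
move=> hp hu e e0; have [M hM] := hu e e0; have [N hN] := hp M.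
by exists N => n /hN /hM.
Qed.

Lemma Clim_0_le (u : nat -> C) (w : nat -> R) :
  (exists N, forall n, (N <= n)%N -> Cmod (u n) <= w n) -> is_lim_seq w 0 -> Clim u 0.
Proof.
move=> [N0 h] /is_lim_seq_spec hw e e0.
have [N hN] := hw (mkposreal e e0).
exists (maxn N N0) => n; rewrite geq_max => /andP[h1 h2].
have -> : (u n - 0)%C = u n by ring.
have /= := hN n ltac:(lia); have := h n h2; rewrite Rminus_0_r.
by have := Rle_abs (w n); lra.
Qed.

Lemma Csum_to_ext (u v : nat -> C) l :
  (forall n, (0 < n)%N -> u n = v n) -> Csum_to u l -> Csum_to v l.
Proof.
move=> h; apply: Clim_ext => N.
by rewrite big_nat_cond [RHS]big_nat_cond; apply: eq_bigr => i; case/andP=> /andP[/h].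
Qed.

Lemma Csum_to_plus u v l m : Csum_to u l -> Csum_to v m ->
  Csum_to (fun n => u n + v n)%C (l + m)%C.
Proof.
by move=> hu hv; apply: Clim_ext (Clim_plus hu hv) => N; rewrite big_split.
Qed.

Lemma Csum_to_scal c u l : Csum_to u l -> Csum_to (fun n => c * u n)%C (c * l)%C.
Proof. by move=> hu; apply: Clim_ext (Clim_scal c hu) => N; rewrite big_distrr. Qed.

Lemma Csum_to_minus u v l m : Csum_to u l -> Csum_to v m ->
  Csum_to (fun n => u n - v n)%C (l - m)%C.
Proof.
by move=> hu hv; apply: Clim_ext (Clim_minus hu hv) => N; rewrite Csum_minus.
Qed.

Lemma Cpartial_sub (u : nat -> C) (M N : nat) : (M <= N)%N ->
  (\sum_(1 <= n < N.+1) u n - \sum_(1 <= n < M.+1) u n = \sum_(M.+1 <= n < N.+1) u n)%C.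
Proof.
by move=> h; rewrite (big_cat_nat _ (m := 1) (n := M.+1) (p := N.+1)) //=; ring.
Qed.

Lemma Csum_to_tail u l (M : nat) (B : R) : Csum_to u l ->
  (forall N, \sum_(M.+1 <= n < N) Cmod (u n) <= B) ->
  Cmod (l - \sum_(1 <= n < M.+1) u n)%C <= B.
Proof.
move=> hu hB; apply: Clim_sub_le hu _; exists M => N hN.
rewrite Cpartial_sub //; exact: Rle_trans (Cmod_sum_le _ _ _) (hB _).
Qed.

Lemma Csum_to_le u l (B : R) : Csum_to u l ->
  (forall N, \sum_(1 <= n < N) Cmod (u n) <= B) -> Cmod l <= B.
Proof.
move=> hu hB; apply: Clim_le hu _; exists 0%N => N _.
exact: Rle_trans (Cmod_sum_le _ _ _) (hB _).
Qed.

(** The hypothesis makes w increasing; being bounded it converges, and its Cauchy property passes to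
    v and then to both coordinates. *)
Lemma Clim_cauchy (v : nat -> C) (w : nat -> R) :
  (forall M N, (M <= N)%N -> Cmod (v N - v M)%C <= w N - w M) ->
  (exists B, forall N, w N <= B) -> exists l, Clim v l.
Proof.
move=> hv [B hB].
have inc n : w n <= w n.+1.
  by have := hv n n.+1 (leqnSn n); have := Cmod_ge_0 (v n.+1 - v n)%C; lra.
have /ex_lim_seq_cauchy_corr hw : ex_finite_lim_seq w by apply: ex_finite_lim_seq_incr inc hB.
have cv (f : C -> R) : (forall a b, Rabs (f a - f b) <= Cmod (a - b)%C) ->
    ex_finite_lim_seq (fun n => f (v n)).
  move=> hf; apply/ex_lim_seq_cauchy_corr => e; have [N hN] := hw e.
  exists N => n m hn hm; wlog hnm : n m hn hm / (m <= n)%N.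
    have [h|/ltnW h] := leqP m n => H; first exact: H.
    by rewrite Rabs_minus_sym; apply: H.
  apply: Rle_lt_trans (hf _ _) _; apply: Rle_lt_trans (hv _ _ hnm) _.
  by apply: Rle_lt_trans (Rle_abs _) (hN _ _ hn hm).
have [a /is_lim_seq_spec ha] : ex_finite_lim_seq (fun n => Re (v n)).
  by apply: cv => x y; have := re_le_Cmod (x - y)%C; case: x y => ? ? [? ?] /=.
have [b /is_lim_seq_spec hb] : ex_finite_lim_seq (fun n => Im (v n)).
  by apply: cv => x y; have := im_le_Cmod (x - y)%C; case: x y => ? ? [? ?] /=.
exists (a, b) => e e0; have e2 : 0 < e / 2 by lra.
have [N1 h1] := ha (mkposreal _ e2); have [N2 h2] := hb (mkposreal _ e2).
exists (maxn N1 N2) => n; rewrite geq_max => /andP[n1 n2].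
have /= := h1 n ltac:(lia); have /= := h2 n ltac:(lia); case: (v n) => x y /= A1 A2.
have -> : ((x, y) - (a, b))%C = (RtoC (x - a) + Ci * RtoC (y - b))%C.
  by apply: injective_projections => /=; ring.
apply: Rle_lt_trans (Cmod_triangle _ _) _.
by rewrite Cmod_mult Cmod_Ci !Cmod_R; lra.
Qed.

Lemma Csum_to_exists (u : nat -> C) (B : R) :
  (forall N, \sum_(1 <= n < N) Cmod (u n) <= B) -> exists l, Csum_to u l.
Proof.
move=> hB; apply: (@Clim_cauchy _ (fun N => \sum_(1 <= n < N.+1) Cmod (u n))); last by exists B.
move=> M N hMN; rewrite Cpartial_sub //.
apply: Rle_trans (Cmod_sum_le _ _ _) _.
by rewrite (big_cat_nat _ (m := 1) (n := M.+1) (p := N.+1)) //=; lra.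
Qed.

Lemma sum_n_big (f : nat -> R) (N : nat) : sum_n f N = \sum_(0 <= k < N.+1) f k.
Proof.
elim: N => [|N IH]; first by rewrite sum_O big_nat1.
by rewrite sum_Sn IH [RHS]big_nat_recr.
Qed.

Lemma Clim_Re u l : Clim u l -> is_lim_seq (fun n => Re (u n)) (Re l).
Proof.
move=> h; apply/is_lim_seq_spec => e; have [N hN] := h e (cond_pos e).
exists N => n hn; have := hN n ltac:(lia); have := re_le_Cmod (u n - l)%C.
by case: (u n) l {h hN} => x y [a b] /=; rewrite /Rminus; lra.
Qed.

Lemma Clim_Im u l : Clim u l -> is_lim_seq (fun n => Im (u n)) (Im l).
Proof.
move=> h; apply/is_lim_seq_spec => e; have [N hN] := h e (cond_pos e).
exists N => n hn; have := hN n ltac:(lia); have := im_le_Cmod (u n - l)%C.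
by case: (u n) l {h hN} => x y [a b] /=; rewrite /Rminus; lra.
Qed.

(** Convergence is what gives the two [Series] of the definition a meaning; everywhere else the
    proof works with [Csum_to]. *)
Lemma dirichlet_series_eq (a : nat -> C) (s l : C) :
  Csum_to (fun n => a n * ncpow_opp n s)%C l -> dirichlet_series a s = l.
Proof.
move=> h; rewrite /dirichlet_series; case: l h => x y h.
congr pair; apply: is_series_unique.
- change (is_lim_seq (sum_n (fun k => Re (a k.+1 * ncpow_opp k.+1 s)%C)) x).
  apply: (is_lim_seq_ext (fun N => Re (\sum_(1 <= n < N.+2) (a n * ncpow_opp n s))%C)).
    by move=> N; rewrite Re_sum sum_n_big big_add1.
  by have := Clim_Re h => /is_lim_seq_incr_1.
- change (is_lim_seq (sum_n (fun k => Im (a k.+1 * ncpow_opp k.+1 s)%C)) y).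
  apply: (is_lim_seq_ext (fun N => Im (\sum_(1 <= n < N.+2) (a n * ncpow_opp n s))%C)).
    by move=> N; rewrite Im_sum sum_n_big big_add1.
  by have := Clim_Im h => /is_lim_seq_incr_1.
Qed.

Definition log_sum_bound (j : nat) (d : R) : R := (2 * INR j.+1 / d) ^ j * (1 + 2 / d).

Lemma log_sum_bound_ge0 j d : 0 < d -> 0 <= log_sum_bound j d.
Proof.
move=> d0; apply: Rmult_le_pos; first exact: ln_pow_const_ge0.
by have := Rdiv_lt_0_compat 2 d ltac:(lra) d0; lra.
Qed.

(** Common growth condition for all the coefficients in use: 1 and chi have j = 0, ln and Lambda
    have j = 1, Lambda times ln has j = 2. *)
Definition log_bounded (a : nat -> C) (j : nat) : Prop :=
  forall n, (0 < n)%N -> Cmod (a n) <= ln (INR n) ^ j.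

Lemma log_bounded_term (a : nat -> C) j n x (d : R) : log_bounded a j ->
  1 + d <= x -> (0 < n)%N -> Cmod (a n) * npw n x <= ln (INR n) ^ j * npw n (1 + d).
Proof.
move=> ha hx n0; apply: Rmult_le_compat.
- exact: Cmod_ge_0.
- by left; apply: npw_gt0.
- exact: ha.
- exact: npw_le.
Qed.

Lemma log_bounded_sum (a : nat -> C) j s d N : log_bounded a j -> 0 < d ->
  1 + d <= Re s ->
  \sum_(1 <= n < N) Cmod (a n * ncpow_opp n s)%C <= log_sum_bound j d.
Proof.
move=> ha d0 hs; apply: Rle_trans (ln_pow_sum_le j N d0).
apply: Rsum_le_nat => n /andP[n0 _]; rewrite Cmod_mult Cmod_ncpow.
exact: log_bounded_term.
Qed.

Lemma log_bounded_tail (a : nat -> C) j s d M N : log_bounded a j -> 0 < d ->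
  1 + d <= Re s -> (0 < M)%N ->
  \sum_(M.+1 <= n < N) Cmod (a n * ncpow_opp n s)%C <=
  (2 * INR j.+1 / d) ^ j * (2 / d) * npw M (d / 2).
Proof.
move=> ha d0 hs M0; apply: Rle_trans (ln_pow_tail j N d0 M0).
apply: Rsum_le_nat => n /andP[n0 _]; rewrite Cmod_mult Cmod_ncpow.
by apply: log_bounded_term => //; lia.
Qed.

Lemma dser_spec (a : nat -> C) j s : log_bounded a j -> 1 < Re s ->
  Csum_to (fun n => a n * ncpow_opp n s)%C (dirichlet_series a s).
Proof.
move=> ha hs; have d0 : 0 < Re s - 1 by lra.
have [l hl] : exists l, Csum_to (fun n => a n * ncpow_opp n s)%C l.
  apply: (Csum_to_exists (B := log_sum_bound j (Re s - 1))) => N.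
  by apply: log_bounded_sum => //; lra.
by rewrite (dirichlet_series_eq hl).
Qed.

Lemma log_bounded_mul_ln (a : nat -> C) j : log_bounded a j ->
  log_bounded (fun n => a n * ln (INR n))%C j.+1.
Proof.
move=> ha n n0; rewrite Cmod_mult Cmod_R Rabs_pos_eq; last exact: ln_INR_ge0.
rewrite /= Rmult_comm; apply: Rmult_le_compat_l; [exact: ln_INR_ge0 | exact: ha].
Qed.

(** Termwise sum of [ncpow_strong_diff]; the plus sign reflects the derivative -ln n n^(-s). The two
    further logarithms of the second-order remainder account for [j.+2]. *)
Lemma dser_strong_diff (a : nat -> C) j (s0 s s' : C) (r d : R) :
  log_bounded a j -> 0 < d -> 1 + d <= Re s0 - 3 * r ->
  Cmod (s - s0)%C <= r -> Cmod (s' - s0)%C <= r ->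
  Cmod (dirichlet_series a s' - dirichlet_series a s +
    (s' - s) * dirichlet_series (fun n => a n * ln (INR n)) s0)%C <=
  Cmod (s' - s)%C * (3 * r * log_sum_bound j.+2 d).
Proof.
move=> ha d0 h0 h1 h2.
have r0 : 0 <= r by have := Cmod_ge_0 (s - s0)%C; lra.
have hs : 1 < Re s by have := Re_ge_sub h1; lra.
have hs' : 1 < Re s' by have := Re_ge_sub h2; lra.
have hs0 : 1 < Re s0 by lra.
have e1 := dser_spec ha hs; have e2 := dser_spec ha hs'.
have e3 := dser_spec (log_bounded_mul_ln ha) hs0.
apply: Csum_to_le (Csum_to_plus (Csum_to_minus e2 e1) (Csum_to_scal (s' - s) e3)) _ => N.
have E := ln_pow_sum_le j.+2 N d0.
have c0 : 0 <= Cmod (s' - s)%C * (3 * r).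
  by apply: Rmult_le_pos; [exact: Cmod_ge_0 | lra].
have := Rmult_le_compat_l _ _ _ c0 E; rewrite -/(log_sum_bound _ _).
rewrite -(Rmult_assoc (Cmod _) (3 * r)); apply: Rle_trans.
rewrite big_distrr /=; apply: Rsum_le_nat => n /andP[n0 _].
rewrite (_ : _ + _ = a n * (ncpow_opp n s' - ncpow_opp n s +
   (s' - s) * (ln (INR n) * ncpow_opp n s0)))%C; last by ring.
rewrite Cmod_mult.
have A := ncpow_strong_diff n h1 h2.
apply: Rle_trans (_ : ln (INR n) ^ j * (Cmod (s' - s)%C *
  (3 * r * (ln (INR n) ^ 2 * npw n (Re s0 - 3 * r)))) <= _).
  apply: Rmult_le_compat => //; [exact: Cmod_ge_0 | exact: Cmod_ge_0 | exact: ha].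
have B := npw_le n h0; have l0 := ln_INR_ge0 n; have lj := pow_le _ j l0.
have H := fun h => Rmult_le_compat_l (Cmod (s' - s)%C * (3 * r) * (ln (INR n) ^ j * ln (INR n) ^ 2)) _ _ h B.
apply: Rle_trans (_ : Cmod (s' - s)%C * (3 * r) * (ln (INR n) ^ j * ln (INR n) ^ 2) * npw n (Re s0 - 3 * r) <= _); first by right; ring.
apply: Rle_trans (H _) _; last by right; rewrite /=; ring.
by apply: Rmult_le_pos => //; apply: Rmult_le_pos => //; apply: pow_le.
Qed.

(** * Critical points of zeta and Newton's method *)

Lemma log_bounded_1 : log_bounded (fun _ => RtoC 1) 0.
Proof. by move=> n _; rewrite Cmod_1 /=; lra. Qed.

Lemma log_bounded_ln : log_bounded (fun n => RtoC (ln (INR n))) 1.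
Proof. by move=> n _; rewrite Cmod_R Rabs_pos_eq ?Rmult_1_r /= ?Rmult_1_r; [lra | exact: ln_INR_ge0]. Qed.

(** The series of ln n n^(-s) is -zeta'(s). When it vanishes, zeta (s + h) - zeta s has no linear
    term and is O(|h|^2). *)
Lemma zeta_critical_point (s : C) : 1 < Re s ->
  dirichlet_series (fun n => ln (INR n)) s = 0 -> critical_point zeta s.
Proof.
move=> hs h0; set d := (Re s - 1) / 2.
have d0 : 0 < d by rewrite /d; lra.
have K0 : 0 <= log_sum_bound 2 d by apply: log_sum_bound_ge0.
have key (h : C) : Cmod h <= d ->
   Cmod (zeta (s + h) - zeta s)%C <= Cmod h ^ 2 * log_sum_bound 2 d.
  move=> hd; have c0 := Cmod_ge_0 h.
  have h1 : Cmod (s + h - s)%C <= Cmod h by right; congr Cmod; ring.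
  have hs' : 1 < Re (s + h) by have := Re_ge_sub h1; rewrite /d in hd; lra.
  have e1 := dser_spec log_bounded_1 hs; have e2 := dser_spec log_bounded_1 hs'.
  have := dser_spec log_bounded_ln hs; rewrite h0 => e3.
  (* The 0 stands for the vanishing sum of ln n n^(-s); adding it termwise gives the expression
     bounded by [ncpow_lip2]. *)
  rewrite (_ : zeta (s + h) - zeta s = zeta (s + h) - zeta s + h * 0)%C; last by ring.
  apply: Csum_to_le (Csum_to_plus (Csum_to_minus e2 e1) (Csum_to_scal h e3)) _ => N.
  have c2 : 0 <= Cmod h ^ 2 by apply: pow_le.
  have := Rmult_le_compat_l _ _ _ c2 (ln_pow_sum_le 2 N d0).
  rewrite -/(log_sum_bound _ _); apply: Rle_trans.
  rewrite big_distrr /=; apply: Rsum_le_nat => n /andP[n0 _].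
  rewrite !Cmult_1_l; apply: Rle_trans (ncpow_lip2 n s h) _.
  apply: Rmult_le_compat_l => //; apply: Rmult_le_compat_l; first by apply: pow_le; apply: ln_INR_ge0.
  by apply: npw_le; rewrite /d in hd *; lra.
split; first exact: is_linear_scal_l.
move=> x /is_filter_lim_locally_unique <- e.
set e' := Rmin d (e / (log_sum_bound 2 d + 1)).
have e'0 : 0 < e'.
  by apply: Rmin_glb_lt => //; apply: Rdiv_lt_0_compat; [exact: cond_pos | lra].
exists (mkposreal _ e'0) => y hy.
have {}hy : Cmod (y - s)%C < e' by exact: hy.
have -> : scal (minus y s) (RtoC 0) = zero by rewrite /scal /= /mult /=; apply: Cmult_0_r.
rewrite /minus opp_zero plus_zero_r.
have := key (y - s)%C; rewrite (_ : s + (y - s) = y)%C; last by ring.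
have m1 := Rmin_l d (e / (log_sum_bound 2 d + 1)); have m2 := Rmin_r d (e / (log_sum_bound 2 d + 1)).
move=> /(_ ltac:(rewrite -/e' in m1; lra)) A.
change (Cmod (zeta y - zeta s)%C <= e * Cmod (y - s)%C).
apply: Rle_trans A _.
have c0 := Cmod_ge_0 (y - s)%C.
have B : Cmod (y - s)%C * (log_sum_bound 2 d + 1) <= e.
  by apply/Rle_div_r; [lra | rewrite -/e' in m2; lra].
have := Rmult_le_compat_l _ _ _ c0 B; nra.
Qed.

(** Newton iteration with the derivative frozen at D. After a step, F is exactly the linearisation
    error of that step, so every step is at most half the previous one; the lengths r/2, r/4, ...
    keep the iterates in the disc. *)
Lemma newton_zero (F : C -> C) (D s0 : C) (r : R) : 0 < r -> D <> 0 ->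
  (forall s s', Cmod (s - s0)%C <= r -> Cmod (s' - s0)%C <= r ->
     Cmod (F s' - F s - (s' - s) * D)%C <= Cmod (s' - s)%C * (Cmod D / 2)) ->
  Cmod (F s0) <= Cmod D * r / 2 ->
  exists s, Cmod (s - s0)%C <= r /\ F s = 0.
Proof.
move=> r0 D0 hF h0; have Dp : 0 < Cmod D by apply/Cmod_gt_0.
have [u [u0 uS]] : exists u : nat -> C, u 0%N = s0 /\
    forall n, u n.+1 = (u n - F (u n) / D)%C.
  by exists (fun n => iter n (fun s => s - F s / D)%C s0).
have inv n : Cmod (u n.+1 - u n)%C <= r / 2 * (/ 2) ^ n /\
   Cmod (u n - s0)%C <= r * (1 - (/ 2) ^ n).
  elim: n => [|n [IH1 IH2]].
    split; last by rewrite u0 /= (_ : s0 - s0 = 0)%C ?Cmod_0; [lra|ring].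
    rewrite uS u0 /= (_ : s0 - F s0 / D - s0 = - (F s0 / D))%C; last by ring.
    rewrite Cmod_opp Cmod_div // Rmult_1_r.
    by apply/Rle_div_l => //; lra.
  have p0 : 0 < (/ 2) ^ n by apply: pow_lt; lra.
  have B2 : Cmod (u n.+1 - s0)%C <= r * (1 - (/ 2) ^ n.+1).
    rewrite (_ : u n.+1 - s0 = (u n.+1 - u n) + (u n - s0))%C; last by ring.
    by have := Cmod_triangle (u n.+1 - u n) (u n - s0); rewrite /=; lra.
  split=> //.
  have p1 : 0 < (/ 2) ^ n.+1 by apply: pow_lt; lra.
  have := hF (u n) (u n.+1) ltac:(nra) ltac:(nra).
  have e1 : (u n.+1 - u n = - (F (u n) / D))%C by rewrite uS; ring.
  have e2 : (u n.+2 - u n.+1 = - (F (u n.+1) / D))%C by rewrite uS; ring.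
  have e3 : (F (u n.+1) - F (u n) - (u n.+1 - u n) * D = F (u n.+1))%C.
    by rewrite e1; field.
  rewrite e3 => A; rewrite e2 Cmod_opp Cmod_div //.
  apply/Rle_div_l => //; apply: Rle_trans A _.
  by have := Rmult_le_compat_r (Cmod D / 2) _ _ ltac:(lra) IH1; rewrite /=; lra.
have [s hs] : exists s, Clim u s.
  (* The majorant is bounded above by 0, and its increments r 2^(-n-1) are the bounds on the step
     lengths. *)
  apply: (@Clim_cauchy _ (fun n => - r * (/ 2) ^ n)).
    move=> M N; elim: N => [|N IH].
      by rewrite leqn0 => /eqP ->; rewrite (_ : u 0%N - u 0%N = 0)%C ?Cmod_0; [lra|ring].
    rewrite leq_eqVlt => /orP[/eqP ->|].
      by rewrite (_ : u N.+1 - u N.+1 = 0)%C ?Cmod_0; [lra|ring].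
    rewrite ltnS => /IH {}IH; have [A _] := inv N.
    rewrite (_ : u N.+1 - u M = (u N.+1 - u N) + (u N - u M))%C; last by ring.
    have := Cmod_triangle (u N.+1 - u N) (u N - u M).
    by rewrite [(/ 2) ^ N.+1]/=; lra.
  exists 0 => N; have : 0 < (/ 2) ^ N by apply: pow_lt; lra.
  nra.
have hsr : Cmod (s - s0)%C <= r.
  apply: Clim_sub_le hs _; exists 0%N => n _; have [_ A] := inv n.
  have : 0 < (/ 2) ^ n by apply: pow_lt; lra.
  nra.
exists s; split => //.
have hFu : Clim (fun n => F (u n)) 0.
  apply: (@Clim_0_le _ (fun n => Cmod D * r / 2 * (/ 2) ^ n)).
    exists 0%N => n _; have [A _] := inv n.
    have -> : F (u n) = (- ((u n.+1 - u n) * D))%C by rewrite uS; field.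
    rewrite Cmod_opp Cmod_mult.
    by have := Rmult_le_compat_r (Cmod D) _ _ ltac:(lra) A; lra.
  have -> : Rbar.Finite 0 = Rbar_mult (Rbar.Finite (Cmod D * r / 2)) (Rbar.Finite 0) by rewrite /= Rmult_0_r.
  apply: is_lim_seq_scal_l; apply: is_lim_seq_geom.
  by rewrite Rabs_pos_eq; lra.
apply: Clim_unique hFu => e e0.
have e2 : 0 < e / (2 * Cmod D) by apply: Rdiv_lt_0_compat; lra.
have [N hN] := hs _ e2; exists N => n /hN A.
have [_ B] := inv n; have p0 : 0 < (/ 2) ^ n by apply: pow_lt; lra.
have := hF s (u n) hsr ltac:(nra).
set z := (u n - s)%C in A * => H.
rewrite (_ : F (u n) - F s = (F (u n) - F s - z * D) + z * D)%C; last by ring.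
apply: Rle_lt_trans (Cmod_triangle _ _) _; rewrite Cmod_mult.
have {}A : Cmod z * (2 * Cmod D) < e by apply/Rlt_div_r; lra.
have := Rmult_le_pos _ _ (Cmod_ge_0 z) (Rlt_le _ _ Dp); nra.
Qed.

(** * Chebyshev and Mertens estimates *)

(** Von Mangoldt's function, as a sum over all pairs (p, j) with p^j = n, of which there is at most
    one. In this form sums over n turn into sums over primes and exponents by exchanging the
    order. *)
Definition vonM (n : nat) : R :=
  \sum_(0 <= p < n.+1 | prime p) \sum_(1 <= j < n.+1 | (p ^ j)%N == n) ln (INR p).

Lemma vonM_ge0 n : 0 <= vonM n.
Proof. by apply: Rsum_ge0 => p _; apply: Rsum_ge0 => j _; apply: ln_INR_ge0. Qed.

Lemma prime_pow_gt p j : prime p -> (0 < j)%N -> (p <= p ^ j)%N /\ (j < p ^ j)%N.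
Proof.
move=> hp j0; split; last by apply: ltn_expl; apply: prime_gt1.
by rewrite -{1}(expn1 p) leq_pexp2l // prime_gt0.
Qed.

(** Makes the ranges of p and j independent of n, so that sums can be exchanged. *)
Lemma vonM_wide n M : (n < M)%N ->
  vonM n = \sum_(0 <= p < M | prime p) \sum_(1 <= j < M | (p ^ j)%N == n) ln (INR p).
Proof.
move=> hn; rewrite /vonM [RHS](big_cat_nat _ (n := n.+1)) //=.
rewrite [X in _ = _ + X]big1_seq ?Rplus_0_r; last first.
  move=> p /andP[hp]; rewrite mem_index_iota => /andP[h1 h2].
  rewrite big1_seq // => j /andP[/eqP hj]; rewrite mem_index_iota => /andP[j1 _].
  by have [] := prime_pow_gt hp j1; lia.
apply: eq_bigr => p hp; have [h|h] := leqP 1 n.+1; last by lia.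
rewrite [RHS](big_cat_nat _ (n := n.+1)) //=.
rewrite [X in _ = _ + X]big1_seq ?Rplus_0_r // => j /andP[/eqP hj].
rewrite mem_index_iota => /andP[j1 _].
by have [] := prime_pow_gt hp (leq_trans h j1); lia.
Qed.

Lemma Csum_eq_nat (N m : nat) (g : nat -> C) :
  (\sum_(1 <= n < N.+1 | m == n) g n = if (0 < m <= N)%N then g m else RtoC 0)%C.
Proof.
rewrite big_mkcond; case: ifP => hm.
  rewrite (bigD1_seq m) /= ?mem_index_iota ?iota_uniq ?eqxx //.
  by rewrite big1 ?Cplus_0_r // => i; rewrite eq_sym => /negbTE ->.
rewrite big1_seq // => i /andP[_]; rewrite mem_index_iota => h.
by case: eqP => // e; rewrite e h in hm.
Qed.

Lemma sum_vonM (N : nat) (g : nat -> C) :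
  (\sum_(1 <= n < N.+1) vonM n * g n =
   \sum_(0 <= p < N.+1 | prime p)
     \sum_(1 <= j < N.+1 | (p ^ j <= N)%N) ln (INR p) * g (p ^ j)%N)%C.
Proof.
transitivity (\sum_(1 <= n < N.+1) \sum_(0 <= p < N.+1 | prime p)
   \sum_(1 <= j < N.+1 | (p ^ j)%N == n) ln (INR p) * g n)%C.
  apply: eq_big_seq => n; rewrite mem_index_iota => /andP[_ hn].
  rewrite (vonM_wide hn) RtoC_sum big_distrl; apply: eq_bigr => p _ /=.
  by rewrite RtoC_sum big_distrl.
rewrite exchange_big /=; apply: eq_bigr => p hp.
under eq_bigr do rewrite big_mkcond.
rewrite exchange_big /= [RHS]big_mkcond /=; apply: eq_bigr => j _.
rewrite -big_mkcond Csum_eq_nat expn_gt0 prime_gt0 //=.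
Qed.

Lemma sum_logn_primes n : (0 < n)%N ->
  \sum_(0 <= p < n.+1 | prime p) INR (logn p n) * ln (INR p) = ln (INR n).
Proof.
move=> n0; have e : (n = \prod_(0 <= p < n.+1 | prime p) p ^ logn p n)%N.
  rewrite -{1}(partnT n0) /partn big_mkcond [RHS]big_mkcond.
  by apply: eq_bigr => p _ /=; case hp: (prime p) => //; rewrite lognE hp.
rewrite [in RHS]e; set P := (\prod_(_ <= _ < _ | _) _)%N.
have -> : INR P = \prod_(p <- index_iota 0 n.+1 | prime p) INR (p ^ logn p n)%N.
  by apply: (big_morph INR) => [x y|] //; rewrite INR_muln.
rewrite ln_prod => [|p _ hp]; last by apply: Rlt_le_trans Rlt_0_1 _; apply: INR_ge1; rewrite expn_gt0 prime_gt0.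
by apply: eq_bigr => p hp; rewrite ln_INR_expn ?prime_gt0.
Qed.

Lemma Csum_const (I : Type) (r : seq I) (P : pred I) (c : C) :
  (\sum_(i <- r | P i) c = INR (count P r) * c)%C.
Proof.
elim: r => [|x r IH]; first by rewrite big_nil /= Cmult_0_l.
rewrite big_cons IH -cat1s count_cat /= INR_addn addn0 RtoC_plus.
by case: (P x); rewrite /=; ring.
Qed.

(** The powers of p that divide n are those with exponent 1, ..., [logn p n], so p contributes
    [logn p n] times ln p. *)
Lemma sum_div_vonM n : (0 < n)%N -> \sum_(1 <= d < n.+1 | d %| n) vonM d = ln (INR n).
Proof.
move=> n0; apply: RtoC_inj; rewrite RtoC_sum.
transitivity (\sum_(1 <= d < n.+1) vonM d * (if d %| n then RtoC 1 else RtoC 0))%C.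
  by rewrite big_mkcond; apply: eq_bigr => d _; case: ifP => _; ring.
rewrite sum_vonM -(sum_logn_primes n0) RtoC_sum; apply: eq_bigr => p hp.
transitivity (\sum_(1 <= j < n.+1 | (j <= logn p n)%N) ln (INR p))%C.
  rewrite big_mkcond [RHS]big_mkcond; apply: eq_bigr => j _.
  rewrite pfactor_dvdn //; case: ifP => h1; case: ifP => h2; try ring.
  by move: h1; rewrite dvdn_leq // pfactor_dvdn.
rewrite Csum_const RtoC_mult; congr (RtoC (INR _) * _)%C.
rewrite -size_filter (_ : [seq j <- _ | _] = iota 1 (logn p n)) ?size_iota //.
rewrite /index_iota subn1 /=.
have h : (logn p n <= n)%N.
  by have := ltn_logl p n0; lia.
have -> : iota 1 n = iota 1 (logn p n) ++ iota (1 + logn p n) (n - logn p n).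
  by rewrite -iotaD subnKC.
rewrite filter_cat.
rewrite (_ : [seq j <- iota 1 _ | _] = iota 1 (logn p n)); last first.
  by apply/all_filterP/allP => j; rewrite mem_iota; lia.
rewrite (_ : [seq j <- iota (1 + _) _ | _] = [::]) ?cats0 //.
by apply/eqP; rewrite -(negbK (_ == _)) -has_filter; apply/hasPn => j; rewrite mem_iota; lia.
Qed.

Lemma vonM_le_ln n : vonM n <= ln (INR n).
Proof.
case: n => [|n].
  by rewrite /vonM big_mkcond big_nat1 /=; apply: (ln_INR_ge0 0).
rewrite -sum_div_vonM // big_mkcond big_nat_recr //= dvdnn.
have : 0 <= \sum_(1 <= i < n.+1) (if i %| n.+1 then vonM i else 0).
  by apply: Rsum_ge0 => i _; case: ifP => _; [apply: vonM_ge0 | lra].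
by lra.
Qed.

Lemma log_bounded_vonM : log_bounded (fun n => RtoC (vonM n)) 1.
Proof.
move=> n _; rewrite Cmod_R Rabs_pos_eq; last exact: vonM_ge0.
by rewrite pow_1; apply: vonM_le_ln.
Qed.

Lemma sum_multiples (d N : nat) (f : nat -> C) : (0 < d)%N ->
  (\sum_(1 <= n < N.+1 | (d %| n)%N) f n = \sum_(1 <= m < (N %/ d).+1) f (d * m)%N)%C.
Proof.
move=> d0; elim: N => [|N IH]; first by rewrite div0n !big_geq.
rewrite big_mkcond big_nat_recr //= -big_mkcond IH divnS //.
case hd: (d %| N.+1) => /=; last by rewrite add0n Cplus_0_r.
rewrite add1n [RHS]big_nat_recr //=; congr (_ + f _)%C.
have := divnK hd; rewrite divnS // hd add1n; lia.
Qed.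

(** Summed form of ln = Lambda * 1. It is used with f = 1 for the estimates of Chebyshev and
    Mertens, with f(n) = n^(-s) for zeta'/zeta, and with f(n) = chi(n)/n for Mertens' theorem with a
    character. *)
Lemma sum_ln_mul (N : nat) (f : nat -> C) :
  (\sum_(1 <= n < N.+1) ln (INR n) * f n =
   \sum_(1 <= d < N.+1) vonM d * \sum_(1 <= m < (N %/ d).+1) f (d * m)%N)%C.
Proof.
transitivity (\sum_(1 <= n < N.+1) \sum_(1 <= d < N.+1 | (d %| n)%N) vonM d * f n)%C.
  apply: eq_big_seq => n; rewrite mem_index_iota => /andP[n0 hn].
  rewrite -sum_div_vonM // RtoC_sum big_distrl /=.
  rewrite [RHS](big_cat_nat _ (n := n.+1)) //=.
  rewrite [X in (_ = _ + X)%C]big1_seq ?Cplus_0_r // => d /andP[hd].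
  rewrite mem_index_iota => /andP[h1 _].
  by have := dvdn_leq n0 hd; lia.
under eq_bigr do rewrite big_mkcond.
rewrite exchange_big /=; apply: eq_big_seq => d; rewrite mem_index_iota => /andP[d0 _].
by rewrite -big_mkcond /= -big_distrr -sum_multiples.
Qed.

Lemma sum_ln_mulR (N : nat) :
  \sum_(1 <= n < N.+1) ln (INR n) = \sum_(1 <= d < N.+1) vonM d * INR (N %/ d).
Proof.
apply: RtoC_inj; rewrite !RtoC_sum.
transitivity (\sum_(1 <= n < N.+1) ln (INR n) * 1)%C.
  by apply: eq_bigr => n _; ring.
rewrite (sum_ln_mul N (fun _ => RtoC 1)); apply: eq_bigr => d _.
rewrite RtoC_mult; congr (_ * _)%C.
by rewrite -RtoC_sum Rsum_const_nat subn1 Rmult_1_r.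
Qed.

Definition cpsi (N : nat) : R := \sum_(1 <= d < N.+1) vonM d.

Lemma cpsi_le M N : (M <= N)%N -> cpsi M <= cpsi N.
Proof. by move=> h; apply: Rsum_widen => // i _; apply: vonM_ge0. Qed.

Lemma sum_ln_fact N : \sum_(1 <= n < N.+1) ln (INR n) = ln (INR N`!).
Proof.
elim: N => [|N IH]; first by rewrite big_geq //= ln_1.
by rewrite big_nat_recr //= IH factS ln_INR_muln ?fact_gt0 // Rplus_comm.
Qed.

(** The logarithm of the central binomial coefficient is the sum of Lambda(d) ([2N/d] - 2[N/d]); the
    bracket is nonnegative, and at least 1 for N < d <= 2N. The coefficient is at most 2^(2N), being
    one term of (1 + 1)^(2N), and ln 2 < 1. *)
Lemma cpsi_double N : cpsi N.*2 - cpsi N <= INR N * 2.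
Proof.
have ln2 : 0 < ln 2 < 1.
  by split; [rewrite -ln_1; apply: ln_increasing; lra | have := ln_lt_2; have := exp_le_3; have := ln_le_sub1 (x := 2) ltac:(lra); have h := ln_increasing 2 (exp 1); have := exp_ineq1 1 ltac:(lra); rewrite ln_exp in h => h1; move=> *; apply: h; lra].
have hb : ln (INR (N.*2)`!) - 2 * ln (INR N`!) <= INR N * 2.
  have h := bin_fact (leq_addr N N); rewrite addKn addnn in h.
  rewrite -h !ln_INR_muln ?fact_gt0 ?muln_gt0 ?bin_gt0 -?addnn ?leq_addr //; last by rewrite fact_gt0.
  have : ln (INR 'C(N + N, N)) <= ln (INR (2 ^ (N + N))%N).
    apply: ln_le; first by apply: Rlt_le_trans Rlt_0_1 (INR_ge1 _); rewrite bin_gt0 leq_addr.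
    apply: INR_leq; rewrite -[2%N]/(1 + 1)%N expnDn (bigD1 (inord N)) //=.
    by rewrite inordK ?ltnS ?leq_addr // !exp1n !muln1 leq_addr.
  rewrite ln_INR_expn // INR_addn (_ : INR 2 = 2); last by [].
  by have := INR_pos N; nra.
apply: Rle_trans hb; rewrite -!sum_ln_fact !sum_ln_mulR.
have e : \sum_(1 <= d < N.+1) vonM d * INR (N %/ d) =
         \sum_(1 <= d < N.*2.+1) vonM d * INR (N %/ d).
  rewrite [RHS](big_cat_nat _ (n := N.+1)) //=; last by rewrite -addnn; lia.
  rewrite [X in _ = _ + X]big1_seq ?Rplus_0_r // => d /andP[_].
  by rewrite mem_index_iota => /andP[h _]; rewrite divn_small // Rmult_0_r.
rewrite e big_distrr -Rsum_minus /cpsi.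
rewrite (big_cat_nat _ (n := N.+1) (p := N.*2.+1)) //=; last by rewrite -addnn; lia.
rewrite (_ : forall a b, a + b - a = b); last by move=> *; lra.
rewrite [X in _ <= X](big_cat_nat _ (n := N.+1)) //=; last by rewrite -addnn; lia.
rewrite -[X in X <= _]Rplus_0_l; apply: Rplus_le_compat.
  apply: Rsum_ge0 => d _.
  have h : 2 * INR (N %/ d) <= INR (N.*2 %/ d).
    rewrite -[2]/(INR 2) -INR_muln; apply: INR_leq.
    case: d => [|d]; first by rewrite !divn0.
    by rewrite leq_divRL // -mul2n -mulnA leq_mul2l /= leq_trunc_div.
  by have := vonM_ge0 d; nra.
apply: Rsum_le_nat => d /andP[h1 h2]; rewrite [(N %/ d)%N]divn_small // !Rmult_0_r Rminus_0_r.
have h : 1 <= INR (N.*2 %/ d) by apply: INR_ge1; rewrite divn_gt0; lia.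
by have := vonM_ge0 d; nra.
Qed.

(** Halving: with M = N/2 rounded up, psi(N) <= psi(M) + 2M <= 6M <= 3(N + 1), which is at most 4N
    once N >= 3. *)
Lemma cpsi_bound N : cpsi N <= 4 * INR N.
Proof.
elim/ltn_ind: N => N IH; have [N1|N2] := leqP N 2.
  have l1 := vonM_le_ln 1; have l2 := vonM_le_ln 2; rewrite /= ln_1 in l1 l2.
  have l3 := ln_le_sub1 (x := 1 + 1) ltac:(lra).
  case: N N1 {IH} => [|[|[|//]]] _; rewrite /cpsi; first by rewrite big_geq //=; lra.
    by rewrite big_nat1 /=; lra.
  by rewrite big_nat_recr //= big_nat1; lra.
pose M := uphalf N; have hM : (M < N)%N by rewrite /M; lia.
have h1 : (N <= M.*2)%N by rewrite /M; lia.
have h2 : INR M <= (INR N + 1) / 2.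
  have : INR (M * 2) <= INR N.+1 by apply: INR_leq; rewrite /M; lia.
  by rewrite INR_muln (S_INR N) [INR 2]/=; lra.
have h3 := cpsi_double M; have h4 := IH _ hM; have h5 := cpsi_le h1.
have : INR 3 <= INR N by apply: INR_leq.
by rewrite [INR 3]/=; lra.
Qed.

Lemma ln_fact_ge N : INR N * ln (INR N) - INR N <= \sum_(1 <= n < N.+1) ln (INR n).
Proof.
elim: N => [|N IH]; first by rewrite big_geq //= Rmult_0_l; lra.
rewrite big_nat_recr //=; case: N IH => [|N] IH.
  by rewrite big_geq //= ln_1; lra.
apply: Rle_trans (Rplus_le_compat_r _ _ _ IH).
have n1 := INR_ge1 (ltn0Sn N).
have h : ln (INR N.+2) - ln (INR N.+1) <= / INR N.+1.
  rewrite -ln_div; [|rewrite (S_INR N.+1); lra|lra].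
  apply: Rle_trans (ln_le_sub1 _) _; first by apply: Rdiv_lt_0_compat; rewrite ?(S_INR N.+1); lra.
  by right; rewrite (S_INR N.+1); field; lra.
have := Rmult_le_compat_l (INR N.+1) _ _ ltac:(lra) h; rewrite Rinv_r; last by lra.
by rewrite (S_INR N.+1) => h'; set x := INR N.+1 in n1 h' *; nra.
Qed.

Lemma divn_INR_bounds N d : (0 < d)%N -> INR N / INR d - 1 <= INR (N %/ d) <= INR N / INR d.
Proof.
move=> d0; have d1 := INR_ge1 d0; split.
  have : INR N <= INR ((N %/ d).+1 * d) by apply: INR_leq; rewrite ltnW // ltn_ceil.
  rewrite INR_muln S_INR => h.
  suff : INR N / INR d <= INR (N %/ d) + 1 by lra.
  by apply/Rle_div_l; lra.
apply/Rle_div_r; first lra.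
by rewrite -INR_muln; apply: INR_leq; apply: leq_trunc_div.
Qed.

(** ln N! is the sum of Lambda(d) [N/d]. Dropping the integer part only helps here; in [mertens_le]
    it costs psi(N) <= 4N, whence the 4. *)
Lemma mertens_ge N : (0 < N)%N ->
  ln (INR N) - 1 <= \sum_(1 <= d < N.+1) vonM d * / INR d.
Proof.
move=> N0; have N1 := INR_ge1 N0.
have h := ln_fact_ge N; rewrite sum_ln_mulR in h.
have : \sum_(1 <= d < N.+1) vonM d * INR (N %/ d) <=
       INR N * \sum_(1 <= d < N.+1) vonM d * / INR d.
  rewrite big_distrr; apply: Rsum_le_nat => d /andP[d0 _] /=.
  have [_ h2] := divn_INR_bounds N d0.
  by have := Rmult_le_compat_l _ _ _ (vonM_ge0 d) h2; rewrite /Rdiv; lra.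
move=> h2; set S := \sum_(1 <= d < N.+1) vonM d * / INR d in h2 *.
have : INR N * (ln (INR N) - 1) <= INR N * S by lra.
by move/Rmult_le_reg_l; apply; lra.
Qed.

Lemma mertens_le N : (0 < N)%N ->
  \sum_(1 <= d < N.+1) vonM d * / INR d <= ln (INR N) + 4.
Proof.
move=> N0; have N1 := INR_ge1 N0.
have h1 : \sum_(1 <= n < N.+1) ln (INR n) <= INR N * ln (INR N).
  apply: Rle_trans (_ : \sum_(1 <= n < N.+1) ln (INR N) <= _).
    apply: Rsum_le_nat => n /andP[n0 nN].
    by apply: ln_le; [have := INR_ge1 n0; lra | apply: INR_leq].
  by rewrite Rsum_const_nat subn1; right.
rewrite sum_ln_mulR in h1.
have h2 : INR N * (\sum_(1 <= d < N.+1) vonM d * / INR d) - cpsi N <=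
       \sum_(1 <= d < N.+1) vonM d * INR (N %/ d).
  rewrite big_distrr /cpsi -Rsum_minus; apply: Rsum_le_nat => d /andP[d0 _] /=.
  have [h2 _] := divn_INR_bounds N d0.
  by have := Rmult_le_compat_l _ _ _ (vonM_ge0 d) h2; rewrite /Rdiv; lra.
have h3 := cpsi_bound N; set S := \sum_(1 <= d < N.+1) vonM d * / INR d in h2 *.
have : INR N * S <= INR N * (ln (INR N) + 4) by lra.
by move/Rmult_le_reg_l; apply; lra.
Qed.

Lemma geom_tail_le (x : R) (M : nat) : 0 <= x <= / 2 ->
  \sum_(2 <= j < M) x ^ j <= 2 * x ^ 2.
Proof.
move=> hx; have x2 : 0 <= x ^ 2 by apply: pow_le; lra.
(* The subtracted tail makes the induction go through, since 2x <= 1. *)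
suff : \sum_(2 <= j < M) x ^ j <= 2 * x ^ 2 - 2 * x ^ (maxn 2 M).
  by have := pow_le x (maxn 2 M) ltac:(lra); lra.
elim: M => [|M IH]; first by rewrite big_geq //=; lra.
have [hM|hM] := ltnP M 2.
  by rewrite big_geq // (_ : maxn 2 M.+1 = 2%N); [lra | lia].
rewrite big_nat_recr //=; move: IH; rewrite (_ : maxn 2 M = M); last by lia.
rewrite (_ : maxn 2 M.+1 = M.+1) /=; last by lia.
by have := pow_le x M ltac:(lra); nra.
Qed.

(* Proper prime powers contribute boundedly: 24 bounds [2 \sum_n (ln n) / n^2]. *)
Lemma vonM_prime_sum (N : nat) (g : nat -> C) :
  (forall n, (0 < n)%N -> Cmod (g n) <= / INR n) ->
  Cmod (\sum_(1 <= n < N.+1) vonM n * g n -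
        \sum_(0 <= p < N.+1 | prime p) ln (INR p) * g p)%C <= 24.
Proof.
move=> hg; rewrite sum_vonM -Csum_minus.
apply: Rle_trans (Cmod_sum_le _ _ _) _.
apply: Rle_trans (_ : \sum_(0 <= p < N.+1 | prime p) 2 * (ln (INR p) ^ 1 * npw p (1 + 1)) <= _).
  apply: Rsum_le_seq => p; rewrite mem_index_iota => /andP[_ pN] hp.
  have p0 := prime_gt0 hp; have p1 := prime_gt1 hp.
  have p2 : 2 <= INR p by apply: (INR_leq (m := 2)).
  rewrite big_mkcond big_ltn ?expn1 -1?ltnS ?pN; last by lia.
  rewrite (_ : forall a b, a + b - a = b)%C; last by move=> *; ring.
  rewrite -big_mkcond; apply: Rle_trans (Cmod_sum_le _ _ _) _.
  rewrite (npw_2 p0) pow_1 -pow_inv.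
  apply: Rle_trans (_ : \sum_(2 <= j < N.+1) ln (INR p) * (/ INR p) ^ j <= _).
    rewrite big_mkcond; apply: Rsum_le => j _.
    have l0 := ln_INR_ge0 p.
    have q0 : 0 <= (/ INR p) ^ j by apply: pow_le; left; apply: Rinv_0_lt_compat; lra.
    case: ifP => _; last by apply: Rmult_le_pos.
    rewrite Cmod_mult Cmod_R Rabs_pos_eq //; apply: Rmult_le_compat_l => //.
    apply: Rle_trans (hg _ _) _; first by rewrite expn_gt0 p0.
    by rewrite INR_expn pow_inv; lra.
  rewrite -big_distrr /=.
  have x0 : 0 <= / INR p <= / 2.
    by split; [left; apply: Rinv_0_lt_compat; lra | apply: Rinv_le_contravar; lra].
  have := Rmult_le_compat_l _ _ _ (ln_INR_ge0 p) (geom_tail_le N.+1 x0).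
  by rewrite /=; lra.
rewrite -big_distrr /=.
apply: Rle_trans (_ : 2 * \sum_(1 <= n < N.+1) ln (INR n) ^ 1 * npw n (1 + 1) <= _).
  apply: Rmult_le_compat_l; first lra.
  rewrite big_mkcond big_ltn //= Rplus_0_l -big_mkcond.
  apply: Rsum_sub => // i _; apply: Rmult_le_pos; last by left; apply: npw_gt0.
  by rewrite Rmult_1_r; apply: ln_INR_ge0.
by have := ln_pow_sum_le 1 N.+1 Rlt_0_1; rewrite [INR 2]/=; lra.
Qed.

(** 25 = 1 + 24, the loss of [mertens_ge] plus that of the proper prime powers; likewise 28 = 4 + 24
    in [prime_sum_le]. *)
Lemma prime_sum_ge N : (0 < N)%N ->
  ln (INR N) - 25 <= \sum_(0 <= p < N.+1 | prime p) ln (INR p) * / INR p.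
Proof.
move=> N0; have h := mertens_ge N0.
have : Cmod (\sum_(1 <= n < N.+1) vonM n * RtoC (/ INR n) -
        \sum_(0 <= p < N.+1 | prime p) ln (INR p) * RtoC (/ INR p))%C <= 24.
  apply: (@vonM_prime_sum N (fun n => RtoC (/ INR n))) => n n0; rewrite Cmod_R Rabs_pos_eq; first lra.
  by left; apply: Rinv_0_lt_compat; have := INR_ge1 n0; lra.
have -> : (\sum_(1 <= n < N.+1) vonM n * RtoC (/ INR n))%C =
   RtoC (\sum_(1 <= n < N.+1) vonM n * / INR n).
  by rewrite RtoC_sum; apply: eq_bigr => n _; rewrite RtoC_mult.
have -> : (\sum_(0 <= p < N.+1 | prime p) ln (INR p) * RtoC (/ INR p))%C =
   RtoC (\sum_(0 <= p < N.+1 | prime p) ln (INR p) * / INR p).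
  by rewrite RtoC_sum; apply: eq_bigr => n _; rewrite RtoC_mult.
rewrite -RtoC_minus Cmod_R => /Rabs_le_between; lra.
Qed.

Lemma prime_sum_le N : (0 < N)%N ->
  \sum_(0 <= p < N.+1 | prime p) ln (INR p) * / INR p <= ln (INR N) + 28.
Proof.
move=> N0; have h := mertens_le N0.
have : Cmod (\sum_(1 <= n < N.+1) vonM n * RtoC (/ INR n) -
        \sum_(0 <= p < N.+1 | prime p) ln (INR p) * RtoC (/ INR p))%C <= 24.
  apply: (@vonM_prime_sum N (fun n => RtoC (/ INR n))) => n n0; rewrite Cmod_R Rabs_pos_eq; first lra.
  by left; apply: Rinv_0_lt_compat; have := INR_ge1 n0; lra.
have -> : (\sum_(1 <= n < N.+1) vonM n * RtoC (/ INR n))%C =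
   RtoC (\sum_(1 <= n < N.+1) vonM n * / INR n).
  by rewrite RtoC_sum; apply: eq_bigr => n _; rewrite RtoC_mult.
have -> : (\sum_(0 <= p < N.+1 | prime p) ln (INR p) * RtoC (/ INR p))%C =
   RtoC (\sum_(0 <= p < N.+1 | prime p) ln (INR p) * / INR p).
  by rewrite RtoC_sum; apply: eq_bigr => n _; rewrite RtoC_mult.
rewrite -RtoC_minus Cmod_R => /Rabs_le_between; lra.
Qed.

Lemma ln_le_vonM_prime p : prime p -> ln (INR p) <= vonM p.
Proof.
move=> hp; rewrite /vonM big_mkcond big_nat_recr //= hp.
rewrite [X in _ <= _ + X]big_mkcond [X in _ <= _ + X]big_ltn ?ltnS ?prime_gt0 //= expn1 eqxx.
have h1 : 0 <= \sum_(0 <= i < p) (if prime i then \sum_(1 <= j < p.+1 | (i ^ j)%N == p) ln (INR i) else 0).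
  by apply: Rsum_ge0 => i _; case: ifP => _; [apply: Rsum_ge0 => j _; apply: ln_INR_ge0 | lra].
have h2 : 0 <= \sum_(2 <= i < p.+1) (if (p ^ i)%N == p then ln (INR p) else 0).
  by apply: Rsum_ge0 => i _; case: ifP => _; [apply: ln_INR_ge0 | lra].
lra.
Qed.

Lemma prime_theta_le N : \sum_(0 <= p < N.+1 | prime p) ln (INR p) <= 4 * INR N.
Proof.
apply: Rle_trans (cpsi_bound N); rewrite big_mkcond big_ltn //= Rplus_0_l.
apply: Rsum_le => p _; case: ifP => [/ln_le_vonM_prime //|_].
exact: vonM_ge0.
Qed.

(** * Sieving and the logarithmic derivative of zeta *)

Lemma npw_lim (x : R) : 0 < x -> is_lim_seq (fun n => npw n x) 0.
Proof.
move=> x0; apply/is_lim_seq_spec => e.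
have [N [_ hN]] := nfloor_ex (exp (Rabs (ln e / x))) ltac:(left; apply: exp_pos).
exists N.+1 => n hn; rewrite Rminus_0_r Rabs_pos_eq; last by left; apply: npw_gt0.
rewrite -[X in _ < X](exp_ln e); last exact: cond_pos.
apply: exp_increasing.
have n1 : exp (Rabs (ln e / x)) < INR n.
  by apply: Rlt_le_trans hN _; rewrite -S_INR; apply: INR_leq; lia.
have h1 := ln_increasing _ _ (exp_pos _) n1; rewrite ln_exp in h1.
have h2 := Rle_abs (- (ln e / x)); rewrite Rabs_Ropp in h2.
have : - (ln e / x) * x < ln (INR n) * x by apply: Rmult_lt_compat_r; lra.
rewrite (_ : - (ln e / x) * x = - ln e); last by field; lra.
lra.
Qed.

Lemma zeta_partial_tail (s : C) (d : R) (M : nat) : 0 < d -> 1 + d <= Re s ->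
  (0 < M)%N -> Cmod (zeta s - \sum_(1 <= n < M.+1) ncpow_opp n s)%C <= npw M d / d.
Proof.
move=> d0 hs M0; have h := dser_spec log_bounded_1 (s := s) ltac:(lra).
have {}h : Csum_to (fun n => ncpow_opp n s) (zeta s).
  by apply: Csum_to_ext h => n _; ring.
apply: Csum_to_tail h _ => N; apply: Rle_trans (npw_tail N d0 M0).
by apply: Rsum_le => n _; rewrite Cmod_ncpow; apply: npw_le.
Qed.

(** No double series is rearranged: by [sum_ln_mul] the difference of the partial sums up to N is
    the sum of Lambda(n) n^(-s) times the tail of zeta beyond N/n. With Re s = 1 + 2d, one part of
    the exponent yields the factor N^(-d) and the rest keeps the sum over n convergent. *)
Lemma zeta_log_derivative (s : C) : 1 < Re s ->
  dirichlet_series (fun n => ln (INR n)) s =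
  (zeta s * dirichlet_series (fun n => vonM n) s)%C.
Proof.
move=> hs; set d := (Re s - 1) / 2; have d0 : 0 < d by rewrite /d; lra.
have h1 := dser_spec log_bounded_ln hs.
have h2 := Csum_to_scal (zeta s) (dser_spec log_bounded_vonM hs).
have hdiff := Clim_minus h2 h1.
suff /(Clim_unique hdiff) e : Clim (fun N =>
   \sum_(1 <= n < N.+1) (zeta s * (vonM n * ncpow_opp n s)) -
   \sum_(1 <= n < N.+1) ln (INR n) * ncpow_opp n s)%C 0.
  set X := dirichlet_series (fun n => RtoC (ln (INR n))) s in e *.
  have -> : X = (zeta s * dirichlet_series (fun n => vonM n) s -
     (zeta s * dirichlet_series (fun n => vonM n) s - X))%C by ring.
  by rewrite e; ring.
set K := log_sum_bound 1 d / (2 * d * npw 2 d).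
apply: (@Clim_0_le _ (fun N => K * npw N d)); last first.
  have -> : Rbar.Finite 0 = Rbar_mult (Rbar.Finite K) (Rbar.Finite 0) by rewrite /= Rmult_0_r.
  by apply: is_lim_seq_scal_l; apply: npw_lim.
exists 1%N => N N0; rewrite (sum_ln_mul N (fun n => ncpow_opp n s)) -Csum_minus.
apply: Rle_trans (Cmod_sum_le _ _ _) _.
have p2 := npw_gt0 2 d.
apply: Rle_trans (_ : \sum_(1 <= n < N.+1) (npw N d / (2 * d * npw 2 d)) *
   (ln (INR n) ^ 1 * npw n (1 + d)) <= _); last first.
  have c0 : 0 <= npw N d / (2 * d * npw 2 d).
    apply: Rlt_le; apply: Rdiv_lt_0_compat; first exact: npw_gt0.
    by apply: Rmult_lt_0_compat; lra.
  have H := Rmult_le_compat_l _ _ _ c0 (ln_pow_sum_le 1 N.+1 d0).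
  rewrite -big_distrr; apply: Rle_trans H _.
  rewrite -/(log_sum_bound _ _) /K; right; field; lra.
apply: Rsum_le_nat => n /andP[n0 nN].
have M0 : (0 < N %/ n)%N by rewrite divn_gt0.
(* Replaces the integer part [N/n] by N/(2n), so that [N/n]^(-d) is controlled by N^(-d) and
   n^(-d). *)
have hM : (N <= 2 * n * (N %/ n))%N.
  have := ltn_ceil N n0; move: M0; set M := (N %/ n)%N; nia.
have e : (\sum_(1 <= m < (N %/ n).+1) ncpow_opp (n * m) s =
  ncpow_opp n s * \sum_(1 <= m < (N %/ n).+1) ncpow_opp m s)%C.
  rewrite big_distrr; apply: eq_big_seq => m; rewrite mem_index_iota => /andP[m0 _].
  by rewrite ncpow_mul.
rewrite e (_ : forall a b c d : C, a * (b * c) - b * (c * d) = b * c * (a - d))%C; last by move=> *; ring.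
rewrite !Cmod_mult Cmod_R Rabs_pos_eq ?Cmod_ncpow; last exact: vonM_ge0.
have d2 : 0 < 2 * d by lra.
have hs2 : 1 + 2 * d <= Re s by rewrite /d; lra.
have T := zeta_partial_tail d2 hs2 M0; set Z := Cmod _ in T *.
have m1 := npw_gt0 (N %/ n) d; have m2 : npw (N %/ n) d <= 1 by apply: npw_le1; lra.
have A : npw (2 * n * (N %/ n)) d <= npw N d by apply: npw_anti => //; lra.
rewrite !npw_mul ?muln_gt0 ?n0 // in A.
have n1 := npw_gt0 n d.
have T2 : Z <= npw N d / (2 * d * npw 2 d) / npw n d.
  apply: Rle_trans T _; rewrite (_ : 2 * d = d + d) ?npw_plus; last by ring.
  apply: Rle_trans (_ : npw (N %/ n) d / (d + d) <= _).
    by apply: Rmult_le_compat_r; [left; apply: Rinv_0_lt_compat; lra | nra].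
  have -> : npw (N %/ n) d / (d + d) =
      npw 2 d * npw n d * npw (N %/ n) d / ((d + d) * npw 2 d) / npw n d by field; lra.
  apply: Rmult_le_compat_r; first by left; apply: Rinv_0_lt_compat.
  apply: Rmult_le_compat_r A; left; apply: Rinv_0_lt_compat; apply: Rmult_lt_0_compat; lra.
have v0 := vonM_ge0 n; have v1 := vonM_le_ln n.
have B : npw n (Re s) <= npw n (1 + d) * npw n d.
  by rewrite -npw_plus; apply: npw_le; rewrite /d; lra.
have s0 := npw_gt0 n (Re s).
have Z0 : 0 <= Z by apply: Cmod_ge_0.
apply: Rle_trans (_ : (ln (INR n) * (npw n (1 + d) * npw n d)) * (npw N d / (2 * d * npw 2 d) / npw n d) <= _).
  apply: Rmult_le_compat => //; first by apply: Rmult_le_pos; lra.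
  by apply: Rmult_le_compat => //; lra.
by right; rewrite pow_1; field; lra.
Qed.

Definition free (A : seq nat) (n : nat) : bool := all (fun p => ~~ (p %| n)) A.

Lemma free_mul A p m : prime p -> all prime A -> p \notin A ->
  free A (p * m) = free A m.
Proof.
move=> hp /allP hA pA; apply: eq_in_all => q hq.
have hq' := hA q hq; rewrite Euclid_dvdM // dvdn_prime2 //.
by case: eqP => // e; move: pA; rewrite -e hq.
Qed.

Lemma free_expn A p j : prime p -> all prime A -> (0 < j)%N ->
  free A (p ^ j) = (p \notin A).
Proof.
move=> hp /allP hA j0; apply/idP/idP => [/allP h|pA].
  by apply/negP => /h; rewrite Euclid_dvdX // j0 dvdnn.
apply/allP => q hq; have hq' := hA q hq; rewrite Euclid_dvdX // j0 andbT dvdn_prime2 //.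
by apply: contra pA => /eqP <-.
Qed.

Definition completely_mul (a : nat -> C) : Prop :=
  a 1%N = 1 /\ forall m n, (0 < m)%N -> (0 < n)%N -> a (m * n)%N = (a m * a n)%C.

(** Eratosthenes: a factor 1 - a p removes the multiples of p. The partial sum over these multiples
    up to N is a p times the partial sum up to N/p, so no absolute convergence enters. *)
Lemma sieve (a : nat -> C) (l : C) (A : seq nat) : completely_mul a ->
  Csum_to a l -> all prime A -> uniq A ->
  Csum_to (fun n => if free A n then a n else 0) (l * \prod_(p <- A) (1 - a p))%C.
Proof.
move=> [a1 aM] hl; elim: A => [_ _|p A IH /= /andP[hp hA] /andP[pA uA]].
  by rewrite big_nil Cmult_1_r.
have {}IH := IH hA uA; rewrite big_cons.
set f := (fun n => if free A n then a n else RtoC 0) in IH.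
set P := (l * _)%C in IH.
have -> : (l * ((1 - a p) * \prod_(j <- A) (1 - a j)) = P - a p * P)%C by rewrite /P; ring.
have h2 : Clim (fun N => \sum_(1 <= n < (N %/ p).+1) f n)%C P.
  apply: (Clim_sub (phi := fun N => (N %/ p)%N) _ IH) => M.
  by exists (M * p)%N => n hn; rewrite leq_divRL ?prime_gt0.
apply: Clim_ext (Clim_minus IH (Clim_scal (a p) h2)) => N.
have -> : (a p * (\sum_(1 <= n < (N %/ p).+1) f n) =
   \sum_(1 <= n < N.+1 | (p %| n)%N) f n)%C.
  rewrite sum_multiples ?prime_gt0 // big_distrr; apply: eq_big_seq => m.
  rewrite mem_index_iota => /andP[m0 _]; rewrite /f free_mul // aM ?(prime_gt0 hp) //.
  by case: ifP => _ //=; ring.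
rewrite [X in (_ - X)%C]big_mkcond -Csum_minus; apply: eq_bigr => n _.
by rewrite /f /=; case: (p %| n); case: (free A n) => /=; ring.
Qed.

Lemma index_iota_mem_sum (A : seq nat) (N : nat) (F : nat -> C) :
  uniq A -> (forall p, p \in A -> (p < N)%N) -> all prime A ->
  (\sum_(0 <= p < N | prime p) (if p \in A then F p else RtoC 0) = \sum_(p <- A) F p)%C.
Proof.
move=> uA hA /allP pA; rewrite big_mkcond.
transitivity (\sum_(0 <= p < N | p \in A) F p)%C.
  rewrite [RHS]big_mkcond; apply: eq_bigr => p _; case: ifP => // hp; case: ifP => // /pA.
  by rewrite hp.
rewrite -big_filter; apply: perm_big; apply: uniq_perm => //.
  by rewrite filter_uniq // iota_uniq.
move=> p; rewrite mem_filter mem_index_iota /=.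
by case hp: (p \in A) => //=; rewrite hA.
Qed.

Lemma leq_trunc_log p j n : (1 < p)%N -> (0 < n)%N -> (p ^ j <= n)%N = (j <= trunc_log p n)%N.
Proof.
move=> p1 n0; apply/idP/idP => h; first exact: trunc_log_max.
by apply: leq_trans (trunc_logP p1 n0); rewrite leq_exp2l.
Qed.

(** Lambda lives on prime powers, so its part that is not free of A is a finite sum of one series
    per prime, cut at p^j <= N. The general u serves both n^(-s) and ln n n^(-s). *)
Lemma sum_nonfree (A : seq nat) (u : nat -> C) (h : nat -> nat -> C) (L : nat -> C) :
  uniq A -> all prime A ->
  (forall p j, p \in A -> (0 < j)%N -> u (p ^ j)%N = h p j) ->
  (forall p, p \in A -> Csum_to (h p) (L p)) ->
  Csum_to (fun n => if free A n then RtoC 0 else vonM n * u n)%C (\sum_(p <- A) ln (INR p) * L p)%C.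
Proof.
move=> uA pA hu hL.
have [B hB] : exists B, forall p, p \in A -> (p < B)%N.
  by exists (sumn A).+1 => p hp; rewrite ltnS sumnE (big_rem p) //= leq_addr.
have H : Clim (fun N => \sum_(p <- A) (if p \in A then ln (INR p) *
   (\sum_(1 <= j < (trunc_log p N).+1) h p j) else RtoC 0))%C (\sum_(p <- A) if p \in A then ln (INR p) * L p else RtoC 0)%C.
  apply: (@Clim_sum _ A (fun p N => if p \in A then (ln (INR p) *
   (\sum_(1 <= j < (trunc_log p N).+1) h p j))%C else RtoC 0) (fun p => if p \in A then (ln (INR p) * L p)%C else RtoC 0)) => p.
  case: ifP => hp; last exact: Clim_const.
  apply: Clim_scal; apply: (Clim_sub (phi := fun N => trunc_log p N) _ (hL p hp)) => M.
  have p1 : (1 < p)%N by apply: prime_gt1; move/allP: pA; apply.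
  by exists (p ^ M)%N => n hn; apply: trunc_log_max.
have e0 : (\sum_(p <- A) (if p \in A then ln (INR p) * L p else RtoC 0) = \sum_(p <- A) ln (INR p) * L p)%C.
  by apply: eq_big_seq => p ->.
rewrite e0 in H; move=> e ep; have [N0 hN0] := H e ep; exists (maxn N0 B) => N.
rewrite geq_max => /andP[h1 h2]; apply: Rle_lt_trans (hN0 N h1); right; congr Cmod; congr (_ - _)%C.
transitivity (\sum_(1 <= n < N.+1) vonM n * (if free A n then RtoC 0 else u n))%C.
  by apply: eq_bigr => n _; case: ifP => _ //; ring.
rewrite sum_vonM -(@index_iota_mem_sum A N.+1) //; last by move=> p /hB; lia.
rewrite big_mkcond [RHS]big_mkcond; apply: eq_big_seq => p.
rewrite mem_index_iota => /andP[_ pN]; case hp: (prime p) => //.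
have Np : (0 < N)%N by have := prime_gt0 hp; lia.
have p1 := prime_gt1 hp.
transitivity (\sum_(1 <= j < N.+1 | (j < (trunc_log p N).+1)%N) ln (INR p) * (if p \in A then h p j else RtoC 0))%C.
  rewrite big_mkcond [RHS]big_mkcond; apply: eq_big_seq => j.
  rewrite mem_index_iota => /andP[j0 _]; rewrite leq_trunc_log // ltnS free_expn //.
  by case: ifP => // _; case hA: (p \in A) => //=; rewrite hu.
have hl : (trunc_log p N <= N)%N.
  by rewrite -ltnS; apply: leq_trans (ltn_expl _ p1) _; rewrite leqW // trunc_logP.
rewrite -(big_nat_widen _ _ _ predT) ?ltnS //= -big_distrr /=.
by case: (p \in A) => //; rewrite big1 //; ring.
Qed.

Lemma Csum_geom (w : C) : Cmod w <= / 2 -> Csum_to (fun j => w ^ j)%C (w / (1 - w))%C.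
Proof.
move=> hw; have w1 : (1 - w)%C <> 0.
  by move=> e; have : Cmod 1 <= / 2; [rewrite (_ : RtoC 1 = w) // -[w]Cplus_0_l -e; ring | rewrite Cmod_1; lra].
apply: (Clim_ext (u := fun N => w / (1 - w) - w * / (1 - w) * w ^ N)%C).
  elim=> [|N IH]; first by rewrite big_geq //=; field.
  by rewrite big_nat_recr //= -IH; field.
rewrite -[X in Clim _ X](_ : w / (1 - w) - w * / (1 - w) * 0 = w / (1 - w))%C; last by ring.
apply: Clim_minus (Clim_const _) (Clim_scal _ _).
apply: (@Clim_0_le _ (fun N => (/ 2) ^ N)).
  by exists 0%N => n _; rewrite Cmod_pow; apply: pow_incr; split => //; apply: Cmod_ge_0.
by apply: is_lim_seq_geom; rewrite Rabs_pos_eq; lra.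
Qed.

Lemma INR_pow_half_le n : INR n * (/ 2) ^ n <= 2 * (3 / 4) ^ n.
Proof.
have h : INR n <= 2 * (3 / 2) ^ n.
  by elim: n => [|n IH]; rewrite ?S_INR /=; [lra | have := pow_R1_Rle (3 / 2) n ltac:(lra); lra].
have -> : 2 * (3 / 4) ^ n = 2 * (3 / 2) ^ n * (/ 2) ^ n.
  by rewrite Rmult_assoc -Rpow_mult_distr; congr (_ * _ ^ _); field.
by apply: Rmult_le_compat_r h; apply: pow_le; lra.
Qed.

Lemma Csum_geom_deriv (w : C) : Cmod w <= / 2 ->
  Csum_to (fun j => INR j * w ^ j)%C (w / ((1 - w) * (1 - w)))%C.
Proof.
move=> hw; have w1 : (1 - w)%C <> 0.
  by move=> e; have : Cmod 1 <= / 2; [rewrite (_ : RtoC 1 = w) // -[w]Cplus_0_l -e; ring | rewrite Cmod_1; lra].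
apply: (Clim_ext (u := fun N => w / ((1 - w) * (1 - w)) - (w / ((1 - w) * (1 - w)) * w ^ N
   + w / (1 - w) * (INR N * w ^ N)))%C).
  elim=> [|N IH]; first by rewrite big_geq //=; field.
  by rewrite big_nat_recr // -IH S_INR RtoC_plus /=; field.
rewrite -[X in Clim _ X](_ : w / ((1 - w) * (1 - w)) - (w / ((1 - w) * (1 - w)) * 0 + w / (1 - w) * 0) = _)%C; last by ring.
apply: Clim_minus (Clim_const _) (Clim_plus (Clim_scal _ _) (Clim_scal _ _)).
  apply: (@Clim_0_le _ (fun N => (/ 2) ^ N)).
    by exists 0%N => n _; rewrite Cmod_pow; apply: pow_incr; split => //; apply: Cmod_ge_0.
  by apply: is_lim_seq_geom; rewrite Rabs_pos_eq; lra.
apply: (@Clim_0_le _ (fun N => 2 * (3 / 4) ^ N)).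
  exists 0%N => n _; rewrite Cmod_mult Cmod_R Rabs_pos_eq; last exact: INR_pos.
  apply: Rle_trans (INR_pow_half_le n); apply: Rmult_le_compat_l; first exact: INR_pos.
  by rewrite Cmod_pow; apply: pow_incr; split => //; apply: Cmod_ge_0.
have -> : Rbar.Finite 0 = Rbar_mult (Rbar.Finite 2) (Rbar.Finite 0) by rewrite /= Rmult_0_r.
by apply: is_lim_seq_scal_l; apply: is_lim_seq_geom; rewrite Rabs_pos_eq; lra.
Qed.

(** * The Basel bound and Mertens' third theorem *)

Lemma Rpow_addn (x : R) (m n : nat) : x ^ (m + n)%N = x ^ m * x ^ n.
Proof. exact: pow_add. Qed.

Lemma Rsum_fold_half (g : nat -> R) (M : nat) :
  \sum_(0 <= k < M + M) g k = \sum_(0 <= k < M) (g k + g (M + M - k.+1)%N).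
Proof.
rewrite (big_cat_nat _ (n := M)) ?leq_addr //= big_split /=; congr (_ + _).
rewrite [RHS]big_nat_rev /= -{1}[M]add0n big_addn addnK; apply: eq_big_seq => k.
by rewrite mem_index_iota => /andP[_ hk]; congr g; lia.
Qed.

(* Hofbauer's proof of the Basel bound, by halving angles in [1 / sin^2]. *)
Lemma inv_sin2_half (x : R) : 0 < x < PI ->
  / sin x ^ 2 = / 4 * (/ sin (x / 2) ^ 2 + / sin ((PI - x) / 2) ^ 2).
Proof.
move=> hx.
have s1 : 0 < sin (x / 2) by apply: sin_gt_0; lra.
have c1 : 0 < cos (x / 2) by apply: cos_gt_0; lra.
have -> : (PI - x) / 2 = PI / 2 - x / 2 by field.
rewrite sin_shift {1}(_ : x = 2 * (x / 2)); last by field.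
rewrite sin_2a; set s := sin _ in s1 *; set c := cos _ in c1 *.
have h : s * s + c * c = 1 := sin2_cos2 (x / 2).
have -> : / s ^ 2 + / c ^ 2 = (s * s + c * c) / (s ^ 2 * c ^ 2) by field; lra.
by rewrite h; field; lra.
Qed.

(** Halving the 2^m angles of one level produces the 2^(m+1) angles of the next; x/2 and (PI - x)/2
    sit at the mirror indices k and 2^(m+1) - 1 - k. At m = 0 the only angle is PI/4. *)
Lemma sum_inv_sin2 (m : nat) :
  \sum_(0 <= k < 2 ^ m) / sin ((2 * INR k + 1) * (PI / 2 ^ (m + 2)%N)) ^ 2 = 2 * 4 ^ m.
Proof.
elim: m => [|m IH].
  rewrite big_nat1 /= (_ : (2 * 0 + 1) * _ = PI / 4); last by field.
  rewrite sin_PI4; have h := sqrt_sqrt 2 ltac:(lra).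
  have s0 : 0 < sqrt 2 by apply: sqrt_lt_R0; lra.
  rewrite (_ : 1 / sqrt 2 * (1 / sqrt 2 * 1) = / (sqrt 2 * sqrt 2)); last by field; lra.
  by rewrite h; field.
rewrite expnS mul2n -addnn Rsum_fold_half [4 ^ _]/= -[RHS]Rmult_1_l.
have -> : 1 * (2 * (4 * 4 ^ m)) = 4 * (2 * 4 ^ m) by ring.
rewrite -IH big_distrr; apply: eq_big_seq => k; rewrite mem_index_iota => /andP[_ hk] /=.
have p2 : 0 < 2 ^ (m + 2) by apply: pow_lt; lra.
have hk1 : INR k + 1 <= 2 ^ m by rewrite -S_INR -[2]/(INR 2) -INR_expn; apply: INR_leq.
have k0 := INR_pos k; have pi := PI_RGT_0.
have e2 : 2 ^ (m + 2) = 4 * 2 ^ m by rewrite Rpow_addn; ring.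
rewrite [X in 4 * X]inv_sin2_half; last first.
  split; first by apply: Rmult_lt_0_compat; [lra | apply: Rdiv_lt_0_compat].
  rewrite (_ : _ * _ = PI * ((2 * INR k + 1) / 2 ^ (m + 2))); last by field; lra.
  rewrite -[X in _ < X]Rmult_1_r; apply: Rmult_lt_compat_l => //.
  by apply/Rlt_div_l => //; lra.
rewrite (_ : forall x, 4 * (/ 4 * x) = x); last by move=> x; field.
congr (/ sin _ ^ 2 + / sin _ ^ 2).
  by rewrite -/(2 ^ (m + 2)); field; lra.
rewrite (_ : (2 ^ m + 2 ^ m - k.+1)%N = (2 ^ m + 2 ^ m - k - 1)%N); last by lia.
have hk' : (k.+1 <= 2 ^ m + 2 ^ m)%N by lia.
rewrite !INR_subn ?INR_addn ?INR_expn; try lia.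
rewrite (_ : INR 2 = 2) // [INR 1]/= -/(2 ^ (m + 2)) e2; field.
by have := pow_lt 2 m; lra.
Qed.

(** Compares 1/y^2 with 1/sin^2 y at the angles of [sum_inv_sin2], using 0 < sin y < y. *)
Lemma sum_odd_inv_sq (m : nat) :
  \sum_(0 <= k < 2 ^ m) / (2 * INR k + 1) ^ 2 <= PI ^ 2 / 8.
Proof.
have pi := PI_RGT_0; have p2 : 0 < 2 ^ (m + 2) by apply: pow_lt; lra.
have p4 : 0 < 4 ^ m by apply: pow_lt; lra.
have e4 : (2 ^ (m + 2)) ^ 2 = 16 * 4 ^ m.
  rewrite Rpow_addn (_ : 4 = 2 * 2) ?Rpow_mult_distr; ring.
have : \sum_(0 <= k < 2 ^ m) (16 * 4 ^ m / PI ^ 2) * / (2 * INR k + 1) ^ 2 <= 2 * 4 ^ m.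
  rewrite -sum_inv_sin2; apply: Rsum_le_nat => k /andP[_ hk].
  have hk1 : INR k + 1 <= 2 ^ m by rewrite -S_INR -[2]/(INR 2) -INR_expn; apply: INR_leq.
  have k0 := INR_pos k.
  set y := (_ + 1) * (PI / _).
  have y0 : 0 < y by apply: Rmult_lt_0_compat; [lra | apply: Rdiv_lt_0_compat].
  have y1 : y < PI.
    rewrite /y (_ : _ * _ = PI * ((2 * INR k + 1) / 2 ^ (m + 2))); last by field; lra.
    rewrite -[X in _ < X]Rmult_1_r; apply: Rmult_lt_compat_l => //.
    by apply/Rlt_div_l => //; rewrite Rpow_addn; lra.
  rewrite (_ : _ * / _ = / y ^ 2); last first.
    rewrite /y -e4; field; lra.
  have s0 := sin_gt_0 y y0 y1; have s1 := sin_lt_x y y0.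
  by apply: Rinv_le_contravar; [apply: pow_lt | apply: pow_incr; lra].
rewrite -big_distrr /=; set S := \big[_/_]_(_ <= _ < _) _ => h.
have : 16 * 4 ^ m / PI ^ 2 * S <= 16 * 4 ^ m / PI ^ 2 * (PI ^ 2 / 8).
  apply: Rle_trans h _; right; field; lra.
apply: Rmult_le_reg_l; apply: Rdiv_lt_0_compat; [lra | exact: pow_lt].
Qed.

(** The even terms up to 2M add up to a quarter of the sum S(M), so S(M) <= S(2M) leaves 3/4 S(M)
    below the odd sum, which is at most PI^2/8. *)
Lemma basel_le (N : nat) : \sum_(1 <= n < N.+1) npw n 2 <= PI ^ 2 / 6.
Proof.
have split_even M : \sum_(1 <= n < (M + M).+1) npw n 2 =
    \sum_(0 <= k < M) / (2 * INR k + 1) ^ 2 + / 4 * \sum_(1 <= n < M.+1) npw n 2.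
  elim: M => [|M IH]; first by rewrite !big_geq //; ring.
  rewrite addnS addSn big_nat_recr //= big_nat_recr //= IH.
  rewrite [\sum_(0 <= k < M.+1) _]big_nat_recr //= [\sum_(1 <= n < M.+2) _]big_nat_recr //=.
  rewrite !npw_2 //; have e1 : INR (M + M).+1 = 2 * INR M + 1 by rewrite S_INR INR_addn; ring.
  have e2 : INR (M + M).+2 = 2 * INR M.+1 by rewrite S_INR e1 S_INR; ring.
  rewrite e1 e2; have m0 := INR_pos M; have m1 := INR_ge1 (ltn0Sn M).
  by field; lra.
have hN : (N <= 2 ^ N)%N by apply: ltnW; apply: ltn_expl.
have h1 : \sum_(1 <= n < N.+1) npw n 2 <= \sum_(1 <= n < (2 ^ N).+1) npw n 2.
  by apply: Rsum_widen => // i _; left; apply: npw_gt0.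
have h2 : \sum_(1 <= n < (2 ^ N).+1) npw n 2 <= \sum_(1 <= n < (2 ^ N + 2 ^ N).+1) npw n 2.
  by apply: Rsum_widen => [|i _]; [lia | left; apply: npw_gt0].
have h3 := sum_odd_inv_sq N; have h4 := split_even (2 ^ N)%N.
lra.
Qed.

(** * Euler's constant *)

Definition harmonic (n : nat) : R := \sum_(1 <= k < n.+1) / INR k.

(** The sequence decreases to its limit. Its nonnegativity is proved as well, to know that [Lim_seq]
    is finite and that [real] does not return a default value. *)
Lemma euler_constant_le (n : nat) : (0 < n)%N ->
  euler_constant <= harmonic n - ln (INR n).
Proof.
move=> n0; rewrite /euler_constant.
set u := fun n => sum_n_m (fun k => / INR k) 1 n - ln (INR n).
have uE m : (0 < m)%N -> u m = harmonic m - ln (INR m).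
  rewrite /u /harmonic => m0; congr (_ - _); elim: m m0 => // -[|m] IH _.
    by rewrite sum_n_n big_nat1.
  by rewrite sum_n_Sm ?IH // ?[RHS]big_nat_recr //; lia.
have u_dec m : (0 < m)%N -> u m.+1 <= u m.
  move=> m0; rewrite !uE // /harmonic big_nat_recr //=; have m1 := INR_ge1 m0.
  have := ln_ge_1subV (x := INR m.+1 / INR m) ltac:(by apply: Rdiv_lt_0_compat; rewrite ?S_INR; lra).
  rewrite ln_div ?(S_INR m); try lra.
  rewrite -/(INR m.+1) (_ : 1 - / ((INR m + 1) / INR m) = / (INR m + 1)); last by field; lra.
  by rewrite ?S_INR; lra.
have u_ge0 m : (0 < m)%N -> 0 <= u m.
  move=> m0; rewrite uE //; suff : ln (INR m.+1) <= harmonic m.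
    by have := ln_le _ _ (Rlt_le_trans _ _ _ Rlt_0_1 (INR_ge1 m0)) (INR_leq (leqnSn m)); lra.
  elim: m m0 => // m IH _; case: m IH => [_|m IH].
    by rewrite /harmonic big_nat1; have := ln_le_sub1 (x := INR 2) ltac:(by rewrite /=; lra); rewrite [INR 2]/= [INR 1]/= Rinv_1; lra.
  have := IH isT; rewrite /harmonic [X in _ -> _ <= X]big_nat_recr //=.
  have m1 := INR_ge1 (ltn0Sn m.+1); rewrite -/(INR m.+1) -/(INR m.+2) -/(INR m.+3).
  have := ln_le_sub1 (x := INR m.+3 / INR m.+2) ltac:(by apply: Rdiv_lt_0_compat; rewrite ?(S_INR m.+2); lra).
  rewrite ln_div; [|rewrite (S_INR m.+2); lra|lra].
  rewrite (_ : INR m.+3 / INR m.+2 - 1 = / INR m.+2); last by rewrite (S_INR m.+2); field; lra.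
  lra.
rewrite -uE //.
have h1 : Rbar_le (Lim_seq u) (u n).
  rewrite -(Lim_seq_const (u n)); apply: Lim_seq_le_loc; exists n => m hm.
  elim: m hm => [|m IH] hm; first by exfalso; lia.
  have [e|h] : n = m.+1 \/ (n <= m)%coq_nat by lia.
    by rewrite e; apply: Rle_refl.
  by apply: Rle_trans (IH h); apply: u_dec; lia.
have h2 : Rbar_le 0 (Lim_seq u).
  rewrite -(Lim_seq_const 0); apply: Lim_seq_le_loc; exists 1%N => m hm.
  by apply: u_ge0; lia.
by case: (Lim_seq u) h1 h2.
Qed.

(** * Sieving by the primes up to N and truncated Euler products *)

Definition primes_le (N : nat) : seq nat := [seq p <- index_iota 0 N.+1 | prime p].

Lemma mem_primes_le N p : (p \in primes_le N) = prime p && (p <= N)%N.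
Proof. by rewrite mem_filter mem_index_iota. Qed.

Lemma primes_le_prime N : all prime (primes_le N).
Proof. exact: filter_all. Qed.

Lemma primes_le_uniq N : uniq (primes_le N).
Proof. by rewrite filter_uniq ?iota_uniq. Qed.

Lemma free_primes_le N n : (0 < n)%N -> (n <= N)%N -> free (primes_le N) n = (n == 1%N).
Proof.
move=> n0 nN; apply/idP/eqP => [/allP h|->].
  have [|h1|//] := ltngtP n 1; first by lia.
  have := h (pdiv n); rewrite mem_primes_le pdiv_prime // pdiv_dvd /=.
  by rewrite (leq_trans (pdiv_leq n0) nN) => /(_ isT).
by apply/allP => p; rewrite mem_primes_le => /andP[hp _]; rewrite dvdn1; case: eqP hp => // ->.
Qed.

(** After sieving by all primes up to N, only 1 and integers beyond N survive. *)
Lemma sieve_primes_le_tail (a : nat -> C) (l : C) (N : nat) (B : R) :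
  completely_mul a -> Csum_to a l -> (0 < N)%N ->
  (forall M, \sum_(N.+1 <= n < M) Cmod (a n) <= B) ->
  Cmod (l * \prod_(p <- primes_le N) (1 - a p) - 1)%C <= B.
Proof.
move=> ha hl N0 hB.
have h := sieve ha hl (primes_le_prime N) (primes_le_uniq N).
rewrite [X in (_ - X)%C](_ : RtoC 1 = \sum_(1 <= n < N.+1)
   (if free (primes_le N) n then a n else RtoC 0))%C.
  apply: Csum_to_tail h _ => M; apply: Rle_trans (hB M); apply: Rsum_le => n _.
  by case: ifP => _; [apply: Rle_refl | rewrite Cmod_0; apply: Cmod_ge_0].
case: ha => a1 _; rewrite big_ltn //= free_primes_le // eqxx a1.
rewrite big1_seq ?Cplus_0_r // => n; rewrite mem_index_iota => /andP[h1 h2].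
rewrite free_primes_le; [|lia..].
by rewrite (_ : (n == 1)%N = false) //; lia.
Qed.

Lemma completely_mul_npw (x : R) : completely_mul (fun n => RtoC (npw n x)).
Proof. by split=> [|m n m0 n0]; rewrite ?npw_1n // npw_mul // RtoC_mult. Qed.

Lemma Csum_to_npw (d : R) : 0 < d ->
  Csum_to (fun n => RtoC (npw n (1 + d))) (zeta (RtoC (1 + d))).
Proof.
move=> d0; have hs : 1 < Re (RtoC (1 + d)) by rewrite /=; lra.
apply: Csum_to_ext (dser_spec log_bounded_1 hs) => n _.
by rewrite Cmult_1_l ncpow_RtoC.
Qed.

Lemma Csum_to_ge_partial (a : nat -> R) (l : C) N : (forall n, 0 <= a n) ->
  Csum_to (fun n => RtoC (a n)) l -> \sum_(1 <= n < N) a n <= Cmod l.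
Proof.
move=> a0 hl; apply: Rle_trans (_ : Re l <= _); last first.
  by have := re_le_Cmod l; have := Rle_abs (Re l); lra.
have h := Clim_Re hl.
have : Rbar_le (Rbar.Finite (\sum_(1 <= n < N) a n)) (Rbar.Finite (Re l)).
  apply: (is_lim_seq_le_loc (fun _ => \sum_(1 <= n < N) a n) _ _ _ _ (is_lim_seq_const _) h).
  exists N => n hn; rewrite -RtoC_sum /=; apply: Rsum_widen => //; lia.
by [].
Qed.

Lemma Csum_to_le_bound (a : nat -> R) (l : C) (B : R) : (forall n, 0 <= a n) ->
  Csum_to (fun n => RtoC (a n)) l -> (forall N, \sum_(1 <= n < N) a n <= B) -> Cmod l <= B.
Proof.
move=> a0 hl hB; apply: Csum_to_le hl _ => N; apply: Rle_trans (hB N).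
by apply: Rsum_le => n _; rewrite Cmod_R Rabs_pos_eq //; lra.
Qed.

Lemma Cprod_one_minus_npw (N : nat) (x : R) :
  (\prod_(p <- primes_le N) (1 - npw p x) = RtoC (\prod_(p <- primes_le N) (1 - npw p x)))%C.
Proof. by rewrite RtoC_prod; apply: eq_bigr => p _; rewrite RtoC_minus. Qed.

Lemma npw_prime_lt1 N p x : 0 < x -> p \in primes_le N -> 0 < 1 - npw p x.
Proof.
move=> x0; rewrite mem_primes_le => /andP[/prime_gt1 hp _].
suff : npw p x < 1 by lra.
rewrite -exp_0 /npw; apply: exp_increasing.
have : 0 < ln (INR p).
  by rewrite -ln_1; apply: ln_increasing; [lra | have := INR_leq hp; rewrite [INR 2]/=; lra].
nra.
Qed.

Lemma euler_prod_gt0 N x : 0 < x -> 0 < \prod_(p <- primes_le N) (1 - npw p x).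
Proof. by move=> x0; apply: Rprod_gt0 => p hp _; apply: npw_prime_lt1 hp. Qed.

Lemma zeta_real_ge (d : R) : 0 < d -> 1 / d <= Cmod (zeta (RtoC (1 + d))).
Proof.
move=> d0; have h := Csum_to_npw d0.
have : Rbar_le (Rbar.Finite (1 / d)) (Rbar.Finite (Cmod (zeta (RtoC (1 + d))))).
  apply: (is_lim_seq_le_loc (fun N => (1 - npw N d) / d) (fun _ => Cmod (zeta (RtoC (1 + d))))).
  - exists 1%N => n hn; apply: Rle_trans (npw_sum_ge d0 _) _; first by lia.
    by apply: Csum_to_ge_partial h => m; left; apply: npw_gt0.
  - have -> : Rbar.Finite (1 / d) = Rbar_mult (Rbar.Finite (1 - 0)) (Rbar.Finite (/ d)).
      by rewrite /= Rminus_0_r.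
    apply: is_lim_seq_scal_r; apply: is_lim_seq_minus'; [exact: is_lim_seq_const | exact: npw_lim].
  - exact: is_lim_seq_const.
by [].
Qed.

Lemma zeta_real_le (d : R) : 0 < d -> Cmod (zeta (RtoC (1 + d))) <= 1 + / d.
Proof.
move=> d0; apply: Csum_to_le_bound (Csum_to_npw d0) _ => [n|N]; first by left; apply: npw_gt0.
exact: npw_sum_le.
Qed.

(** The sieved zeta series is at most 1 plus its tail, while zeta(1 + d) >= 1/d. *)
Lemma euler_prod_le (N : nat) (d : R) : 0 < d -> (0 < N)%N ->
  \prod_(p <- primes_le N) (1 - npw p (1 + d)) <= d * (1 + npw N d / d).
Proof.
move=> d0 N0; have h := Csum_to_npw d0.
have := sieve_primes_le_tail (completely_mul_npw (1 + d)) h N0 (B := npw N d / d).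
rewrite Cprod_one_minus_npw; set P := \prod_(p <- _) _.
have P0 : 0 < P by apply: euler_prod_gt0; lra.
have HB M : \sum_(N.+1 <= n < M) Cmod (RtoC (npw n (1 + d))) <= npw N d / d.
  apply: Rle_trans (npw_tail M d0 N0); apply: Rsum_le => n _.
  by rewrite Cmod_R Rabs_pos_eq; [lra | left; apply: npw_gt0].
move=> /(_ HB) H; set z := zeta _ in H.
have : Cmod (z * P)%C <= 1 + npw N d / d.
  rewrite (_ : z * P = 1 + (z * P - 1))%C; last by ring.
  by apply: Rle_trans (Cmod_triangle _ _) _; rewrite Cmod_1; lra.
rewrite Cmod_mult Cmod_R Rabs_pos_eq; last lra.
have := zeta_real_ge d0; rewrite -/z => h1 h2.
have : 1 / d * P <= 1 + npw N d / d by apply: Rle_trans h2; apply: Rmult_le_compat_r; lra.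
move=> h3; have := Rmult_le_compat_l d _ _ ltac:(lra) h3.
by rewrite (_ : d * (1 / d * P) = P); [|field; lra].
Qed.

Lemma euler_prod_sq_ge (N : nat) (x : R) : 2 <= x -> (0 < N)%N ->
  1 <= PI ^ 2 / 6 * \prod_(p <- primes_le N) (1 - npw p x).
Proof.
move=> hx N0; have d0 : 0 < x - 1 by lra.
have := Csum_to_npw d0; rewrite (_ : 1 + (x - 1) = x); last by ring.
set z := zeta _ => h.
have hz : Cmod z <= PI ^ 2 / 6.
  apply: Csum_to_le_bound h _ => [n|M]; first by left; apply: npw_gt0.
  apply: Rle_trans (basel_le M); apply: Rle_trans (_ : \sum_(1 <= n < M) npw n 2 <= _).
    by apply: Rsum_le => n _; apply: npw_le.
  by apply: Rsum_widen => // i _; left; apply: npw_gt0.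
have := sieve (completely_mul_npw x) h (primes_le_prime N) (primes_le_uniq N).
rewrite Cprod_one_minus_npw; set P := \prod_(p <- _) _ => H.
have P0 : 0 < P by apply: euler_prod_gt0; lra.
have : 1 <= Cmod (z * P)%C.
  apply: Rle_trans (Csum_to_ge_partial (a := fun n => if free (primes_le N) n then npw n x else 0) 2 _ _).
  - by rewrite big_nat1 free_primes_le // npw_1n; apply: Rle_refl.
  - by move=> n; case: ifP => _; [left; apply: npw_gt0 | lra].
  - by apply: Csum_to_ext H => n _; case: ifP.
rewrite Cmod_mult Cmod_R Rabs_pos_eq; last lra.
by have := Rmult_le_compat_r P _ _ ltac:(lra) hz; lra.
Qed.

(** Factor 1 - y^2 = (1 - y)(1 + y) with y = p^(-1-d): the product of 1 - y^2 is at least 6/PI^2 and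
    that of 1 - y is at most about d. *)
Lemma euler_prod_plus_ge (N : nat) (d : R) : 0 < d -> (0 < N)%N ->
  1 <= PI ^ 2 / 6 * (d * (1 + npw N d / d)) * \prod_(p <- primes_le N) (1 + npw p (1 + d)).
Proof.
move=> d0 N0; have h1 := euler_prod_le d0 N0.
have h2 := euler_prod_sq_ge (x := (1 + d) + (1 + d)) ltac:(lra) N0.
have e : \prod_(p <- primes_le N) (1 - npw p (1 + d + (1 + d))) =
  \prod_(p <- primes_le N) (1 - npw p (1 + d)) * \prod_(p <- primes_le N) (1 + npw p (1 + d)).
  by rewrite -big_split /=; apply: eq_bigr => p _; rewrite npw_plus; ring.
rewrite e in h2; set P := \prod_(p <- _) (1 + _) in h2 *.
have P0 : 0 < P by apply: Rprod_gt0 => p _ _; have := npw_gt0 p (1 + d); lra.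
apply: Rle_trans h2 _; rewrite -!Rmult_assoc; apply: Rmult_le_compat_r; first lra.
rewrite Rmult_assoc; apply: Rmult_le_compat_l => //.
by have := PI_RGT_0; nra.
Qed.

(** With c = p^(-d) and y = 1/p this moves the damping p^(-d) out of the logarithm, which turns the
    logarithm of a product at 1 + d into an Abel mean of ln (1 + 1/p). *)
Lemma ln_one_plus_scale (c y : R) : 0 <= c <= 1 -> 0 <= y ->
  ln (1 + c * y) <= c * ln (1 + y) + (1 - c) * y ^ 2.
Proof.
move=> hc y0; have p1 : 0 < 1 + c * y by nra.
have e : ln (1 + c * y) = ln (1 + y) + ln ((1 + c * y) / (1 + y)).
  by rewrite ln_div; lra.
have h : ln ((1 + c * y) / (1 + y)) <= - ((1 - c) * (y / (1 + y))).
  apply: Rle_trans (ln_le_sub1 _) _; first by apply: Rdiv_lt_0_compat; lra.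
  by right; field; lra.
have h2 := ln_le_sub1 (x := 1 + y) ltac:(lra).
have h3 : y - y / (1 + y) <= y ^ 2.
  have -> : y - y / (1 + y) = y ^ 2 * / (1 + y) by field; lra.
  rewrite -[X in _ <= X]Rmult_1_r; apply: Rmult_le_compat_l; first nra.
  by rewrite -[X in _ <= X]Rinv_1; apply: Rinv_le_contravar; lra.
have : (1 - c) * (ln (1 + y) - y / (1 + y)) <= (1 - c) * y ^ 2.
  by apply: Rmult_le_compat_l; lra.
lra.
Qed.

Lemma one_minus_npw_le p d : 1 - npw p d <= d * ln (INR p).
Proof. by have := exp_ineq1_le (- d * ln (INR p)); rewrite -/(npw p d); lra. Qed.

Definition efl (r : R) : nat := proj1_sig (nfloor_ex (exp r) (Rlt_le _ _ (exp_pos r))).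

Lemma efl_spec r : INR (efl r) <= exp r < INR (efl r) + 1.
Proof. by rewrite /efl; case: nfloor_ex. Qed.

Lemma leq_efl (n : nat) r : (0 < n)%N -> (n <= efl r)%N <-> ln (INR n) <= r.
Proof.
move=> n0; have [h1 h2] := efl_spec r; have n1 := INR_ge1 n0; split=> h.
  by rewrite -(ln_exp r); apply: ln_le; [lra | have := INR_leq h; lra].
rewrite -ltnS; apply/ltP; apply: INR_lt; rewrite S_INR; apply: Rle_lt_trans h2.
by rewrite -(exp_ln (INR n)); [apply: exp_le_compat | lra].
Qed.

Lemma efl_gt0 r : 0 <= r -> (0 < efl r)%N.
Proof. by move=> h; apply/leq_efl => //; rewrite /= ln_1. Qed.

Lemma efl_mono r s : r <= s -> (efl r <= efl s)%N.
Proof.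
move=> h; have [->//|r0] := posnP (efl r); apply/leq_efl => //.
by have /leq_efl := leqnn (efl r) => /(_ r0); lra.
Qed.

Lemma efl0 : efl 0 = 1%N.
Proof.
have [h1 h2] := efl_spec 0; rewrite exp_0 in h1 h2.
have := efl_gt0 (Rle_refl 0); have := INR_leq_inv (n := 1) (m := efl 0) h1; lia.
Qed.

Lemma ln_efl r : 0 <= r -> r - 1 <= ln (INR (efl r)) <= r.
Proof.
move=> r0; have e0 := efl_gt0 r0; split; last by apply/leq_efl.
have [_ h] := efl_spec r; have e1 := INR_ge1 e0.
have h2 : exp r <= INR (efl r) * exp 1 by have := exp_ineq1_le 1; nra.
have := ln_le _ _ (exp_pos r) h2; rewrite ln_mult; [|lra|exact: exp_pos].
by rewrite !ln_exp; lra.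
Qed.

(** The difference of the two sides vanishes at 0 and has derivative t^N / (1 - t) >= 0. *)
Lemma sum_pow_div_le (y : R) (N : nat) : 0 < y < 1 ->
  \sum_(1 <= k < N.+1) y ^ k / INR k <= - ln (1 - y).
Proof.
move=> hy.
have hd t : 0 <= t <= y -> derivable_pt_lim
    (fun t => - ln (1 - t) - \sum_(1 <= k < N.+1) t ^ k / INR k) t (t ^ N / (1 - t)).
  move=> ht; apply/is_derive_Reals.
  have h1 : is_derive (fun t => - ln (1 - t)) t (/ (1 - t)).
    by auto_derive; [lra | field; lra].
  have h2 : is_derive (fun t => \sum_(1 <= k < N.+1) t ^ k / INR k) t (\sum_(0 <= k < N) t ^ k).
    elim: N => [|N IH].
      rewrite big_geq //; apply: (is_derive_ext (fun _ => 0)) => [x|]; first by rewrite big_geq.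
      exact: (is_derive_const (V := R_NormedModule)).
    rewrite big_nat_recr //=.
    apply: (is_derive_ext (fun t => \sum_(1 <= k < N.+1) t ^ k / INR k + t ^ N.+1 / INR N.+1)) => [x|].
      by rewrite [RHS]big_nat_recr.
    apply: (is_derive_plus (V := R_NormedModule)) => //.
    auto_derive => //; rewrite -/(INR N.+1); have := INR_ge1 (ltn0Sn N).
    by move=> n1; field; lra.
  have e : \sum_(0 <= k < N) t ^ k = (1 - t ^ N) / (1 - t).
    elim: N {h2} => [|N IH]; first by rewrite big_geq //=; field; lra.
    by rewrite big_nat_recr //= IH; field; lra.
  rewrite (_ : t ^ N / (1 - t) = / (1 - t) - (1 - t ^ N) / (1 - t)); last by field; lra.
  by rewrite -e; apply: (is_derive_minus (V := R_NormedModule)).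
have [t [h1 [h2 h3]]] := MVT_cor2 _ _ 0 y (proj1 hy) hd.
have z0 : \sum_(1 <= k < N.+1) 0 ^ k / INR k = 0.
  rewrite big_nat big1 // => -[|k] /andP[//] _ _.
  by rewrite /= Rmult_0_l /Rdiv Rmult_0_l.
rewrite z0 !Rminus_0_r ln_1 Ropp_0 Rminus_0_r in h1.
have : 0 <= t ^ N / (1 - t) * y.
  apply: Rmult_le_pos; last lra; apply: Rmult_le_pos; first by apply: pow_le; lra.
  by left; apply: Rinv_0_lt_compat; lra.
lra.
Qed.

Definition log_prod (k : nat) : R := \sum_(p <- primes_le (efl (INR k))) ln (1 + / INR p).

Lemma ln_one_plus_inv_ge0 p : 0 <= ln (1 + / INR p).
Proof.
rewrite -ln_1; apply: ln_le; first lra.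
by have := pos_INR p; case: (Req_dec (INR p) 0) => [->|h] h2; [rewrite Rinv_0; lra | have := Rinv_0_lt_compat (INR p) ltac:(lra); lra].
Qed.

Lemma primes_le_sum (N : nat) (F : nat -> R) :
  \sum_(p <- primes_le N) F p = \sum_(0 <= p < N.+1 | prime p) F p.
Proof. by rewrite /primes_le big_filter. Qed.

Lemma log_prod0 : log_prod 0 = 0.
Proof.
rewrite /log_prod efl0 primes_le_sum big1_seq // => p /andP[/prime_gt1 hp].
by rewrite mem_index_iota; lia.
Qed.

(** Groups the primes by e^(k-1) < p <= e^k; there p^(-d) <= e^d e^(-dk). *)
Lemma log_prod_weighted_le (d : R) (N : nat) : 0 < d ->
  \sum_(p <- primes_le (efl (INR N))) npw p d * ln (1 + / INR p) <=
  exp d * \sum_(1 <= k < N.+1) (log_prod k - log_prod k.-1) * exp (- d) ^ k.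
Proof.
move=> d0; elim: N => [|N IH].
  rewrite big_geq // efl0 Rmult_0_r primes_le_sum big1_seq => [|p /andP[/prime_gt1 hp]]; first lra.
  by rewrite mem_index_iota; lia.
rewrite big_nat_recr //= Rmult_plus_distr_l primes_le_sum.
have hm : (efl (INR N) <= efl (INR N.+1))%N by apply: efl_mono; apply: INR_leq.
rewrite (big_cat_nat _ (n := (efl (INR N)).+1)) //=.
rewrite primes_le_sum in IH; apply: Rplus_le_compat => //.
rewrite /log_prod !primes_le_sum.
rewrite [X in X - _](big_cat_nat _ (n := (efl (INR N)).+1)) //=.
rewrite (_ : forall a b, a + b - a = b); last by move=> *; lra.
rewrite (_ : forall S, exp d * (S * (exp (- d) * exp (- d) ^ N)) = exp (- d) ^ N * S); last first.
  by move=> S; rewrite exp_Ropp; field; have := exp_pos d; lra.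
rewrite big_distrr; apply: Rsum_le_seq => p; rewrite mem_index_iota => /andP[h1 h2] hp /=.
apply: Rmult_le_compat_r; first exact: ln_one_plus_inv_ge0.
have p0 := prime_gt0 hp.
have hN : INR N < ln (INR p).
  apply: Rnot_le_lt => h; have /leq_efl := h; move/(_ p0) => h3; lia.
have -> : exp (- d) ^ N = exp (- d * INR N).
  rewrite -(exp_ln (exp (- d) ^ N)); last by apply: pow_lt; apply: exp_pos.
  by rewrite ln_pow ?ln_exp; [congr exp; ring | apply: exp_pos].
by apply: exp_le_compat; nra.
Qed.

(** Summation by parts writes the left side as a mean of G with nonnegative weights y^k - y^(k+1)
    and y^N; the indices before K0 carry total weight 1 - y^K0, which vanishes as y tends to 1. *)
Lemma abel_two_bounds (G : nat -> R) (y B c : R) (K0 N : nat) : 0 < y < 1 ->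
  G 0%N = 0 -> 0 <= B -> (forall k, G k <= B) -> (forall k, (K0 <= k)%N -> G k <= - c) ->
  (K0 <= N)%N ->
  \sum_(1 <= k < N.+1) (G k - G k.-1) * y ^ k <= B * (1 - y ^ K0) - c * y ^ K0.
Proof.
move=> hy G0 B0 hB hc hN.
pose T n := \sum_(1 <= k < n.+1) (G k - G k.-1) * y ^ k - G n * y ^ n.
have TS n : T n.+1 = T n + G n * (y ^ n - y ^ n.+1).
  by rewrite /T big_nat_recr //=; ring.
have yp n : 0 <= y ^ n - y ^ n.+1.
  by rewrite /=; have := pow_le y n ltac:(lra); nra.
have T1 n : T n <= B * (1 - y ^ n).
  elim: n => [|n IH]; first by rewrite /T big_geq // G0 /=; lra.
  by rewrite TS; have := Rmult_le_compat_r _ _ _ (yp n) (hB n); lra.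
have T2 : T N <= B * (1 - y ^ K0) - c * (y ^ K0 - y ^ N).
  elim: N hN => [|N IH].
    by rewrite leqn0 => /eqP ->; have := T1 0%N; lra.
  rewrite leq_eqVlt => /orP[/eqP ->|]; first by have := T1 N.+1; lra.
  rewrite ltnS => h; have := IH h; rewrite TS.
  by have := Rmult_le_compat_r _ _ _ (yp N) (hc N h); lra.
have := Rmult_le_compat_r _ _ _ (pow_le y N ltac:(lra)) (hc N hN).
by rewrite /T in T2; lra.
Qed.

Lemma PI2_6_gt1 : 1 < PI ^ 2 / 6.
Proof.
have h := basel_le 2; rewrite big_ltn // big_nat1 npw_1n in h.
by have := npw_gt0 2 2; lra.
Qed.

Lemma one_minus_exp_le d : 0 <= d -> 1 - exp (- d) <= d.
Proof. by have := exp_ineq1_le (- d); lra. Qed.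

(* Mertens' third theorem along a subsequence, by comparison of the Abel means
   of [log_prod] and [harmonic], both equal to [- ln d] up to a constant. *)
Lemma mertens_third_limsup (eta : R) (K0 : nat) : 0 < eta ->
  exists K, (K0 <= K)%N /\ harmonic K - ln (PI ^ 2 / 6) - eta <= log_prod K.
Proof.
move=> eta0.
case: (Classical_Prop.classic (exists K, (K0 <= K)%N /\
  harmonic K - ln (PI ^ 2 / 6) - eta <= log_prod K)) => // hno; exfalso.
have hlt k : (K0 <= k)%N -> log_prod k - harmonic k <= - (ln (PI ^ 2 / 6) + eta).
  move=> hk; apply: Rnot_lt_le => h; apply: hno; exists k; split=> //; lra.
set c := ln (PI ^ 2 / 6) + eta.
have l0 : 0 < ln (PI ^ 2 / 6) by rewrite -ln_1; apply: ln_increasing; have := PI2_6_gt1; lra.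
pose G k := log_prod k - harmonic k.
have G0 : G 0%N = 0 by rewrite /G log_prod0 /harmonic big_geq //; lra.
pose B := \sum_(0 <= k < K0) Rabs (G k).
have B0 : 0 <= B by apply: Rsum_ge0 => k _; apply: Rabs_pos.
have hB k : G k <= B.
  have [h|h] := leqP K0 k; first by have := hlt k h; rewrite /G; lra.
  apply: Rle_trans (Rle_abs _) _; rewrite /B (bigD1_seq k) ?mem_index_iota ?iota_uniq //=.
  have : 0 <= \sum_(i <- index_iota 0 K0 | i != k) Rabs (G i).
    by apply: Rsum_ge0 => i _; apply: Rabs_pos.
  lra.
pose C1 := (B + c) * INR K0; have C10 : 0 <= C1.
  by apply: Rmult_le_pos; [rewrite /c; lra | exact: INR_pos].
(* Below: the Euler product at 1 + d, where 13 = 1 + 12 collects ln (1 + t) <= d and the exchange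
   error of [ln_one_plus_scale]. Above: the Abel mean of [harmonic], at most -ln d + d, lowered by c
   under the assumption to be refuted. *)
have main d : 0 < d <= / 2 ->
  - ln d - ln (PI ^ 2 / 6) - 13 * d <=
  exp d * (- ln d + d - c + C1 * d).
  move=> hd; have d0 : 0 < d by lra.
  have [N [hN1 hN2]] : exists N : nat, (maxn K0 1 <= N)%N /\ npw (efl (INR N)) d <= d * d.
    have /is_lim_seq_spec /(_ (mkposreal (d * d) ltac:(nra))) [M hM] := npw_lim d0.
    exists (maxn (maxn K0 1) M.+1); split; first exact: leq_maxl.
    have hle : (M <= efl (INR (maxn (maxn K0 1) M.+1)))%N.
      case: M {hM} => // M.
      apply/leq_efl => //; apply: Rle_trans (ln_le_sub1 _) _.
        by have := INR_ge1 (ltn0Sn M); lra.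
      apply: Rle_trans (_ : INR M.+1 <= _); first lra.
      by apply: INR_leq; rewrite leq_max; apply/orP; right; lia.
    have /= := hM _ ltac:(apply/leP; exact: hle); rewrite Rminus_0_r.
    by have := Rle_abs (npw (efl (INR (maxn (maxn K0 1) M.+1))) d); lra.
  have N1 : (0 < N)%N by lia.
  have K0N : (K0 <= N)%N by lia.
  have hx0 : (0 < efl (INR N))%N by apply: efl_gt0; apply: INR_pos.
  have low : - ln d - ln (PI ^ 2 / 6) - 13 * d <=
     \sum_(p <- primes_le (efl (INR N))) npw p d * ln (1 + / INR p).
    have h1 := euler_prod_plus_ge d0 hx0; set P := \prod_(p <- _) _ in h1.
    have P0 : 0 < P by apply: Rprod_gt0 => p _ _; have := npw_gt0 p (1 + d); lra.
    have t1 : npw (efl (INR N)) d / d <= d by apply/Rle_div_l; lra.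
    have t0 : 0 < npw (efl (INR N)) d / d by apply: Rdiv_lt_0_compat => //; apply: npw_gt0.
    set t := npw _ d / d in h1 t0 t1.
    have q0 : 0 < PI ^ 2 / 6 by have := PI2_6_gt1; lra.
    have h2 := ln_le _ _ Rlt_0_1 h1.
    have q1 : 0 < d * (1 + t) by apply: Rmult_lt_0_compat; lra.
    rewrite ln_1 ln_mult ?(ln_mult (_ / _)) ?(ln_mult d) in h2; try lra; last exact: Rmult_lt_0_compat.
    have h3 := ln_le_sub1 (x := 1 + t) ltac:(lra).
    have h4 : ln P <= \sum_(p <- primes_le (efl (INR N))) npw p d * ln (1 + / INR p) + 12 * d.
      rewrite /P ln_prod => [|p _ _]; last by have := npw_gt0 p (1 + d); lra.
      apply: Rle_trans (_ : \sum_(p <- primes_le (efl (INR N))) (npw p d * ln (1 + / INR p) + d * (ln (INR p) ^ 1 * npw p (1 + 1))) <= _).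
        apply: Rsum_le_seq => p; rewrite mem_primes_le => /andP[hp _] _.
        have p0 := prime_gt0 hp; have y0 : 0 <= / INR p by left; apply: Rinv_0_lt_compat; have := INR_ge1 p0; lra.
        have hc : 0 <= npw p d <= 1 by split; [left; apply: npw_gt0 | apply: npw_le1; lra].
        have := ln_one_plus_scale hc y0; rewrite Rplus_comm npw_plus npw_1 // (Rmult_comm (npw p d)) (npw_plus p 1 1) npw_1 //.
        have := one_minus_npw_le p d; have : 0 <= (/ INR p) ^ 2 by apply: pow_le.
        move=> h5 h6; have := Rmult_le_compat_r _ _ _ h5 h6.
        by rewrite (Rplus_comm (/ INR p * _)) (Rmult_comm (/ INR p)) pow_1 /=; lra.
      rewrite big_split /= -big_distrr /=; apply: Rplus_le_compat_l.
      rewrite (Rmult_comm 12); apply: Rmult_le_compat_l; first lra.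
      apply: Rle_trans (_ : \sum_(1 <= n < (efl (INR N)).+1) ln (INR n) ^ 1 * npw n (1 + 1) <= _).
        rewrite primes_le_sum big_mkcond big_ltn //= Rplus_0_l -big_mkcond.
        apply: Rsum_sub => // i _; apply: Rmult_le_pos; last by left; apply: npw_gt0.
        by rewrite Rmult_1_r; apply: ln_INR_ge0.
      by have := ln_pow_sum_le 1 (efl (INR N)).+1 Rlt_0_1; rewrite [INR 2]/=; lra.
    lra.
  apply: Rle_trans low _; apply: Rle_trans (log_prod_weighted_le N d0) _.
  apply: Rmult_le_compat_l; first by left; apply: exp_pos.
  set y := exp (- d).
  have hy : 0 < y < 1.
    by split; [apply: exp_pos | rewrite /y -exp_0; apply: exp_increasing; lra].
  have -> : \sum_(1 <= k < N.+1) (log_prod k - log_prod k.-1) * y ^ k =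
    \sum_(1 <= k < N.+1) y ^ k / INR k + \sum_(1 <= k < N.+1) (G k - G k.-1) * y ^ k.
    rewrite -big_split; apply: eq_big_seq => k; rewrite mem_index_iota => /andP[k0 _] /=.
    rewrite /G; case: k k0 => // k _; rewrite [k.+1.-1]/=.
    by rewrite (_ : harmonic k.+1 = harmonic k + / INR k.+1) /Rdiv; [ring | rewrite /harmonic big_nat_recr].
  have A := abel_two_bounds hy G0 B0 hB hlt K0N; rewrite -/c in A.
  have A2 := sum_pow_div_le N hy.
  have yK : 1 - y ^ K0 <= d * INR K0.
    have -> : y ^ K0 = exp (- (d * INR K0)).
      rewrite -(exp_ln (y ^ K0)); last by apply: pow_lt; lra.
      by rewrite ln_pow ?ln_exp; [congr exp; ring | lra].
    by apply: one_minus_exp_le; apply: Rmult_le_pos; [lra | apply: INR_pos].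
  have y1 : d * y <= 1 - y.
    have := exp_ineq1_le d; have e : exp d * y = 1 by rewrite /y -exp_plus Rplus_opp_r exp_0.
    by nra.
  have l1 : - ln (1 - y) <= - ln d + d.
    have dy : 0 < d * y by apply: Rmult_lt_0_compat; lra.
    have := ln_le _ _ dy y1; rewrite ln_mult; try lra.
    by rewrite {1}/y ln_exp; lra.
  have : (B + c) * (1 - y ^ K0) <= C1 * d.
    rewrite /C1 Rmult_assoc (Rmult_comm (INR K0)); apply: Rmult_le_compat_l => //.
    by rewrite /c; lra.
  lra.
pose C2 := 2 * (16 + C1 + 4).
(* [main] is applied at d = e^2: then -ln d <= 2/e, so d (-ln d) <= 2e, an elementary form of d ln d
   -> 0. *)
pose e := Rmin (/ 2) (eta / (2 * C2)).
have C20 : 0 < C2 by rewrite /C2; lra.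
have e0 : 0 < e by apply: Rmin_glb_lt; [lra | apply: Rdiv_lt_0_compat; lra].
have e1 : e <= / 2 := Rmin_l _ _.
have e2 : e * (2 * C2) <= eta by apply/Rle_div_r; [lra | exact: Rmin_r].
have hd : 0 < e * e <= / 2 by nra.
have h := main _ hd; set d := e * e in hd h.
have E : exp d <= 1 + 2 * d.
  have := exp_ineq1_le (- d); have e3 : exp d * exp (- d) = 1 by rewrite -exp_plus Rplus_opp_r exp_0.
  have := exp_pos d; have := exp_pos (- d); nra.
have L : - ln d <= 2 / e.
  rewrite /d ln_mult //; have := ln_ge_1subV e0; rewrite /Rdiv; lra.
have L0 : 0 <= - ln d.
  by have := ln_le d 1 ltac:(lra) ltac:(lra); rewrite ln_1; lra.
have dL : d * - ln d <= 2 * e.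
  by apply: Rle_trans (Rmult_le_compat_l d _ _ ltac:(lra) L) _; right; rewrite /d; field; lra.
have E1 : 1 <= exp d by have := exp_ineq1_le d; lra.
set X := - ln d in h L0 dL.
have : exp d * (X + d - c + C1 * d) <= X + 2 * (d * X) + 2 * (d + C1 * d) - c.
  have : (exp d - 1) * X <= 2 * d * X by apply: Rmult_le_compat_r; lra.
  have : (exp d - 1) * (d + C1 * d) <= 1 * (d + C1 * d).
    by apply: Rmult_le_compat_r; nra.
  have : c <= exp d * c by rewrite /c; nra.
  lra.
have de : d <= e by rewrite /d; nra.
have : C1 * d <= C1 * e by apply: Rmult_le_compat_l.
have A3 := Rmult_le_pos _ _ C10 (Rlt_le _ _ e0); have hc : c = ln (PI ^ 2 / 6) + eta by []. 
rewrite /C2 in e2; lra.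
Qed.

Lemma mertens_third_prod (eta : R) (K0 : nat) : 0 < eta -> (0 < K0)%N ->
  exists K, (K0 <= K)%N /\
  exp (- eta) * (exp euler_constant * INR K) / (PI ^ 2 / 6) <=
  \prod_(p <- primes_le (efl (INR K))) (1 + / INR p).
Proof.
move=> eta0 K00; have [K [hK h]] := mertens_third_limsup K0 eta0.
exists K; split=> //; have K0' : (0 < K)%N by apply: leq_trans hK.
have q0 : 0 < PI ^ 2 / 6 by have := PI2_6_gt1; lra.
have k1 := INR_ge1 K0'; have hg := euler_constant_le K0'.
rewrite -(exp_ln (\prod_(p <- _) _)); last first.
  apply: Rprod_gt0 => p; rewrite mem_primes_le => /andP[/prime_gt0 p0 _] _.
  by have := Rinv_0_lt_compat (INR p) ltac:(have := INR_ge1 p0; lra); lra.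
rewrite ln_prod => [|p]; last first.
  rewrite mem_primes_le => /andP[/prime_gt0 p0 _] _.
  by have := Rinv_0_lt_compat (INR p) ltac:(have := INR_ge1 p0; lra); lra.
have -> : exp (- eta) * (exp euler_constant * INR K) / (PI ^ 2 / 6) =
  exp (- eta + (euler_constant + ln (INR K)) + - ln (PI ^ 2 / 6)).
  rewrite !exp_plus exp_Ropp (exp_ln (INR K)); last lra.
  by rewrite (exp_Ropp (ln _)) exp_ln.
rewrite -/(log_prod K); apply: exp_le_compat; lra.
Qed.

(** * Characters and sums of chi(n)/n *)

Record nat_character (q : nat) (X : nat -> C) : Prop := {
  nchar_per : forall n, X (n + q)%N = X n;
  nchar_mul : forall m n, X (m * n)%N = (X m * X n)%C;
  nchar_supp : forall n, X n <> 0 <-> coprime n q }.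

Lemma nat_character_of (q : nat) (chi : Z -> C) : dirichlet_character q chi ->
  nat_character q (fun n => chi (Z.of_nat n)).
Proof.
case=> per mul supp; split=> [n|m n|n].
- by rewrite Nat2Z.inj_add per.
- by rewrite Nat2Z.inj_mul mul.
- rewrite supp (_ : Z.gcd _ _ = Z.of_nat (gcdn n q)); last by lia.
  by rewrite /coprime; split=> [h|/eqP -> //]; apply/eqP; lia.
Qed.

Section Nat_character.
Variables (q : nat) (X : nat -> C).
Hypotheses (q0 : (0 < q)%N) (hX : nat_character q X).

Lemma nchar_1 : X 1%N = 1.
Proof.
have h1 : X 1%N <> 0 by apply/(nchar_supp hX); apply: coprime1n.
have := nchar_mul hX 1 1; rewrite muln1 => e.
move: (X 1%N) h1 e => x x0 e.
transitivity (x * x / x)%C; first by field.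
by rewrite -e; field.
Qed.

Lemma nchar_modn n : X (n %% q)%N = X n.
Proof.
rewrite {2}(divn_eq n q) addnC; elim: (n %/ q)%N => [|k IH]; first by rewrite addn0.
by rewrite mulSn addnCA addnC (nchar_per hX).
Qed.

Lemma nchar_expn n j : X (n ^ j)%N = (X n ^ j)%C.
Proof.
elim: j => [|j IH]; first by rewrite expn0 nchar_1.
by rewrite expnS (nchar_mul hX) IH.
Qed.

Lemma nchar_not_coprime n : ~~ coprime n q -> X n = 0.
Proof.
move=> h; case: (Ceq_dec (X n) 0) => // h2; exfalso; move/negP: h; apply.
exact/(nchar_supp hX).
Qed.

(** By Euler's theorem X n is a root of unity of order dividing the totient of q. *)
Lemma nchar_Cmod n : coprime n q -> Cmod (X n) = 1.
Proof.
move=> h; have e : (X n ^ totient q)%C = 1.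
  rewrite -nchar_expn -nchar_modn (cyclic.Euler_exp_totient h) ?nchar_modn ?nchar_1 //.
have := f_equal Cmod e; rewrite Cmod_pow Cmod_1.
have t0 : (0 < totient q)%N by rewrite totient_gt0.
have := Cmod_ge_0 (X n); set r := Cmod _; case: (totient q) t0 => // t _ r0 hr.
have [h1|[//|h1]] := Rtotal_order r 1.
  by have := pow_lt_1_compat r t.+1 (conj r0 h1) ltac:(lia); lra.
by have := Rlt_pow_R1 r t.+1 h1 ltac:(lia); lra.
Qed.

Lemma nchar_le1 n : Cmod (X n) <= 1.
Proof.
case hn: (coprime n q); first by rewrite nchar_Cmod //; lra.
by rewrite nchar_not_coprime ?hn // Cmod_0; lra.
Qed.

Lemma log_bounded_nchar : log_bounded X 0.
Proof. by move=> n _; rewrite /=; apply: nchar_le1. Qed.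

Variables (a : nat).
Hypotheses (ca : coprime a q) (Xa : X a <> 1).

(** Multiplication by a permutes the residues mod q, so X a times the sum is the sum itself, while X
    a is not 1. *)
Lemma nchar_sum_period : (\sum_(0 <= n < q) X n = 0)%C.
Proof.
set S := (\big[_/_]_(_ <= _ < _) _).
have h : (X a * S = S)%C.
  rewrite /S big_distrr /= !big_mkord.
  pose f (i : 'I_q) : 'I_q := Ordinal (ltn_pmod (a * i) q0).
  have finj : injective f.
    move=> i j; wlog hij : i j / (j <= i)%N.
      by move=> H; have [h|/ltnW h] := leqP j i => e; [exact: H | apply/esym/H].
    move/(congr1 val) => /= /eqP; rewrite eqn_mod_dvd ?leq_mul2l ?hij ?orbT //.
    rewrite -mulnBr Gauss_dvdr ?[coprime q a]coprime_sym // -eqn_mod_dvd //.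
    by rewrite !modn_small // => /eqP/val_inj.
  rewrite [RHS](reindex_inj finj) /=; apply: eq_bigr => i _.
  by rewrite nchar_modn (nchar_mul hX).
have e : ((X a - 1) * S = 0)%C.
  rewrite (_ : (X a - 1) * S = X a * S - S)%C; last by ring.
  by rewrite h; ring.
have d0 : (X a - 1)%C <> 0.
  move=> h2; apply: Xa; rewrite (_ : X a = X a - 1 + 1)%C; last by ring.
  by rewrite h2; ring.
transitivity ((X a - 1) * S / (X a - 1))%C; first by field.
by rewrite e; field.
Qed.

Lemma nchar_sum_le N : Cmod (\sum_(0 <= n < N) X n)%C <= INR q.
Proof.
rewrite (divn_eq N q).
have -> : (\sum_(0 <= n < N %/ q * q + N %% q) X n = \sum_(0 <= n < N %% q) X n)%C.
  elim: (N %/ q)%N => [|k IH]; first by rewrite mul0n add0n.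
  rewrite mulSn -addnA (big_cat_nat _ (n := q)) //= ?leq_addr //.
  rewrite nchar_sum_period Cplus_0_l -IH.
  rewrite -[X in \big[_/_]_(X <= _ < _) _ = _]add0n big_addn addKn.
  by apply: eq_bigr => i _; rewrite (nchar_per hX).
apply: Rle_trans (Cmod_sum_le _ _ _) _.
apply: Rle_trans (_ : \sum_(0 <= i < N %% q) 1 <= _).
  by apply: Rsum_le => i _; apply: nchar_le1.
rewrite Rsum_const_nat subn0 Rmult_1_r; apply: INR_leq.
by apply: ltnW; apply: ltn_pmod.
Qed.

Lemma nchar_sum_interval m N : Cmod (\sum_(m <= n < N) X n)%C <= 2 * INR q.
Proof.
have q1 := INR_ge1 q0.
have [h|h] := leqP m N; last by rewrite big_geq ?Cmod_0; [lra | lia].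
have h1 := nchar_sum_le m; have h2 := nchar_sum_le N.
have -> : (\sum_(m <= n < N) X n = \sum_(0 <= n < N) X n + - \sum_(0 <= n < m) X n)%C.
  by rewrite (big_cat_nat _ (m := 0%N) (n := m) (p := N)) //=; ring.
apply: Rle_trans (Cmod_triangle _ _) _; rewrite Cmod_opp; lra.
Qed.

End Nat_character.

(** * Summation by parts and Mertens' theorem for characters *)

Lemma abel_sum (b : nat -> C) (w : nat -> R) (m N : nat) :
  (m <= N)%N ->
  (\sum_(m <= n < N) b n * w n = (\sum_(m <= n < N) b n) * w N +
   \sum_(m <= n < N) (\sum_(m <= k < n.+1) b k) * RtoC (w n - w n.+1)%R)%C.
Proof.
elim: N => [|N IH]; first by rewrite leqn0 => /eqP ->; rewrite !big_geq //; ring.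
rewrite leq_eqVlt => /orP[/eqP ->|]; first by rewrite !big_geq //; ring.
rewrite ltnS => h; rewrite big_nat_recr //= IH // [X in (X * w N.+1)%C]big_nat_recr //=.
rewrite [X in (_ = _ + X)%C]big_nat_recr //= [X in (X * RtoC (w N - _)%R)%C]big_nat_recr //=.
by rewrite RtoC_minus; ring.
Qed.

Lemma abel_le (b : nat -> C) (w : nat -> R) (m N : nat) (B : R) :
  (forall n, (m <= n)%N -> 0 <= w n.+1 <= w n) -> 0 <= w m ->
  (forall M, Cmod (\sum_(m <= n < M) b n)%C <= B) ->
  Cmod (\sum_(m <= n < N) b n * w n)%C <= B * w m.
Proof.
move=> hw w0 hB; have B0 : 0 <= B by have := Cmod_ge_0 (\sum_(m <= n < m) b n)%C; have := hB m; lra.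
have [h|h] := leqP m N; last by rewrite big_geq ?Cmod_0; [apply: Rmult_le_pos | lia].
have wN : 0 <= w N.
  move: h; rewrite leq_eqVlt => /orP[/eqP <- //|].
  by case: N => // N; rewrite ltnS => /hw; lra.
rewrite abel_sum //; apply: Rle_trans (Cmod_triangle _ _) _.
rewrite Cmod_mult Cmod_R Rabs_pos_eq //.
have h1 : Cmod (\sum_(m <= n < N) (\sum_(m <= k < n.+1) b k) * RtoC (w n - w n.+1)%R)%C <= B * (w m - w N).
  apply: Rle_trans (Cmod_sum_le _ _ _) _.
  apply: Rle_trans (_ : \sum_(m <= n < N) B * (w n - w n.+1) <= _).
    apply: Rsum_le_nat => n /andP[hn _]; have := hw n hn => h2.
    rewrite Cmod_mult Cmod_R Rabs_pos_eq; last lra.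
    by apply: Rmult_le_compat_r; [lra | apply: hB].
  rewrite -big_distrr /=; apply: Rmult_le_compat_l => //; right.
  elim: N h {wN} => [|N IH]; first by rewrite leqn0 => /eqP ->; rewrite big_geq //; ring.
  rewrite leq_eqVlt => /orP[/eqP ->|]; first by rewrite big_geq //; ring.
  by rewrite ltnS => h; rewrite big_nat_recr //= IH //; ring.
have := Rmult_le_compat_r _ _ _ wN (hB N); lra.
Qed.

(** For conditionally convergent series such as L(1, chi), where [Clim_cauchy] would ask for a
    bounded majorant of the absolute increments. *)
Lemma Clim_cauchy_le (v : nat -> C) (e : nat -> R) :
  (forall M N, (M <= N)%N -> Cmod (v N - v M)%C <= e M) ->
  is_lim_seq e 0 -> exists l, Clim v l.
Proof.
move=> hv /is_lim_seq_spec he.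
have cv (f : C -> R) : (forall a b, Rabs (f a - f b) <= Cmod (a - b)%C) ->
    ex_finite_lim_seq (fun n => f (v n)).
  move=> hf; apply/ex_lim_seq_cauchy_corr => eps.
  have e2 : 0 < eps / 2 by have := cond_pos eps; lra.
  have [N hN] := he (mkposreal _ e2).
  exists N => n m hn hm.
  have A k : (N <= k)%coq_nat -> Rabs (f (v k) - f (v N)) < eps / 2.
    move=> hk; apply: Rle_lt_trans (hf _ _) _; apply: Rle_lt_trans (hv _ _ _) _; first by lia.
    by have := hN N (le_n _); rewrite Rminus_0_r; apply: Rle_lt_trans; apply: Rle_abs.
  have := A n hn; have := A m hm.
  have := Rabs_triang (f (v n) - f (v N)) (f (v N) - f (v m)).
  rewrite (_ : f (v n) - f (v N) + (f (v N) - f (v m)) = f (v n) - f (v m)); last by ring.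
  by rewrite (Rabs_minus_sym (f (v N))); lra.
have [a /is_lim_seq_spec ha] : ex_finite_lim_seq (fun n => Re (v n)).
  by apply: cv => x y; have := re_le_Cmod (x - y)%C; case: x y => ? ? [? ?] /=.
have [b /is_lim_seq_spec hb] : ex_finite_lim_seq (fun n => Im (v n)).
  by apply: cv => x y; have := im_le_Cmod (x - y)%C; case: x y => ? ? [? ?] /=.
exists (a, b) => eps e0; have e2 : 0 < eps / 2 by lra.
have [N1 h1] := ha (mkposreal _ e2); have [N2 h2] := hb (mkposreal _ e2).
exists (maxn N1 N2) => n; rewrite geq_max => /andP[n1 n2].
have /= := h1 n ltac:(lia); have /= := h2 n ltac:(lia); case: (v n) => x y /= A1 A2.
have -> : ((x, y) - (a, b))%C = (RtoC (x - a) + Ci * RtoC (y - b))%C.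
  by apply: injective_projections => /=; ring.
apply: Rle_lt_trans (Cmod_triangle _ _) _.
by rewrite Cmod_mult Cmod_Ci !Cmod_R; lra.
Qed.

Section Nonprincipal.
Variables (q : nat) (X : nat -> C) (a : nat).
Hypotheses (q0 : (0 < q)%N) (hX : nat_character q X).
Hypotheses (ca : coprime a q) (Xa : X a <> 1).

Definition Lpartial (N : nat) : C := (\sum_(1 <= n < N.+1) X n * RtoC (/ INR n)%R)%C.

Lemma nchar_weight_le (w : nat -> R) (m N : nat) :
  (forall n, (m <= n)%N -> 0 <= w n.+1 <= w n) -> 0 <= w m ->
  Cmod (\sum_(m <= n < N) X n * w n)%C <= 2 * INR q * w m.
Proof. by move=> hw w0; apply: abel_le => // M; apply: (nchar_sum_interval q0 hX ca Xa). Qed.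

Lemma inv_INR_dec n : (0 < n)%N -> 0 <= / INR n.+1 <= / INR n.
Proof.
move=> n0; have n1 := INR_ge1 n0; split.
  by left; apply: Rinv_0_lt_compat; rewrite S_INR; lra.
by apply: Rinv_le_contravar; rewrite ?S_INR; lra.
Qed.

Lemma Lpartial_cauchy M N : (M <= N)%N ->
  Cmod (Lpartial N - Lpartial M)%C <= 2 * INR q * / INR M.+1.
Proof.
move=> h; rewrite /Lpartial Cpartial_sub //; apply: nchar_weight_le => [n hn|].
  by apply: inv_INR_dec; lia.
by left; apply: Rinv_0_lt_compat; have := INR_ge1 (ltn0Sn M); lra.
Qed.

Lemma Lone_exists : exists l, Clim Lpartial l.
Proof.
apply: (Clim_cauchy_le Lpartial_cauchy).
have -> : Rbar.Finite 0 = Rbar_mult (Rbar.Finite (2 * INR q)) (Rbar.Finite 0) by rewrite /= Rmult_0_r.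
apply: is_lim_seq_scal_l.
apply: (is_lim_seq_ext (fun n => npw n.+1 1)) => [n|]; first by rewrite npw_1.
by have := npw_lim Rlt_0_1 => /is_lim_seq_incr_1.
Qed.

Lemma Lone_tail l M : Clim Lpartial l -> Cmod (l - Lpartial M)%C <= 2 * INR q * / INR M.+1.
Proof.
move=> hl; apply: Clim_sub_le hl _; exists M => N; exact: Lpartial_cauchy.
Qed.

(** ln x / x decreases only from x = e on; this is why the terms n = 1, 2 are split off in
    [nchar_log_sum_le]. *)
Lemma ln_div_dec n : (3 <= n)%N ->
  0 <= ln (INR n.+1) * / INR n.+1 <= ln (INR n) * / INR n.
Proof.
move=> n3; have n1 : 3 <= INR n by have := INR_leq n3; rewrite [INR 3]/=; lra.
split; first by apply: Rmult_le_pos; [apply: ln_INR_ge0 | left; apply: Rinv_0_lt_compat; rewrite S_INR; lra].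
have h : ln (INR n.+1) - ln (INR n) <= / INR n.
  rewrite -ln_div; [|rewrite S_INR; lra|lra].
  apply: Rle_trans (ln_le_sub1 _) _; first by apply: Rdiv_lt_0_compat; rewrite ?S_INR; lra.
  by right; rewrite S_INR; field; lra.
have l1 : 1 <= ln (INR n).
  by rewrite -(ln_exp 1); apply: ln_le; [apply: exp_pos | have := exp_le_3; lra].
have p1 : 0 < INR n.+1 by rewrite S_INR; lra.
apply: (Rmult_le_reg_r (INR n * INR n.+1)); first by apply: Rmult_lt_0_compat; lra.
rewrite (_ : ln (INR n.+1) * / INR n.+1 * _ = ln (INR n.+1) * INR n); last by field; lra.
rewrite (_ : ln (INR n) * / INR n * _ = ln (INR n) * INR n.+1); last by field; lra.
have := Rmult_le_compat_r (INR n) _ _ ltac:(lra) h; rewrite Rinv_l; last lra.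
by rewrite (S_INR n); lra.
Qed.

Lemma nchar_log_sum_le N :
  Cmod (\sum_(1 <= n < N.+1) ln (INR n) * (X n * RtoC (/ INR n)%R))%C <= 2 * INR q + 1.
Proof.
have q1 := INR_ge1 q0.
have e n : (ln (INR n) * (X n * RtoC (/ INR n)%R) = X n * RtoC (ln (INR n) * / INR n)%R)%C.
  by rewrite RtoC_mult; ring.
rewrite (eq_bigr _ (fun n _ => e n)).
have t2 : Cmod (X 2 * RtoC (ln (INR 2) * / INR 2)%R)%C <= / 2.
  rewrite Cmod_mult Cmod_R Rabs_pos_eq; last first.
    by apply: Rmult_le_pos; [apply: ln_INR_ge0 | rewrite [INR 2]/=; lra].
  have := nchar_le1 q0 hX 2; have := Cmod_ge_0 (X 2).
  have := ln_le_sub1 (x := 2) ltac:(lra); have := ln_INR_ge0 2.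
  by rewrite (_ : INR 2 = 2) //; nra.
have t1 : (X 1%N * RtoC (ln (INR 1) * / INR 1)%R = 0)%C.
  by rewrite [INR 1]/= ln_1 Rmult_0_l Cmult_0_r.
have [hN|hN] := leqP N 2.
  case: N hN => [|[|[|//]]] _; first by rewrite big_geq // Cmod_0; lra.
    by rewrite big_nat1 t1 Cmod_0; lra.
  by rewrite big_ltn // big_nat1 t1 Cplus_0_l; lra.
rewrite big_ltn; last by lia.
rewrite t1 Cplus_0_l big_ltn; last by lia.
apply: Rle_trans (Cmod_triangle _ _) _.
have l3 : ln (INR 3) * / INR 3 <= / 2.
  have := ln_le_sub1 (x := INR 3 / 2) ltac:(by rewrite /=; lra).
  have := ln_le_sub1 (x := 2) ltac:(lra).
  by rewrite ln_div; rewrite ?[INR 3]/=; lra.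
have := nchar_weight_le (m := 3) N.+1 ln_div_dec.
move=> /(_ ltac:(apply: Rmult_le_pos; [apply: ln_INR_ge0 | rewrite [INR 3]/=; lra])).
by nra.
Qed.

(** By [sum_ln_mul] the bounded sum of ln n chi(n)/n equals the sum of Lambda(d) chi(d)/d times the
    partial sum of L(1, chi) up to N/d. Replacing that partial sum by l costs at most 2q d/N for
    each d, in total 8q by Chebyshev's bound; dividing by l gives (8q + 2q + 1)/|l|. *)
Lemma mertens_nchar l N : Clim Lpartial l -> l <> 0 ->
  Cmod (\sum_(1 <= n < N.+1) vonM n * (X n * RtoC (/ INR n)%R))%C <=
  (10 * INR q + 1) / Cmod l.
Proof.
move=> hl l0; have lp : 0 < Cmod l by apply/Cmod_gt_0.
have q1 := INR_ge1 q0.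
case: N => [|N'].
  by rewrite big_geq // Cmod_0; apply: Rlt_le; apply: Rdiv_lt_0_compat; lra.
set N := N'.+1; have N1 : 1 <= INR N by apply: INR_ge1.
apply/Rle_div_r => //; rewrite -Cmod_mult.
have h1 := nchar_log_sum_le N.
rewrite (sum_ln_mul N (fun n => X n * RtoC (/ INR n)%R)%C) in h1.
have e : (\sum_(1 <= d < N.+1) vonM d * \sum_(1 <= m < (N %/ d).+1) (X (d * m)%N * RtoC (/ INR (d * m)%N)%R) =
  \sum_(1 <= d < N.+1) (vonM d * (X d * RtoC (/ INR d)%R)) * Lpartial (N %/ d))%C.
  apply: eq_big_seq => d; rewrite mem_index_iota => /andP[d0 _].
  rewrite /Lpartial -Cmult_assoc; congr (_ * _)%C; rewrite big_distrr; apply: eq_big_seq => m.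
  rewrite mem_index_iota => /andP[m0 _] /=.
  by rewrite (nchar_mul hX) INR_muln Rinv_mult RtoC_mult; ring.
rewrite e in h1.
set S := (\big[_/_]_(_ <= _ < _) _)%C in h1.
have -> : ((\sum_(1 <= n < N.+1) vonM n * (X n * RtoC (/ INR n)%R)) * l =
  S + \sum_(1 <= d < N.+1) (vonM d * (X d * RtoC (/ INR d)%R)) * (l - Lpartial (N %/ d)))%C.
  rewrite /S big_distrl -big_split; apply: eq_bigr => d _ /=; ring.
apply: Rle_trans (Cmod_triangle _ _) _.
suff h2 : Cmod (\sum_(1 <= d < N.+1) (vonM d * (X d * RtoC (/ INR d)%R)) * (l - Lpartial (N %/ d)))%C <= 8 * INR q by lra.
apply: Rle_trans (Cmod_sum_le _ _ _) _.
apply: Rle_trans (_ : \sum_(1 <= d < N.+1) 2 * INR q * / INR N * vonM d <= _).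
  apply: Rsum_le_nat => d /andP[d0 _]; have d1 := INR_ge1 d0.
  rewrite !Cmod_mult !Cmod_R !Rabs_pos_eq; [|by left; apply: Rinv_0_lt_compat; lra|exact: vonM_ge0].
  have A := Lone_tail (N %/ d) hl; have v0 := vonM_ge0 d.
  have B := nchar_le1 q0 hX d; have C0 := Cmod_ge_0 (X d).
  have D : / INR d * / INR (N %/ d).+1 <= / INR N.
    rewrite -Rinv_mult; apply: Rinv_le_contravar; first lra.
    rewrite -INR_muln; apply: INR_leq; rewrite mulnC; apply: ltnW; exact: ltn_ceil.
  have i0 : 0 < / INR d by apply: Rinv_0_lt_compat; lra.
  apply: Rle_trans (_ : vonM d * (1 * / INR d) * (2 * INR q * / INR (N %/ d).+1) <= _).
    apply: Rmult_le_compat => //.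
    - by apply: Rmult_le_pos => //; apply: Rmult_le_pos; lra.
    - exact: Cmod_ge_0.
    - by apply: Rmult_le_compat_l => //; apply: Rmult_le_compat_r; lra.
  rewrite (_ : vonM d * (1 * / INR d) * (2 * INR q * / INR (N %/ d).+1) =
     (2 * INR q * vonM d) * (/ INR d * / INR (N %/ d).+1)); last by ring.
  rewrite (_ : 2 * INR q * / INR N * vonM d = (2 * INR q * vonM d) * / INR N); last by ring.
  by apply: Rmult_le_compat_l D; apply: Rmult_le_pos => //; lra.
rewrite -big_distrr /= -/(cpsi N); have := cpsi_bound N => h.
have : 2 * INR q * / INR N * cpsi N <= 2 * INR q * / INR N * (4 * INR N).
  apply: Rmult_le_compat_l h; apply: Rmult_le_pos; first lra.
  by left; apply: Rinv_0_lt_compat; lra.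
by rewrite (_ : 2 * INR q * / INR N * (4 * INR N) = 8 * INR q); [|field; lra].
Qed.

End Nonprincipal.

(** * Non-vanishing of L(1, chi) *)

Section Complex_nonvanishing.
Variables (q : nat) (X : nat -> C) (a : nat).
Hypotheses (q0 : (0 < q)%N) (hX : nat_character q X).
Hypotheses (ca : coprime a q) (Xa : X a <> 1).

Lemma completely_mul_twist (s : C) : completely_mul (fun n => X n * ncpow_opp n s)%C.
Proof.
split=> [|m n m0 n0]; first by rewrite (nchar_1 hX) ncpow_1n; ring.
by rewrite (nchar_mul hX) ncpow_mul //; ring.
Qed.

(** A finite substitute for the Euler product: sieving by the primes up to Y leaves 1 and a tail of
    size at most 1/2. *)
Lemma nchar_euler_prod_ge (d : R) (Y : nat) : 0 < d -> (0 < Y)%N ->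
  npw Y d / d <= / 2 ->
  / 2 <= Cmod (dirichlet_series X (RtoC (1 + d))) *
    \prod_(p <- primes_le Y) Cmod (1 - X p * npw p (1 + d)%R)%C.
Proof.
move=> d0 Y0 hY; set s := RtoC (1 + d).
have hs : 1 < Re s by rewrite /=; lra.
have h := dser_spec (log_bounded_nchar q0 hX) hs.
have := sieve_primes_le_tail (completely_mul_twist s) h Y0 (B := / 2).
set D := dirichlet_series X s; set P := (\big[_/_]_(_ <- _) _)%C => H.
have {}H : Cmod (D * P - 1)%C <= / 2.
  apply: H => M; apply: Rle_trans hY; apply: Rle_trans (npw_tail M d0 Y0).
  apply: Rsum_le => n _; rewrite Cmod_mult Cmod_ncpow.
  have := nchar_le1 q0 hX n; have := npw_gt0 n (1 + d); rewrite [Re s]/=; nra.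
have : 1 <= Cmod (D * P)%C + / 2.
  rewrite -{1}Cmod_1; apply: Rle_trans (_ : Cmod (D * P)%C + Cmod (D * P - 1)%C <= _); last lra.
  rewrite -(Cmod_opp (_ - _)); apply: Rle_trans (Cmod_triangle _ _); right; congr Cmod; ring.
rewrite Cmod_mult /P Cmod_prod.
have -> : \prod_(i <- primes_le Y) Cmod (1 - X i * ncpow_opp i s)%C =
    \prod_(p <- primes_le Y) Cmod (1 - X p * npw p (1 + d)%R)%C.
  by apply: eq_bigr => p _; rewrite ncpow_RtoC.
lra.
Qed.

(** If L(1, chi) = 0 the partial sums of chi(n)/n are O(q/n), and summation by parts against n^(-d),
    whose differences are at most d/n, gives O(q d). *)
Lemma Lone_zero_small (d : R) : 0 < d -> Clim (Lpartial X) 0 ->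
  Cmod (dirichlet_series X (RtoC (1 + d))) <= 4 * INR q * d.
Proof.
move=> d0 hl; have q1 := INR_ge1 q0.
have hs : 1 < Re (RtoC (1 + d)) by rewrite /=; lra.
have h := dser_spec (log_bounded_nchar q0 hX) hs.
have lb n : Cmod (Lpartial X n) <= 2 * INR q * / INR n.+1.
  rewrite (_ : Lpartial X n = - (0 - Lpartial X n))%C; last by ring.
  by rewrite Cmod_opp; apply: (Lone_tail q0 hX ca Xa).
have key N : Cmod (\sum_(1 <= n < N.+1) X n * ncpow_opp n (RtoC (1 + d)))%C <=
   2 * INR q * / INR N.+1 + 4 * INR q * d.
  have -> : (\sum_(1 <= n < N.+1) X n * ncpow_opp n (RtoC (1 + d)) =
     \sum_(1 <= n < N.+1) (X n * RtoC (/ INR n)%R) * npw n d)%C.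
    apply: eq_big_seq => n; rewrite mem_index_iota => /andP[n0 _].
    by rewrite ncpow_RtoC npw_plus npw_1 // RtoC_mult; ring.
  rewrite abel_sum //; apply: Rle_trans (Cmod_triangle _ _) _; apply: Rplus_le_compat.
    rewrite Cmod_mult Cmod_R Rabs_pos_eq; last by left; apply: npw_gt0.
    rewrite -[X in _ <= X]Rmult_1_r; apply: Rmult_le_compat; first exact: Cmod_ge_0.
    - by left; apply: npw_gt0.
    - exact: lb.
    - by apply: npw_le1; lra.
  apply: Rle_trans (Cmod_sum_le _ _ _) _.
  apply: Rle_trans (_ : \sum_(1 <= n < N.+1) (2 * INR q * d) * npw n (1 + 1) <= _).
    apply: Rsum_le_nat => n /andP[n0 _]; have n1 := INR_ge1 n0.
    have w1 := npw_succ_diff_le d0 n0; have w0 : npw n.+1 d <= npw n d by apply: npw_anti => //; lra.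
    rewrite Cmod_mult Cmod_R Rabs_pos_eq; last lra.
    have w2 : npw n d - npw n.+1 d <= d * npw n 1.
      by apply: Rle_trans w1 _; apply: Rmult_le_compat_l; [lra | apply: npw_le; lra].
    have l2 : Cmod (Lpartial X n) <= 2 * INR q * npw n 1.
      apply: Rle_trans (lb n) _; rewrite npw_1 //; apply: Rmult_le_compat_l; first lra.
      by have := inv_INR_dec n0; lra.
    apply: Rle_trans (_ : (2 * INR q * npw n 1) * (d * npw n 1) <= _).
      by apply: Rmult_le_compat; [exact: Cmod_ge_0 | lra | exact: l2 | lra].
    by rewrite npw_plus; right; ring.
  rewrite -big_distrr /=; have := npw_sum_le N.+1 Rlt_0_1; rewrite Rinv_1 => h2.
  have := Rmult_le_compat_l (2 * INR q * d) _ _ ltac:(by apply: Rmult_le_pos; lra) h2.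
  lra.
apply: Rnot_lt_le => hlt; set D := Cmod _ in hlt.
have [e e0 he] : exists2 e, 0 < e & D = 4 * INR q * d + 2 * e.
  by exists ((D - 4 * INR q * d) / 2); [lra | field].
have [N1 hN1] := h e e0.
have [N2 hN2] : exists N : nat, 2 * INR q / e < INR N.
  have [n hn] := nfloor_ex (2 * INR q / e) ltac:(apply: Rlt_le; apply: Rdiv_lt_0_compat; lra).
  by exists n.+1; rewrite S_INR; lra.
set N := maxn N1 N2.
have A := hN1 N (leq_maxl _ _); have B := key N.
have N2' : INR N2 <= INR N.+1 by apply: INR_leq; rewrite /N; lia.
have B2 : 2 * INR q * / INR N.+1 < e.
  have p1 : 0 < INR N.+1 by apply: lt_0_INR; lia.
  have h3 : 2 * INR q < INR N.+1 * e by apply/Rlt_div_l => //; lra.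
  by apply/Rlt_div_l => //; lra.
set T := (\big[_/_]_(_ <= _ < _) _)%C in A B.
have : D <= Cmod T + Cmod (T - dirichlet_series X (RtoC (1 + d)))%C.
  rewrite -(Cmod_opp (T - _)); apply: Rle_trans (Cmod_triangle _ _).
  by right; rewrite /D; congr Cmod; ring.
lra.
Qed.

Lemma Lfun_real_bounded (d : R) : 0 < d ->
  Cmod (dirichlet_series X (RtoC (1 + d))) <= 2 * INR q.
Proof.
move=> d0; have hs : 1 < Re (RtoC (1 + d)) by rewrite /=; lra.
have h := dser_spec (log_bounded_nchar q0 hX) hs.
apply: Clim_le h _; exists 0%N => N _.
have -> : (\sum_(1 <= n < N.+1) X n * ncpow_opp n (RtoC (1 + d)) =
  \sum_(1 <= n < N.+1) X n * npw n (1 + d))%C.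
  by apply: eq_bigr => n _; rewrite ncpow_RtoC.
apply: Rle_trans (nchar_weight_le q0 hX ca Xa (w := fun n => npw n (1 + d)) _ _ _) _.
- move=> n hn; split; first by left; apply: npw_gt0.
  by apply: npw_anti => //; lra.
- by left; apply: npw_gt0.
- by rewrite npw_1n; lra.
Qed.

End Complex_nonvanishing.

Lemma Cmod_sq (z : C) : Cmod z ^ 2 = Re z ^ 2 + Im z ^ 2.
Proof. exact: Cmod2_alt. Qed.

Lemma sq_exp_le (u v : R) : 0 <= u -> u ^ 2 <= exp v -> u <= exp (v / 2).
Proof.
move=> u0 h; apply: Rnot_lt_le => h2.
have e : exp v = exp (v / 2) * exp (v / 2) by rewrite -exp_plus; congr exp; field.
have := exp_pos (v / 2); rewrite /= in h; nra.
Qed.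

(** Local form of the 3-4-1 inequality. By 1 + u <= exp u the linear terms of the exponents add up
    to -2y (1 + Re z)^2 <= 0 and the quadratic ones to 4y^2. *)
Lemma three_four_one (z : C) (y : R) : Cmod z = 1 -> 0 <= y <= 1 ->
  (1 - y) ^ 3 * Cmod (1 - z * y)%C ^ 4 * Cmod (1 - z * z * y)%C <= exp (4 * y ^ 2).
Proof.
case: z => c t hz hy.
have h1 : c ^ 2 + t ^ 2 = 1 by have := Cmod_sq (c, t); rewrite hz /=; lra.
have A1 : 1 - y <= exp (- y) by have := exp_ineq1_le (- y); lra.
have A1' : (1 - y) ^ 3 <= exp ((- 6 * y + 3 * y ^ 2) / 2).
  apply: Rle_trans (_ : exp (- y) ^ 3 <= _); first by apply: pow_incr; lra.
  rewrite -(exp_ln (exp (- y) ^ 3)); last by apply: pow_lt; apply: exp_pos.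
  by rewrite ln_pow ?ln_exp; [apply: exp_le_compat; rewrite [INR 3]/=; nra | apply: exp_pos].
have A2 : Cmod (1 - (c, t) * y)%C <= exp ((- 2 * c * y + y ^ 2) / 2).
  apply: sq_exp_le; first exact: Cmod_ge_0.
  rewrite Cmod_sq /=; apply: Rle_trans (exp_ineq1_le _); nra.
have A3 : Cmod (1 - (c, t) * (c, t) * y)%C <= exp ((- 4 * c ^ 2 * y + 2 * y + y ^ 2) / 2).
  apply: sq_exp_le; first exact: Cmod_ge_0.
  rewrite Cmod_sq /=; apply: Rle_trans (exp_ineq1_le _); right.
  transitivity (1 - 2 * (c ^ 2 - t ^ 2) * y + (c ^ 2 + t ^ 2) ^ 2 * y ^ 2); first by ring.
  by rewrite h1 (_ : t ^ 2 = 1 - c ^ 2); [ring | lra].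
have A2' : Cmod (1 - (c, t) * y)%C ^ 4 <= exp ((- 8 * c * y + 4 * y ^ 2) / 2).
  apply: Rle_trans (pow_incr _ _ 4 (conj (Cmod_ge_0 _) A2)) _.
  rewrite -(exp_ln (exp _ ^ 4)); last by apply: pow_lt; apply: exp_pos.
  by rewrite ln_pow ?ln_exp; [apply: exp_le_compat; rewrite [INR 4]/=; lra | apply: exp_pos].
apply: Rle_trans (_ : exp ((- 6 * y + 3 * y ^ 2) / 2) * exp ((- 8 * c * y + 4 * y ^ 2) / 2)
   * exp ((- 4 * c ^ 2 * y + 2 * y + y ^ 2) / 2) <= _).
  have c1 := Cmod_ge_0 (1 - (c, t) * y)%C; have c2 := Cmod_ge_0 (1 - (c, t) * (c, t) * y)%C.
  have p1 : 0 <= (1 - y) ^ 3 by apply: pow_le; lra.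
  have p2 := pow_le _ 4 c1.
  apply: Rmult_le_compat => //; first by apply: Rmult_le_pos.
  exact: Rmult_le_compat.
rewrite -!exp_plus; apply: exp_le_compat.
have : 0 <= y * (1 + c) ^ 2 by apply: Rmult_le_pos; [lra | apply: pow2_ge_0].
nra.
Qed.

(** At 1 + d the product zeta^3 L(chi)^4 L(chi^2) would be O(d^(-3) d^4), since L(chi^2) is bounded
    when chi^2 is nonprincipal. But the local factors, whose product is at most e^8, keep it above
    2^(-8) e^(-8). *)
Lemma Lone_neq0_complex (q : nat) (X : nat -> C) (a : nat) (l : C) :
  (0 < q)%N -> nat_character q X -> coprime a q -> (X a * X a)%C <> 1 ->
  Clim (Lpartial X) l -> l <> 0.
Proof.
move=> q0 hX ca Xaa hl l0; rewrite l0 in hl.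
have Xa : X a <> 1 by move=> e; apply: Xaa; rewrite e; ring.
pose X2 n := (X n * X n)%C; pose X0 (n : nat) := RtoC 1.
have hX2 : nat_character q X2.
  split=> [n|m n|n]; rewrite /X2.
  - by rewrite (nchar_per hX).
  - by rewrite (nchar_mul hX); ring.
  rewrite -(nchar_supp hX); split=> h1 h2; apply: h1; first by rewrite h2; ring.
  apply: Cmod_eq_0; have := f_equal Cmod h2; rewrite Cmod_mult Cmod_0.
  by have := Cmod_ge_0 (X n); nra.
have hX0 : nat_character 1 X0 by split=> //= [m n|n]; [rewrite /X0; ring | rewrite coprimen1; split=> // _ /RtoC_inj; lra].
have q1 := INR_ge1 q0.
have main d : 0 < d <= 1 -> / (2 ^ 8 * exp 8) <= 4096 * INR q ^ 5 * d.
  move=> [d0 d1].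
  have [Y [Y0 hY]] : exists Y, (0 < Y)%N /\ npw Y d / d <= / 2.
    have /is_lim_seq_spec /(_ (mkposreal (d / 2) ltac:(lra))) [M hM] := npw_lim d0.
    exists M.+1; split => //; have /= := hM M.+1 ltac:(lia).
    rewrite Rminus_0_r => h; apply/Rle_div_l => //.
    by have := Rle_abs (npw M.+1 d); lra.
  have G0 := nchar_euler_prod_ge (ltn0Sn 0) hX0 d0 Y0 hY.
  have G1 := nchar_euler_prod_ge q0 hX d0 Y0 hY.
  have G2 := nchar_euler_prod_ge q0 hX2 d0 Y0 hY.
  have B0 := zeta_real_le d0.
  have B1 := Lone_zero_small q0 hX ca Xa d0 hl.
  have B2 := Lfun_real_bounded q0 hX2 ca Xaa d0.
  rewrite -/(zeta _) in G0.
  set z0 := Cmod (zeta _) in G0 B0; set z1 := Cmod _ in G1 B1; set z2 := Cmod _ in G2 B2.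
  set P0 := \prod_(p <- _) _ in G0; set P1 := \prod_(p <- _) _ in G1; set P2 := \prod_(p <- _) _ in G2.
  have P00 : 0 <= P0 by rewrite /P0; elim/big_ind: _ => [|x y|p _]; [lra | exact: Rmult_le_pos | exact: Cmod_ge_0].
  have P10 : 0 <= P1 by rewrite /P1; elim/big_ind: _ => [|x y|p _]; [lra | exact: Rmult_le_pos | exact: Cmod_ge_0].
  have P20 : 0 <= P2 by rewrite /P2; elim/big_ind: _ => [|x y|p _]; [lra | exact: Rmult_le_pos | exact: Cmod_ge_0].
  have z00 : 0 <= z0 by apply: Cmod_ge_0.
  have z10 : 0 <= z1 by apply: Cmod_ge_0.
  have z20 : 0 <= z2 by apply: Cmod_ge_0.
  have HP : P0 ^ 3 * P1 ^ 4 * P2 <= exp 8.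
    have -> : P0 ^ 3 * P1 ^ 4 * P2 = \prod_(p <- primes_le Y)
        (Cmod (1 - X0 p * npw p (1 + d)%R)%C ^ 3 * Cmod (1 - X p * npw p (1 + d)%R)%C ^ 4 *
         Cmod (1 - X2 p * npw p (1 + d)%R)%C).
      by rewrite /P0 /P1 -!Rprod_pow /P2 -!big_split.
    apply: Rle_trans (_ : \prod_(p <- primes_le Y) exp (4 * npw p (1 + d) ^ 2) <= _).
      apply: Rprod_le => p hp _; have p0 := npw_gt0 p (1 + d).
      have p1 := npw_prime_lt1 (x := 1 + d) ltac:(lra) hp.
      split.
        by apply: Rmult_le_pos; [apply: Rmult_le_pos; apply: (pow_le _ _ (Cmod_ge_0 _)) | exact: Cmod_ge_0].
      rewrite Cmult_1_l -RtoC_minus Cmod_R Rabs_pos_eq; last lra.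
      case hc: (coprime p q).
        by apply: three_four_one; [apply: (nchar_Cmod q0 hX hc) | lra].
      rewrite /X2 (nchar_not_coprime hX) ?hc // !Cmult_0_l.
      rewrite (_ : (1 - 0 = 1)%C) ?Cmod_1; last by ring.
      rewrite pow1 !Rmult_1_r; apply: Rle_trans (_ : 1 <= _).
        by rewrite -[X in _ <= X](pow1 3); apply: pow_incr; lra.
      rewrite -[X in X <= _]exp_0; apply: exp_le_compat; have := pow2_ge_0 (npw p (1 + d)); lra.
    rewrite Rprod_exp; apply: exp_le_compat.
    have -> : \sum_(p <- primes_le Y) 4 * npw p (1 + d) ^ 2 =
      4 * \sum_(p <- primes_le Y) npw p (1 + d) ^ 2 by rewrite big_distrr.
    suff : \sum_(p <- primes_le Y) npw p (1 + d) ^ 2 <= 2 by move=> h; lra.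
    apply: Rle_trans (_ : \sum_(1 <= n < Y.+1) npw n (1 + 1) <= _).
      rewrite primes_le_sum big_mkcond big_ltn //= Rplus_0_l.
      apply: Rsum_le => p _; case: ifP => _; last by left; apply: npw_gt0.
      rewrite Rmult_1_r -npw_plus; apply: npw_le; lra.
    by have := npw_sum_le Y.+1 Rlt_0_1; rewrite Rinv_1; lra.
  have HB : z0 ^ 3 * z1 ^ 4 * z2 <= 4096 * INR q ^ 5 * d.
    have b0 : z0 <= 2 / d.
      apply: Rle_trans B0 _; rewrite -[X in X + _](Rinv_l d) /Rdiv; last lra.
      have := Rinv_0_lt_compat d d0; nra.
    apply: Rle_trans (_ : (2 / d) ^ 3 * (4 * INR q * d) ^ 4 * (2 * INR q) <= _); last by right; field; lra.
    apply: Rmult_le_compat => //; first by apply: Rmult_le_pos; apply: pow_le.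
    by apply: Rmult_le_compat; try apply: pow_le => //; apply: pow_incr.
  have H : (/ 2) ^ 8 <= (z0 ^ 3 * z1 ^ 4 * z2) * (P0 ^ 3 * P1 ^ 4 * P2).
    have -> : z0 ^ 3 * z1 ^ 4 * z2 * (P0 ^ 3 * P1 ^ 4 * P2) = (z0 * P0) ^ 3 * (z1 * P1) ^ 4 * (z2 * P2) by ring.
    have -> : (/ 2) ^ 8 = (/ 2) ^ 3 * (/ 2) ^ 4 * / 2 by field.
    have h1 : 0 <= / 2 by lra.
    apply: Rmult_le_compat => //; first by apply: Rmult_le_pos; apply: pow_le.
    by apply: Rmult_le_compat; try apply: pow_le => //; apply: pow_incr.
  have zz : 0 <= z0 ^ 3 * z1 ^ 4 * z2.
    by apply: Rmult_le_pos => //; apply: Rmult_le_pos; apply: pow_le.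
  have e8 := exp_pos 8.
  have H2 : (/ 2) ^ 8 <= (4096 * INR q ^ 5 * d) * exp 8.
    apply: Rle_trans H _; apply: Rle_trans (Rmult_le_compat_l _ _ _ zz HP) _.
    by apply: Rmult_le_compat_r HB; lra.
  rewrite Rinv_mult -pow_inv; apply/Rle_div_l; lra.
set K := 4096 * INR q ^ 5; have K0 : 0 < K by apply: Rmult_lt_0_compat; [lra | apply: pow_lt; lra].
set c := / (2 ^ 8 * exp 8) in main.
have c0 : 0 < c by apply: Rinv_0_lt_compat; apply: Rmult_lt_0_compat; [lra | apply: exp_pos].
have d0 : 0 < Rmin 1 (c / (2 * K)) by apply: Rmin_glb_lt; [lra | apply: Rdiv_lt_0_compat; lra].
have := main _ (conj d0 (Rmin_l _ _)); rewrite -/K.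
have : K * Rmin 1 (c / (2 * K)) <= K * (c / (2 * K)) by apply: Rmult_le_compat_l; [lra | exact: Rmin_r].
rewrite (_ : K * (c / (2 * K)) = c / 2); last by field; lra.
lra.
Qed.

(** * Real characters and Lambert series *)

Lemma sum_add_divisors (f : nat -> C) (p e : nat) (s : seq nat) :
  (forall d, f (p * d)%N = f p * f d)%C ->
  (\sum_(d <- PrimeDecompAux.add_divisors (p, e) s) f d =
   (\sum_(0 <= j < e.+1) f p ^ j) * \sum_(d <- s) f d)%C.
Proof.
move=> hf; rewrite /PrimeDecompAux.add_divisors; elim: e => [|e IH] /=.
  by rewrite big_nat1 /=; ring.
rewrite (perm_big _ (introT permPl (perm_merge _ _ _))) big_cat big_map /=.
rewrite big_nat_recl //= Cmult_plus_distr_r Cplus_comm; congr (_ + _)%C; first by ring.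
transitivity (f p * \sum_(d <- PrimeDecompAux.add_divisors (p, e) s) f d)%C.
  by rewrite big_distrr; apply: eq_bigr => d _; rewrite NatTrec.mulE hf.
by rewrite IH Cmult_assoc; congr (_ * _)%C; rewrite big_distrr; apply: eq_bigr.
Qed.

Lemma sum_divisors_mul (f : nat -> C) (n : nat) : f 1%N = 1 ->
  (forall m k, f (m * k)%N = f m * f k)%C ->
  (\sum_(d <- divisors n) f d =
   \prod_(p <- primes n) \sum_(0 <= j < (logn p n).+1) f p ^ j)%C.
Proof.
move=> f1 hf; rewrite /divisors.
have -> : (\prod_(p <- primes n) \sum_(0 <= j < (logn p n).+1) f p ^ j =
  \prod_(pe <- prime_decomp n) \sum_(0 <= j < pe.2.+1) f pe.1 ^ j)%C.
  by rewrite prime_decompE big_map.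
elim: (prime_decomp n) => [|[p e] s IH] /=.
  by rewrite big_seq1 big_nil.
by rewrite sum_add_divisors // IH big_cons.
Qed.

Lemma sum_dvd_divisors (f : nat -> C) (n N : nat) : (0 < n)%N -> (n <= N)%N ->
  (\sum_(1 <= d < N.+1 | (d %| n)%N) f d = \sum_(d <- divisors n) f d)%C.
Proof.
move=> n0 hN; rewrite -big_filter; apply: perm_big; apply: uniq_perm.
- by rewrite filter_uniq ?iota_uniq.
- exact: divisors_uniq.
move=> d; rewrite mem_filter mem_index_iota -dvdn_divisors //.
case hd: (d %| n) => //=; have := dvdn_leq n0 hd; have := dvdn_gt0 n0 hd; lia.
Qed.

Lemma lambert_term_ge0 (y : R) (n : nat) : 0 < y < 1 -> (0 < n)%N ->
  INR n * (1 - y) * y ^ n <= 1 - y ^ n.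
Proof.
move=> hy; case: n => // n _; elim: n => [|n IH]; first by rewrite /=; nra.
rewrite (S_INR n.+1) -[y ^ n.+2]/(y * y ^ n.+1).
have p0 : 0 < y ^ n.+1 by apply: pow_lt; lra.
have : y ^ n.+1 <= 1 by rewrite -(pow1 n.+1); apply: pow_incr; lra.
move: IH p0; set P := y ^ n.+1; set I := INR n.+1 => IH p0 P1.
have h1 := Rmult_le_compat_l y _ _ ltac:(lra) IH.
have h2 : (1 - y) * (y * P) <= (1 - y) * 1 by apply: Rmult_le_compat_l; [lra | nra].
lra.
Qed.

(** Arithmetic-geometric mean, pairing the first and last terms: 1 + z^(2n+2) >= 2 z^(n+1). The base
    is a square so that the middle power z^(n-1) is an integral one. *)
Lemma geom_sum_ge (z : R) (n : nat) : 0 < z < 1 ->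
  INR n * z ^ n.-1 <= \sum_(0 <= i < n) (z * z) ^ i.
Proof.
move=> hz; elim/ltn_ind: n => -[_|[_|n IH]].
- by rewrite big_geq //=; lra.
- by rewrite big_nat1 /=; lra.
have := IH n ltac:(lia).
rewrite big_nat_recl //= big_nat_recr //= => h.
have e : \sum_(0 <= i < n) (z * z) * (z * z) ^ i = (z * z) * \sum_(0 <= i < n) (z * z) ^ i.
  by rewrite big_distrr.
rewrite e.
have zp : 0 < z ^ n by apply: pow_lt; lra.
have e2 : (z * z) ^ n = z ^ n * z ^ n by rewrite Rpow_mult_distr.
rewrite e2.
have h2 : INR n * (z * z ^ n) <= z * z * \sum_(0 <= i < n) (z * z) ^ i.
  case: n h {IH e zp e2} => [|n] h; first by rewrite /= big_geq //; lra.
  have := Rmult_le_compat_l (z * z) _ _ ltac:(nra) h; rewrite [n.+1.-1]/= /=; lra.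
have : 2 * (z * z ^ n) <= 1 + z * z * (z ^ n * z ^ n).
  have := pow2_ge_0 (1 - z * z ^ n); rewrite /=; lra.
rewrite -/(INR n.+1) -/(INR n.+2) !S_INR; lra.
Qed.

(* Monsky's proof for real characters: if [L(1, X) = 0], the Lambert series
   [\sum_n X n y^n / (1 - y^n)] equals [- \sum_n X n * lambert_gap y n], which stays bounded as
   [y] tends to 1 because the gaps decrease; but its coefficients are nonnegative, and
   at least 1 at squares. *)
Definition lambert_gap (y : R) (n : nat) : R := / (INR n * (1 - y)) - y ^ n / (1 - y ^ n).

(** With S_n the sum of y^i over i < n, the decrease amounts to n (n+1) y^n <= S_n S_(n+1). This
    follows from [geom_sum_ge] for z = sqrt y, with a factor z to spare. *)
Lemma lambert_gap_dec (y : R) (n : nat) : 0 < y < 1 -> (0 < n)%N ->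
  0 <= lambert_gap y n.+1 <= lambert_gap y n.
Proof.
move=> hy n0.
have yn m : (0 < m)%N -> 0 < 1 - y ^ m.
  by move=> m0; have := pow_lt_1_compat y m ltac:(lra) ltac:(lia); lra.
have n1 := INR_ge1 n0; have n2 : 0 < INR n.+1 by rewrite S_INR; lra.
have y1 := yn n n0; have y2 := yn n.+1 isT.
split.
  rewrite /lambert_gap; have := lambert_term_ge0 hy (ltn0Sn n) => h.
  suff : y ^ n.+1 / (1 - y ^ n.+1) <= / (INR n.+1 * (1 - y)) by lra.
  apply: (Rmult_le_reg_r ((1 - y ^ n.+1) * (INR n.+1 * (1 - y)))).
    by apply: Rmult_lt_0_compat => //; apply: Rmult_lt_0_compat; lra.
  rewrite (_ : _ / _ * _ = INR n.+1 * (1 - y) * y ^ n.+1); last by field; lra.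
  by rewrite (_ : / _ * _ = 1 - y ^ n.+1); [|field; lra].
have hz : 0 < sqrt y < 1.
  split; first by apply: sqrt_lt_R0; lra.
  by rewrite -[X in _ < X]sqrt_1; apply: sqrt_lt_1; lra.
have zz : sqrt y * sqrt y = y by apply: sqrt_sqrt; lra.
have g1 := geom_sum_ge n hz; have g2 := geom_sum_ge n.+1 hz.
rewrite zz in g1 g2; set z := sqrt y in hz zz g1 g2.
have gs m : (1 - y) * \sum_(0 <= i < m) y ^ i = 1 - y ^ m.
  elim: m => [|m IH]; first by rewrite big_geq //=; lra.
  by rewrite big_nat_recr //= Rmult_plus_distr_l IH; ring.
have e1 := gs n; have e2 := gs n.+1.
set S1 := \sum_(0 <= i < n) _ in g1 e1; set S2 := \sum_(0 <= i < n.+1) _ in g2 e2.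
have P1 : 0 < S1 by nra.
have P2 : 0 < S2 by nra.
have zn : 0 < z ^ n.-1 by apply: pow_lt; lra.
have key : INR n * INR n.+1 * y ^ n <= S1 * S2.
  have ey : y ^ n = z * (z ^ n.-1 * z ^ n).
    by rewrite -zz Rpow_mult_distr; case: (n) n0 => // m _; rewrite /=; ring.
  have h : (INR n * z ^ n.-1) * (INR n.+1 * z ^ n) <= S1 * S2.
    apply: Rmult_le_compat => //; first by apply: Rmult_le_pos; lra.
    by apply: Rmult_le_pos; [lra | apply: pow_le; lra].
  apply: Rle_trans h; rewrite ey.
  have : 0 <= INR n * INR n.+1 * (z ^ n.-1 * z ^ n).
    by apply: Rmult_le_pos; apply: Rmult_le_pos; try lra; apply: pow_le; lra.
  nra.
have S2E : S2 = y * S1 + 1.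
  have : (1 - y) * S2 = (1 - y) * (y * S1 + 1).
    by rewrite e2 (_ : (1 - y) * (y * S1 + 1) = y * ((1 - y) * S1) + (1 - y)); [rewrite e1 /=; ring | ring].
  by move/Rmult_eq_reg_l; apply; lra.
rewrite /lambert_gap -e1 -e2.
suff : / (INR n.+1) - y ^ n.+1 / S2 <= / INR n - y ^ n / S1.
  move=> h; have i0 : 0 < / (1 - y) by apply: Rinv_0_lt_compat; lra.
  have := Rmult_le_compat_r _ _ _ (Rlt_le _ _ i0) h.
  rewrite (_ : (/ INR n.+1 - y ^ n.+1 / S2) * / (1 - y) = / (INR n.+1 * (1 - y)) - y ^ n.+1 / ((1 - y) * S2)); last by field; lra.
  by rewrite (_ : (/ INR n - y ^ n / S1) * / (1 - y) = / (INR n * (1 - y)) - y ^ n / ((1 - y) * S1)); last by field; lra.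
have e3 : y ^ n / S1 - y ^ n.+1 / S2 = y ^ n / (S1 * S2).
  rewrite -[y ^ n.+1]/(y * y ^ n).
  transitivity (y ^ n * (S2 - y * S1) / (S1 * S2)); first by field; lra.
  by rewrite {1}S2E; field; lra.
have e4 : / INR n - / INR n.+1 = / (INR n * INR n.+1) by rewrite S_INR; field; lra.
suff : y ^ n / (S1 * S2) <= / (INR n * INR n.+1) by lra.
apply/Rle_div_l; first exact: Rmult_lt_0_compat.
have p : 0 < INR n * INR n.+1 by apply: Rmult_lt_0_compat; lra.
apply: (Rmult_le_reg_l (INR n * INR n.+1)) => //.
rewrite -Rmult_assoc Rinv_r; lra.
Qed.

Section Real_nonvanishing.
Variables (q : nat) (X : nat -> C) (a : nat).
Hypotheses (q0 : (0 < q)%N) (hX : nat_character q X).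
Hypotheses (ca : coprime a q) (Xa : X a <> 1).
Hypothesis Xreal : forall b, coprime b q -> (X b * X b)%C = 1.

Lemma nchar_real_val n : X n = RtoC 0 \/ X n = RtoC 1 \/ X n = RtoC (-1).
Proof.
case h: (coprime n q); last by left; apply: (nchar_not_coprime hX); rewrite h.
right; have e := Xreal h; case: (Ceq_dec (X n) 1) => [->|h1]; first by left.
right; have d0 : (X n - 1)%C <> 0.
  by move=> h2; apply: h1; rewrite (_ : X n = X n - 1 + 1)%C; [rewrite h2; ring | ring].
transitivity ((X n * X n - 1) / (X n - 1) - 1)%C; first by field.
by rewrite e (_ : RtoC (-1) = - (1))%C; [field | rewrite -RtoC_opp].
Qed.

Lemma nchar_RtoC n : X n = RtoC (Re (X n)).
Proof. by case: (nchar_real_val n) => [->|[->|->]]. Qed.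

(** The convolution 1 * chi, that is, the coefficients of the Lambert series; [Re] loses nothing
    because chi is real. *)
Definition rdiv (n : nat) : R := \sum_(d <- divisors n) Re (X d).

Lemma rdivE n : rdiv n = \prod_(p <- primes n) \sum_(0 <= j < (logn p n).+1) Re (X p) ^ j.
Proof.
apply: RtoC_inj; rewrite /rdiv RtoC_sum RtoC_prod.
transitivity (\sum_(d <- divisors n) X d)%C.
  by apply: eq_bigr => d _; rewrite -nchar_RtoC.
rewrite (sum_divisors_mul _ (nchar_1 hX) (nchar_mul hX)); apply: eq_bigr => p _.
by rewrite RtoC_sum; apply: eq_bigr => j _; rewrite RtoC_pow -nchar_RtoC.
Qed.

Lemma alt_sum_val (m : nat) : \sum_(0 <= j < m) (-1) ^ j = if odd m then 1 else 0.
Proof.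
elim: m => [|m IH]; first by rewrite big_geq.
have e : (-1) ^ m = if odd m then -1 else 1.
  elim: m {IH} => [|m IH] //=; rewrite IH; case: (odd m) => /=; lra.
by rewrite big_nat_recr //= IH e; case: (odd m) => /=; lra.
Qed.

Lemma pow_sum_ge0 p m : 0 <= \sum_(0 <= j < m) Re (X p) ^ j.
Proof.
case: (nchar_real_val p) => [->|[->|->]] /=.
- by apply: Rsum_ge0 => j _; apply: pow_le; lra.
- by apply: Rsum_ge0 => j _; apply: pow_le; lra.
- by rewrite alt_sum_val; case: ifP => _; lra.
Qed.

Lemma pow_sum_ge1 p m : 1 <= \sum_(0 <= j < m.*2.+1) Re (X p) ^ j.
Proof.
case: (nchar_real_val p) => [->|[->|->]].
- rewrite big_nat_recl // [Re _]/=.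
  have : 0 <= \sum_(0 <= i < m.*2) 0 ^ i.+1 by apply: Rsum_ge0 => j _; apply: pow_le; lra.
  by rewrite /=; lra.
- rewrite big_nat_recl // [Re _]/=.
  have : 0 <= \sum_(0 <= i < m.*2) 1 ^ i.+1 by apply: Rsum_ge0 => j _; apply: pow_le; lra.
  by rewrite /=; lra.
- by rewrite alt_sum_val /= odd_double /=; lra.
Qed.

Lemma rdiv_ge0 n : 0 <= rdiv n.
Proof.
rewrite rdivE; elim/big_ind: _ => [|x y|p _]; [lra | exact: Rmult_le_pos | exact: pow_sum_ge0].
Qed.

Lemma rdiv_square_ge1 n : 1 <= rdiv (n ^ 2).
Proof.
rewrite rdivE; elim/big_ind: _ => [|x y|p _]; [lra | nra |].
by rewrite lognX mul2n; apply: pow_sum_ge1.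
Qed.

(** Each y^n/(1 - y^n) is expanded up to the exponent M. The main part is the sum of [rdiv m] y^m,
    at least the sum over squares; each of the M remainders is at most y^M/(1 - y). *)
Lemma lambert_lower (y : R) (J M : nat) : 0 < y < 1 -> (J ^ 2 <= M)%N ->
  \sum_(1 <= j < J.+1) y ^ (j ^ 2)%N - INR M * (y ^ M / (1 - y)) <=
  \sum_(1 <= n < M.+1) Re (X n) * (y ^ n / (1 - y ^ n)).
Proof.
move=> hy hJ.
have yn m : (0 < m)%N -> 0 < 1 - y ^ m.
  by move=> m0; have := pow_lt_1_compat y m ltac:(lra) ltac:(lia); lra.
have geo n K : (0 < n)%N -> y ^ n / (1 - y ^ n) =
    \sum_(1 <= k < K.+1) y ^ (n * k)%N + y ^ (n * K.+1)%N / (1 - y ^ n).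
  move=> n0; have h := yn n n0; elim: K => [|K IH].
    by rewrite big_geq // muln1; ring.
  rewrite big_nat_recr //= IH [(n * K.+2)%N]mulnS Rpow_addn; field; lra.
have -> : \sum_(1 <= n < M.+1) Re (X n) * (y ^ n / (1 - y ^ n)) =
   \sum_(1 <= n < M.+1) Re (X n) * (\sum_(1 <= k < (M %/ n).+1) y ^ (n * k)%N) +
   \sum_(1 <= n < M.+1) Re (X n) * (y ^ (n * (M %/ n).+1)%N / (1 - y ^ n)).
  rewrite -big_split; apply: eq_big_seq => n; rewrite mem_index_iota => /andP[n0 _] /=.
  by rewrite (geo n (M %/ n)%N n0); ring.
have A : \sum_(1 <= j < J.+1) y ^ (j ^ 2)%N <=
   \sum_(1 <= n < M.+1) Re (X n) * (\sum_(1 <= k < (M %/ n).+1) y ^ (n * k)%N).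
  have -> : \sum_(1 <= n < M.+1) Re (X n) * (\sum_(1 <= k < (M %/ n).+1) y ^ (n * k)%N) =
     \sum_(1 <= m < M.+1) rdiv m * y ^ m.
    apply: RtoC_inj; rewrite !RtoC_sum.
    transitivity (\sum_(1 <= n < M.+1) \sum_(1 <= m < M.+1 | (n %| m)%N) X n * RtoC (y ^ m)%R)%C.
      apply: eq_big_seq => n; rewrite mem_index_iota => /andP[n0 _].
      rewrite -big_distrr /= sum_multiples // RtoC_mult -nchar_RtoC; congr (_ * _)%C.
      by rewrite RtoC_sum.
    under eq_bigr do rewrite big_mkcond.
    rewrite exchange_big /=; apply: eq_big_seq => m; rewrite mem_index_iota => /andP[m0 hm].
    rewrite -big_mkcond /= -big_distrl /= RtoC_mult; congr (_ * _)%C.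
    rewrite sum_dvd_divisors // /rdiv RtoC_sum; apply: eq_bigr => d _.
    by rewrite -nchar_RtoC.
  rewrite [X in _ <= X](bigID (fun m => m \in [seq (j ^ 2)%N | j <- index_iota 1 J.+1])) /=.
  apply: Rle_trans (_ : \sum_(1 <= m < M.+1 | m \in [seq (j ^ 2)%N | j <- index_iota 1 J.+1]) rdiv m * y ^ m <= _); last first.
    rewrite -[X in X <= _]Rplus_0_r; apply: Rplus_le_compat_l.
    by apply: Rsum_ge0 => m _; apply: Rmult_le_pos; [apply: rdiv_ge0 | apply: pow_le; lra].
  rewrite -[X in _ <= X]big_filter.
  rewrite [X in _ <= X](perm_big [seq (j ^ 2)%N | j <- index_iota 1 J.+1]) /=; last first.
    apply: uniq_perm; first by rewrite filter_uniq ?iota_uniq.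
      rewrite map_inj_uniq ?iota_uniq // => i j /eqP; rewrite eqn_exp2r // => /eqP //.
    move=> m; rewrite mem_filter; case hm: (m \in map _ _) => //=.
    move/mapP: hm => [j]; rewrite mem_index_iota => /andP[j1 j2] ->.
    rewrite mem_index_iota; apply/andP; split; first by rewrite expn_gt0 j1.
    by rewrite ltnS; apply: leq_trans _ hJ; rewrite leq_exp2r.
  rewrite big_map; apply: Rsum_le => j _.
  have := rdiv_square_ge1 j; have := pow_le y (j ^ 2)%N ltac:(lra); nra.
suff B : - (INR M * (y ^ M / (1 - y))) <= \sum_(1 <= n < M.+1) Re (X n) * (y ^ (n * (M %/ n).+1)%N / (1 - y ^ n)).
  lra.
have -> : - (INR M * (y ^ M / (1 - y))) = \sum_(1 <= n < M.+1) - (y ^ M / (1 - y)).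
  by rewrite Rsum_const_nat subn1 /=; ring.
apply: Rsum_le_nat => n /andP[n0 nM]; have h := yn n n0.
have x1 : -1 <= Re (X n) by case: (nchar_real_val n) => [->|[->|->]] /=; lra.
have t0 : 0 <= y ^ (n * (M %/ n).+1)%N / (1 - y ^ n).
  by apply: Rlt_le; apply: Rdiv_lt_0_compat => //; apply: pow_lt; lra.
suff : y ^ (n * (M %/ n).+1)%N / (1 - y ^ n) <= y ^ M / (1 - y) by nra.
apply: Rmult_le_compat.
- by apply: pow_le; lra.
- by left; apply: Rinv_0_lt_compat.
- have hle : (M <= n * (M %/ n).+1)%N by rewrite mulnC ltnW // ltn_ceil.
  rewrite -(subnKC hle) Rpow_addn -[X in _ <= X]Rmult_1_r.
  apply: Rmult_le_compat_l; first by apply: pow_le; lra.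
  by rewrite -(pow1 (n * (M %/ n).+1 - M)); apply: pow_incr; lra.
- apply: Rinv_le_contravar; first lra.
  suff : y ^ n <= y by lra.
  case: n n0 {nM h x1 t0} => // n _ /=; have : y ^ n <= 1 by rewrite -(pow1 n); apply: pow_incr; lra.
  have := pow_le y n ltac:(lra); nra.
Qed.

(** Splits off the partial sum of L(1, chi), which is O(q/M) by assumption. The rest is summed by
    parts against the decreasing gaps, the first of which equals 1. *)
Lemma lambert_upper (y : R) (M : nat) : 0 < y < 1 -> (0 < M)%N -> Clim (Lpartial X) 0 ->
  \sum_(1 <= n < M.+1) Re (X n) * (y ^ n / (1 - y ^ n)) <=
  2 * INR q + 2 * INR q / INR M / (1 - y).
Proof.
move=> hy M0 hl; have q1 := INR_ge1 q0; have M1 := INR_ge1 M0.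
have e : \sum_(1 <= n < M.+1) Re (X n) * (y ^ n / (1 - y ^ n)) =
   / (1 - y) * Re (Lpartial X M) - Re (\sum_(1 <= n < M.+1) X n * lambert_gap y n)%C.
  rewrite /Lpartial !Re_sum big_distrr -Rsum_minus; apply: eq_big_seq => n.
  rewrite mem_index_iota => /andP[n0 _] /=; have n1 := INR_ge1 n0.
  have h : 0 < 1 - y ^ n by have := pow_lt_1_compat y n ltac:(lra) ltac:(lia); lra.
  by rewrite /lambert_gap; case: (X n) => u v /=; field; lra.
rewrite e.
have A : Cmod (\sum_(1 <= n < M.+1) X n * lambert_gap y n)%C <= 2 * INR q * lambert_gap y 1.
  apply: (nchar_weight_le q0 hX ca Xa) => [n hn|]; first exact: lambert_gap_dec.
  by have := lambert_gap_dec hy (isT : (0 < 1)%N); lra.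
have g1 : lambert_gap y 1 = 1 by rewrite /lambert_gap /=; field; lra.
rewrite g1 in A.
have B : Cmod (Lpartial X M) <= 2 * INR q / INR M.
  rewrite (_ : Lpartial X M = - (0 - Lpartial X M))%C; last by ring.
  rewrite Cmod_opp; apply: Rle_trans (Lone_tail q0 hX ca Xa M hl) _.
  by apply: Rmult_le_compat_l; [lra | have := inv_INR_dec M0; lra].
have rA := re_le_Cmod (\sum_(1 <= n < M.+1) X n * lambert_gap y n)%C.
have rB := re_le_Cmod (Lpartial X M).
have A' := Rabs_le_between (Re (\sum_(1 <= n < M.+1) X n * lambert_gap y n)%C) (2 * INR q).
have {}A' := proj1 A' ltac:(lra).
have B' := Rle_abs (Re (Lpartial X M)).
have i0 : 0 < / (1 - y) by apply: Rinv_0_lt_compat; lra.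
have : / (1 - y) * Re (Lpartial X M) <= 2 * INR q / INR M / (1 - y).
  by rewrite [X in _ <= X]Rmult_comm; apply: Rmult_le_compat_l; lra.
lra.
Qed.

Lemma Lone_neq0_real (l : C) : Clim (Lpartial X) l -> l <> 0.
Proof.
move=> hl l0; rewrite l0 in hl; have q1 := INR_ge1 q0.
(* With b = 1/(2 J^2) every y^(j^2), j <= J, is at least 1/2, so the squares contribute J/2 = 2q +
   7/2. The two truncation errors below are at most 1 each, and the upper bound is 2q plus one of
   them. *)
pose J := (4 * q + 7)%N.
have J1 : INR J = 4 * INR q + 7 by rewrite /J INR_addn INR_muln /=; ring.
pose b := / (2 * INR J ^ 2); have b0 : 0 < b by apply: Rinv_0_lt_compat; nra.
pose y := exp (- b).
have hy : 0 < y < 1.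
  by split; [apply: exp_pos | rewrite /y -exp_0; apply: exp_increasing; lra].
have ye n : y ^ n = exp (- b * INR n).
  rewrite -(exp_ln (y ^ n)); last by apply: pow_lt; lra.
  by rewrite ln_pow ?ln_exp; [congr exp; ring | lra].
have S1 : INR J / 2 <= \sum_(1 <= j < J.+1) y ^ (j ^ 2)%N.
  have -> : INR J / 2 = \sum_(1 <= j < J.+1) / 2 by rewrite Rsum_const_nat subn1.
  apply: Rsum_le_nat => j /andP[j0 jJ]; rewrite ye INR_expn.
  have h : INR j ^ 2 <= INR J ^ 2 by apply: pow_incr; split; [exact: INR_pos | exact: INR_leq].
  have := exp_ineq1_le (- b * INR j ^ 2).
  have : b * INR j ^ 2 <= b * INR J ^ 2 by apply: Rmult_le_compat_l; lra.
  have -> : b * INR J ^ 2 = / 2 by rewrite /b; field; nra.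
  lra.
have lim : is_lim_seq (fun M => (2 / b) * exp (- (b / 2)) ^ M) 0.
  have -> : Rbar.Finite 0 = Rbar_mult (Rbar.Finite (2 / b)) (Rbar.Finite 0) by rewrite /= Rmult_0_r.
  apply: is_lim_seq_scal_l; apply: is_lim_seq_geom.
  rewrite Rabs_pos_eq; last by left; apply: exp_pos.
  by rewrite -exp_0; apply: exp_increasing; lra.
move/is_lim_seq_spec: lim => /(_ (mkposreal (1 - y) ltac:(lra))) [M1 hM1].
have [M2 [_ hM2]] := nfloor_ex (2 * INR q / (1 - y)) ltac:(apply: Rlt_le; apply: Rdiv_lt_0_compat; lra).
(* One M large enough for both errors: M y^M/(1 - y) from below and 2q/(M (1 - y)) from above. *)
pose M := (M1 + M2.+1 + J ^ 2)%N.
have hJM : (J ^ 2 <= M)%N by rewrite /M; lia.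
have M0 : (0 < M)%N by rewrite /M; lia.
have U := lambert_upper hy M0 hl; have L := lambert_lower hy hJM.
have m1 := INR_ge1 M0.
have E1 : INR M * (y ^ M / (1 - y)) <= 1.
  have /= := hM1 M ltac:(rewrite /M; lia); rewrite Rminus_0_r => h.
  have h1 : INR M <= (2 / b) * exp (b / 2 * INR M).
    have := exp_ineq1_le (b / 2 * INR M) => h1.
    have : INR M = (2 / b) * (b / 2 * INR M) by field; lra.
    have b2 : 0 < 2 / b by apply: Rdiv_lt_0_compat; lra.
    have := Rmult_le_compat_l (2 / b) _ _ ltac:(lra) h1; lra.
  have h2 : INR M * y ^ M <= (2 / b) * exp (- (b / 2)) ^ M.
    have -> : exp (- (b / 2)) ^ M = exp (b / 2 * INR M) * y ^ M.
      rewrite ye -exp_plus -(exp_ln (exp (- (b / 2)) ^ M)); last by apply: pow_lt; apply: exp_pos.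
      by rewrite ln_pow ?ln_exp; [congr exp; field | apply: exp_pos].
    rewrite -Rmult_assoc; apply: Rmult_le_compat_r h1; apply: pow_le; lra.
  have h3 := Rle_abs (2 / b * exp (- (b / 2)) ^ M).
  have -> : INR M * (y ^ M / (1 - y)) = INR M * y ^ M / (1 - y) by field; lra.
  have y1 : 0 < 1 - y by lra.
  by apply/(Rle_div_l _ _ _ y1); lra.
have E2 : 2 * INR q / INR M / (1 - y) <= 1.
  apply/Rle_div_l; first lra; apply/Rle_div_l; first lra.
  have h : 2 * INR q / (1 - y) <= INR M.
    by apply: Rle_trans (Rlt_le _ _ hM2) _; rewrite -S_INR; apply: INR_leq; rewrite /M; lia.
  have y1 : 0 < 1 - y by lra.
  by have := proj1 (Rle_div_l _ _ _ y1) h; lra.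
lra.
Qed.

End Real_nonvanishing.

Lemma Lone_neq0 (q : nat) (X : nat -> C) (a : nat) (l : C) :
  (0 < q)%N -> nat_character q X -> coprime a q -> X a <> 1 ->
  Clim (Lpartial X) l -> l <> 0.
Proof.
move=> q0 hX ca Xa hl.
case: (Classical_Prop.classic (exists b, coprime b q /\ (X b * X b)%C <> 1)).
  by move=> [b [cb Xb]]; apply: Lone_neq0_complex hX cb Xb hl.
move=> hno; apply: Lone_neq0_real hX ca Xa _ _ hl => // b cb.
by case: (Ceq_dec (X b * X b)%C 1) => // h; exfalso; apply: hno; exists b.
Qed.

Lemma mertens_nchar_bounded (q : nat) (X : nat -> C) (a : nat) :
  (0 < q)%N -> nat_character q X -> coprime a q -> X a <> 1 ->
  exists B, 0 <= B /\ forall N,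
   Cmod (\sum_(1 <= n < N.+1) vonM n * (X n * RtoC (/ INR n)%R))%C <= B.
Proof.
move=> q0 hX ca Xa; have [l hl] := Lone_exists q0 hX ca Xa.
have l0 := Lone_neq0 q0 hX ca Xa hl; have lp : 0 < Cmod l by apply/Cmod_gt_0.
exists ((10 * INR q + 1) / Cmod l); split.
  by apply: Rlt_le; apply: Rdiv_lt_0_compat => //; have := INR_pos q; lra.
by move=> N; apply: (mertens_nchar q0 hX ca Xa N hl).
Qed.

(** Otherwise chi would be induced by the trivial character mod 1, and primitivity would give q = 1.
    The work lies in passing from an integer to its residue, since the witness is to be a natural
    number. *)
Lemma primitive_nonprincipal (q : nat) (chi : Z -> C) : (2 < q)%N ->
  primitive_character q chi ->
  exists a, coprime a q /\ chi (Z.of_nat a) <> 1.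
Proof.
move=> hq [hd hprim].
case: (Classical_Prop.classic (exists a, coprime a q /\ chi (Z.of_nat a) <> 1)) => // hno.
exfalso; suff : 1%N = q by lia.
apply: (hprim 1%N (fun _ => RtoC 1)).
- by exists q; lia.
- split=> // [m n|n]; first by ring.
  by rewrite Z.gcd_1_r; split=> // _ /RtoC_inj; lra.
- move=> n hn; have hX := nat_character_of hd.
  pose m := Z.to_nat (n mod Z.of_nat q).
  have hm : Z.of_nat m = (n mod Z.of_nat q)%Z.
    by rewrite /m Z2Nat.id //; have := Z.mod_pos_bound n (Z.of_nat q) ltac:(lia); lia.
  have per k : chi (Z.of_nat m + k * Z.of_nat q)%Z = chi (Z.of_nat m).
    have pn (j : nat) : forall x, chi (x + Z.of_nat j * Z.of_nat q)%Z = chi x.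
      elim: j => [|j IH] x; first by congr chi; lia.
      rewrite (_ : x + Z.of_nat j.+1 * Z.of_nat q = (x + Z.of_nat j * Z.of_nat q) + Z.of_nat q)%Z; last by lia.
      by rewrite (dchar_periodic _ _ hd) IH.
    case: (Z.le_ge_cases 0 k) => hk.
      by rewrite -[k in LHS](Z2Nat.id k) // pn.
    rewrite -(pn (Z.to_nat (- k)) (Z.of_nat m + k * Z.of_nat q)%Z) Z2Nat.id; last by lia.
    by congr chi; lia.
  have hn2 : n = (Z.of_nat m + (n / Z.of_nat q) * Z.of_nat q)%Z.
    by rewrite hm; have := Z.div_mod n (Z.of_nat q) ltac:(lia); lia.
  rewrite hn2 per; case: (Ceq_dec (chi (Z.of_nat m)) 1) => // h1.
  exfalso; apply: hno; exists m; split=> //; apply/(nchar_supp hX) => h0.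
  have : chi n <> 0 by apply/(dchar_support _ _ hd).
  by rewrite hn2 per.
Qed.

(** * Mean squares and resonance *)

(** Dirichlet polynomials in n^(-it), as lists of pairs of an integer n and its coefficient. *)
Definition dpoly := seq (nat * C).

Definition dpoly_eval (P : dpoly) (t : R) : C := (\sum_(x <- P) x.2 * ncpow_opp x.1 (0, t))%C.
Definition dpoly_norm2 (P : dpoly) : R := \sum_(x <- P) Cmod x.2 ^ 2.
Definition dpoly_wf (N : nat) (P : dpoly) : bool :=
  uniq (map fst P) && all (fun m => (0 < m <= N)%N) (map fst P).

Lemma map_fst_inj_C (P : dpoly) : uniq (map fst P) ->
  forall F : nat * C -> nat * C -> R, 
  (forall x y, x.1 <> y.1 -> F x y = 0) ->
  \sum_(x <- P) \sum_(y <- P) F x y = \sum_(x <- P) F x x.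
Proof.
elim: P => [|a P IH] /=; first by move=> _ F _; rewrite !big_nil.
move=> /andP[ha uP] F hF; rewrite !big_cons.
have z1 (x : nat * C) : (x.1 \in map fst P) -> F a x = 0.
  by move=> hx; apply: hF => e; move/negP: ha; apply; rewrite e.
have z2 (x : nat * C) : (x.1 \in map fst P) -> F x a = 0.
  by move=> hx; apply: hF => e; move/negP: ha; apply; rewrite -e.
have in_fst (s : dpoly) (G : nat * C -> R) : (forall x, x.1 \in map fst s -> G x = 0) ->
    \sum_(x <- s) G x = 0.
  elim: s => [|b s IHs] hG; first by rewrite big_nil.
  rewrite big_cons hG ?inE ?eqxx // IHs; first by lra.
  by move=> x hx; apply: hG; rewrite inE hx orbT.
rewrite (in_fst P (F a)) //.
under eq_bigr do rewrite big_cons.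
by rewrite big_split /= (in_fst P (F^~ a)) // IH //; lra.
Qed.

Lemma is_derive_sum (I : Type) (r : seq I) (F G : I -> R -> R) (t : R) :
  (forall i, is_derive (F i) t (G i t)) ->
  is_derive (fun t => \sum_(i <- r) F i t) t (\sum_(i <- r) G i t).
Proof.
move=> h; elim: r => [|i r IH].
  rewrite big_nil; apply: (is_derive_ext (fun _ => 0)) => [x|]; first by rewrite big_nil.
  exact: (is_derive_const (V := R_NormedModule)).
rewrite big_cons; apply: (is_derive_ext (fun t => F i t + \sum_(i <- r) F i t)) => [x|].
  by rewrite big_cons.
exact: (is_derive_plus (V := R_NormedModule)).
Qed.

Definition pair_osc (x y : nat * C) (t : R) : R :=
  Re (x.2 * Cconj y.2 * Cexp (t * (- Ci * RtoC (ln (INR x.1) - ln (INR y.1))%R)))%C.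

(** An explicit antiderivative of [pair_osc]; mean squares are then handled by the mean value
    theorem, without integrals. *)
Definition pair_prim (x y : nat * C) (t : R) : R :=
  if x.1 == y.1 then t * Re (x.2 * Cconj y.2)%C
  else Re (x.2 * Cconj y.2 * Ci / RtoC (ln (INR x.1) - ln (INR y.1))%R *
           Cexp (t * (- Ci * RtoC (ln (INR x.1) - ln (INR y.1))%R)))%C.

Lemma ln_INR_sub_ge (m n N : nat) : (0 < m <= N)%N -> (0 < n <= N)%N -> m <> n ->
  / INR N <= Rabs (ln (INR m) - ln (INR n)).
Proof.
wlog hmn : m n / (m < n)%N.
  move=> H hm hn ne; have [h|h|//] := ltngtP m n; first exact: H.
  by rewrite Rabs_minus_sym; apply: H => //; exact: nesym.
move=> /andP[m0 mN] /andP[n0 nN] _; rewrite Rabs_minus_sym.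
have m1 := INR_ge1 m0; have n1 := INR_ge1 n0.
have h : / INR n <= ln (INR n) - ln (INR m).
  rewrite -ln_div; try lra.
  apply: Rle_trans (ln_ge_1subV _); last by apply: Rdiv_lt_0_compat; lra.
  have : INR m.+1 <= INR n by apply: INR_leq.
  rewrite S_INR => h2; rewrite Rinv_div.
  have : INR m / INR n + / INR n <= 1 by rewrite -Rdiv_1_l -Rdiv_plus_distr; apply/Rle_div_l; lra.
  lra.
have i0 : 0 < / INR n by apply: Rinv_0_lt_compat; lra.
rewrite Rabs_pos_eq; last lra.
by apply: Rle_trans h; apply: Rinv_le_contravar; [lra | apply: INR_leq].
Qed.

Lemma pair_prim_derive (x y : nat * C) (t : R) : (0 < x.1)%N -> (0 < y.1)%N ->
  is_derive (pair_prim x y) t (pair_osc x y t).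
Proof.
move=> x0 y0; rewrite /pair_prim /pair_osc; case: eqP => [e|ne].
  rewrite e Rminus_diag Cmult_0_r Cmult_0_r Cexp_0 Cmult_1_r.
  by move: (Re _) => r; auto_derive => //; ring.
set l := ln (INR x.1) - ln (INR y.1).
have l0 : RtoC l <> 0.
  move=> /RtoC_inj h; have := @ln_INR_sub_ge x.1 y.1 (maxn x.1 y.1).
  rewrite x0 y0 leq_maxl leq_maxr => /(_ isT isT ne); rewrite -/l h Rabs_R0.
  have : 0 < / INR (maxn x.1 y.1) by apply: Rinv_0_lt_compat; apply: Rlt_le_trans Rlt_0_1 (INR_ge1 _); rewrite leq_max x0.
  lra.
have := is_derive_Re_Cexp (x.2 * Cconj y.2 * Ci / RtoC l) (- Ci * RtoC l) t.
have -> : (x.2 * Cconj y.2 * Ci / RtoC l * (- Ci * RtoC l) = x.2 * Cconj y.2)%C.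
  have i2 : (Ci * Ci = - (1))%C by apply: injective_projections => /=; ring.
  transitivity (x.2 * Cconj y.2 * (- (Ci * Ci)))%C; first by field.
  by rewrite i2; ring.
by [].
Qed.

Lemma pair_prim_bound (x y : nat * C) (t : R) (N : nat) :
  (0 < x.1 <= N)%N -> (0 < y.1 <= N)%N -> x.1 <> y.1 ->
  Rabs (pair_prim x y t) <= INR N * (Cmod x.2 * Cmod y.2).
Proof.
move=> hx hy ne; rewrite /pair_prim; case: eqP => // _.
apply: Rle_trans (re_le_Cmod _) _.
have h := ln_INR_sub_ge hx hy ne; set l := _ - _ in h *.
have N0 : 0 < INR N by apply: Rlt_le_trans Rlt_0_1 (INR_ge1 _); case/andP: hx => *; lia.
have iN : 0 < / INR N by apply: Rinv_0_lt_compat.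
have l0 : RtoC l <> 0 by move=> /RtoC_inj e; rewrite e Rabs_R0 in h; lra.
rewrite Cmod_mult Cmod_Cexp Cmod_div // !Cmod_mult Cmod_conj Cmod_Ci Cmod_R.
have -> : Re (t * (- Ci * RtoC l)) = 0 by rewrite /=; ring.
rewrite exp_0 !Rmult_1_r /Rdiv (Rmult_comm _ (/ Rabs l)); apply: Rmult_le_compat_r.
  by apply: Rmult_le_pos; apply: Cmod_ge_0.
by rewrite -(Rinv_inv (INR N)); apply: Rinv_le_contravar.
Qed.

Lemma dpoly_eval_sq (P : dpoly) (t : R) : all (fun x => 0 < x.1)%N P ->
  Cmod (dpoly_eval P t) ^ 2 = \sum_(x <- P) \sum_(y <- P) pair_osc x y t.
Proof.
move=> _; have e : Cmod (dpoly_eval P t) ^ 2 = Re (dpoly_eval P t * Cconj (dpoly_eval P t))%C.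
  by rewrite -Cmod2_conj.
rewrite e {e} /dpoly_eval Cconj_sum big_distrl Re_sum; apply: eq_bigr => x _.
rewrite big_distrr Re_sum; apply: eq_bigr => y _; rewrite /pair_osc; congr Re.
transitivity (x.2 * ncpow_opp x.1 (0, t) * Cconj (y.2 * ncpow_opp y.1 (0, t)))%C; first by [].
rewrite Cmult_conj Cconj_ncpow.
have -> : (x.2 * ncpow_opp x.1 (0, t) * (Cconj y.2 * ncpow_opp y.1 (Cconj (0, t))) =
   x.2 * Cconj y.2 * (ncpow_opp x.1 (0, t) * ncpow_opp y.1 (Cconj (0, t))))%C by ring.
congr (_ * _)%C; rewrite /ncpow_opp -Cexp_plus; congr Cexp.
by apply: injective_projections => /=; ring.
Qed.

Lemma dpoly_size_le N P : dpoly_wf N P -> (size P <= N)%N.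
Proof.
rewrite /dpoly_wf => /andP[uP /allP hP]; rewrite -(size_map fst) -(size_iota 1 N).
apply: uniq_leq_size => // m hm; rewrite mem_iota.
by have /andP[] := hP m hm; lia.
Qed.

Lemma eq_Rsum_all (I : Type) (r : seq I) (P : pred I) (F G : I -> R) : all P r ->
  (forall i, P i -> F i = G i) -> \sum_(i <- r) F i = \sum_(i <- r) G i.
Proof.
move=> + h; elim: r => [|i r IH] /=; first by rewrite !big_nil.
by move=> /andP[hi /IH e]; rewrite !big_cons (h i hi) e.
Qed.

Lemma Rsum_le_all (I : Type) (r : seq I) (P : pred I) (F G : I -> R) : all P r ->
  (forall i, P i -> F i <= G i) -> \sum_(i <- r) F i <= \sum_(i <- r) G i.
Proof.
move=> + h; elim: r => [|i r IH] /=; first by rewrite !big_nil; lra.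
by move=> /andP[hi /IH e]; rewrite !big_cons; have := h i hi; lra.
Qed.

(** G plays the part of the integral of |P|^2. The logarithms of distinct integers up to N are at
    least 1/N apart, so an off-diagonal pair contributes at most 2N |a||b| <= N (|a|^2 + |b|^2), and
    there are at most N terms. *)
Lemma dpoly_mean_square (N : nat) (P : dpoly) : dpoly_wf N P ->
  exists G : R -> R, (forall t, is_derive G t (Cmod (dpoly_eval P t) ^ 2)) /\
  forall s t, Rabs (G t - G s - (t - s) * dpoly_norm2 P) <= 2 * INR N ^ 2 * dpoly_norm2 P.
Proof.
move=> wf; have sN := dpoly_size_le wf; move/andP: wf => [uP]; rewrite all_map => hP.
have hP0 : all (fun x => 0 < x.1)%N P by apply: sub_all hP => x /andP[].
(* The guard is always true on P; it is there because [is_derive_sum] asks for the derivative at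
   every index, not only at the members of the list. *)
exists (fun t => \sum_(x <- P) \sum_(y <- P) (if (0 < x.1)%N && (0 < y.1)%N then pair_prim x y t else 0)).
have e t : \sum_(x <- P) \sum_(y <- P) (if (0 < x.1)%N && (0 < y.1)%N then pair_osc x y t else 0) =
    \sum_(x <- P) \sum_(y <- P) pair_osc x y t.
  apply: (eq_Rsum_all hP0) => x hx; apply: (eq_Rsum_all hP0) => y hy.
  by rewrite hx hy.
split=> [t|s t].
  rewrite dpoly_eval_sq // -e.
  apply: (@is_derive_sum _ P
    (fun x t => \sum_(y <- P) (if (0 < x.1)%N && (0 < y.1)%N then pair_prim x y t else 0))
    (fun x t => \sum_(y <- P) (if (0 < x.1)%N && (0 < y.1)%N then pair_osc x y t else 0))) => x.
  apply: (@is_derive_sum _ P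
    (fun y t => if (0 < x.1)%N && (0 < y.1)%N then pair_prim x y t else 0)
    (fun y t => if (0 < x.1)%N && (0 < y.1)%N then pair_osc x y t else 0)) => y.
  case: ifP => [/andP[x0 y0]|_]; first exact: pair_prim_derive.
  exact: (is_derive_const (V := R_NormedModule)).
have diag : (t - s) * dpoly_norm2 P = \sum_(x <- P) \sum_(y <- P)
    (if x.1 == y.1 then (t - s) * Re (x.2 * Cconj y.2)%C else 0).
  rewrite (map_fst_inj_C uP); last by move=> x y; case: eqP.
  rewrite big_distrr; apply: eq_bigr => x _ /=; rewrite eqxx; congr (_ * _).
  by have := Cmod2_conj x.2 => /(f_equal Re) /= <-; ring.
rewrite diag -!Rsum_minus.
apply: Rle_trans (Rabs_sum_le _ _ _) _.
apply: Rle_trans (_ : \sum_(x <- P) \sum_(y <- P) INR N * (Cmod x.2 ^ 2 + Cmod y.2 ^ 2) <= _).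
  apply: (Rsum_le_all hP) => x hx.
  rewrite -!Rsum_minus; apply: Rle_trans (Rabs_sum_le _ _ _) _.
  apply: (Rsum_le_all hP) => y hy; have /andP[-> _] := hx; have /andP[-> _] := hy => /=.
  have n0 := INR_pos N.
  case: eqP => [e1|ne].
    rewrite /pair_prim e1 eqxx (_ : forall a b r : R, a * r - b * r - (a - b) * r = 0); last by move=> *; ring.
    by rewrite Rabs_R0; apply: Rmult_le_pos => //; have := pow2_ge_0 (Cmod x.2); have := pow2_ge_0 (Cmod y.2); lra.
  rewrite Rminus_0_r; have b1 := pair_prim_bound t hx hy ne; have b2 := pair_prim_bound s hx hy ne.
  have := Rabs_triang (pair_prim x y t) (- pair_prim x y s); rewrite Rabs_Ropp -/(Rminus _ _).
  have := pow2_ge_0 (Cmod x.2 - Cmod y.2) => sq tr.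
  have : INR N * (2 * (Cmod x.2 * Cmod y.2)) <= INR N * (Cmod x.2 ^ 2 + Cmod y.2 ^ 2).
    by apply: Rmult_le_compat_l => //; lra.
  lra.
have -> : \sum_(x <- P) \sum_(y <- P) INR N * (Cmod x.2 ^ 2 + Cmod y.2 ^ 2) =
   2 * INR N * INR (size P) * dpoly_norm2 P.
  transitivity (\sum_(x <- P) (INR N * INR (size P) * Cmod x.2 ^ 2 + INR N * dpoly_norm2 P)).
    apply: eq_bigr => x _; rewrite /dpoly_norm2 big_distrr /=.
    transitivity (\sum_(y <- P) (INR N * Cmod x.2 ^ 2 + INR N * Cmod y.2 ^ 2)).
      by apply: eq_bigr => y _; ring.
    by rewrite big_split /= Rsum_const; congr (_ + _); ring.
  by rewrite big_split /= Rsum_const -big_distrr /= -/(dpoly_norm2 P); ring.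
apply: Rmult_le_compat_r; first by apply: Rsum_ge0 => x _; apply: pow2_ge_0.
have n0 := INR_pos N; have := INR_leq sN; rewrite /= => h.
have := Rmult_le_compat_l (INR N) _ _ n0 h; lra.
Qed.

(** Averages over a window of length T = 8 N^2. Up to the factor B N^2 times the norm of V, the mean
    squares of the Q total at most T + 2N^2, i.e. 10, whereas 4B |V|^2 contributes at least 4 (8 -
    2) = 24; the mean value theorem then gives a point t. *)
Lemma dpoly_exists_t (I : eqType) (r : seq I) (w : I -> R) (Q : I -> dpoly)
    (V : dpoly) (N : nat) (B T0 : R) :
  (0 < N)%N -> 0 < B -> dpoly_wf N V -> (forall i, i \in r -> dpoly_wf N (Q i)) ->
  (forall i, 0 <= w i) -> 0 < dpoly_norm2 V ->
  \sum_(i <- r) w i * dpoly_norm2 (Q i) <= B * dpoly_norm2 V ->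
  exists t, T0 <= t <= T0 + 8 * INR N ^ 2 /\
    \sum_(i <- r) w i * Cmod (dpoly_eval (Q i) t) ^ 2 < 4 * B * Cmod (dpoly_eval V t) ^ 2.
Proof.
move=> N0 B0 wV wQ w0 V0 hB; have N1 := INR_ge1 N0; set T := 8 * INR N ^ 2.
have T0' : 0 < T by rewrite /T /=; nra.
have [GV [dV bV]] := dpoly_mean_square wV.
have [G [dG bG]] : exists G : R -> R,
   (forall t, is_derive G t (\sum_(i <- r) w i * Cmod (dpoly_eval (Q i) t) ^ 2)) /\
   G (T0 + T) - G T0 <= (T + 2 * INR N ^ 2) * \sum_(i <- r) w i * dpoly_norm2 (Q i).
  elim: r wQ {hB} => [|i r IH] wQ.
    exists (fun _ => 0); split=> [t|]; last by rewrite big_nil; lra.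
    by rewrite big_nil; apply: (is_derive_const (V := R_NormedModule)).
  have [G [dG bG]] := IH (fun j hj => wQ j (mem_behead (s := i :: r) hj)).
  have [Gi [di bi]] := dpoly_mean_square (wQ i (mem_head _ _)).
  exists (fun t => w i * Gi t + G t); split=> [t|].
    rewrite big_cons; apply: (is_derive_plus (V := R_NormedModule)) => //.
    by apply: is_derive_scal; apply: di.
  rewrite big_cons; have := bi T0 (T0 + T); move/Rabs_le_between => [_ h].
  have := Rmult_le_compat_l _ _ _ (w0 i) h; lra.
have [t [h1 h2]] := MVT_cor2 (fun t => 4 * B * GV t - G t) _ T0 (T0 + T) ltac:(lra)
  (fun t _ => proj1 (is_derive_Reals _ _ _) (is_derive_minus (V := R_NormedModule) _ _ _ _ _
     (is_derive_scal _ _ (4 * B) _ (dV t)) (dG t))).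
exists t; split; first lra.
have := bV T0 (T0 + T); move/Rabs_le_between => [hV _].
have hS : (T + 2 * INR N ^ 2) * \sum_(i <- r) w i * dpoly_norm2 (Q i) <=
    (T + 2 * INR N ^ 2) * (B * dpoly_norm2 V).
  by apply: Rmult_le_compat_l hB; rewrite /T; nra.
have hV' := Rmult_le_compat_l (4 * B) _ _ ltac:(lra) hV.
have e1 : T0 + T - T0 = T by ring.
rewrite e1 in h1 hV'.
move: h1; rewrite /minus /plus /opp /scal /= /mult /=.
set D := \sum_(i <- r) _; set S := Cmod _ * _ => h1.
apply: Rnot_le_lt => hle.
have : (4 * B * S + - D) * T <= 0 by nra.
have : 0 < B * dpoly_norm2 V * (INR N ^ 2).
  by apply: Rmult_lt_0_compat; [exact: Rmult_lt_0_compat | nra].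
rewrite /T in hS hV' h1 bG *; nra.
Qed.

(** * Products of Dirichlet polynomials *)

Definition dpoly_mul (P Q : dpoly) : dpoly :=
  [seq ((x.1 * y.1)%N, (x.2 * y.2)%C) | x <- P, y <- Q].

Lemma dpoly_mul_eval (P Q : dpoly) (t : R) :
  all (fun m => 0 < m)%N (map fst P) -> all (fun m => 0 < m)%N (map fst Q) ->
  dpoly_eval (dpoly_mul P Q) t = (dpoly_eval P t * dpoly_eval Q t)%C.
Proof.
rewrite !all_map /dpoly_eval /dpoly_mul big_allpairs_dep /= => hP hQ.
elim: P hP => [_|x P IH /andP[x0 /IH {}IH]]; first by rewrite !big_nil; ring.
rewrite !big_cons IH Cmult_plus_distr_r; congr (_ + _)%C.
elim: Q hQ {IH} => [_|y Q IH /andP[y0 /IH {}IH]]; first by rewrite !big_nil; ring.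
by rewrite !big_cons IH Cmult_plus_distr_l /= ncpow_mul //; ring.
Qed.

Lemma dpoly_mul_norm2 (P Q : dpoly) :
  dpoly_norm2 (dpoly_mul P Q) = dpoly_norm2 P * dpoly_norm2 Q.
Proof.
rewrite /dpoly_norm2 /dpoly_mul big_allpairs_dep big_distrl /=; apply: eq_bigr => x _.
rewrite big_distrr; apply: eq_bigr => y _ /=.
by rewrite Cmod_mult; ring.
Qed.

Lemma dpoly_mul_keys (P Q : dpoly) :
  map fst (dpoly_mul P Q) = [seq (m * n)%N | m <- map fst P, n <- map fst Q].
Proof.
by rewrite /dpoly_mul map_allpairs allpairs_mapl allpairs_mapr.
Qed.

Definition keys_nat (pi : nat_pred) (P : dpoly) : bool :=
  uniq (map fst P) && all (fun m => pi.-nat m) (map fst P).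

Lemma partn_mul_pi (pi : nat_pred) (m n : nat) : pi.-nat m -> (pi^').-nat n ->
  ((m * n)`_pi = m)%N.
Proof.
move=> hm hn; case/andP: (hm) => m0 _; case/andP: (hn) => n0 _; rewrite partnM //.
by rewrite (part_pnat_id hm) (part_p'nat hn) muln1.
Qed.

(** [dpoly_mul] does not collect equal integers, so its norm is multiplicative by construction;
    unique factorisation enters only here. The pi-part of a product recovers the first factor, so no
    two products coincide. *)
Lemma dpoly_mul_uniq (pi : nat_pred) (P Q : dpoly) :
  keys_nat pi P -> keys_nat pi^' Q -> uniq (map fst (dpoly_mul P Q)).
Proof.
rewrite /keys_nat dpoly_mul_keys => /andP[uP /allP hP] /andP[uQ /allP hQ].
apply: allpairs_uniq => // -[m n] [m' n'] /allpairsP[[a b] /= [ha hb [-> ->]]].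
move=> /allpairsP[[a' b'] /= [ha' hb' [-> ->]]] /= e.
have ea : a = a'.
  by rewrite -(partn_mul_pi (hP a ha) (hQ b hb)) e partn_mul_pi ?hP ?hQ.
have a0 : (0 < a')%N by case/andP: (hP a' ha').
move: e; rewrite ea => /eqP; rewrite eqn_pmul2l //.
by move=> /eqP ->.
Qed.

Lemma dpoly_mul_pos (P Q : dpoly) :
  all (fun m => 0 < m)%N (map fst P) -> all (fun m => 0 < m)%N (map fst Q) ->
  all (fun m => 0 < m)%N (map fst (dpoly_mul P Q)).
Proof.
rewrite dpoly_mul_keys => /allP hP /allP hQ; apply/allP => k /allpairsP[[m n] /= [hm hn ->]].
by rewrite muln_gt0 hP ?hQ.
Qed.

Lemma dpoly_mul_le (N M : nat) (P Q : dpoly) :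
  all (fun m => m <= N)%N (map fst P) -> all (fun m => m <= M)%N (map fst Q) ->
  all (fun m => m <= N * M)%N (map fst (dpoly_mul P Q)).
Proof.
rewrite dpoly_mul_keys => /allP hP /allP hQ; apply/allP => k /allpairsP[[m n] /= [hm hn ->]].
by apply: leq_mul; [apply: hP | apply: hQ].
Qed.

Definition prime_dpoly (p : nat) (c : nat -> C) (D : nat) : dpoly :=
  [seq ((p ^ j)%N, c j) | j <- iota 0 D.+1].

Definition prod_dpoly (A : seq nat) (c : nat -> nat -> C) (D : nat) : dpoly :=
  foldr (fun p acc => dpoly_mul (prime_dpoly p (c p) D) acc) [:: (1%N, RtoC 1)] A.

Lemma prime_dpoly_keys p c D : map fst (prime_dpoly p c D) = [seq (p ^ j)%N | j <- iota 0 D.+1].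
Proof. by rewrite /prime_dpoly -map_comp. Qed.

Lemma prime_dpoly_nat p c D : prime p -> keys_nat p (prime_dpoly p c D).
Proof.
move=> hp; rewrite /keys_nat prime_dpoly_keys; apply/andP; split.
  rewrite map_inj_uniq ?iota_uniq // => i j /eqP; rewrite eqn_exp2l ?prime_gt1 //.
  by move/eqP.
by apply/allP => m /mapP[j _ ->]; rewrite pnatX pnat_id.
Qed.

Lemma prime_dpoly_pos p c D : prime p -> all (fun m => 0 < m)%N (map fst (prime_dpoly p c D)).
Proof.
move=> hp; rewrite prime_dpoly_keys; apply/allP => m /mapP[j _ ->].
by rewrite expn_gt0 prime_gt0.
Qed.

Lemma prime_dpoly_le p c D : prime p ->
  all (fun m => m <= p ^ D)%N (map fst (prime_dpoly p c D)).
Proof.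
move=> hp; rewrite prime_dpoly_keys; apply/allP => m /mapP[j].
by rewrite mem_iota => /andP[_ hj] ->; rewrite leq_exp2l ?prime_gt1.
Qed.

Lemma prime_dpoly_eval p c D t : prime p ->
  dpoly_eval (prime_dpoly p c D) t = (\sum_(0 <= j < D.+1) c j * ncpow_opp p (0, t) ^ j)%C.
Proof.
move=> hp; rewrite /dpoly_eval /prime_dpoly big_map; apply: eq_bigr => j _ /=.
by rewrite ncpow_expn ?prime_gt0.
Qed.

Lemma prime_dpoly_norm2 p c D :
  dpoly_norm2 (prime_dpoly p c D) = \sum_(0 <= j < D.+1) Cmod (c j) ^ 2.
Proof. by rewrite /dpoly_norm2 /prime_dpoly big_map. Qed.

Lemma prod_dpoly_pos A c D : all prime A -> all (fun m => 0 < m)%N (map fst (prod_dpoly A c D)).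
Proof.
elim: A => //= p A IH /andP[hp hA]; apply: dpoly_mul_pos; last exact: IH.
exact: prime_dpoly_pos.
Qed.

Lemma prod_dpoly_le A c D : all prime A ->
  all (fun m => m <= (\prod_(p <- A) p) ^ D)%N (map fst (prod_dpoly A c D)).
Proof.
elim: A => [|p A IH] /=; first by rewrite big_nil exp1n.
move=> /andP[hp hA]; rewrite big_cons expnMn; apply: dpoly_mul_le; last exact: IH.
exact: prime_dpoly_le.
Qed.

Lemma prod_dpoly_nat A c D : all prime A -> uniq A ->
  keys_nat [pred p in A] (prod_dpoly A c D).
Proof.
elim: A => [_ _|p A IH] /=; first by rewrite /keys_nat /=.
move=> /andP[hp hA] /andP[pA uA]; have {}IH := IH hA uA.
have hpd := prime_dpoly_nat (c p) D hp.
have hA' : keys_nat (p^')%N (prod_dpoly A c D).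
  move/andP: IH => [u /allP h]; rewrite /keys_nat u; apply/allP => m hm.
  apply: sub_in_pnat (h m hm) => r _ hr; rewrite !inE /=; apply: contra pA => /eqP <-.
  by rewrite -topredE /= in hr.
rewrite /keys_nat (dpoly_mul_uniq hpd hA') dpoly_mul_keys; apply/allP => k.
move=> /allpairsP[[m n] /= [hm hn ->]].
move/andP: hpd => [_ /allP h1]; move/andP: IH => [_ /allP h2].
rewrite pnatM; apply/andP; split.
  by apply: sub_in_pnat (h1 m hm) => r _; rewrite !inE => /eqP ->; rewrite eqxx.
by apply: sub_in_pnat (h2 n hn) => r _; rewrite !inE => ->; rewrite orbT.
Qed.

Lemma prod_dpoly_eval A c D t : all prime A ->
  dpoly_eval (prod_dpoly A c D) t =
  (\prod_(p <- A) \sum_(0 <= j < D.+1) c p j * ncpow_opp p (0, t) ^ j)%C.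
Proof.
elim: A => [_|p A IH] /=.
  by rewrite /dpoly_eval big_seq1 big_nil /= ncpow_1n; ring.
move=> /andP[hp hA]; rewrite dpoly_mul_eval; [|exact: prime_dpoly_pos|exact: prod_dpoly_pos].
by rewrite big_cons IH // prime_dpoly_eval.
Qed.

Lemma prod_dpoly_norm2 A c D :
  dpoly_norm2 (prod_dpoly A c D) = \prod_(p <- A) \sum_(0 <= j < D.+1) Cmod (c p j) ^ 2.
Proof.
elim: A => [|p A IH] /=.
  by rewrite /dpoly_norm2 big_seq1 big_nil /= Cmod_1; ring.
by rewrite dpoly_mul_norm2 big_cons IH prime_dpoly_norm2.
Qed.

(* [fejer_coef z k] are the coefficients of [F(u) = \sum_(j <= k) (conj z u)^j]
   and [fejer_diff z k] those of [(u - z) F(u)], for [Cmod z = 1]. *)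
Definition fejer_coef (z : C) (k j : nat) : C :=
  if (j <= k)%N then (Cconj z ^ j)%C else 0.

Definition fejer_diff (z : C) (k j : nat) : C :=
  if j == 0%N then (- z)%C else if j == k.+1 then (Cconj z ^ k)%C else RtoC 0.

Lemma fejer_eval (z u : C) (k : nat) : Cmod z = 1 ->
  (\sum_(0 <= j < k.+2) fejer_diff z k j * u ^ j =
   (u - z) * \sum_(0 <= j < k.+2) fejer_coef z k j * u ^ j)%C.
Proof.
move=> hz; have zz : (z * Cconj z = 1)%C by rewrite -Cmod2_conj hz pow1.
have -> : (\sum_(0 <= j < k.+2) fejer_coef z k j * u ^ j = \sum_(0 <= j < k.+1) (Cconj z * u) ^ j)%C.
  rewrite big_nat_recr //= /fejer_coef ltnn Cmult_0_l Cplus_0_r.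
  by apply: eq_big_nat => j /andP[_ hj]; rewrite -ltnS hj Cpow_mult_l.
have -> : (\sum_(0 <= j < k.+2) fejer_diff z k j * u ^ j = - z + Cconj z ^ k * u ^ k.+1)%C.
  rewrite big_nat_recr // big_nat_recl //= /fejer_diff !eqxx /=.
  rewrite big1_seq ?Cplus_0_r => [|j]; first by ring.
  rewrite mem_index_iota => /andP[_ hj]; rewrite eqSS (_ : (j == k) = false) ?Cmult_0_l //.
  by apply/eqP; lia.
elim: k => [|k IH]; first by rewrite big_nat1 /=; ring.
rewrite big_nat_recr // [in RHS]/= Cmult_plus_distr_l -IH Cpow_mult_l.
have -> : (- z + Cconj z ^ k.+1 * u ^ k.+2 =
   - z + Cconj z ^ k * u ^ k.+1 + (u * (Cconj z ^ k.+1 * u ^ k.+1) - 1 * Cconj z ^ k * u ^ k.+1))%C.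
  by rewrite /=; ring.
by rewrite -zz /=; ring.
Qed.

Lemma fejer_coef_norm2 (z : C) (k : nat) : Cmod z = 1 ->
  \sum_(0 <= j < k.+2) Cmod (fejer_coef z k j) ^ 2 = INR k.+1.
Proof.
move=> hz; rewrite big_nat_recr // /fejer_coef ltnn Cmod_0.
rewrite (_ : \sum_(0 <= j < k.+1) _ = \sum_(0 <= j < k.+1) 1).
  by rewrite Rsum_const_nat subn0 pow_ne_zero // Rmult_1_r; apply: Rplus_0_r.
apply: eq_big_nat => j /andP[_ hj]; rewrite -ltnS hj Cmod_pow Cmod_conj hz pow1; ring.
Qed.

Lemma fejer_diff_norm2 (z : C) (k : nat) : Cmod z = 1 ->
  \sum_(0 <= j < k.+2) Cmod (fejer_diff z k j) ^ 2 = 2.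
Proof.
move=> hz; rewrite big_nat_recr // big_nat_recl //= /fejer_diff !eqxx /=.
rewrite big1_seq => [|j].
  by rewrite Cmod_opp Cmod_pow Cmod_conj hz pow1; ring.
rewrite mem_index_iota => /andP[_ hj]; rewrite eqSS (_ : (j == k) = false) ?Cmod_0; first by ring.
by apply/eqP; lia.
Qed.

(** Starts at 2: the integer 1 is free of A too, but carries the main term and cannot be made
    small. *)
Definition free_dpoly (A : seq nat) (Y : nat) (a : nat -> C) : dpoly :=
  [seq (n, a n) | n <- index_iota 2 Y.+1 & free A n].

Lemma free_dpoly_keys A Y a : map fst (free_dpoly A Y a) = [seq n <- index_iota 2 Y.+1 | free A n].
Proof. by rewrite /free_dpoly -map_comp map_id. Qed.

Lemma free_dpoly_nat A Y a : all prime A ->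
  keys_nat ([pred p in A] : nat_pred)^' (free_dpoly A Y a).
Proof.
move=> hA; rewrite /keys_nat free_dpoly_keys filter_uniq ?iota_uniq //=.
apply/allP => n; rewrite mem_filter mem_index_iota => /andP[/allP hf /andP[n2 _]].
apply/pnatP => [|p hp pn]; first by lia.
by rewrite !inE -topredE /=; apply/negP => /hf; rewrite pn.
Qed.

Lemma free_dpoly_eval A Y a t : dpoly_eval (free_dpoly A Y a) t =
  (\sum_(2 <= n < Y.+1 | free A n) a n * ncpow_opp n (0, t))%C.
Proof. by rewrite /dpoly_eval /free_dpoly big_map big_filter. Qed.

Lemma free_dpoly_norm2 A Y a : dpoly_norm2 (free_dpoly A Y a) =
  \sum_(2 <= n < Y.+1 | free A n) Cmod (a n) ^ 2.
Proof. by rewrite /dpoly_norm2 /free_dpoly big_map big_filter. Qed.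

(* The weight is [V(t) = \prod_(p <- A) \sum_(j <= k) (conj (z p) p^(-it))^j]: multiplying
   one factor by [p^(-it) - z p] shrinks its mean square by [2 / (k+1)], and a polynomial
   supported on integers free of A has unique factorisation against V, so that mean
   squares multiply. *)
Lemma resonance (A : seq nat) (z : nat -> C) (w : nat -> R) (m : nat)
    (a : nat -> nat -> C) (Y k : nat) (B T0 : R) :
  all prime A -> uniq A -> (forall p, Cmod (z p) = 1) -> (forall p, 0 <= w p) ->
  (0 < Y)%N -> 0 < B ->
  (\sum_(p <- A) w p) * (2 / INR k.+1) +
    \sum_(0 <= i < m) \sum_(2 <= n < Y.+1 | free A n) Cmod (a i n) ^ 2 <= B ->
  exists t, T0 <= t <= T0 + 8 * INR ((\prod_(p <- A) p) ^ k.+1 * Y)%N ^ 2 /\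
    \sum_(p <- A) w p * Cmod (ncpow_opp p (0, t) - z p)%C ^ 2 <= 4 * B /\
    forall i, (i < m)%N ->
      Cmod (\sum_(2 <= n < Y.+1 | free A n) a i n * ncpow_opp n (0, t))%C ^ 2 <= 4 * B.
Proof.
move=> pA uA hz w0 Y0 B0 hB; set N := (_ * Y)%N.
have prod0 : (0 < \prod_(p <- A) p)%N.
  by rewrite big_seq prodn_cond_gt0 // => p; move/allP: pA => h /h /prime_gt0.
have N0 : (0 < N)%N by rewrite muln_gt0 expn_gt0 prod0.
pose c0 p := fejer_coef (z p) k.
(* [cd p0] replaces the factor of V at p0 by its product with p0^(-it) - z p0, so the polynomial it
   defines is V times that difference. *)
pose cd p0 p := if p == p0 then fejer_diff (z p) k else c0 p.
pose V := prod_dpoly A c0 k.+1.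
pose Q (i : nat + nat) := match i with
  | inl p => prod_dpoly A (cd p) k.+1
  | inr i => dpoly_mul V (free_dpoly A Y (a i)) end.
pose W (i : nat + nat) := match i with inl p => w p | inr _ => 1 end.
pose r : seq (nat + nat) := map inl A ++ map inr (index_iota 0 m).
have k1 : 0 < INR k.+1 by apply: lt_0_INR; lia.
have wfprod c : dpoly_wf N (prod_dpoly A c k.+1).
  have /andP[u _] := prod_dpoly_nat c k.+1 pA uA; rewrite /dpoly_wf u.
  apply/allP => x hx; have /allP/(_ x hx) -> := prod_dpoly_pos c k.+1 pA.
  have /allP/(_ x hx) := prod_dpoly_le c k.+1 pA.
  by rewrite /N; move=> h; apply: leq_trans h (leq_pmulr _ Y0).
have fpos i : all (fun m => 0 < m)%N (map fst (free_dpoly A Y (a i))).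
  by rewrite free_dpoly_keys; apply/allP => n; rewrite mem_filter mem_index_iota => /andP[_ /andP[h _]]; lia.
have wfQ i : i \in r -> dpoly_wf N (Q i).
  case: i => [p|i] _; first exact: wfprod.
  rewrite /dpoly_wf /Q (dpoly_mul_uniq (prod_dpoly_nat c0 k.+1 pA uA) (free_dpoly_nat Y (a i) pA)).
  apply/allP => x hx.
  have /allP/(_ x hx) -> := dpoly_mul_pos (prod_dpoly_pos c0 k.+1 pA) (fpos i).
  apply: (allP (dpoly_mul_le (prod_dpoly_le c0 k.+1 pA) _)) hx.
  by rewrite free_dpoly_keys; apply/allP => n; rewrite mem_filter mem_index_iota => /andP[_ /andP[_ h]].
have nV : dpoly_norm2 V = INR k.+1 ^ size A.
  rewrite /V prod_dpoly_norm2; elim: (A) => [|p s IH]; first by rewrite big_nil.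
  by rewrite big_cons IH fejer_coef_norm2.
have V0 : 0 < dpoly_norm2 V by rewrite nV; apply: pow_lt.
have nQ p : p \in A -> dpoly_norm2 (Q (inl p)) = 2 / INR k.+1 * dpoly_norm2 V.
  move=> hp; rewrite /V /Q !prod_dpoly_norm2 (bigD1_seq p) // [in RHS](bigD1_seq p) //.
  rewrite {1}/cd eqxx fejer_diff_norm2 // fejer_coef_norm2 //.
  set P1 := \big[_/_]_(_ <- _ | _) _; set P2 := \big[_/_]_(_ <- _ | _) _.
  have -> : P1 = P2 by apply: eq_bigr => i /negbTE hi; rewrite /cd hi.
  by move: (INR k.+1) k1 => K K0 /=; field; lra.
have nR i : dpoly_norm2 (Q (inr i)) =
    (\sum_(2 <= n < Y.+1 | free A n) Cmod (a i n) ^ 2) * dpoly_norm2 V.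
  by rewrite /Q dpoly_mul_norm2 free_dpoly_norm2 Rmult_comm.
have W0 i : 0 <= W i by case: i => [p|i] /=; [apply: w0 | lra].
have hS : \sum_(i <- r) W i * dpoly_norm2 (Q i) <= B * dpoly_norm2 V.
  rewrite /r big_cat !big_map.
  have -> : \sum_(p <- A) W (inl p) * dpoly_norm2 (Q (inl p)) =
     (\sum_(p <- A) w p) * (2 / INR k.+1) * dpoly_norm2 V.
    rewrite !big_distrl; apply: eq_big_seq => p hp; rewrite nQ // /W /=; ring.
  have -> : \sum_(i <- index_iota 0 m) W (inr i) * dpoly_norm2 (Q (inr i)) =
     (\sum_(0 <= i < m) \sum_(2 <= n < Y.+1 | free A n) Cmod (a i n) ^ 2) * dpoly_norm2 V.
    by rewrite big_distrl; apply: eq_bigr => i _; rewrite nR /W /= Rmult_1_l.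
  have := Rmult_le_compat_r _ _ _ (Rlt_le _ _ V0) hB; rewrite Rmult_plus_distr_r.
  by [].
have [t [ht hlt]] := dpoly_exists_t T0 N0 B0 (wfprod c0) wfQ W0 V0 hS.
exists t; split=> //; set E := Cmod _ ^ 2 in hlt.
have eQ p : p \in A -> Cmod (dpoly_eval (Q (inl p)) t) ^ 2 =
    Cmod (ncpow_opp p (0, t) - z p)%C ^ 2 * E.
  move=> hp; rewrite /E /Q !prod_dpoly_eval // (bigD1_seq p) //= [in RHS](bigD1_seq p) //=.
  set P1 := \big[Cmult/_]_(_ <- _ | _) _; set P2 := \big[Cmult/_]_(_ <- _ | _) _.
  have -> : P1 = P2 by apply: eq_bigr => i /negbTE hi; rewrite /cd hi.
  by rewrite (_ : cd p p = fejer_diff (z p) k) ?fejer_eval // ?/cd ?eqxx // !Cmod_mult /c0; ring.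
have eR i : Cmod (dpoly_eval (Q (inr i)) t) ^ 2 =
   Cmod (\sum_(2 <= n < Y.+1 | free A n) a i n * ncpow_opp n (0, t))%C ^ 2 * E.
  rewrite /Q dpoly_mul_eval; [|exact: prod_dpoly_pos|exact: fpos].
  by rewrite Cmod_mult free_dpoly_eval /E /V; ring.
have E0 : 0 <= E by apply: pow2_ge_0.
(* The strict inequality of [dpoly_exists_t] forces V(t) <> 0, which permits division by
   |V(t)|^2. *)
have Ep : 0 < E.
  have h : 0 <= \sum_(i <- r) W i * Cmod (dpoly_eval (Q i) t) ^ 2.
    by apply: Rsum_ge0 => i _; apply: Rmult_le_pos => //; apply: pow2_ge_0.
  by have h2 := Rle_lt_trans _ _ _ h hlt; apply: (Rmult_lt_reg_l (4 * B)); lra.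
move: hlt; rewrite /r big_cat !big_map.
have -> : \sum_(p <- A) W (inl p) * Cmod (dpoly_eval (Q (inl p)) t) ^ 2 =
   (\sum_(p <- A) w p * Cmod (ncpow_opp p (0, t) - z p)%C ^ 2) * E.
  by rewrite big_distrl; apply: eq_big_seq => p hp; rewrite eQ // /W /=; ring.
have -> : \sum_(i <- index_iota 0 m) W (inr i) * Cmod (dpoly_eval (Q (inr i)) t) ^ 2 =
   (\sum_(0 <= i < m) Cmod (\sum_(2 <= n < Y.+1 | free A n) a i n * ncpow_opp n (0, t))%C ^ 2) * E.
  by rewrite big_distrl; apply: eq_bigr => i _; rewrite eR /W /= Rmult_1_l.
set S1 := \sum_(p <- A) _; set S2 := \sum_(0 <= i < m) _ => hlt.
have S10 : 0 <= S1 by apply: Rsum_ge0 => p _; apply: Rmult_le_pos => //; apply: pow2_ge_0.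
have S20 : 0 <= S2 by apply: Rsum_ge0 => i _; apply: pow2_ge_0.
have tot : S1 + S2 <= 4 * B.
  apply: (Rmult_le_reg_r E) => //; move: hlt; rewrite /=; lra.
split; first lra.
move=> i hi; apply: Rle_trans (_ : S2 <= _); last lra.
rewrite /S2 (bigD1_seq i) ?mem_index_iota ?iota_uniq //= -[X in X <= _]Rplus_0_r.
by apply: Rplus_le_compat_l; apply: Rsum_ge0 => j _; apply: (pow2_ge_0 (Cmod _)).
Qed.

(** * Prescribed phases *)

Definition large_nat (P : nat -> Prop) : Prop := exists K0, forall K, (K0 <= K)%N -> P K.

Lemma large_and P Q : large_nat P -> large_nat Q -> large_nat (fun K => P K /\ Q K).
Proof.
move=> [a ha] [b hb]; exists (maxn a b) => K; rewrite geq_max => /andP[h1 h2].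
by split; [apply: ha | apply: hb].
Qed.

Lemma large_impl (P Q : nat -> Prop) : (forall K, P K -> Q K) -> large_nat P -> large_nat Q.
Proof. by move=> h [a ha]; exists a => K /ha /h. Qed.

Lemma large_ge (M : R) : large_nat (fun K => M <= INR K).
Proof.
have [n [_ hn]] := nfloor_ex (Rabs M) (Rabs_pos M).
exists n.+1 => K hK; have := INR_leq hK; rewrite S_INR; have := Rle_abs M; lra.
Qed.

Lemma large_exp (a : nat) (c : R) : 0 < c ->
  large_nat (fun K => exp (- (c * INR K)) <= / INR K ^ a).
Proof.
move=> c0; have a1 := INR_ge1 (ltn0Sn a).
set g := 2 * INR a.+1 / c; have g0 : 0 < g by apply: Rdiv_lt_0_compat; lra.
set Q := g ^ a; have Q0 : 0 < Q by apply: pow_lt.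
apply: large_impl (large_and (large_ge 1) (large_ge (2 * Q / c))) => K [k1 kQ].
set x := INR K in k1 kQ *.
have xa : 0 < x ^ a by apply: pow_lt; lra.
have h1 : x <= g * exp (x / g).
  have := Rmult_le_compat_l g _ _ (Rlt_le _ _ g0) (exp_ineq1_le (x / g)).
  by rewrite (_ : g * (1 + x / g) = g + x); [lra | field; lra].
have h2 : x ^ a <= Q * exp (c * x / 2).
  have x0 : 0 <= x by lra.
  apply: Rle_trans (pow_incr _ _ a (conj x0 h1)) _.
  rewrite Rpow_mult_distr; apply: Rmult_le_compat_l; first exact: Rlt_le.
  rewrite -(exp_ln (exp (x / g) ^ a)); last by apply: pow_lt; apply: exp_pos.
  rewrite ln_pow ?ln_exp; last by apply: exp_pos.
  apply: exp_le_compat; rewrite /g.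
  have -> : INR a * (x / (2 * INR a.+1 / c)) = (c * x / 2) * (INR a / INR a.+1) by field; lra.
  rewrite -[X in _ <= X]Rmult_1_r; apply: Rmult_le_compat_l; first by apply: Rmult_le_pos; nra.
  by apply/Rle_div_l; [lra | rewrite S_INR; lra].
have h3 : Q <= exp (c * x / 2).
  have := exp_ineq1_le (c * x / 2); have : 2 * Q <= x * c by apply/Rle_div_l.
  lra.
have h4 : x ^ a <= exp (c * x).
  apply: Rle_trans h2 _; rewrite [X in _ <= exp X](_ : c * x = c * x / 2 + c * x / 2); last by field.
  by rewrite exp_plus; apply: Rmult_le_compat_r => //; left; apply: exp_pos.
by rewrite exp_Ropp; apply: Rinv_le_contravar.
Qed.

Lemma npw_efl_le (r c : R) : 0 <= r -> 0 <= c -> npw (efl r) c <= exp (c - c * r).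
Proof.
move=> r0 c0; apply: exp_le_compat; have := ln_efl r0; nra.
Qed.

Lemma gt_efl_ln (n : nat) (r : R) : (efl r < n)%N -> r < ln (INR n).
Proof.
move=> h; apply: Rnot_le_lt => h2; have n0 : (0 < n)%N by lia.
have /leq_efl := h2 => /(_ n0); lia.
Qed.

(** 53 = 25 + 28, the errors of the lower bound at b and of the upper bound at a; p^(-d) is at least
    b^(-d) throughout. *)
Lemma prime_interval_sum_ge (a b : nat) (d : R) : (0 < a)%N -> (a <= b)%N -> 0 <= d ->
  npw b d * (ln (INR b) - ln (INR a) - 53) <=
  \sum_(a.+1 <= p < b.+1 | prime p) ln (INR p) * npw p (1 + d).
Proof.
move=> a0 ab d0; have b0 : (0 < b)%N by lia.
have h1 := prime_sum_ge b0; have h2 := prime_sum_le a0.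
rewrite (big_cat_nat _ (m := 0) (n := a.+1) (p := b.+1)) //= in h1.
have h3 : ln (INR b) - ln (INR a) - 53 <= \sum_(a.+1 <= p < b.+1 | prime p) ln (INR p) * / INR p by lra.
apply: Rle_trans (Rmult_le_compat_l _ _ _ (Rlt_le _ _ (npw_gt0 b d)) h3) _.
rewrite big_distrr; apply: Rsum_le_seq => p; rewrite mem_index_iota => /andP[hp1 hp2] hp /=.
have p0 := prime_gt0 hp; rewrite npw_plus npw_1 //.
have : npw b d <= npw p d by apply: npw_anti.
have : 0 <= ln (INR p) * / INR p.
  by apply: Rmult_le_pos; [exact: ln_INR_ge0 | left; apply: Rinv_0_lt_compat; have := INR_ge1 p0; lra].
move=> h4 h5; have := Rmult_le_compat_r _ _ _ h4 h5; lra.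
Qed.

(** A discrete intermediate value argument: terms of size at most mu are added until m is reached,
    overshooting by at most mu. *)
Lemma sum_prefix_select (F : nat -> R) (a b : nat) (m mu : R) : (a <= b)%N ->
  0 <= m -> 0 <= mu -> (forall n, (a < n)%N -> (n <= b)%N -> F n <= mu) ->
  m <= \sum_(a.+1 <= n < b.+1) F n ->
  exists c, (a <= c)%N /\ (c <= b)%N /\ m <= \sum_(a.+1 <= n < c.+1) F n <= m + mu.
Proof.
move=> ab m0 mu0; elim: b ab => [|b IH] ab hF hm.
  exists a; split=> //; split=> //.
  by move: hm; rewrite !big_geq //; lra.
move: ab; rewrite leq_eqVlt => /orP[/eqP e|ab].
  by exists a; rewrite e; split=> //; split=> //; move: hm; rewrite e big_geq //; lra.
have [h|h] := Rle_lt_dec m (\sum_(a.+1 <= n < b.+1) F n).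
  have [c [h1 [h2 h3]]] := IH ab (fun n h1 h2 => hF n h1 (leqW h2)) h.
  by exists c; split=> //; split=> //; apply: leqW.
exists b.+1; split; first exact: ltnW; split=> //.
move: hm; rewrite big_nat_recr //= => hm; split=> //.
by have := hF b.+1 ab (leqnn _); lra.
Qed.

(** The sum of w^j over j >= 1; [lfac2] is the sum of j w^j. At w = p^(-s), multiplied by ln p and
    (ln p)^2, they are the contributions of the powers of p to F and to -F'. *)
Definition lfac (w : C) : C := (w / (1 - w))%C.
Definition lfac2 (w : C) : C := (w / ((1 - w) * (1 - w)))%C.

Lemma one_minus_neq0 (w : C) : Cmod w <= / 2 -> (1 - w)%C <> 0 /\ / 2 <= Cmod (1 - w)%C.
Proof.
move=> hw; have h : / 2 <= Cmod (1 - w)%C.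
  have : Cmod 1 <= Cmod (1 - w)%C + Cmod w.
    by apply: Rle_trans (Cmod_triangle _ _); right; congr Cmod; ring.
  by rewrite Cmod_1; lra.
by split=> // e; rewrite e Cmod_0 in h; lra.
Qed.

Lemma lfac_approx (w : C) : Cmod w <= / 2 -> Cmod (lfac w - w)%C <= 2 * Cmod w ^ 2.
Proof.
move=> hw; have [n0 h] := one_minus_neq0 hw.
have -> : (lfac w - w = w * w / (1 - w))%C by rewrite /lfac; field.
rewrite Cmod_div // Cmod_mult; apply/Rle_div_l; first lra.
by have := Cmod_ge_0 w; nra.
Qed.

Lemma lfac2_approx (w : C) : Cmod w <= / 2 -> Cmod (lfac2 w - w)%C <= 10 * Cmod w ^ 2.
Proof.
move=> hw; have [n0 h] := one_minus_neq0 hw.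
have -> : (lfac2 w - w = w * w * (2 - w) / ((1 - w) * (1 - w)))%C by rewrite /lfac2; field.
have c0 := Cmod_ge_0 w.
have n1 : ((1 - w) * (1 - w))%C <> 0 by apply: Cmult_neq_0.
have t : Cmod (2 - w)%C <= 5 / 2.
  apply: Rle_trans (Cmod_triangle _ _) _; rewrite Cmod_opp Cmod_R Rabs_pos_eq; lra.
rewrite Cmod_div // !Cmod_mult; apply/Rle_div_l; first nra.
have c2 : 0 <= Cmod w * Cmod w by nra.
have : / 4 <= Cmod (1 - w)%C * Cmod (1 - w)%C by nra.
have := Cmod_ge_0 (2 - w)%C; rewrite /= Rmult_1_r; set P := Cmod w * Cmod w in c2 *.
by move=> h1 h2; nra.
Qed.

Lemma lfac_lip (w v : C) : Cmod w <= / 2 -> Cmod v <= / 2 ->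
  Cmod (lfac w - lfac v)%C <= 4 * Cmod (w - v)%C.
Proof.
move=> hw hv; have [n0 h] := one_minus_neq0 hw; have [m0 h'] := one_minus_neq0 hv.
have -> : (lfac w - lfac v = (w - v) / ((1 - w) * (1 - v)))%C by rewrite /lfac; field.
rewrite Cmod_div; last exact: Cmult_neq_0.
rewrite Cmod_mult; apply/Rle_div_l; first nra.
have : / 4 <= Cmod (1 - w)%C * Cmod (1 - v)%C by nra.
by have := Cmod_ge_0 (w - v)%C; nra.
Qed.

Lemma lfac2_lip (w v : C) : Cmod w <= / 2 -> Cmod v <= / 2 ->
  Cmod (lfac2 w - lfac2 v)%C <= 20 * Cmod (w - v)%C.
Proof.
move=> hw hv; have [n0 h] := one_minus_neq0 hw; have [m0 h'] := one_minus_neq0 hv.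
have -> : (lfac2 w - lfac2 v = (w - v) * (1 - w * v) / (((1 - w) * (1 - w)) * ((1 - v) * (1 - v))))%C.
  by rewrite /lfac2; field.
rewrite Cmod_div; last by repeat apply: Cmult_neq_0.
have t : Cmod (1 - w * v)%C <= 5 / 4.
  apply: Rle_trans (Cmod_triangle _ _) _; rewrite Cmod_opp Cmod_1 Cmod_mult.
  by have := Cmod_ge_0 w; have := Cmod_ge_0 v; nra.
rewrite !Cmod_mult.
set a := Cmod (1 - w)%C in h *; set b := Cmod (1 - v)%C in h' *.
have a2 : / 4 <= a * a by nra.
have b2 : / 4 <= b * b by nra.
have ab : / 16 <= a * a * (b * b) by nra.
apply/Rle_div_l; first nra.
have c0 := Cmod_ge_0 (w - v)%C; set P := Cmod (w - v)%C in c0 *.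
have : P * Cmod (1 - w * v)%C <= P * (5 / 4) by apply: Rmult_le_compat_l.
have : P * / 16 <= P * (a * a * (b * b)) by apply: Rmult_le_compat_l.
lra.
Qed.

Lemma prime_INR_ge2 p : prime p -> 2 <= INR p.
Proof. by move=> /prime_gt1 h; have := INR_leq h; rewrite [INR 2]/=. Qed.

Lemma Cmod_phase_le (z : C) (p : nat) (s : R) : Cmod z = 1 -> prime p -> 1 <= s ->
  Cmod (z * npw p s)%C <= / INR p /\ / INR p <= / 2.
Proof.
move=> hz hp hs; split; last by apply: Rinv_le_contravar; [lra | exact: prime_INR_ge2].
rewrite Cmod_mult hz Cmod_R Rabs_pos_eq; last by left; apply: npw_gt0.
by rewrite Rmult_1_l; apply: npw_leV => //; apply: prime_gt0.
Qed.

(* Replacing [lfac w], [lfac2 w] by [w] costs a convergent sum over prime squares. *)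
Lemma lfac_sum_approx (A : seq nat) (z : nat -> C) (s : R) (j : nat) (g : C -> C) (c : R) (B : R) :
  all prime A -> (forall p, Cmod (z p) = 1) -> 1 <= s -> 0 <= c ->
  (forall w, Cmod w <= / 2 -> Cmod (g w - w)%C <= c * Cmod w ^ 2) ->
  \sum_(p <- A) ln (INR p) ^ j * npw p 2 <= B ->
  Cmod (\sum_(p <- A) RtoC (ln (INR p) ^ j)%R * g (z p * npw p s) -
        \sum_(p <- A) RtoC (ln (INR p) ^ j)%R * (z p * npw p s))%C <= c * B.
Proof.
move=> pA hz hs c0 hg hB; rewrite -Csum_minus.
apply: Rle_trans (Cmod_sum_le _ _ _) _.
apply: Rle_trans (Rmult_le_compat_l _ _ _ c0 hB); rewrite big_distrr.
apply: (Rsum_le_all pA) => p hp /=.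
have [h1 h2] := Cmod_phase_le (hz p) hp hs.
have l0 : 0 <= ln (INR p) ^ j by apply: pow_le; apply: ln_INR_ge0.
rewrite (_ : forall a b e : C, a * b - a * e = a * (b - e))%C; last by move=> *; ring.
rewrite Cmod_mult Cmod_R Rabs_pos_eq //.
have := hg (z p * npw p s)%C ltac:(lra) => h3.
have h4 : Cmod (z p * npw p s)%C ^ 2 <= npw p 2.
  rewrite npw_2 ?prime_gt0 // -pow_inv; apply: pow_incr; split => //; exact: Cmod_ge_0.
apply: Rle_trans (Rmult_le_compat_l _ _ _ l0 h3) _.
have := Rmult_le_compat_l _ _ _ (Rmult_le_pos _ _ l0 c0) h4; lra.
Qed.

Lemma abel_incr_le (b : nat -> C) (w : nat -> R) (m N : nat) (B : R) : (m <= N)%N ->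
  (forall n, (m <= n)%N -> 0 <= w n <= w n.+1) ->
  (forall M, Cmod (\sum_(m <= n < M) b n)%C <= B) ->
  Cmod (\sum_(m <= n < N) b n * w n)%C <= 2 * B * w N.
Proof.
move=> h hw hB; have B0 : 0 <= B by have := Cmod_ge_0 (\sum_(m <= n < m) b n)%C; have := hB m; lra.
have wN := hw N h.
rewrite abel_sum //; apply: Rle_trans (Cmod_triangle _ _) _.
rewrite Cmod_mult Cmod_R Rabs_pos_eq; last lra.
have h1 : Cmod (\sum_(m <= n < N) (\sum_(m <= k < n.+1) b k) * RtoC (w n - w n.+1)%R)%C <= B * (w N - w m).
  apply: Rle_trans (Cmod_sum_le _ _ _) _.
  apply: Rle_trans (_ : \sum_(m <= n < N) B * (w n.+1 - w n) <= _).
    apply: Rsum_le_nat => n /andP[hn _]; have := hw n hn => h2.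
    rewrite Cmod_mult Cmod_R Rabs_minus_sym Rabs_pos_eq; last lra.
    by apply: Rmult_le_compat_r; [lra | apply: hB].
  rewrite -big_distrr /=; apply: Rmult_le_compat_l => //; right.
  elim: N h {wN} => [|N IH]; first by rewrite leqn0 => /eqP ->; rewrite big_geq //; ring.
  rewrite leq_eqVlt => /orP[/eqP ->|]; first by rewrite big_geq //; ring.
  by rewrite ltnS => h; rewrite big_nat_recr //= IH //; ring.
have := Rmult_le_compat_r _ _ _ (proj1 wN) (hB N).
have := hw m (leqnn m); nra.
Qed.

Section Phases.
Variables (q : nat) (X : nat -> C) (a : nat).
Hypotheses (q0 : (0 < q)%N) (hX : nat_character q X).
Hypotheses (ca : coprime a q) (Xa : X a <> 1).

(** Chosen so that X p times the phase is -1. At p dividing q, where X p = 0, any unimodular value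
    would do. *)
Definition base_phase (p : nat) : C := if coprime p q then (- Cconj (X p))%C else RtoC 1.

Lemma base_phase_unit p : Cmod (base_phase p) = 1.
Proof.
rewrite /base_phase; case hc: (coprime p q); last exact: Cmod_1.
by rewrite Cmod_opp Cmod_conj (nchar_Cmod q0 hX).
Qed.

Lemma base_phase_mul p : coprime p q -> (X p * base_phase p = - (1))%C.
Proof.
move=> hc; rewrite /base_phase hc.
have -> : (X p * - Cconj (X p) = - (X p * Cconj (X p)))%C by ring.
by rewrite -Cmod2_conj (nchar_Cmod q0 hX) // pow1.
Qed.

Lemma primes_le_Csum (N : nat) (F : nat -> C) :
  (\sum_(p <- primes_le N) F p = \sum_(1 <= n < N.+1) if prime n then F n else RtoC 0)%C.
Proof. by rewrite /primes_le big_filter big_mkcond big_ltn //= Cplus_0_l. Qed.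

Lemma primes_le_sum1 (N : nat) (F : nat -> R) :
  \sum_(p <- primes_le N) F p = \sum_(1 <= n < N.+1) if prime n then F n else 0.
Proof. by rewrite /primes_le big_filter big_mkcond big_ltn //= Rplus_0_l. Qed.

(** Mertens' theorem for chi, freed of proper prime powers, bounds the partial sums of chi(p) ln p /
    p. Summation by parts adds the decreasing weight p^(-d) at no cost and the increasing weight ln
    p at the cost of a logarithm. *)
Lemma prime_nchar_sums : exists B, 0 <= B /\ forall N (d : R), 0 < d ->
  Cmod (\sum_(p <- primes_le N) RtoC (ln (INR p) ^ 1)%R * (X p * npw p (1 + d)))%C <= B /\
  Cmod (\sum_(p <- primes_le N) RtoC (ln (INR p) ^ 2)%R * (X p * npw p (1 + d)))%C
    <= 2 * B * ln (INR N.+1).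
Proof.
have [B [B0 hB]] := mertens_nchar_bounded q0 hX ca Xa.
exists (B + 24); split; first lra.
pose b n : C := if prime n then (ln (INR n) * (X n * RtoC (/ INR n)%R))%C else RtoC 0.
have hb M : Cmod (\sum_(1 <= n < M) b n)%C <= B + 24.
  case: M => [|N]; first by rewrite big_geq // Cmod_0; lra.
  have := @vonM_prime_sum N (fun n => X n * RtoC (/ INR n)%R)%C.
  have hg n : (0 < n)%N -> Cmod (X n * RtoC (/ INR n)%R)%C <= / INR n.
    move=> n0; have n1 := INR_ge1 n0; have i0 : 0 < / INR n by apply: Rinv_0_lt_compat; lra.
    rewrite Cmod_mult Cmod_R Rabs_pos_eq; last lra.
    by have := nchar_le1 q0 hX n; have := Cmod_ge_0 (X n); nra.
  move=> /(_ hg) h1; have h2 := hB N.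
  rewrite -[X in Cmod (_ - X)](big_filter _ prime) -/(primes_le N) primes_le_Csum in h1.
  set S := (\sum_(1 <= n < N.+1) b n)%C; set T := (\big[_/_]_(_ <= _ < _) (vonM _ * _))%C in h1 h2.
  have : Cmod S <= Cmod T + Cmod (T - S)%C.
    rewrite -(Cmod_opp (T - S)); apply: Rle_trans (Cmod_triangle _ _); right; congr Cmod; ring.
  by rewrite -/S in h1; lra.
move=> N d d0.
have hb' M : Cmod (\sum_(1 <= n < M) b n * npw n d)%C <= B + 24.
  rewrite -[X in _ <= X]Rmult_1_r -[X in _ <= _ * X](npw_1n d).
  apply: (@abel_le b (fun n => npw n d) 1 M) => //; last by left; apply: npw_gt0.
  move=> n n1; split; first by left; apply: npw_gt0.
  by apply: npw_anti => //; lra.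
split.
  rewrite primes_le_Csum; have := hb' N.+1; congr (_ <= _); congr Cmod.
  apply: eq_big_nat => n /andP[n0 _]; rewrite /b; case: ifP => _; last by ring.
  by rewrite pow_1 npw_plus npw_1 // RtoC_mult; ring.
rewrite primes_le_Csum.
have := @abel_incr_le (fun n => b n * npw n d)%C (fun n => ln (INR n)) 1 N.+1 (B + 24) isT _ hb'.
have hw n : (1 <= n)%N -> 0 <= ln (INR n) <= ln (INR n.+1).
  move=> n1; split; first exact: ln_INR_ge0.
  by apply: ln_le; [have := INR_ge1 n1; lra | apply: INR_leq].
move=> /(_ hw); congr (_ <= _); congr Cmod.
apply: eq_big_nat => n /andP[n0 _]; rewrite /b; case: ifP => _; last by ring.
by rewrite npw_plus npw_1 // (RtoC_mult (/ _)) RtoC_pow /=; ring.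
Qed.

Lemma prime_divisors_sum_le (N j : nat) (d : R) : 0 < d ->
  \sum_(p <- primes_le N) ln (INR p) ^ j * (if coprime p q then 0 else npw p (1 + d)) <=
  \sum_(1 <= n < q.+1) ln (INR n) ^ j.
Proof.
move=> d0; rewrite primes_le_sum1.
have lj n : 0 <= ln (INR n) ^ j by apply: pow_le; apply: ln_INR_ge0.
apply: Rle_trans (_ : \sum_(1 <= n < N.+1) (if (n <= q)%N then ln (INR n) ^ j else 0) <= _).
  apply: Rsum_le_nat => n /andP[n0 _]; have := lj n.
  case hp: (prime n); last by case: ifP => _; lra.
  rewrite (prime_coprime q hp); case hd: (n %| q) => /=.
    by rewrite (dvdn_leq q0 hd) => h; have := npw_le1 n (x := 1 + d) ltac:(lra); nra.
  by case: ifP => _; lra.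
apply: Rle_trans (_ : \sum_(1 <= n < (maxn N q).+1) (if (n <= q)%N then ln (INR n) ^ j else 0) <= _).
  by apply: Rsum_widen => [|n _]; [lia | case: ifP => _; [exact: lj | lra]].
rewrite (big_cat_nat _ (n := q.+1)) //=; last by lia.
rewrite [X in _ + X]big1_seq ?Rplus_0_r => [|n /andP[_]]; last first.
  by rewrite mem_index_iota => /andP[h _]; rewrite leqNgt h.
by apply: Rsum_le_nat => n /andP[_]; rewrite ltnS => ->; lra.
Qed.

Lemma primes_sq_sum_le (N j : nat) :
  \sum_(p <- primes_le N) ln (INR p) ^ j * npw p 2 <= log_sum_bound j 1.
Proof.
rewrite primes_le_sum1; apply: Rle_trans (ln_pow_sum_le j N.+1 Rlt_0_1).
apply: Rsum_le_nat => n _; rewrite -/(1 + 1).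
case: ifP => _; first by right.
apply: Rmult_le_pos; [apply: pow_le; apply: ln_INR_ge0 | left; apply: npw_gt0].
Qed.

(** The base phases are -conj chi(p), so these sums are conjugates of those in [prime_nchar_sums],
    up to the finitely many p dividing q and the squares of primes. The bound W is independent of
    both N and d. *)
Lemma base_phase_sums : exists W, 0 <= W /\ forall N (d : R), 0 < d ->
  Cmod (\sum_(p <- primes_le N) RtoC (ln (INR p) ^ 1)%R * lfac (base_phase p * npw p (1 + d)))%C <= W /\
  Cmod (\sum_(p <- primes_le N) RtoC (ln (INR p) ^ 2)%R * lfac2 (base_phase p * npw p (1 + d)))%C
    <= W * (1 + ln (INR N.+1)).
Proof.
have [B [B0 hB]] := prime_nchar_sums.
pose D j := \sum_(1 <= n < q.+1) ln (INR n) ^ j.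
have D0 j : 0 <= D j by apply: Rsum_ge0 => n _; apply: pow_le; apply: ln_INR_ge0.
have L1 := log_sum_bound_ge0 1 Rlt_0_1; have L2 := log_sum_bound_ge0 2 Rlt_0_1.
have split_phase j N d S : 0 < d ->
   Cmod (\sum_(p <- primes_le N) RtoC (ln (INR p) ^ j)%R * (X p * npw p (1 + d)))%C <= S ->
   Cmod (\sum_(p <- primes_le N) RtoC (ln (INR p) ^ j)%R * (base_phase p * npw p (1 + d)))%C <= S + D j.
  move=> d0 hS.
  have -> : (\sum_(p <- primes_le N) RtoC (ln (INR p) ^ j)%R * (base_phase p * npw p (1 + d)) =
     - Cconj (\sum_(p <- primes_le N) RtoC (ln (INR p) ^ j)%R * (X p * npw p (1 + d))) +
     RtoC (\sum_(p <- primes_le N) ln (INR p) ^ j * (if coprime p q then 0 else npw p (1 + d)))%R)%C.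
    rewrite Cconj_sum RtoC_sum -Csum_opp -big_split; apply: eq_bigr => p _ /=.
    have cR (r : R) : Cconj (RtoC r) = RtoC r by rewrite /Cconj /= Ropp_0.
    rewrite !Cmult_conj !cR RtoC_mult /base_phase; case hc: (coprime p q).
      by ring.
    by rewrite (nchar_not_coprime hX) ?hc // (cR 0); ring.
  apply: Rle_trans (Cmod_triangle _ _) _; rewrite Cmod_opp Cmod_conj Cmod_R.
  apply: Rplus_le_compat => //; rewrite Rabs_pos_eq; first exact: prime_divisors_sum_le.
  apply: Rsum_ge0 => p _; apply: Rmult_le_pos; first by apply: pow_le; apply: ln_INR_ge0.
  by case: ifP => _; [lra | left; apply: npw_gt0].
exists (2 * B + D 1%N + D 2%N + 2 * log_sum_bound 1 1 + 10 * log_sum_bound 2 1).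
have := D0 1%N; have := D0 2%N => d2 d1.
split; first lra.
move=> N d d0; have [h1 h2] := hB N d d0.
have l0 := ln_INR_ge0 N.+1.
have s1 : 1 <= 1 + d by lra.
split.
  have A := lfac_sum_approx (primes_le_prime N) base_phase_unit s1 (ltac:(lra) : 0 <= 2) lfac_approx (primes_sq_sum_le N 1).
  have A2 := split_phase 1%N N d B d0 h1.
  set S := (\sum_(p <- primes_le N) _)%C in A *; set T := (\sum_(p <- primes_le N) _)%C in A A2.
  rewrite (_ : S = (S - T) + T)%C; last by ring.
  by apply: Rle_trans (Cmod_triangle _ _) _; lra.
have A := lfac_sum_approx (primes_le_prime N) base_phase_unit s1 (ltac:(lra) : 0 <= 10) lfac2_approx (primes_sq_sum_le N 2).
have A2 := split_phase 2%N N d _ d0 h2.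
set S := (\sum_(p <- primes_le N) _)%C in A *; set T := (\sum_(p <- primes_le N) _)%C in A A2.
rewrite (_ : S = (S - T) + T)%C; last by ring.
apply: Rle_trans (Cmod_triangle _ _) _; nra.
Qed.

End Phases.

Lemma exp_half_le2 : exp (/ 2) <= 2.
Proof.
apply: Rnot_lt_le => h; have e : exp 1 = exp (/ 2) * exp (/ 2) by rewrite -exp_plus; congr exp; field.
have := exp_le_3; nra.
Qed.

Lemma npw_efl_half_le (r : R) : 0 <= r -> npw (efl r) (1 / 2) <= 2 * exp (- (/ 2 * r)).
Proof.
move=> r0; apply: Rle_trans (npw_efl_le r0 (ltac:(lra) : 0 <= 1 / 2)) _.
rewrite (_ : 1 / 2 - 1 / 2 * r = / 2 + - (/ 2 * r)); last by field.
by rewrite exp_plus; apply: Rmult_le_compat_r exp_half_le2; left; apply: exp_pos.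
Qed.

(** On the blocks the linearisation error of [lfac] must be far below any used power of 1/k, not
    just bounded; the squares of primes beyond e^r provide this. *)
Lemma interval_sq_sum_le (I : seq nat) (r : R) (j : nat) : 0 <= r -> uniq I ->
  (forall p, p \in I -> (efl r < p)%N) ->
  \sum_(p <- I) ln (INR p) ^ j * npw p 2 <=
  (2 * INR j.+1 / 1) ^ j * (2 / 1) * (2 * exp (- (/ 2 * r))).
Proof.
move=> r0 uI hI.
have F0 n : 0 <= ln (INR n) ^ j * npw n (1 + 1).
  by apply: Rmult_le_pos; [apply: pow_le; apply: ln_INR_ge0 | left; apply: npw_gt0].
pose N := (sumn I).+1.
have hN p : p \in I -> (p < N)%N by move=> hp; rewrite ltnS sumnE (big_rem p) //= leq_addr.
apply: Rle_trans (_ : \sum_((efl r).+1 <= n < N) ln (INR n) ^ j * npw n (1 + 1) <= _).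
  apply: Rle_trans (_ : \sum_((efl r).+1 <= n < N | n \in I) ln (INR n) ^ j * npw n (1 + 1) <= _).
    rewrite -[X in _ <= X]big_filter; right; apply: perm_big; apply: uniq_perm => //.
      by rewrite filter_uniq ?iota_uniq.
    move=> p; rewrite mem_filter mem_index_iota; case hp: (p \in I) => //=.
    by rewrite hI ?hN.
  by apply: Rsum_sub.
apply: Rle_trans (ln_pow_tail j N Rlt_0_1 (efl_gt0 r0)) _.
apply: Rmult_le_compat_l; last exact: npw_efl_half_le.
by apply: Rmult_le_pos; [apply: ln_pow_const_ge0; lra | lra].
Qed.

(** The factor 2 in 2m pays for p^(-d) >= 1/2, and 54 is 53 plus 1 for rounding e^s. A single prime
    weighs at most 2t e^(-t), as ln p <= s <= 2t and p > e^r >= e^t. *)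
Lemma prime_interval_select (r s t m d : R) : 1 <= r -> r <= s -> 0 <= m -> 0 <= d ->
  d * s <= / 2 -> 2 * m <= s - r - 54 -> s <= 2 * t -> t <= r ->
  exists c, (efl r <= c)%N /\ (c <= efl s)%N /\
  m <= \sum_(p <- [seq p <- index_iota (efl r).+1 c.+1 | prime p]) ln (INR p) * npw p (1 + d)
    <= m + 2 * t * exp (- t).
Proof.
move=> r1 rs m0 d0 ds hm st tr.
pose F n := if prime n then ln (INR n) * npw n (1 + d) else 0.
have r0 : (0 < efl r)%N by apply: efl_gt0; lra.
have hle : (efl r <= efl s)%N by apply: efl_mono.
have hF : m <= \sum_((efl r).+1 <= n < (efl s).+1) F n.
  rewrite /F -big_mkcond; apply: Rle_trans (prime_interval_sum_ge r0 hle d0).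
  have [_ h1] := ln_efl (ltac:(lra) : 0 <= r); have [h2 h3] := ln_efl (ltac:(lra) : 0 <= s).
  have h4 : / 2 <= npw (efl s) d.
    have := exp_ineq1_le (- d * ln (INR (efl s))); rewrite -/(npw _ _).
    have : d * ln (INR (efl s)) <= d * s by apply: Rmult_le_compat_l.
    lra.
  have : / 2 * (2 * m) <= npw (efl s) d * (ln (INR (efl s)) - ln (INR (efl r)) - 53).
    by apply: Rmult_le_compat; lra.
  lra.
have mu0 : 0 <= 2 * t * exp (- t) by apply: Rmult_le_pos; [lra | left; apply: exp_pos].
have hmu n : (efl r < n)%N -> (n <= efl s)%N -> F n <= 2 * t * exp (- t).
  move=> h1 h2; rewrite /F; case: ifP => // hp; have n0 := prime_gt0 hp.
  have l1 := gt_efl_ln h1; have l2 : ln (INR n) <= s by apply/leq_efl.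
  have n1 := INR_ge1 n0.
  have b1 : npw n (1 + d) <= exp (- t).
    apply: exp_le_compat; nra.
  have := npw_gt0 n (1 + d); have := ln_INR_ge0 n => h3 h4.
  by apply: Rmult_le_compat; lra.
have [c [h1 [h2 h3]]] := sum_prefix_select hle m0 mu0 hmu hF.
exists c; split=> //; split=> //.
by rewrite big_filter; move: h3; rewrite /F -big_mkcond.
Qed.

Section Phase_choice.
Variables (q : nat) (X : nat -> C) (a : nat).
Hypotheses (q0 : (0 < q)%N) (hX : nat_character q X).
Hypotheses (ca : coprime a q) (Xa : X a <> 1).

Lemma phases (eta : R) : 0 < eta <= / 3 -> exists M, 0 <= M /\
  large_nat (fun K => exists (I : seq nat) (z : nat -> C),
    let A := primes_le (efl (INR K)) ++ I in
    let s := 1 + / INR K ^ 3 in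
    uniq I /\ all prime I /\
    (forall p, p \in I -> (efl (INR K) < p)%N /\ (p <= efl ((1 + 3 * eta) * INR K))%N) /\
    (forall p, Cmod (z p) = 1) /\
    (forall p, p \in primes_le (efl (INR K)) -> coprime p q -> (X p * z p = - (1))%C) /\
    \sum_(p <- I) ln (INR p) * npw p s <= M /\
    Cmod (\sum_(p <- A) RtoC (ln (INR p) ^ 1)%R * lfac (z p * npw p s))%C <= / INR K ^ 40 /\
    INR K <= Cmod (\sum_(p <- A) RtoC (ln (INR p) ^ 2)%R * lfac2 (z p * npw p s))%C).
Proof.
move=> heta; have [W [W0 hW]] := base_phase_sums q0 hX ca Xa.
(* The second moments of the blocks differ by at least (1 + 2 eta) k (m1 - W) - (1 + eta) k m1,
   whose leading term is eta k m1 >= k (6W + 1500). The 6W covers the loss of W and the second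
   moment, at most 3kW, of the base primes; the 1500 covers the linearisation error 1440. *)
pose M := (6 * W + 1500) / eta.
have Meta : M * eta = 6 * W + 1500 by rewrite /M; field; lra.
have M0 : 6 * W + 1500 <= M.
  by apply/Rle_div_r; [lra | nra].
(* The total mass is m1 + m2, with m1 close to M and m2 close to |v| <= m1 + W. *)
exists (2 * M + W + 3); split; first lra.
(* Each block has logarithmic length eta K, which must exceed twice its mass plus 54. *)
apply: large_impl (large_and (large_and (large_ge 100) (large_ge ((4 * M + 4 * W + 100) / eta)))
   (large_exp 50 (ltac:(lra) : 0 < / 2))) => K [[k100 kM] hexp].
set k := INR K in k100 kM hexp *; set d := / k ^ 3.
have k3 : 0 < k ^ 3 by apply: pow_lt; lra.
have d0 : 0 < d by apply: Rinv_0_lt_compat.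
have dk : d * (3 * k) <= / 2.
  have -> : d * (3 * k) = 3 / k ^ 2 by rewrite /d; field; lra.
  apply/Rle_div_l; nra.
have keta : 4 * M + 4 * W + 100 <= k * eta by apply/Rle_div_l; lra.
set e2 := exp (- (/ 2 * k)) in hexp.
have e20 : 0 < e2 by apply: exp_pos.
have ek : exp (- k) <= e2 by apply: exp_le_compat; lra.
have k50 : 0 < k ^ 50 by apply: pow_lt; lra.
have ksmall : k * e2 <= / k ^ 49.
  apply: Rle_trans (Rmult_le_compat_l k _ _ ltac:(lra) hexp) _.
  right; rewrite -[k ^ 50]/(k * k ^ 49); field; lra.
have k49 : / k ^ 49 <= / k.
  apply: Rinv_le_contravar; first lra.
  by rewrite -{1}(pow_1 k); apply: Rle_pow; [lra | lia].
have kinv : / k <= / 100 by apply: Rinv_le_contravar; lra.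
have mu1 : 2 * k * exp (- k) <= 2 * / k ^ 49.
  have : k * exp (- k) <= k * e2 by apply: Rmult_le_compat_l; lra.
  lra.
have kek : k * eta <= k / 3 by have : eta * k <= / 3 * k; [apply: Rmult_le_compat_r; lra | lra].
have [c1 [c1a [c1b c1m]]] := @prime_interval_select k ((1 + eta) * k) k M d ltac:(lra) ltac:(lra)
   ltac:(lra) ltac:(lra) ltac:(nra) ltac:(lra) ltac:(lra) ltac:(lra).
set I1 := [seq p <- index_iota (efl k).+1 c1.+1 | prime p] in c1m.
set m1 := \sum_(p <- I1) _ in c1m.
pose A0 := primes_le (efl k).
set w0 := (\sum_(p <- A0) RtoC (ln (INR p) ^ 1)%R * lfac (base_phase q X p * npw p (1 + d)))%C.
have [hw0 hw1] := hW (efl k) d d0; rewrite -/A0 -/w0 in hw0 hw1.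
set v := (w0 + RtoC m1)%C.
have vge : m1 - W <= Cmod v.
  have : Cmod (RtoC m1) <= Cmod v + Cmod w0.
    rewrite -(Cmod_opp w0); apply: Rle_trans (Cmod_triangle _ _); right; congr Cmod; rewrite /v; ring.
  by rewrite Cmod_R Rabs_pos_eq; lra.
have vle : Cmod v <= m1 + W.
  by apply: Rle_trans (Cmod_triangle _ _) _; rewrite Cmod_R Rabs_pos_eq; lra.
have [c2 [c2a [c2b c2m]]] := @prime_interval_select ((1 + 2 * eta) * k) ((1 + 3 * eta) * k) k (Cmod v) d
   ltac:(lra) ltac:(lra) ltac:(lra) ltac:(lra) ltac:(nra) ltac:(lra) ltac:(lra) ltac:(lra).
set x2 := efl ((1 + 2 * eta) * k) in c2a c2m *.
set I2 := [seq p <- index_iota x2.+1 c2.+1 | prime p] in c2m.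
set m2 := \sum_(p <- I2) _ in c2m.
have v0 : 0 < Cmod v by lra.
set u := (- (v / RtoC (Cmod v)))%C.
have vC : RtoC (Cmod v) <> 0 by move=> /RtoC_inj; lra.
have hu : Cmod u = 1.
  by rewrite /u Cmod_opp Cmod_div // Cmod_R Rabs_pos_eq; [field; lra | lra].
pose z (p : nat) : C := if (p <= efl k)%N then base_phase q X p else
  if (p <= x2)%N then RtoC 1 else u.
have hz p : Cmod (z p) = 1.
  rewrite /z; case: ifP => _; first exact: base_phase_unit.
  by case: ifP => _; [exact: Cmod_1 | exact: hu].
have y1x2 : (efl ((1 + eta) * k) <= x2)%N by apply: efl_mono; lra.
have xx2 : (efl k <= x2)%N by apply: efl_mono; lra.
have zA0 p : p \in A0 -> z p = base_phase q X p.
  by rewrite mem_primes_le /z => /andP[_ ->].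
have I1p p : p \in I1 -> [&& prime p, (efl k < p)%N & (p <= x2)%N].
  rewrite mem_filter mem_index_iota => /andP[-> /andP[-> h]] /=; lia.
have I2p p : p \in I2 -> [&& prime p, (x2 < p)%N & (p <= efl ((1 + 3 * eta) * k))%N].
  rewrite mem_filter mem_index_iota => /andP[-> /andP[-> h]] /=; lia.
have zI1 p : p \in I1 -> z p = 1.
  by move=> /I1p /and3P[_ h1 h2]; rewrite /z leqNgt h1 /= h2.
have zI2 p : p \in I2 -> z p = u.
  by move=> /I2p /and3P[_ h1 h2]; rewrite /z !ifF //; apply/negbTE; rewrite -ltnNge // (leq_ltn_trans xx2 h1).
pose I := I1 ++ I2.
have uI : uniq I.
  rewrite /I cat_uniq !filter_uniq ?iota_uniq //= andbT.
  by apply/hasPn => p /I2p /and3P[_ h1 _]; apply/negP => /I1p /and3P[_ _ h2]; lia.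
have pI : all prime I.
  by rewrite /I all_cat !filter_all.
have hI p : p \in I -> (efl k < p)%N /\ (p <= efl ((1 + 3 * eta) * k))%N.
  have hx : (x2 <= efl ((1 + 3 * eta) * k))%N by apply: efl_mono; lra.
  by rewrite mem_cat => /orP[/I1p /and3P[_ h1 h2]|/I2p /and3P[_ h1 h2]]; split=> //; lia.
exists I, z; rewrite -/d; split=> //; split=> //; split=> //; split=> //.
split; first by move=> p hp hc; rewrite zA0 //; apply: base_phase_mul.
split; first by rewrite /I big_cat /= -/m1 -/m2; lra.
have s1 : 1 <= 1 + d by lra.
have sq j := interval_sq_sum_le j (ltac:(lra) : 0 <= k) uI (fun p hp => proj1 (hI p hp)).
have lin j : (\sum_(p <- I) RtoC (ln (INR p) ^ j)%R * (z p * npw p (1 + d)) =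
   RtoC (\sum_(p <- I1) ln (INR p) ^ j * npw p (1 + d))%R +
   u * RtoC (\sum_(p <- I2) ln (INR p) ^ j * npw p (1 + d))%R)%C.
  rewrite /I big_cat /= !RtoC_sum big_distrr /=; congr (_ + _)%C.
    by apply: eq_big_seq => p hp; rewrite zI1 // RtoC_mult; ring.
  by apply: eq_big_seq => p hp; rewrite zI2 // RtoC_mult; ring.
have base j (g : C -> C) : (\sum_(p <- A0) RtoC (ln (INR p) ^ j)%R * g (z p * npw p (1 + d)) =
    \sum_(p <- A0) RtoC (ln (INR p) ^ j)%R * g (base_phase q X p * npw p (1 + d)))%C.
  by apply: eq_big_seq => p hp; rewrite zA0.
have pw1 (J : seq nat) : \sum_(p <- J) ln (INR p) ^ 1 * npw p (1 + d) = \sum_(p <- J) ln (INR p) * npw p (1 + d).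
  by apply: eq_bigr => p _; rewrite pow_1.
have e2k : e2 <= k * e2.
  by rewrite -{1}(Rmult_1_l e2); apply: Rmult_le_compat_r; lra.
split.
  rewrite (@big_cat _ _ Cplus) -/A0 base -/w0.
  have B1 := lfac_sum_approx pI hz s1 (ltac:(lra) : 0 <= 2) lfac_approx (sq 1%N).
  rewrite lin !pw1 -/m1 -/m2 in B1.
  set S := (\sum_(p <- I) _)%C in B1 *.
  rewrite (_ : Cmod _ = Cmod (w0 + S)%C) //.
  have -> : (w0 + S = (S - (RtoC m1 + u * RtoC m2)) + u * RtoC (m2 - Cmod v)%R)%C.
    rewrite RtoC_minus /u; transitivity (w0 + S + (v - (w0 + RtoC m1)))%C; first by rewrite /v; ring.
    by field.
  apply: Rle_trans (Cmod_triangle _ _) _; rewrite Cmod_mult hu Rmult_1_l Cmod_R Rabs_pos_eq; last lra.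
  rewrite -/e2 [INR 2]/= in B1.
  (* 34 = 32 + 2: the linearisation error on the blocks and the overshoot of m2 over |v|. *)
  have hk : 34 * / k ^ 49 <= / k ^ 40.
    rewrite (_ : k ^ 49 = k ^ 9 * k ^ 40); last by ring.
    rewrite Rinv_mult -Rmult_assoc -[X in _ <= X]Rmult_1_l; apply: Rmult_le_compat_r.
      by left; apply: Rinv_0_lt_compat; apply: pow_lt; lra.
    apply/Rle_div_l; first by apply: pow_lt; lra.
    by rewrite Rmult_1_l -[34](pow_1); apply: Rle_trans (_ : k ^ 1 <= _); [rewrite !pow_1; lra | apply: Rle_pow; [lra | lia]].
  lra.
rewrite (@big_cat _ _ Cplus) -/A0 base.
set T0 := (\sum_(p <- A0) _)%C in hw1 *.
have B2 := lfac_sum_approx pI hz s1 (ltac:(lra) : 0 <= 10) lfac2_approx (sq 2%N).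
rewrite lin in B2; set S := (\sum_(p <- I) _)%C in B2 *.
set l1 := \sum_(p <- I1) _ in B2; set l2 := \sum_(p <- I2) _ in B2.
have l1le : l1 <= (1 + eta) * k * m1.
  rewrite /l1 /m1 big_distrr; apply: Rsum_le_seq => p hp _ /=.
  have hpp : ln (INR p) <= (1 + eta) * k.
    have : (p <= efl ((1 + eta) * k))%N by move: hp; rewrite mem_filter mem_index_iota => /andP[_ /andP[_ h]]; lia.
    by move/leq_efl; apply; have /and3P[h _ _] := I1p p hp; apply: prime_gt0.
  have : 0 <= ln (INR p) * npw p (1 + d).
    by apply: Rmult_le_pos; [apply: ln_INR_ge0 | left; apply: npw_gt0].
  move=> h; have := Rmult_le_compat_r _ _ _ h hpp; rewrite Rmult_1_r; lra.
have l10 : 0 <= l1.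
  by apply: Rsum_ge0 => p _; apply: Rmult_le_pos; [apply: pow_le; apply: ln_INR_ge0 | left; apply: npw_gt0].
have l2ge : (1 + 2 * eta) * k * m2 <= l2.
  rewrite /l2 /m2 big_distrr; apply: Rsum_le_seq => p hp _ /=.
  have /and3P[_ h1 _] := I2p p hp; have hpp := gt_efl_ln h1.
  have : 0 <= ln (INR p) * npw p (1 + d).
    by apply: Rmult_le_pos; [apply: ln_INR_ge0 | left; apply: npw_gt0].
  move=> h; have := Rmult_le_compat_r _ _ _ h (Rlt_le _ _ hpp); rewrite Rmult_1_r; lra.
have tri : l2 <= Cmod (T0 + S)%C + Cmod T0 + l1 + Cmod (S - (RtoC l1 + u * RtoC l2))%C.
  have l20 : 0 <= l2 by apply: Rle_trans l2ge; apply: Rmult_le_pos; [nra | lra].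
  have e : Cmod (u * RtoC l2)%C = l2 by rewrite Cmod_mult hu Cmod_R Rabs_pos_eq // Rmult_1_l.
  rewrite -{1}e.
  rewrite [X in Cmod X <= _](_ : _ = (T0 + S) + - T0 + - RtoC l1 + - (S - (RtoC l1 + u * RtoC l2)))%C; last by ring.
  apply: Rle_trans (Cmod_triangle _ _) _; rewrite Cmod_opp; apply: Rplus_le_compat_r.
  apply: Rle_trans (Cmod_triangle _ _) _; rewrite Cmod_opp Cmod_R (Rabs_pos_eq l1) //; apply: Rplus_le_compat_r.
  by apply: Rle_trans (Cmod_triangle _ _) _; rewrite Cmod_opp; lra.
have lnN : ln (INR (efl k).+1) <= k + 1.
  have [_ h] := ln_efl (ltac:(lra) : 0 <= k).
  have x0 := INR_ge1 (efl_gt0 (ltac:(lra) : 0 <= k)).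
  have : ln (INR (efl k).+1) <= ln (INR (efl k) * 2).
    by apply: ln_le; rewrite S_INR; lra.
  rewrite ln_mult; [|lra..]; have := ln_le_sub1 (x := 2) ltac:(lra); lra.
have T0le : Cmod T0 <= W * (3 * k).
  by apply: Rle_trans hw1 _; apply: Rmult_le_compat_l => //; lra.
have B2' : Cmod (S - (RtoC l1 + u * RtoC l2))%C <= 1440.
  apply: Rle_trans B2 _; rewrite -/e2 [INR 3]/=; lra.
have m2m1 : (1 + 2 * eta) * k * (m1 - W) <= (1 + 2 * eta) * k * m2.
  by apply: Rmult_le_compat_l; [nra | lra].
have kW : k * eta * W <= k / 3 * W by apply: Rmult_le_compat_r.
have kM2 : k * (M * eta) <= k * (m1 * eta).
  by apply: Rmult_le_compat_l; [lra | apply: Rmult_le_compat_r; lra].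
have kW0 : 0 <= k * W by apply: Rmult_le_pos; lra.
rewrite Meta in kM2.
rewrite (_ : Cmod _ = Cmod (T0 + S)%C) //; lra.
Qed.

End Phase_choice.

(** * Critical points near resonant heights *)

(** What remains after the part l carried by A and the term n = 1 is the free sum up to Y, left to
    the resonator, and an absolutely small tail. *)
Lemma free_dser_split (A : seq nat) (a : nat -> C) (j : nat) (s l : C) (d : R) (Y : nat) :
  all prime A -> log_bounded a j -> 0 < d -> 1 + d <= Re s -> (0 < Y)%N ->
  Csum_to (fun n => if free A n then RtoC 0 else a n * ncpow_opp n s)%C l ->
  Cmod (dirichlet_series a s - (l + a 1%N))%C <=
  Cmod (\sum_(2 <= n < Y.+1 | free A n) a n * ncpow_opp n s)%C +
  (2 * INR j.+1 / d) ^ j * (2 / d) * npw Y (d / 2).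
Proof.
move=> pA ha d0 hs Y0 hl.
have hD := dser_spec ha (ltac:(lra) : 1 < Re s).
have hF : Csum_to (fun n => if free A n then a n * ncpow_opp n s else RtoC 0)%C (dirichlet_series a s - l)%C.
  by apply: Csum_to_ext (Csum_to_minus hD hl) => n _; case: ifP => _; ring.
have F1 : free A 1.
  by apply/allP => p /(allP pA) /prime_gt1 hp; rewrite dvdn1; apply/eqP; lia.
have hB N : \sum_(Y.+1 <= n < N) Cmod (if free A n then a n * ncpow_opp n s else RtoC 0)%C <=
    (2 * INR j.+1 / d) ^ j * (2 / d) * npw Y (d / 2).
  apply: Rle_trans (log_bounded_tail N ha d0 hs Y0); apply: Rsum_le_nat => n _.
  by case: ifP => _; [right | rewrite Cmod_0; apply: Cmod_ge_0].
have := Csum_to_tail hF hB; rewrite big_ltn // F1 ncpow_1n.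
rewrite -big_mkcond; set S := (\big[Cplus/_]_(_ <= _ < _ | _) _)%C => T.
have -> : (dirichlet_series a s - (l + a 1%N) = (dirichlet_series a s - l - (a 1%N * 1 + S)) + S)%C by ring.
by apply: Rle_trans (Cmod_triangle _ _) _; lra.
Qed.

Lemma ncpow_pair (n : nat) (s t : R) : ncpow_opp n (s, t) = (npw n s * ncpow_opp n (0, t))%C.
Proof.
rewrite -ncpow_RtoC -ncpow_plus; congr ncpow_opp.
by rewrite /Cplus /=; congr pair; ring.
Qed.

Lemma Cmod_ncpow_prime_le (p : nat) (s : C) : prime p -> 1 <= Re s ->
  Cmod (ncpow_opp p s) <= / INR p /\ / INR p <= / 2.
Proof.
move=> hp hs; split; last by apply: Rinv_le_contravar; [lra | exact: prime_INR_ge2].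
by rewrite Cmod_ncpow; apply: npw_leV => //; apply: prime_gt0.
Qed.

Lemma nonfree_vonM (A : seq nat) (s : C) : uniq A -> all prime A -> 1 <= Re s ->
  Csum_to (fun n => if free A n then RtoC 0 else vonM n * ncpow_opp n s)%C
    (\sum_(p <- A) RtoC (ln (INR p) ^ 1)%R * lfac (ncpow_opp p s))%C.
Proof.
move=> uA pA hs.
have := @sum_nonfree A (fun n => ncpow_opp n s) (fun p j => ncpow_opp p s ^ j)%C
  (fun p => lfac (ncpow_opp p s)) uA pA.
have h1 p j : p \in A -> (0 < j)%N -> ncpow_opp (p ^ j) s = (ncpow_opp p s ^ j)%C.
  by move=> hp _; apply: ncpow_expn; apply: prime_gt0; apply: (allP pA).
have h2 p : p \in A -> Csum_to (fun j => ncpow_opp p s ^ j)%C (lfac (ncpow_opp p s)).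
  move=> hp; apply: Csum_geom; have := Cmod_ncpow_prime_le (allP pA p hp) hs; lra.
move=> /(_ h1 h2); congr Csum_to.
by apply: eq_bigr => p _; rewrite pow_1.
Qed.

Lemma nonfree_vonM_ln (A : seq nat) (s : C) : uniq A -> all prime A -> 1 <= Re s ->
  Csum_to (fun n => if free A n then RtoC 0 else vonM n * ln (INR n) * ncpow_opp n s)%C
    (\sum_(p <- A) RtoC (ln (INR p) ^ 2)%R * lfac2 (ncpow_opp p s))%C.
Proof.
move=> uA pA hs.
have := @sum_nonfree A (fun n => ln (INR n) * ncpow_opp n s)%C
  (fun p j => ln (INR p) * (INR j * ncpow_opp p s ^ j))%C
  (fun p => ln (INR p) * lfac2 (ncpow_opp p s))%C uA pA.
have h1 p j : p \in A -> (0 < j)%N -> (ln (INR (p ^ j)) * ncpow_opp (p ^ j) s =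
   ln (INR p) * (INR j * ncpow_opp p s ^ j))%C.
  move=> hp _; have p0 : (0 < p)%N by apply: prime_gt0; apply: (allP pA).
  by rewrite ncpow_expn // ln_INR_expn // RtoC_mult; ring.
have h2 p : p \in A -> Csum_to (fun j => ln (INR p) * (INR j * ncpow_opp p s ^ j))%C
    (ln (INR p) * lfac2 (ncpow_opp p s))%C.
  move=> hp; apply: Csum_to_scal; apply: Csum_geom_deriv.
  have := Cmod_ncpow_prime_le (allP pA p hp) hs; lra.
move=> /(_ h1 h2) T.
have {T} := @Csum_to_ext _ (fun n => if free A n then RtoC 0 else vonM n * ln (INR n) * ncpow_opp n s)%C _ _ T.
move=> T; have {T} := T _ => T.
have e : (\sum_(p <- A) RtoC (ln (INR p) ^ 2)%R * lfac2 (ncpow_opp p s) =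
          \sum_(p <- A) ln (INR p) * (ln (INR p) * lfac2 (ncpow_opp p s)))%C.
  by apply: eq_bigr => p _; rewrite (_ : ln (INR p) ^ 2 = ln (INR p) * ln (INR p)); [rewrite RtoC_mult; ring | ring].
by rewrite e; apply: T => n _; case: ifP => // _; ring.
Qed.

Lemma primes_subset_sum_le (A : seq nat) (N : nat) (F : nat -> R) : uniq A -> all prime A ->
  (forall p, p \in A -> (p <= N)%N) -> (forall n, 0 <= F n) ->
  \sum_(p <- A) F p <= \sum_(0 <= p < N.+1 | prime p) F p.
Proof.
move=> uA pA hA F0.
apply: Rle_trans (_ : \sum_(0 <= p < N.+1 | prime p && (p \in A)) F p <= _).
  right; rewrite -[RHS]big_filter; apply: perm_big; apply: uniq_perm => //.
    by rewrite filter_uniq ?iota_uniq.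
  move=> p; rewrite mem_filter mem_index_iota; case hp: (p \in A); last by rewrite andbF.
  by rewrite (allP pA) // ltnS hA.
by apply: Rsum_sub => // p /andP[].
Qed.

Lemma primes_weight_le (A : seq nat) (N : nat) : uniq A -> all prime A -> (0 < N)%N ->
  (forall p, p \in A -> (p <= N)%N) -> \sum_(p <- A) ln (INR p) * / INR p <= ln (INR N) + 28.
Proof.
move=> uA pA N0 hA; apply: Rle_trans (prime_sum_le N0).
have F0 n : 0 <= ln (INR n) * / INR n.
  case: n => [|n]; first by rewrite /= Rinv_0 Rmult_0_r; lra.
  apply: Rmult_le_pos; [exact: ln_INR_ge0 | left; apply: Rinv_0_lt_compat; have := INR_ge1 (ltn0Sn n); lra].
exact: primes_subset_sum_le uA pA hA F0.
Qed.

(** An integer n >= 2 free of all primes up to x exceeds x, so the energy is a tail of the sum of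
    (ln n)^(2j) / n^2. *)
Lemma free_energy_le (A : seq nat) (x Y j : nat) (a : nat -> C) : (0 < x)%N ->
  {subset primes_le x <= A} ->
  (forall n, (0 < n)%N -> Cmod (a n) <= ln (INR n) ^ j * npw n 1) ->
  \sum_(2 <= n < Y.+1 | free A n) Cmod (a n) ^ 2 <=
  (2 * INR (j * 2).+1 / 1) ^ (j * 2) * (2 / 1) * npw x (1 / 2).
Proof.
move=> x0 hA ha.
pose G n := ln (INR n) ^ (j * 2) * npw n (1 + 1).
have G0 n : 0 <= G n.
  by apply: Rmult_le_pos; [apply: pow_le; apply: ln_INR_ge0 | left; apply: npw_gt0].
apply: Rle_trans (ln_pow_tail (j * 2) (maxn Y x).+1 Rlt_0_1 x0).
apply: Rle_trans (_ : \sum_(2 <= n < Y.+1) (if (x < n)%N then G n else 0) <= _).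
  rewrite big_mkcond; apply: Rsum_le_nat => n /andP[n2 _].
  have n0 : (0 < n)%N by lia.
  case hf: (free A n); last by case: ifP => _; [apply: G0 | lra].
  have -> : (x < n)%N.
    rewrite ltnNge; apply/negP => hx; have := free_primes_le n0 hx.
    have -> : free (primes_le x) n by apply/allP => p /hA hp; apply: (allP hf).
    by move=> /esym /eqP; lia.
  rewrite /G npw_plus pow_mult.
  rewrite (_ : _ * (npw n 1 * npw n 1) = (ln (INR n) ^ j * npw n 1) ^ 2); last by rewrite Rpow_mult_distr; ring.
  by apply: pow_incr; split; [apply: Cmod_ge_0 | apply: ha].
apply: Rle_trans (_ : \sum_(1 <= n < (maxn Y x).+1) (if (x < n)%N then G n else 0) <= _).
  apply: Rle_trans (_ : \sum_(1 <= n < Y.+1) (if (x < n)%N then G n else 0) <= _).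
    case: Y => [|Y]; first by rewrite !big_geq //; lra.
    rewrite [X in _ <= X]big_ltn //; have : 0 <= if (x < 1)%N then G 1%N else 0 by case: ifP => _; [apply: G0 | lra].
    lra.
  by apply: Rsum_widen => [|n _]; [lia | case: ifP => _; [apply: G0 | lra]].
rewrite (@big_cat_nat _ _ _ x.+1) //=; last by lia.
rewrite big1_seq ?Rplus_0_l => [|n /andP[_]]; last first.
  by rewrite mem_index_iota => /andP[_ h]; rewrite ifF //; apply/negbTE; rewrite -leqNgt; lia.
by apply: Rsum_le_nat => n /andP[h _]; rewrite h; right.
Qed.

(** Passes from the mean square delivered by the resonator to the mean; c is chosen to balance the
    two terms. *)
Lemma weighted_am_gm (A : seq nat) (w v : nat -> R) (c : R) : 0 < c -> (forall p, 0 <= w p) ->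
  \sum_(p <- A) w p * v p <= (c * \sum_(p <- A) w p + / c * \sum_(p <- A) w p * v p ^ 2) / 2.
Proof.
move=> c0 hw; have ci : 0 < / c by apply: Rinv_0_lt_compat.
rewrite !big_distrr -big_split /=.
rewrite /Rdiv Rmult_comm big_distrr /=; apply: Rsum_le => p _.
have := hw p => w0.
have h : v p <= / 2 * (c + / c * v p ^ 2).
  have : 0 <= / c * (c - v p) ^ 2 by apply: Rmult_le_pos; [lra | apply: pow2_ge_0].
  have -> : / c * (c - v p) ^ 2 = c - 2 * v p + / c * v p ^ 2 by field; lra.
  lra.
have := Rmult_le_compat_l _ _ _ w0 h; lra.
Qed.

(** Replaces p^(-it) by z p. One logarithm stays in the weight ln p / p of the resonance estimate;
    the other j are bounded by L. *)
Lemma phase_perturb (A : seq nat) (z : nat -> C) (g : C -> C) (s t c : R) (j : nat) (L : R) :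
  all prime A -> (forall p, Cmod (z p) = 1) -> 1 <= s -> 0 <= c ->
  (forall w v, Cmod w <= / 2 -> Cmod v <= / 2 -> Cmod (g w - g v)%C <= c * Cmod (w - v)%C) ->
  (forall p, p \in A -> ln (INR p) ^ j <= L) ->
  Cmod (\sum_(p <- A) RtoC (ln (INR p) ^ j.+1)%R * g (ncpow_opp p (s, t)) -
        \sum_(p <- A) RtoC (ln (INR p) ^ j.+1)%R * g (z p * npw p s))%C <=
  c * L * \sum_(p <- A) ln (INR p) * / INR p * Cmod (ncpow_opp p (0, t) - z p)%C.
Proof.
move=> pA hz hs c0 hg hL; rewrite -Csum_minus; apply: Rle_trans (Cmod_sum_le _ _ _) _.
rewrite big_distrr; apply: Rsum_le_seq => p hpA _ /=; have hp := allP pA p hpA.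
have [h1 h2] := Cmod_phase_le (hz p) hp hs.
have [h3 _] := @Cmod_ncpow_prime_le p (s, t) hp hs.
rewrite (_ : forall a b e : C, a * b - a * e = a * (b - e))%C; last by move=> *; ring.
have l0 := ln_INR_ge0 p; have lj : 0 <= ln (INR p) ^ j by apply: pow_le.
rewrite Cmod_mult Cmod_R Rabs_pos_eq; last by apply: Rmult_le_pos.
have h4 : Cmod (g (ncpow_opp p (s, t)) - g (z p * npw p s))%C <= c * Cmod (ncpow_opp p (s, t) - z p * npw p s)%C.
  by apply: hg; lra.
have h5 : Cmod (ncpow_opp p (s, t) - z p * npw p s)%C <= / INR p * Cmod (ncpow_opp p (0, t) - z p)%C.
  rewrite ncpow_pair (_ : forall a b e : C, a * b - e * a = a * (b - e))%C; last by move=> *; ring.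
  rewrite Cmod_mult Cmod_R Rabs_pos_eq; last by left; apply: npw_gt0.
  by apply: Rmult_le_compat_r; [apply: Cmod_ge_0 | apply: npw_leV => //; apply: prime_gt0].
set P := / INR p * _ in h5.
have P0 : 0 <= P by apply: Rle_trans h5; apply: Cmod_ge_0.
have h6 : Cmod (g (ncpow_opp p (s, t)) - g (z p * npw p s))%C <= c * P.
  by apply: Rle_trans h4 _; apply: Rmult_le_compat_l.
have h7 := Rmult_le_compat _ _ _ _ lj (Cmod_ge_0 _) (hL p hpA) h6.
have h8 := Rmult_le_compat_l _ _ _ l0 h7.
rewrite Rmult_assoc; apply: Rle_trans h8 _; right; rewrite /P; ring.
Qed.

Lemma inv_pow_mono (k : R) (m n : nat) : 1 <= k -> (m <= n)%N -> / k ^ n <= / k ^ m.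
Proof.
move=> k1 h; apply: Rinv_le_contravar; first by apply: pow_lt; lra.
by apply: Rle_pow => //; apply/leP.
Qed.

Lemma inv_pow_absorb (k c : R) (m n : nat) : 1 <= k -> c <= k -> (m < n)%N -> c * / k ^ n <= / k ^ m.
Proof.
move=> k1 ck h; apply: Rle_trans (_ : k * / k ^ m.+1 <= _).
  have i0 : 0 < / k ^ n by apply: Rinv_0_lt_compat; apply: pow_lt; lra.
  apply: Rle_trans (Rmult_le_compat_r _ _ _ (Rlt_le _ _ i0) ck) _.
  by apply: Rmult_le_compat_l; [lra | exact: inv_pow_mono].
by right; rewrite -tech_pow_Rmult; field; split; [apply: pow_nonzero; lra | lra].
Qed.

Lemma log_sum_bound_half (j : nat) (k : R) : 1 <= k ->
  log_sum_bound j (/ k ^ 3 / 2) <= (4 * INR j.+1 * k ^ 3) ^ j * (5 * k ^ 3).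
Proof.
move=> k1; have k3 : 1 <= k ^ 3 by apply: pow_R1_Rle.
rewrite /log_sum_bound (_ : 2 * INR j.+1 / (/ k ^ 3 / 2) = 4 * INR j.+1 * k ^ 3); last by field; lra.
rewrite (_ : 2 / (/ k ^ 3 / 2) = 4 * k ^ 3); last by field; lra.
apply: Rmult_le_compat_l; last lra.
by apply: pow_le; have := pos_INR j.+1; nra.
Qed.

(** On a disc of radius k^-20 the derivative of F varies by O(k^-20 k^12), far less than |D| >= k/2,
    and |F| <= k^-30 at the centre is far below |D| k^-20 / 2. A zero of F is a zero of zeta' =
    -zeta F. *)
Lemma critical_point_near (k t : R) : 1000000 <= k ->
  Cmod (dirichlet_series (fun n => vonM n) (1 + / k ^ 3, t)) <= / k ^ 30 ->
  k / 2 <= Cmod (dirichlet_series (fun n => vonM n * ln (INR n))%C (1 + / k ^ 3, t)) ->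
  exists rho, Cmod (rho - ((1 + / k ^ 3)%R, t))%C <= / k ^ 20 /\ 1 + / k ^ 3 / 2 <= Re rho /\
    critical_point zeta rho.
Proof.
move=> hk; set d := / k ^ 3; set s0 := (1 + d, t) : C => hF hD.
set D := dirichlet_series _ _ in hD; set r := / k ^ 20.
have kpos n : 0 < k ^ n by apply: pow_lt; lra.
have d0 : 0 < d by apply: Rinv_0_lt_compat.
have r0 : 0 < r by apply: Rinv_0_lt_compat.
have rd : 6 * r <= d by apply: inv_pow_absorb => //; lra.
have rd3 : 1 + d / 2 <= Re s0 - 3 * r by rewrite /s0 [Re _]/=; lra.
have d2 : 0 < d / 2 by lra.
have L3 : 3 * r * log_sum_bound 3 (d / 2) <= k / 4.
  apply: Rle_trans (_ : 3 * r * ((4 * INR 4 * k ^ 3) ^ 3 * (5 * k ^ 3)) <= _).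
    by apply: Rmult_le_compat_l; [lra | apply: log_sum_bound_half; lra].
  have -> : 3 * r * ((4 * INR 4 * k ^ 3) ^ 3 * (5 * k ^ 3)) = 61440 * / k ^ 8.
    by rewrite /r [INR 4]/=; field; lra.
  by have := @inv_pow_absorb k 61440 0 8 ltac:(lra) ltac:(lra) isT; rewrite pow_O Rinv_1; lra.
have D0 : (- D)%C <> 0.
  by move=> e; have := Cmod_opp D; rewrite e Cmod_0; lra.
have [rho [h1 h2]] : exists s, Cmod (s - s0)%C <= r /\ dirichlet_series (fun n => vonM n) s = 0.
  apply: (@newton_zero (dirichlet_series (fun n => vonM n)) (- D)%C s0 r) => //; last first.
    rewrite Cmod_opp; apply: Rle_trans hF _.
    apply: Rle_trans (_ : r <= _); first by apply: inv_pow_mono => //; lra.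
    have : 1 * r <= Cmod D * r / 2 * 1 by nra.
    lra.
  move=> s s' hs hs'.
  have := dser_strong_diff log_bounded_vonM d2 rd3 hs hs'; rewrite -/D.
  rewrite (_ : forall a b c e : C, a - b - c * - e = a - b + c * e)%C; last by move=> *; ring.
  move=> h; apply: Rle_trans h _; apply: Rmult_le_compat_l; first exact: Cmod_ge_0.
  by rewrite Cmod_opp; lra.
have hRe := Re_ge_sub h1.
exists rho; split=> //; split; first by lra.
have re1 : 1 < Re rho by lra.
by apply: zeta_critical_point => //; rewrite zeta_log_derivative // h2; ring.
Qed.

(** Explains the cut at e^(k^5): raised to the power -k^-3 / 4 it is e^(-k^2/4), smaller than every
    power of 1/k. *)
Lemma dirichlet_tail_small (k : R) (j : nat) : 1000000 <= k -> exp (- (/ 2 * k)) <= / k ^ 100 -> (j <= 2)%N ->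
  (2 * INR j.+1 / (/ k ^ 3 / 2)) ^ j * (2 / (/ k ^ 3 / 2)) * npw (efl (k ^ 5)) (/ k ^ 3 / 2 / 2) <= / k ^ 50.
Proof.
move=> hk he hj; set d := / k ^ 3.
have kpos n : 0 < k ^ n by apply: pow_lt; lra.
have d0 : 0 < d by apply: Rinv_0_lt_compat.
have d1 : d <= 1 by have := @inv_pow_mono k 0 3 ltac:(lra) isT; rewrite pow_O Rinv_1.
have h : npw (efl (k ^ 5)) (d / 2 / 2) <= / k ^ 100.
  apply: Rle_trans he; apply: Rle_trans (npw_efl_le (Rlt_le _ _ (kpos 5%N)) (ltac:(lra) : 0 <= d / 2 / 2)) _.
  apply: exp_le_compat.
  have -> : d / 2 / 2 * k ^ 5 = k * k / 4 by rewrite /d; field; lra.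
  nra.
rewrite (_ : 2 * INR j.+1 / (d / 2) = 4 * INR j.+1 * k ^ 3); last by rewrite /d; field; lra.
rewrite (_ : 2 / (d / 2) = 4 * k ^ 3); last by rewrite /d; field; lra.
apply: Rle_trans (_ : (4 * INR j.+1 * k ^ 3) ^ j * (4 * k ^ 3) * / k ^ 100 <= _).
  apply: Rmult_le_compat_l => //; apply: Rmult_le_pos; last by have := kpos 3%N; lra.
  by apply: pow_le; apply: Rmult_le_pos; [have := pos_INR j.+1; lra | left].
case: j hj => [|[|[|//]]] _.
- rewrite [INR 1]/= (_ : _ * / _ = 4 * / k ^ 97); last by field; lra.
  by apply: inv_pow_absorb => //; lra.
- rewrite [INR 2]/= (_ : _ * / _ = 32 * / k ^ 94); last by field; lra.
  by apply: inv_pow_absorb => //; lra.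
rewrite [INR 3]/= (_ : _ * / _ = 576 * / k ^ 91); last by field; lra.
by apply: inv_pow_absorb => //; lra.
Qed.

(** The resonator makes the free sum small at s0 only; this carries it to the nearby zero. *)
Lemma free_partial_lip (A : seq nat) (a : nat -> C) (s s0 : C) (r d : R) (Y : nat) :
  log_bounded a 0 -> Cmod (s - s0)%C <= r -> 0 < d -> 1 + d <= Re s0 - r ->
  Cmod (\sum_(2 <= n < Y.+1 | free A n) a n * ncpow_opp n s)%C <=
  Cmod (\sum_(2 <= n < Y.+1 | free A n) a n * ncpow_opp n s0)%C + r * log_sum_bound 1 d.
Proof.
move=> ha hr d0 hd.
set S := (\sum_(2 <= n < _ | _) _)%C; set S0 := (\sum_(2 <= n < _ | _) _)%C.
have -> : S = (S0 + (S - S0))%C by ring.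
apply: Rle_trans (Cmod_triangle _ _) _; apply: Rplus_le_compat_l.
rewrite -Csum_minus; apply: Rle_trans (Cmod_sum_le _ _ _) _.
have r0 : 0 <= r by apply: Rle_trans hr; apply: Cmod_ge_0.
apply: Rle_trans (Rmult_le_compat_l _ _ _ r0 (ln_pow_sum_le 1 Y.+1 d0)).
rewrite (_ : r * _ = \sum_(1 <= n < Y.+1) r * (ln (INR n) ^ 1 * npw n (1 + d))); last by rewrite big_distrr.
have G0 n : 0 <= ln (INR n) ^ 1 * npw n (1 + d).
  by apply: Rmult_le_pos; [apply: pow_le; apply: ln_INR_ge0 | left; apply: npw_gt0].
apply: Rle_trans (_ : \sum_(2 <= n < Y.+1) r * (ln (INR n) ^ 1 * npw n (1 + d)) <= _); last first.
  case: Y {S S0} => [|Y]; first by rewrite !big_geq //; right.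
  rewrite [X in _ <= X]big_ltn //; have := Rmult_le_pos _ _ r0 (G0 1%N); lra.
rewrite big_mkcond; apply: Rsum_le_nat => n /andP[n2 _].
case: ifP => _; last by apply: Rmult_le_pos.
rewrite (_ : forall x y z : C, x * y - x * z = x * (y - z))%C; last by move=> *; ring.
rewrite Cmod_mult; have a1 := ha n (ltnW n2); rewrite pow_O in a1.
have h := ncpow_lip n s0 (s - s0); rewrite (_ : s0 + (s - s0) = s)%C in h; last by ring.
have l0 := ln_INR_ge0 n.
have h2 : ln (INR n) * npw n (Re s0 - Cmod (s - s0)%C) <= ln (INR n) ^ 1 * npw n (1 + d).
  by rewrite pow_1; apply: Rmult_le_compat_l => //; apply: npw_le; lra.
have h3 : Cmod (ncpow_opp n s - ncpow_opp n s0)%C <= r * (ln (INR n) ^ 1 * npw n (1 + d)).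
  apply: Rle_trans h _; apply: Rmult_le_compat => //; first exact: Cmod_ge_0.
  by apply: Rmult_le_pos => //; left; apply: npw_gt0.
have := Cmod_ge_0 (a n); have := Cmod_ge_0 (ncpow_opp n s - ncpow_opp n s0)%C => c0 c1.
rewrite -[X in _ <= X]Rmult_1_l; apply: Rmult_le_compat => //.
Qed.

(** Three replacements: rho by 1 + d + it, p^(-1-d) by 1/p, and p^(-it) by z p. The 2 in the last
    one comes from 1 <= 2 ln p, which brings in the weight ln p / p. *)
Lemma phase_sum_near (A : seq nat) (z : nat -> C) (rho : C) (d t r : R) :
  all prime A -> (forall p, Cmod (z p) = 1) -> 0 <= d ->
  Cmod (rho - ((1 + d)%R, t))%C <= r -> r <= d ->
  \sum_(p <- A) Cmod (ncpow_opp p rho - z p * RtoC (/ INR p)%R)%C <=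
  (r + d) * (\sum_(p <- A) ln (INR p) * / INR p) +
  2 * \sum_(p <- A) ln (INR p) * / INR p * Cmod (ncpow_opp p (0, t) - z p)%C.
Proof.
move=> pA hz d0 hr rd.
rewrite !big_distrr -big_split /=; apply: (Rsum_le_all pA) => p hp.
have p0 := prime_gt0 hp; have p2 := prime_INR_ge2 hp.
have i0 : 0 < / INR p by apply: Rinv_0_lt_compat; lra.
have l2 : / 2 <= ln (INR p).
  apply: Rle_trans (_ : ln 2 <= _); last by apply: ln_le; lra.
  by have := ln_ge_1subV (x := 2) ltac:(lra); lra.
set s0 := ((1 + d)%R, t) : C in hr; have Res0 : Re s0 = 1 + d by [].
have r0 : 0 <= r by apply: Rle_trans hr; apply: Cmod_ge_0.
have h1 : Cmod (ncpow_opp p rho - ncpow_opp p s0)%C <= r * (ln (INR p) * / INR p).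
  have h := ncpow_lip p s0 (rho - s0); rewrite (_ : s0 + (rho - s0) = rho)%C in h; last by ring.
  apply: Rle_trans h _; apply: Rmult_le_compat => //; first exact: Cmod_ge_0.
    by apply: Rmult_le_pos; [lra | left; apply: npw_gt0].
  apply: Rmult_le_compat_l; first lra.
  by apply: npw_leV => //; rewrite Res0; lra.
have e0 : 0 <= 1 - npw p d <= d * ln (INR p).
  by split; [have := npw_le1 p d0; lra | exact: one_minus_npw_le].
have h2 : Cmod (ncpow_opp p s0 - z p * RtoC (/ INR p)%R)%C <=
    / INR p * Cmod (ncpow_opp p (0, t) - z p)%C + / INR p * (d * ln (INR p)).
  rewrite /s0 ncpow_pair npw_plus npw_1 //.
  have -> : (RtoC (/ INR p * npw p d)%R * ncpow_opp p (0, t) - z p * RtoC (/ INR p)%R =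
     RtoC (/ INR p)%R * (RtoC (npw p d) * (ncpow_opp p (0, t) - z p)) - RtoC (/ INR p * (1 - npw p d))%R * z p)%C.
    by rewrite !RtoC_mult RtoC_minus; ring.
  apply: Rle_trans (Cmod_triangle _ _) _; rewrite Cmod_opp !Cmod_mult hz !Cmod_R Rmult_1_r.
  rewrite (Rabs_pos_eq (/ INR p)); last lra.
  rewrite (Rabs_pos_eq (npw p d)); last by left; apply: npw_gt0.
  rewrite Rabs_pos_eq; last by apply: Rmult_le_pos; lra.
  apply: Rplus_le_compat; last by apply: Rmult_le_compat_l; lra.
  apply: Rmult_le_compat_l; first lra.
  rewrite -[X in _ <= X]Rmult_1_l; apply: Rmult_le_compat_r; [apply: Cmod_ge_0 | lra].
have h3 : / INR p * Cmod (ncpow_opp p (0, t) - z p)%C <=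
   2 * (ln (INR p) * / INR p * Cmod (ncpow_opp p (0, t) - z p)%C).
  set P := / INR p * _; have P0 : 0 <= P by apply: Rmult_le_pos; [lra | apply: Cmod_ge_0].
  rewrite (_ : 2 * _ = (2 * ln (INR p)) * P); last by rewrite /P; ring.
  rewrite -{1}(Rmult_1_l P); apply: Rmult_le_compat_r; lra.
rewrite (_ : ncpow_opp p rho - _ = (ncpow_opp p rho - ncpow_opp p s0) + (ncpow_opp p s0 - z p * RtoC (/ INR p)%R))%C; last by ring.
apply: Rle_trans (Cmod_triangle _ _) _; lra.
Qed.

(** By Chebyshev the product of the primes of A has logarithm at most 4 e^u, so ln tau is O(k^100
    e^u); the power of k is absorbed by e^(eta k). *)
Lemma ln_ln_height_le (A : seq nat) (k u eta b tau : R) (D Y N : nat) :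
  all prime A -> uniq A -> (forall p, p \in A -> (p <= N)%N) -> INR N <= exp u ->
  1000000 <= k -> k <= u -> 0 < eta -> INR D = k ^ 100 -> INR Y <= exp (k ^ 5) -> (0 < Y)%N ->
  exp (- (eta * k)) <= / k ^ 101 -> 0 < tau -> b <= k ->
  tau <= b + 8 * INR ((\prod_(p <- A) p) ^ D.+1 * Y)%N ^ 2 ->
  1 < tau -> ln (ln tau) <= u + eta * k.
Proof.
move=> pA uA hN hNu hk ku eta0 hD hY Y0 hexp tau0 hb htau tau1.
set Q := (\prod_(p <- A) p)%N in htau.
have Q0 : (0 < Q)%N.
  by rewrite /Q; elim: A pA {uA hN Q htau} => [|p A IH] /=; rewrite ?big_nil ?big_cons // muln_gt0 => /andP[/prime_gt0 -> /IH].
have lnQ : ln (INR Q) <= 4 * exp u.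
  apply: Rle_trans (_ : \sum_(p <- A) ln (INR p) <= _).
    right; rewrite /Q; elim: A pA {uA hN Q htau Q0} => [|p A IH]; first by rewrite !big_nil [INR 1]/= ln_1.
    move=> /= /andP[hp pA]; rewrite !big_cons -IH // ln_INR_muln //; first exact: prime_gt0.
    by elim: A pA {IH} => [|p' A IH] /=; rewrite ?big_nil ?big_cons // muln_gt0 => /andP[/prime_gt0 -> /IH].
  apply: Rle_trans (_ : 4 * INR N <= _); last by apply: Rmult_le_compat_l; lra.
  exact: Rle_trans (primes_subset_sum_le uA pA hN ln_INR_ge0) (prime_theta_le N).
have kpos n : 0 < k ^ n by apply: pow_lt; lra.
set W := (Q ^ D.+1 * Y)%N in htau.
have W0 : (0 < W)%N by rewrite muln_gt0 expn_gt0 Q0.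
have W1 := INR_ge1 W0.
have lnY : ln (INR Y) <= k ^ 5.
  rewrite -(ln_exp (k ^ 5)); apply: ln_le hY; have := INR_ge1 Y0; lra.
have lnW : ln (INR W) <= (k ^ 100 + 1) * (4 * exp u) + k ^ 5.
  rewrite /W ln_INR_muln ?expn_gt0 ?Q0 // ln_INR_expn // S_INR hD.
  by apply: Rplus_le_compat => //; apply: Rmult_le_compat_l => //; have := kpos 100%N; lra.
have k1 : 1 <= k by lra.
have lnk : ln k <= k by have := ln_le_sub1 (x := k) ltac:(lra); lra.
have htau2 : tau <= k * (9 * INR W ^ 2).
  have w2 : 1 <= INR W ^ 2 by apply: pow_R1_Rle.
  apply: Rle_trans htau _; nra.
have lntau : ln tau <= k + 8 + 2 * ln (INR W).
  apply: Rle_trans (ln_le _ _ tau0 htau2) _.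
  have w0 : 0 < INR W ^ 2 by apply: pow_lt; lra.
  rewrite (ln_mult k); [|lra..]; rewrite (ln_mult 9); [|lra..]; rewrite (ln_pow (INR W) 2); last lra.
  rewrite [INR 2]/=; have := ln_le_sub1 (x := 9) ltac:(lra); lra.
set E := exp u in lnQ lnW hNu.
have E1 : k <= E by have := exp_ineq1_le u; rewrite -/E; lra.
have he : k ^ 101 <= exp (eta * k).
  have := hexp; rewrite exp_Ropp => h.
  rewrite -(Rinv_inv (k ^ 101)) -(Rinv_inv (exp (eta * k))); apply: Rinv_le_contravar => //.
  by apply: Rinv_0_lt_compat; apply: exp_pos.
have main : ln tau <= exp (u + eta * k).
  rewrite exp_plus -/E; apply: Rle_trans (Rmult_le_compat_l _ _ _ (ltac:(lra) : 0 <= E) he).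
  have a5 : k ^ 5 <= k ^ 100 by apply: Rle_pow => //; lia.
  have a1 : 1 <= k ^ 100 by apply: pow_R1_Rle.
  have b1 : k ^ 5 <= k ^ 100 * E.
    by rewrite -[X in X <= _]Rmult_1_r; apply: Rmult_le_compat; try lra; left.
  have b2 : E <= k ^ 100 * E.
    by rewrite -{1}(Rmult_1_l E); apply: Rmult_le_compat_r; lra.
  have b3 : 1000000 * (k ^ 100 * E) <= E * k ^ 101.
    rewrite -tech_pow_Rmult (_ : E * _ = k * (k ^ 100 * E)); last by ring.
    by apply: Rmult_le_compat_r; lra.
  lra.
have lt0 : 0 < ln tau by rewrite -ln_1; apply: ln_increasing; lra.
by rewrite -(ln_exp (u + eta * k)); apply: ln_le.
Qed.

Lemma vonM_1 : vonM 1 = 0.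
Proof.
by apply: Rle_antisym (vonM_ge0 1); apply: Rle_trans (vonM_le_ln 1) _; rewrite [INR 1]/= ln_1; right.
Qed.

Lemma sqr_le_abs (x y : R) : 0 <= y -> x ^ 2 <= y ^ 2 -> x <= y.
Proof. by move=> y0 h; apply: Rnot_lt_le => h2; nra. Qed.

Section Resonant_points.
Variables (q : nat) (X : nat -> C) (a : nat).
Hypotheses (q0 : (0 < q)%N) (hX : nat_character q X).
Hypotheses (ca : coprime a q) (Xa : X a <> 1).

(** The three series to be controlled at one height: L for i = 0, F for i = 1, -F' otherwise. The
    factor n^(-s) is part of the coefficient, leaving n^(-it) to the polynomial. *)
Definition resonant_coef (s : R) (i n : nat) : C :=
  (match i with 0%N => X n | 1%N => RtoC (vonM n) | _ => vonM n * ln (INR n) end * npw n s)%C.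

Lemma resonant_coef_le (s : R) (i n : nat) : (i < 3)%N -> 1 <= s -> (0 < n)%N ->
  Cmod (resonant_coef s i n) <= ln (INR n) ^ i * npw n 1.
Proof.
move=> hi hs n0; rewrite /resonant_coef Cmod_mult (Cmod_R (npw n s)) Rabs_pos_eq; last by left; apply: npw_gt0.
have h := @npw_le n 1 s hs; have g := npw_gt0 n s.
have l0 := log_bounded_nchar q0 hX n0; have l1 := log_bounded_vonM n0.
have l2 := log_bounded_mul_ln log_bounded_vonM n0.
by case: i hi => [|[|[|//]]] _; apply: Rmult_le_compat => //; try exact: Cmod_ge_0; lra.
Qed.

Lemma resonant_energy_le (A : seq nat) (k s : R) (Y : nat) : 0 <= k -> 1 <= s ->
  {subset primes_le (efl k) <= A} ->
  \sum_(0 <= i < 3) \sum_(2 <= n < Y.+1 | free A n) Cmod (resonant_coef s i n) ^ 2 <=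
  50000 * exp (- (/ 2 * k)).
Proof.
move=> k0 hs hA; have x0 := efl_gt0 k0.
have h i (hi : (i < 3)%N) := free_energy_le Y x0 hA (fun n n0 => resonant_coef_le hi hs n0).
have := h 0%N isT; have := h 1%N isT; have := h 2%N isT => {h}.
have e (F : nat -> R) : \sum_(0 <= i < 3) F i = F 0%N + F 1%N + F 2%N.
  by rewrite /index_iota /= !big_cons big_nil; ring.
rewrite e.
have := npw_efl_half_le k0; set P := npw _ _.
set S0 := (\sum_(2 <= n < Y.+1 | _) _); set S1 := (\sum_(2 <= n < Y.+1 | _) _); set S2 := (\sum_(2 <= n < Y.+1 | _) _).
rewrite (_ : (2 * INR (2 * 2).+1 / 1) ^ (2 * 2) * (2 / 1) = 20000); last first.
  by rewrite (_ : (2 * 2).+1 = 5%N) // (_ : (2 * 2)%N = 4%N) // [INR 5]/=; field.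
rewrite (_ : (2 * INR (1 * 2).+1 / 1) ^ (1 * 2) * (2 / 1) = 72); last first.
  by rewrite (_ : (1 * 2).+1 = 3%N) // (_ : (1 * 2)%N = 2%N) // [INR 3]/=; field.
rewrite (_ : (2 * INR (0 * 2).+1 / 1) ^ (0 * 2) * (2 / 1) = 2); last first.
  by rewrite (_ : (0 * 2).+1 = 1%N) // (_ : (0 * 2)%N = 0%N) // pow_O; field.
have := exp_pos (- (/ 2 * k)); lra.
Qed.

Lemma resonant_coef_sum (A : seq nat) (Y i : nat) (s t : R) :
  (\sum_(2 <= n < Y.+1 | free A n) resonant_coef s i n * ncpow_opp n (0, t) =
   \sum_(2 <= n < Y.+1 | free A n)
     match i with 0%N => X n | 1%N => RtoC (vonM n) | _ => vonM n * ln (INR n) end * ncpow_opp n (s, t))%C.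
Proof. by apply: eq_bigr => n _; rewrite (ncpow_pair n s t) /resonant_coef Cmult_assoc. Qed.

(** By the sieve this product is the sum of chi(n) n^(-rho) over the n free of A, that is, 1 plus a
    small remainder. *)
Lemma Lfactor_removed_le (A : seq nat) (rho s0 : C) (k : R) :
  uniq A -> all prime A -> 1000000 <= k -> exp (- (/ 2 * k)) <= / k ^ 100 ->
  Cmod (rho - s0)%C <= / k ^ 20 -> Re s0 = 1 + / k ^ 3 ->
  Cmod (\sum_(2 <= n < (efl (k ^ 5)).+1 | free A n) X n * ncpow_opp n s0)%C <= 2 * / k ^ 40 ->
  Cmod (dirichlet_series X rho * \prod_(p <- A) (1 - X p * ncpow_opp p rho))%C <= 1 + / k.
Proof.
move=> uA pA hk he hr hs hS; set d := / k ^ 3 in hs; set Y := efl _ in hS.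
have kpos n : 0 < k ^ n by apply: pow_lt; lra.
have d0 : 0 < d by apply: Rinv_0_lt_compat.
have rd : 6 * / k ^ 20 <= d by apply: inv_pow_absorb => //; lra.
have r0 : 0 < / k ^ 20 by apply: Rinv_0_lt_compat.
have hRe := Re_ge_sub hr.
have hX0 := log_bounded_nchar q0 hX.
have Y0 : (0 < Y)%N by apply: efl_gt0; left.
have d2 : 0 < d / 2 by lra.
have hD := dser_spec hX0 (ltac:(lra) : 1 < Re rho).
have hF := sieve (completely_mul_twist hX rho) hD pA uA.
set L := dirichlet_series X rho in hD hF *; set P := (\prod_(p <- A) _)%C in hF *.
have hN : Csum_to (fun n => if free A n then RtoC 0 else X n * ncpow_opp n rho)%C (L - L * P)%C.
  by apply: Csum_to_ext (Csum_to_minus hD hF) => n _; case: ifP => _; ring.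
have := free_dser_split pA hX0 d2 (ltac:(lra) : 1 + d / 2 <= Re rho) Y0 hN.
rewrite -/L (nchar_1 hX) => h1.
have h2 := dirichlet_tail_small hk he (isT : (0 <= 2)%N); rewrite -/d -/Y in h2.
have h3 := @free_partial_lip A X rho s0 _ (d / 2) Y hX0 hr d2 ltac:(lra).
have h4 : / k ^ 20 * log_sum_bound 1 (d / 2) <= 40 * / k ^ 14.
  apply: Rle_trans (Rmult_le_compat_l _ _ _ (Rlt_le _ _ r0) (log_sum_bound_half 1 (ltac:(lra) : 1 <= k))) _.
  by right; rewrite [INR 2]/=; field; lra.
have h5 : Cmod (L * P - 1)%C <= / k.
  rewrite (_ : L * P - 1 = L - (L - L * P + 1))%C; last by ring.
  apply: Rle_trans h1 _.
  have b1 := @inv_pow_absorb k 100 1 14 ltac:(lra) ltac:(lra) isT.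
  have b2 := @inv_pow_mono k 14 40 ltac:(lra) isT; have b3 := @inv_pow_mono k 14 50 ltac:(lra) isT.
  have b4 : 0 < / k ^ 14 by apply: Rinv_0_lt_compat.
  rewrite pow_1 in b1; lra.
rewrite (_ : L * P = 1 + (L * P - 1))%C; last by ring.
by apply: Rle_trans (Cmod_triangle _ _) _; rewrite Cmod_1; lra.
Qed.

End Resonant_points.

Section Resonant_points.
Variables (q : nat) (X : nat -> C) (a : nat).
Hypotheses (q0 : (0 < q)%N) (hX : nat_character q X).
Hypotheses (ca : coprime a q) (Xa : X a <> 1).

(** The exponents leave wide margins: Fejer degree k^100, mean-square level k^-80, mean phase error
    E = O(k^-39), |F| <= k^-30 at s0, Newton radius k^-20. Numerical constants are absorbed by spare
    powers of k. *)
Lemma resonant_points (eta : R) : 0 < eta <= / 3 -> exists M, 0 <= M /\ forall T0,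
  large_nat (fun K => exists (I : seq nat) (z : nat -> C) (rho : C),
    let A := primes_le (efl (INR K)) ++ I in
    uniq A /\ all prime A /\
    (forall p, p \in primes_le (efl (INR K)) -> coprime p q -> (X p * z p = - (1))%C) /\
    \sum_(p <- I) / INR p <= M / INR K /\
    critical_point zeta rho /\ 1 < Re rho /\ T0 < Im rho /\
    ln (ln (Im rho)) <= (1 + 4 * eta) * INR K /\
    \sum_(p <- A) Cmod (ncpow_opp p rho - z p * RtoC (/ INR p)%R)%C <= / INR K /\
    Cmod (dirichlet_series X rho * \prod_(p <- A) (1 - X p * ncpow_opp p rho))%C <= 1 + / INR K).
Proof.
move=> heta; have [M [M0 hM]] := phases q0 hX ca Xa heta.
exists (2 * M); split; first lra.
move=> T0.
apply: large_impl (large_and (large_and hM (large_ge (1000010 + Rabs T0)))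
  (large_and (large_exp 100 (ltac:(lra) : 0 < / 2)) (large_exp 101 (proj1 heta)))).
move=> K [[[I [z ph]] kbig] [he1 he2]].
have : exists D : nat, INR D = INR K ^ 100 by exists (K ^ 100)%N; rewrite INR_expn.
move: ph kbig he1 he2; set k := INR K => ph kbig he1 he2 [D hD].
case: ph => uI [pI [hI [hz [hXz [hIs [hl1 hl2]]]]]].
have T00 := Rabs_pos T0; have T01 := Rle_abs T0.
have hk : 1000000 <= k by lra.
have kpos n : 0 < k ^ n by apply: pow_lt; lra.
set A := primes_le (efl k) ++ I in hl1 hl2 *.
set d := / k ^ 3 in hIs hl1 hl2; set s := 1 + d in hIs hl1 hl2.
have d0 : 0 < d by apply: Rinv_0_lt_compat.
have d1 : 1000000 * d <= 1.
  by have := @inv_pow_absorb k 1000000 0 3 ltac:(lra) ltac:(lra) isT; rewrite pow_O Rinv_1.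
have s1 : 1 <= s by rewrite /s; lra.
have etak : eta * k <= / 3 * k by apply: Rmult_le_compat_r; lra.
have etak0 : 0 <= eta * k by apply: Rmult_le_pos; lra.
pose u := (1 + 3 * eta) * k; have u2 : k <= u <= 2 * k by rewrite /u; lra.
have sub : {subset primes_le (efl k) <= A} by move=> p hp; rewrite mem_cat hp.
have uA : uniq A.
  rewrite cat_uniq primes_le_uniq uI andbT /=.
  by apply/hasPn => p /hI [h _]; rewrite mem_primes_le negb_and -ltnNge h orbT.
have pA : all prime A by rewrite all_cat primes_le_prime.
have hA p : p \in A -> (p <= efl u)%N.
  rewrite mem_cat => /orP[|/hI[_ //]]; rewrite mem_primes_le => /andP[_ h].
  by apply: leq_trans h _; apply: efl_mono; lra.
have Nu0 : (0 < efl u)%N by apply: efl_gt0; lra.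
have lnA p : p \in A -> ln (INR p) <= 2 * k.
  move=> hp; have := proj1 (leq_efl u (prime_gt0 (allP pA p hp))) (hA p hp); lra.
have Sle : \sum_(p <- A) ln (INR p) * / INR p <= 3 * k.
  have := primes_weight_le uA pA Nu0 hA; have [_] := ln_efl (ltac:(lra) : 0 <= u); lra.
set S := \sum_(p <- A) _ in Sle.
have w0 p : 0 <= ln (INR p) * / INR p.
  case: p => [|p]; first by rewrite /= Rinv_0 Rmult_0_r; lra.
  by apply: Rmult_le_pos; [exact: ln_INR_ge0 | left; apply: Rinv_0_lt_compat; have := INR_ge1 (ltn0Sn p); lra].
set Y := efl (k ^ 5); have Y0 : (0 < Y)%N by apply: efl_gt0; left.
(* The prime part of the energy is at most 6 k^-99 and the free part is exponentially small in k. *)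
set B := / k ^ 80; have B0 : 0 < B by apply: Rinv_0_lt_compat.
have hB : S * (2 / INR D.+1) + \sum_(0 <= i < 3) \sum_(2 <= n < Y.+1 | free A n) Cmod (resonant_coef X s i n) ^ 2 <= B.
  have h1 := resonant_energy_le q0 hX Y (ltac:(lra) : 0 <= k) s1 sub.
  have h2 : S * (2 / INR D.+1) <= 3 * k * (2 * / k ^ 100).
    have S0 : 0 <= S by apply: Rsum_ge0 => p _; apply: w0.
    have i0 : / INR D.+1 <= / k ^ 100 by apply: Rinv_le_contravar => //; rewrite S_INR hD; lra.
    have i1 : 0 < / INR D.+1 by apply: Rinv_0_lt_compat; rewrite S_INR hD; have := kpos 100%N; lra.
    by apply: Rmult_le_compat; rewrite /Rdiv; lra.
  have h3 : 3 * k * (2 * / k ^ 100) = 6 * / k ^ 99 by field; lra.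
  have b1 := @inv_pow_absorb k 100000 80 99 ltac:(lra) ltac:(lra) isT.
  have b2 := @inv_pow_mono k 99 100 ltac:(lra) isT.
  have b3 : 0 < / k ^ 99 by apply: Rinv_0_lt_compat.
  rewrite -/B in b1; lra.
(* The 2 leaves room for the distance from t to Im rho, so that Im rho exceeds both T0 and 1. *)
have [t [ht [hEn hfree]]] := resonance (Rabs T0 + 2) pA uA hz w0 Y0 B0 hB.
set E := \sum_(p <- A) ln (INR p) * / INR p * Cmod (ncpow_opp p (0, t) - z p)%C.
(* k^-40 is the square root of the level k^-80, which balances the two terms of [weighted_am_gm]. *)
have c0 : 0 < / k ^ 40 by apply: Rinv_0_lt_compat.
have Ele : E <= 4 * / k ^ 39.
  apply: Rle_trans (weighted_am_gm A _ c0 w0) _; rewrite -/S Rinv_inv.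
  have h1 : / k ^ 40 * S <= / k ^ 40 * (3 * k) by apply: Rmult_le_compat_l; lra.
  have h2 : / k ^ 40 * (3 * k) = 3 * / k ^ 39 by field; lra.
  have h3 := Rmult_le_compat_l _ _ _ (Rlt_le _ _ (kpos 40%N)) hEn.
  have h4 : k ^ 40 * (4 * B) = 4 * / k ^ 40 by rewrite /B; field; lra.
  have b2 := @inv_pow_mono k 39 40 ltac:(lra) isT; lra.
have E0 : 0 <= E by apply: Rsum_ge0 => p _; apply: Rmult_le_pos; [apply: w0 | apply: Cmod_ge_0].
have hfr i : (i < 3)%N -> Cmod (\sum_(2 <= n < Y.+1 | free A n)
     match i with 0%N => X n | 1%N => RtoC (vonM n) | _ => vonM n * ln (INR n) end * ncpow_opp n (s, t))%C <= 2 * / k ^ 40.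
  move=> hi; rewrite -resonant_coef_sum; apply: sqr_le_abs; first lra.
  by apply: Rle_trans (hfree i hi) _; right; rewrite /B; field; lra.
have d2 : 0 < d / 2 by lra.
set s0 := (s, t) : C; have Res0 : Re s0 = s by [].
have Re0 : 1 <= Re s0 by rewrite Res0.
have Rs0 : 1 + d / 2 <= Re s0 by rewrite Res0 /s; lra.
have tl j (hj : (j <= 2)%N) := dirichlet_tail_small hk he1 hj.
have hF : Cmod (dirichlet_series (fun n => vonM n) s0) <= / k ^ 30.
  have h1 := free_dser_split pA log_bounded_vonM d2 Rs0 Y0 (nonfree_vonM uA pA Re0).
  have h2 := hfr 1%N isT; have h3 := tl 1%N isT; rewrite -/d -/Y in h3.
  have h4 := @phase_perturb A z lfac s t 4 0 1 pA hz s1 ltac:(lra) lfac_lip ltac:(by move=> p _; rewrite pow_O; lra).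
  rewrite -/E -/s0 vonM_1 in h1 h4.
  set F := dirichlet_series _ _ in h1 *; set l := (\sum_(p <- A) _)%C in h1 h4; set l' := (\sum_(p <- A) _)%C in h4 hl1.
  rewrite -/s0 in h2; set f := (\sum_(2 <= n < _ | _) _)%C in h1 h2.
  have -> : F = (F - (l + 0) + (l - l') + l')%C by ring.
  apply: Rle_trans (Cmod_triangle _ _) _.
  have := Cmod_triangle (F - (l + 0))%C (l - l')%C.
  have b1 := @inv_pow_absorb k 100 30 39 ltac:(lra) ltac:(lra) isT.
  have b2 := @inv_pow_mono k 39 40 ltac:(lra) isT; have b3 := @inv_pow_mono k 39 50 ltac:(lra) isT.
  lra.
have hDD : k / 2 <= Cmod (dirichlet_series (fun n => vonM n * ln (INR n))%C s0).
  have h1 := free_dser_split pA (log_bounded_mul_ln log_bounded_vonM) d2 Rs0 Y0 (nonfree_vonM_ln uA pA Re0).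
  have h2 := hfr 2%N isT; have h3 := tl 2%N isT; rewrite -/d -/Y in h3.
  have h4 := @phase_perturb A z lfac2 s t 20 1 (2 * k) pA hz s1 ltac:(lra) lfac2_lip ltac:(by move=> p hp; rewrite pow_1; apply: lnA).
  rewrite -/E -/s0 vonM_1 in h1 h4.
  set F := dirichlet_series _ _ in h1 *; set l := (\sum_(p <- A) _)%C in h1 h4; set l' := (\sum_(p <- A) _)%C in h4 hl2.
  rewrite -/s0 in h2; set f := (\sum_(2 <= n < _ | _) _)%C in h1 h2.
  have e : l' = (F + - (F - (l + 0 * ln (INR 1))) + - (l - l'))%C by ring.
  have tr := Cmod_triangle (F + - (F - (l + 0 * ln (INR 1))))%C (- (l - l'))%C.
  have tr2 := Cmod_triangle F (- (F - (l + 0 * ln (INR 1))))%C.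
  rewrite -e !Cmod_opp in tr; rewrite Cmod_opp in tr2.
  have h5 : 20 * (2 * k) * E <= 20 * (2 * k) * (4 * / k ^ 39) by apply: Rmult_le_compat_l; lra.
  have h6 : 20 * (2 * k) * (4 * / k ^ 39) = 160 * / k ^ 38 by field; lra.
  have b1 := @inv_pow_absorb k 1000 0 38 ltac:(lra) ltac:(lra) isT; rewrite pow_O Rinv_1 in b1.
  have b2 := @inv_pow_mono k 38 40 ltac:(lra) isT; have b3 := @inv_pow_mono k 38 50 ltac:(lra) isT.
  lra.
have [rho [hr [hRe hcrit]]] := critical_point_near hk hF hDD.
rewrite -/d -/s -/s0 in hr hRe.
have r1 : / k ^ 20 <= d by apply: inv_pow_mono => //; lra.
have hIm := Im_ge_sub hr; rewrite [Im s0]/= in hIm.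
exists I, z, rho; rewrite -/A; split=> //; split=> //; split=> //; split.
  (* For p in I one has ln p > k and p^(-d) >= 1/2, hence 1/p <= (2/k) ln p p^(-s); this is the 2 in
     [2 * M]. *)
  have k0 : 0 < k by lra.
  rewrite (_ : 2 * M / k = 2 / k * M); last by field; lra.
  apply: Rle_trans (Rmult_le_compat_l _ _ _ (Rlt_le _ _ (Rdiv_lt_0_compat 2 k Rlt_0_2 k0)) hIs).
  rewrite big_distrr; apply: Rsum_le_seq => p hp _ /=.
  have hpA : p \in A by rewrite mem_cat hp orbT.
  have hpp := allP pI p hp; have p2 := prime_INR_ge2 hpp.
  have l1 := gt_efl_ln (proj1 (hI p hp)); have l2 := lnA p hpA.
  have i0 : 0 < / INR p by apply: Rinv_0_lt_compat; lra.
  have h1 : / INR p * / 2 <= npw p s.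
    rewrite /s npw_plus npw_1 ?prime_gt0 //; apply: Rmult_le_compat_l; first lra.
    have := one_minus_npw_le p d; have : d * ln (INR p) <= d * (2 * k) by apply: Rmult_le_compat_l; lra.
    have -> : d * (2 * k) = 2 * / k ^ 2 by rewrite /d; field; lra.
    have := @inv_pow_absorb k 100 0 2 ltac:(lra) ltac:(lra) isT; rewrite pow_O Rinv_1; lra.
  have h2 : k * (/ INR p * / 2) <= ln (INR p) * npw p s by apply: Rmult_le_compat; nra.
  have h3 := Rmult_le_compat_l _ _ _ (Rlt_le _ _ (Rdiv_lt_0_compat 2 k Rlt_0_2 k0)) h2.
  by rewrite (_ : 2 / k * (k * (/ INR p * / 2)) = / INR p) in h3; last by field; lra.
split=> //; split; first by lra.
split; first by lra.
split.
  have -> : (1 + 4 * eta) * k = u + eta * k by rewrite /u; ring.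
  have [hNe _] := efl_spec u; have [hYe _] := efl_spec (k ^ 5).
  apply: (@ln_ln_height_le A k u eta (Rabs T0 + 4) (Im rho) D Y (efl u)) => //; try lra.
split; last first.
  apply: (Lfactor_removed_le (s0 := s0) q0 hX uA pA hk he1 hr) => //.
  exact: (hfr 0%N isT).
have h := phase_sum_near pA hz (Rlt_le _ _ d0) hr r1; rewrite -/S -/E in h.
apply: Rle_trans h _.
have h1 : (/ k ^ 20 + d) * S <= (2 * d) * (3 * k).
  have r0 : 0 < / k ^ 20 by apply: Rinv_0_lt_compat.
  have S0 : 0 <= S by apply: Rsum_ge0 => p _; apply: w0.
  by apply: Rmult_le_compat; lra.
have h2 : 2 * d * (3 * k) = 6 * / k ^ 2 by rewrite /d; field; lra.
have b1 := @inv_pow_absorb k 100 1 2 ltac:(lra) ltac:(lra) isT; rewrite pow_1 in b1.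
have b2 := @inv_pow_mono k 2 39 ltac:(lra) isT.
have b3 : 0 < / k ^ 39 by apply: Rinv_0_lt_compat.
lra.
Qed.

End Resonant_points.

(** * The lower limit *)

Lemma Zprime_prime (p : nat) : Znumtheory.prime (Z.of_nat p) <-> prime p.
Proof.
rewrite -Znumtheory.prime_alt; split.
  move=> [p1 h]; apply/primeP; split; first by lia.
  move=> n hn; have n0 : (0 < n)%N by apply: dvdn_gt0 hn; lia.
  have np : (n <= p)%N by apply: dvdn_leq => //; lia.
  have [//|n1] := eqVneq n 1%N; have [//|n2] := eqVneq n p; exfalso.
  apply: (h (Z.of_nat n)); first by lia.
  by have /dvdnP[m ->] := hn; exists (Z.of_nat m); lia.
move=> hp; split; first by have := prime_gt1 hp; lia.
move=> n hn [m hm]; have : (Z.to_nat n %| p)%N.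
  by apply/dvdnP; exists (Z.to_nat m); nia.
by move=> hd; have /primeP[_ /(_ _ hd)] := hp; case/orP => /eqP; lia.
Qed.

Lemma prime_divisor_listE (q : nat) : prime_divisor_list q =
  [seq p <- iota 1 q | if Znumtheory.prime_dec (Z.of_nat p) then Nat.eqb (Nat.modulo q p) 0 else false].
Proof.
have fE (f : nat -> bool) s : List.filter f s = seq.filter f s by [].
have sE m n : List.seq m n = iota m n by elim: n m => //= n IH m; rewrite IH.
by rewrite /prime_divisor_list fE sE; apply: eq_filter => p; case: Znumtheory.prime_dec.
Qed.

Lemma mem_prime_divisor_list (q p : nat) : (0 < q)%N ->
  p \in prime_divisor_list q = prime p && (p %| q)%N.
Proof.
move=> q0; rewrite prime_divisor_listE mem_filter mem_iota.
case: Znumtheory.prime_dec => [hz|hp] /=.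
  have hp := proj1 (Zprime_prime p) hz; rewrite hp /=; have p0 := prime_gt0 hp.
  have -> : Nat.eqb (Nat.modulo q p) 0 = (p %| q)%N.
    apply/Nat.eqb_spec/dvdnP => [h|[m ->]].
      by exists (Nat.div q p); have := Nat.div_mod q p; lia.
    by apply: Nat.Div0.mod_mul.
  case hd: (p %| q)%N => //=; have := dvdn_leq q0 hd; lia.
by case hp': (prime p) => //; case: hp; apply/Zprime_prime.
Qed.

Lemma prod_prime_divisors_eq (q N : nat) : (0 < q)%N -> (q <= N)%N ->
  prod_prime_divisors q (fun p => (INR p + 1) / INR p) =
  \prod_(p <- primes_le N | ~~ coprime p q) (1 + / INR p).
Proof.
move=> q0 qN; rewrite /prod_prime_divisors.
have -> (f : nat -> R) s : List.fold_right Rmult 1 (List.map f s) = \prod_(p <- s) f p.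
  by elim: s => [|p s IH]; rewrite ?big_nil //= big_cons IH.
rewrite -[RHS]big_filter.
transitivity (\prod_(p <- [seq p <- primes_le N | ~~ coprime p q]) ((INR p + 1) / INR p)).
  apply: perm_big; apply: uniq_perm.
  - by rewrite prime_divisor_listE filter_uniq ?iota_uniq.
  - by rewrite filter_uniq ?primes_le_uniq.
  move=> p; rewrite mem_prime_divisor_list // mem_filter mem_primes_le.
  case hp: (prime p); rewrite ?andbF //= prime_coprime // negbK.
  by case hd: (p %| q)%N => //=; rewrite (leq_trans (dvdn_leq q0 hd) qN).
apply: eq_big_seq => p; rewrite mem_filter mem_primes_le => /andP[_ /andP[hp _]].
by have := prime_INR_ge2 hp => h; field; lra.
Qed.

(** Since X p z p = -1, the factor with w p = z p / p would be exactly 1 + 1/p. An error e_p costs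
    at most a factor 1 - e_p, and these combine by Weierstrass' inequality. *)
Lemma character_factor_ge (q : nat) (X : nat -> C) (A : seq nat) (z : nat -> C) (w : nat -> C) (y : R) :
  (0 < q)%N -> nat_character q X -> all prime A ->
  (forall p, p \in A -> coprime p q -> (X p * z p = - (1))%C) ->
  y <= 1 -> \sum_(p <- A) Cmod (w p - z p * RtoC (/ INR p)%R)%C <= y ->
  (\prod_(p <- A) (if coprime p q then 1 + / INR p else 1)) * (1 - y) <=
  Cmod (\prod_(p <- A) (1 - X p * w p))%C.
Proof.
move=> q0 hX pA hz y1 hy; pose e p := Cmod (w p - z p * RtoC (/ INR p)%R)%C.
have {hy} hy : \sum_(p <- A) e p <= y by [].
have e0 p : 0 <= e p by apply: Cmod_ge_0.
have e1 p : p \in A -> 0 <= e p <= 1.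
  move=> hp; split=> //; apply: Rle_trans y1; apply: Rle_trans hy; rewrite (big_rem p) //=.
  by rewrite -[X in X <= _]Rplus_0_r; apply: Rplus_le_compat_l; apply: Rsum_ge0.
pose b p := if coprime p q then 1 + / INR p else 1.
have b0 p : p \in A -> 0 < b p.
  move=> /(allP pA) /prime_INR_ge2 p2; have : 0 < / INR p by apply: Rinv_0_lt_compat; lra.
  by rewrite /b; case: ifP => _; lra.
apply: Rle_trans (_ : \prod_(p <- A) (b p * (1 - e p)) <= _).
  rewrite big_split; apply: Rmult_le_compat_l; first by left; apply: Rprod_gt0 => p hp _; apply: b0.
  apply: Rle_trans (@Rprod_one_minus_ge _ A predT e (fun p hp _ => e1 p hp)).
  exact: Rplus_le_compat_l (Ropp_le_contravar _ _ hy).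
rewrite Cmod_prod; apply: Rprod_le => p hp _; have hb := b0 p hp; have he := e1 p hp.
split; first by apply: Rmult_le_pos; lra.
rewrite /b; case hc: (coprime p q); last first.
  by rewrite (nchar_not_coprime hX) ?hc // (_ : 1 - 0 * w p = 1)%C; [rewrite Cmod_1; lra | ring].
have p2 := prime_INR_ge2 (allP pA p hp); have i0 : 0 < / INR p by apply: Rinv_0_lt_compat; lra.
have hw : RtoC (1 + / INR p) = ((1 - X p * w p) + X p * (w p - z p * RtoC (/ INR p)%R))%C.
  rewrite RtoC_plus; transitivity (1 + - (X p * z p) * / INR p)%C; last by rewrite RtoC_inv; [ring | lra].
  by rewrite (hz p hp hc) RtoC_inv; [ring | lra].
have := Cmod_triangle (1 - X p * w p)%C (X p * (w p - z p * RtoC (/ INR p)%R))%C.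
rewrite -hw Cmod_R Rabs_pos_eq; last lra.
rewrite Cmod_mult -/(e p); have := nchar_le1 q0 hX p; have := Cmod_ge_0 (X p); nra.
Qed.

(** For the block primes, whose phases serve F and not L, the trivial bound 1 - 1/p suffices. *)
Lemma unit_factor_ge (q : nat) (X : nat -> C) (I : seq nat) (s : C) (y : R) :
  (0 < q)%N -> nat_character q X -> all prime I -> 1 <= Re s ->
  \sum_(p <- I) / INR p <= y ->
  1 - y <= Cmod (\prod_(p <- I) (1 - X p * ncpow_opp p s))%C.
Proof.
move=> q0 hX pI hs hy.
have hi p : p \in I -> 0 <= / INR p <= 1.
  move=> /(allP pI) /prime_INR_ge2 p2; split; first by left; apply: Rinv_0_lt_compat; lra.
  by rewrite -Rinv_1; apply: Rinv_le_contravar; lra.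
apply: Rle_trans (_ : \prod_(p <- I) (1 - / INR p) <= _).
  apply: Rle_trans (@Rprod_one_minus_ge _ I predT (fun p => / INR p) (fun p hp _ => hi p hp)).
  exact: Rplus_le_compat_l (Ropp_le_contravar _ _ hy).
rewrite Cmod_prod; apply: Rprod_le => p hp _; have hb := hi p hp; split; first lra.
have [h1 _] := Cmod_ncpow_prime_le (allP pI p hp) hs.
have := Cmod_triangle (1 - X p * ncpow_opp p s)%C (X p * ncpow_opp p s)%C.
rewrite (_ : 1 - X p * ncpow_opp p s + X p * ncpow_opp p s = 1)%C; last by ring.
rewrite Cmod_1 Cmod_mult; have := nchar_le1 q0 hX p; have := Cmod_ge_0 (X p).
have := Cmod_ge_0 (ncpow_opp p s); nra.
Qed.

(** In use l = |L(rho, chi)|, P is the modulus of the product of local factors, b and D are the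
    products of 1 + 1/p over p prime to q and over p dividing q, G = e^C0 / (PI^2/6) and y = ln ln
    (Im rho). The factor 1 + 20h dominates (1 + 4h)(1 + h)/(1 - h)^3. *)
Lemma small_error_le (h l P b D G k y : R) : 0 < h <= / 20 -> 0 <= l -> 0 < b -> 0 < G -> 0 < k -> 0 <= D ->
  l * P <= 1 + h -> b * (1 - h) * (1 - h) <= P ->
  exp (- h) * (G * k) <= b * D -> y <= (1 + 4 * h) * k ->
  l * y <= D / G * (1 + 20 * h).
Proof.
move=> hh l0 b0 G0 k0 D0 hP hb hG hy.
have e1 : 1 - h <= exp (- h) by have := exp_ineq1_le (- h); lra.
have a1 : l * (b * (1 - h) * (1 - h)) <= 1 + h by apply: Rle_trans hP; apply: Rmult_le_compat_l.
have a2 : (1 - h) * (G * k) <= b * D.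
  by apply: Rle_trans hG; apply: Rmult_le_compat_r => //; apply: Rmult_le_pos; lra.
have a3 : l * (1 - h) * (1 - h) * ((1 - h) * (G * k)) <= (1 + h) * D.
  apply: Rle_trans (_ : l * (1 - h) * (1 - h) * (b * D) <= _).
    by apply: Rmult_le_compat_l => //; repeat (apply: Rmult_le_pos; try lra).
  have -> : l * (1 - h) * (1 - h) * (b * D) = l * (b * (1 - h) * (1 - h)) * D by ring.
  by apply: Rmult_le_compat_r.
have a4 : l * y <= l * ((1 + 4 * h) * k) by apply: Rmult_le_compat_l.
have c0 : 0 < (1 - h) * (1 - h) * (1 - h) by repeat apply: Rmult_lt_0_compat; lra.
apply: Rle_trans a4 _; apply: (Rmult_le_reg_l ((1 - h) * (1 - h) * (1 - h) * G)); first exact: Rmult_lt_0_compat.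
have -> : (1 - h) * (1 - h) * (1 - h) * G * (l * ((1 + 4 * h) * k)) =
   (1 + 4 * h) * (l * (1 - h) * (1 - h) * ((1 - h) * (G * k))) by ring.
have -> : (1 - h) * (1 - h) * (1 - h) * G * (D / G * (1 + 20 * h)) =
   (1 - h) * (1 - h) * (1 - h) * (1 + 20 * h) * D by field; lra.
apply: Rle_trans (Rmult_le_compat_l _ _ _ (ltac:(lra) : 0 <= 1 + 4 * h) a3) _.
rewrite -Rmult_assoc; apply: Rmult_le_compat_r => //.
have g1 : 1 - 3 * h <= (1 - h) * (1 - h) * (1 - h) by nra.
have g2 : (1 + 4 * h) * (1 + h) <= (1 - 3 * h) * (1 + 20 * h) by nra.
apply: Rle_trans g2 _; apply: Rmult_le_compat_r; lra.
Qed.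

Lemma LimInf_Im_le (A : C -> Prop) (f : C -> R) (V : R) :
  (forall eps T, 0 < eps -> exists z, A z /\ T < Im z /\ f z <= V + eps) ->
  Rbar_le (LimInf_Im A f) (Rbar.Finite V).
Proof.
move=> h; rewrite /LimInf_Im.
set E := fun m : Rbar => _.
have [_ hlub] : Rbar_is_lub E (Rbar_lub E) := proj2_sig (Rbar_ex_lub E); apply: hlub => _ [T ->].
set P := fun x : R => _; have [hglb _] := Glb_Rbar_correct P.
have hle eps : 0 < eps -> Rbar_le (Glb_Rbar P) (Rbar.Finite (V + eps)).
  move=> e0; have [z [hA [hT hf]]] := h eps T e0.
  by apply: (Rbar_le_trans _ (Rbar.Finite (f z))) => //; apply: hglb; exists z.
case: (Glb_Rbar P) hle => [g| |] hle //=; last by have := hle 1 Rlt_0_1.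
apply: Rnot_lt_le => hlt; have := hle ((g - V) / 2) ltac:(lra); rewrite /=; lra.
Qed.

Lemma critical_point_small_L (q : nat) (chi : Z -> C) (eps T : R) :
  (2 < q)%N -> primitive_character q chi -> 0 < eps ->
  exists rho, (critical_point zeta rho /\ 1 < Re rho) /\ T < Im rho /\
    Cmod (Lfun chi rho) * ln (ln (Im rho)) <=
    PI ^ 2 * exp (- euler_constant) / 6 *
      prod_prime_divisors q (fun p => (INR p + 1) / INR p) + eps.
Proof.
move=> hq hprim e0; have [a [ca Xa]] := primitive_nonprincipal hq hprim.
have q0 : (0 < q)%N by lia.
have hX := nat_character_of (proj1 hprim); set X := (fun n => chi (Z.of_nat n)) in hX.
set Dq := prod_prime_divisors _ _.
have hDq N : (q <= N)%N -> Dq = \prod_(p <- primes_le N | ~~ coprime p q) (1 + / INR p).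
  by move=> h; rewrite -prod_prime_divisors_eq.
have inv0 p : prime p -> 0 < / INR p.
  by move=> /prime_INR_ge2 h; apply: Rinv_0_lt_compat; lra.
have Dq0 : 0 < Dq.
  rewrite (hDq q) //; apply: Rprod_gt0 => p; rewrite mem_primes_le => /andP[hp _] _.
  by have := inv0 p hp; lra.
set G := exp euler_constant / (PI ^ 2 / 6).
have pi1 := PI2_6_gt1.
have G0 : 0 < G by apply: Rdiv_lt_0_compat; [apply: exp_pos | lra].
have hV : PI ^ 2 * exp (- euler_constant) / 6 * Dq = Dq / G.
  rewrite exp_Ropp /G; field.
  by have := exp_pos euler_constant; have := PI_RGT_0 => ? ?; repeat split; lra.
rewrite hV; set V := Dq / G; have V0 : 0 < V by apply: Rdiv_lt_0_compat.
(* A single h bounds all relative errors; the final loss 20 h V stays below eps. *)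
pose h := Rmin (/ 20) (eps / (20 * V)).
have h0 : 0 < h by apply: Rmin_glb_lt; [lra | apply: Rdiv_lt_0_compat; lra].
have h1 : h <= / 20 by apply: Rmin_l.
have h2 : V * (20 * h) <= eps.
  have : h <= eps / (20 * V) by apply: Rmin_r.
  by move=> /Rle_div_r; lra.
have [M [M0 hM]] := resonant_points q0 hX ca Xa (ltac:(lra) : 0 < h <= / 3).
have [K0 hK0] := large_and (hM T) (large_and (large_ge ((M + 1) / h)) (large_ge (INR q))).
(* The Mertens bound holds only for infinitely many K, so K is taken from it; the resonance holds
   for every K beyond K0. *)
have [K [hK hmert]] := mertens_third_prod h0 (ltac:(by rewrite leq_max orbT) : (0 < maxn K0 1)%N).
have [[I [z [rho [uA [pA [hXz [hI [hcrit [hRe [hIm [hln [hsum hL]]]]]]]]]]]] [kM kq]] :=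
  hK0 K (leq_trans (leq_maxl _ _) hK).
move: kM kq hI hln hsum hL hmert; set k := INR K => kM kq hI hln hsum hL hmert.
have kM' : M + 1 <= k * h by apply/Rle_div_l.
have k1 : 20 <= k by nra.
have ki : / k <= h.
  apply: (Rmult_le_reg_l k); first lra.
  by rewrite Rinv_r; lra.
have kiM : M / k <= h by apply/Rle_div_l; lra.
set x := efl k in uA pA hXz hsum hL hmert *.
have qx : (q <= x)%N.
  apply/(leq_efl _ q0); have := ln_le_sub1 (x := INR q); have := INR_ge1 q0; lra.
exists rho; split=> //; split=> //.
move: pA; rewrite all_cat => /andP[pA pI].
rewrite (@big_cat _ _ Rplus) in hsum; rewrite (@big_cat _ _ Cmult) in hL.
have sI : 0 <= \sum_(p <- I) Cmod (ncpow_opp p rho - z p * RtoC (/ INR p)%R)%C.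
  by apply: Rsum_ge0 => p _; apply: Cmod_ge_0.
set Sx := \sum_(p <- primes_le x) _ in hsum; set SI := \sum_(p <- I) _ in hsum sI.
have hSx : Sx <= h by have : Sx + SI <= / k by []; lra.
have f1 := character_factor_ge q0 hX pA hXz (ltac:(lra) : h <= 1) hSx.
have f2 := unit_factor_ge q0 hX pI (Rlt_le _ _ hRe) (Rle_trans _ _ _ hI kiM).
set b := \prod_(p <- primes_le x) _ in f1.
have b0 : 0 < b.
  apply: Rprod_gt0 => p hp _; have := inv0 p (allP pA p hp); case: ifP => _; lra.
set P1 := (\prod_(p <- primes_le x) _)%C in f1 hL; set P2 := (\prod_(p <- I) _)%C in f2 hL.
have hbD : \prod_(p <- primes_le x) (1 + / INR p) = b * Dq.
  rewrite (hDq x qx) [in RHS]big_mkcond /b -big_split; apply: eq_bigr => p _ /=.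
  by case: (coprime p q); rewrite /=; ring.
have hP : Cmod (Lfun chi rho) * (Cmod P1 * Cmod P2) <= 1 + h.
  have {hL} hL : Cmod (Lfun chi rho * (P1 * P2))%C <= 1 + / k by [].
  by move: hL; rewrite !Cmod_mult; lra.
have hb : b * (1 - h) * (1 - h) <= Cmod P1 * Cmod P2.
  by apply: Rmult_le_compat => //; try lra; apply: Rmult_le_pos; lra.
have hG : exp (- h) * (G * k) <= b * Dq.
  rewrite -hbD; apply: Rle_trans hmert; right; rewrite /G -/k; field.
  by have := PI_RGT_0; lra.
have := small_error_le (conj h0 h1) (Cmod_ge_0 (Lfun chi rho)) b0 G0 (ltac:(lra) : 0 < k)
   (Rlt_le _ _ Dq0) hP hb hG hln.
rewrite -/V; lra.
Qed.

Lemma liminf_critical_points_le (q : nat) (chi : Z -> C) : (2 < q)%N -> primitive_character q chi ->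
  Rbar_le
    (LimInf_Im (fun rho => critical_point zeta rho /\ 1 < Re rho)
       (fun rho => Cmod (Lfun chi rho) * ln (ln (Im rho))))
    (Rbar.Finite (PI ^ 2 * exp (- euler_constant) / 6 *
       prod_prime_divisors q (fun p => (INR p + 1) / INR p))).
Proof.
move=> hq hprim; apply: LimInf_Im_le => eps T e0.
have [rho [h1 [h2 h3]]] := critical_point_small_L T hq hprim e0.
by exists rho.
Qed.

End Resonance.

Theorem theorem4 (q : nat) (chi : Z -> C)
  (hq : (2 < q)%nat) (hchi : primitive_character q chi) :
  Rbar_le
    (LimInf_Im (fun rho => critical_point zeta rho /\ 1 < Re rho)
       (fun rho => Cmod (Lfun chi rho) * ln (ln (Im rho))))
    (Finite (PI ^ 2 * exp (- euler_constant) / 6 *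
       prod_prime_divisors q (fun p => (INR p + 1) / INR p))).
Proof.
exact (Resonance.liminf_critical_points_le (ssrbool.introT ssrnat.ltP hq) hchi).
Qed.
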